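(* Let $N\ge3$, $\rho>0$. Assume that $b$ satisfies: (b0) $b:[0,+\infty)\to(0,+\infty)$ is of class $\mathcal C^1$; (b1) there exist $q\in(1,+\infty)$ and $c_1,c_2>0$ such that, for all $s\in\mathbb R$, $c_1(s^2+|s|^q)\le b(s^2)s^2\le c_2(s^2+|s|^q)$ and $c_1(s^2+|s|^q)\le B(s^2)\le c_2(s^2+|s|^q)$, where $B(s)=\int_0^s b(t)\,dt$; (b2) $b$ is increasing; (b3) for some $\alpha>\frac{2(N+2)}{Np}$, one has $\alpha\, b(s)s\le B(s)<\frac{2(N+p)}{Np}\,b(s)s$ for every $s>0$; and that $$\Big(1+\frac2N\Big)\max\{2,q\}<p<2^*,\qquad q>\frac{2N}{N+2}.$$ Then there exists a radial normalized solution $u\in\mathcal X$ (for some $\lambda\in\mathbb R$) of $$\begin{cases}-\mathrm{div}\big(b(|\nabla u|^2)\nabla u\big)=|u|^{p-2}u-\lambda u & \text{in }\mathbb R^N,\\ u(x)\to0&\text{as }|x|\to+\infty,\\ \int_{\mathbb R^N}|u|^2\,dx=\rho^2.&\end{cases}$$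
   Context: $2^*=\frac{2N}{N-2}$. $\mathcal X=H^1(\mathbb R^N)\cap D^{1,q}(\mathbb R^N)$ is the completion of $\mathcal C_0^\infty(\mathbb R^N)$ with respect to $\|u\|_{\mathcal X}=(\|\nabla u\|_2^2+\|u\|_2^2+\|\nabla u\|_q^2)^{1/2}$. Solutions are weak solutions: $\int b(|\nabla u|^2)\nabla u\cdot\nabla\phi\,dx=\int(|u|^{p-2}u-\lambda u)\phi\,dx$ for all $\phi\in\mathcal X$; the number $\lambda$ is part of the unknown. ''Normalized'' refers to the condition $\int|u|^2dx=\rho^2$. *)

(* Defs.v *)
From HB Require Import structures.
From mathcomp Require Import all_boot all_order all_algebra.
From mathcomp Require Import all_classical all_reals all_analysis.

Set Implicit Arguments.
Unset Strict Implicit.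
Unset Printing Implicit Defensive.

Import Order.TTheory GRing.Theory Num.Theory.
Import numFieldNormedType.Exports.

Local Open Scope classical_set_scope.
Local Open Scope ring_scope.

Section measurable_rV.
Context {d : measure_display} {T : measurableType d}.
Variable n : nat.

Let coors : 'I_n -> 'rV[T]_n -> T := fun i x => x ord0 i.

Let rV_set0 : g_sigma_preimage coors set0.
Proof. exact: sigma_algebra0. Qed.

Let rV_setC A : g_sigma_preimage coors A -> g_sigma_preimage coors (~` A).
Proof. exact: sigma_algebraC. Qed.

Let rV_bigcup (F : _^nat) : (forall i, g_sigma_preimage coors (F i)) ->
  g_sigma_preimage coors (\bigcup_i (F i)).
Proof. exact: sigma_algebra_bigcup. Qed.

(* As for tuples, the sigma-algebra generated by the coordinates; for T = R it
   is the Borel sigma-algebra of R^n. *)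
HB.instance Definition _ := @isMeasurable.Build (measure_tuple_display d)
  'rV[T]_n (g_sigma_preimage coors) rV_set0 rV_setC rV_bigcup.

Lemma measurable_coord (i : 'I_n) :
  measurable_fun [set: 'rV[T]_n] (fun x : 'rV[T]_n => x ord0 i).
Proof.
move=> _ Y mY; rewrite setTI; apply: sub_sigma_algebra => /=.
rewrite -bigcup_seq/=; exists i => /=; first by rewrite mem_index_enum.
by exists Y => //; rewrite setTI.
Qed.

Lemma measurable_fun_rV d' (S : measurableType d') (f : S -> 'rV[T]_n) :
  (forall i, measurable_fun [set: S] (fun s => f s ord0 i)) ->
  measurable_fun [set: S] f.
Proof.
move=> mf _ Y mY; rewrite setTI.
suff: (@measurable _ 'rV[T]_n) `<=`
    [set A | measurable (f @^-1` A)] by apply.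
apply: smallest_sub.
- split => /=.
  + by rewrite preimage_set0.
  + by move=> A mA; rewrite setTD preimage_setC; exact: measurableC.
  + by move=> A mA; rewrite preimage_bigcup; exact: bigcup_measurable.
- rewrite -bigcup_seq => A [i _ [B mB <-]] /=.
  by rewrite setTI -[X in measurable X]setTI; exact: mf.
Qed.

End measurable_rV.

Section lebesgue_rV.
Context {R : realType}.

Definition rV_cons n (z : R * 'rV[R]_n) : 'rV[R]_n.+1 :=
  \row_i (if unlift ord0 i is Some j then z.2 ord0 j else z.1).

Definition rV_uncons n (x : 'rV[R]_n.+1) : R * 'rV[R]_n :=
  (x ord0 ord0, \row_i x ord0 (lift ord0 i)).

Lemma rV_consK n : cancel (@rV_cons n) (@rV_uncons n).
Proof.
move=> [a x]; rewrite /rV_uncons /rV_cons mxE unlift_none; congr pair.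
by apply/rowP => i; rewrite !mxE liftK.
Qed.

Lemma rV_unconsK n : cancel (@rV_uncons n) (@rV_cons n).
Proof.
by move=> x; apply/rowP => i; rewrite mxE; case: unliftP => [j ->|->] /=;
  rewrite ?mxE.
Qed.

Lemma measurable_rV_cons n : measurable_fun setT (@rV_cons n).
Proof.
apply: measurable_fun_rV => i.
have [j ij|i0] := unliftP ord0 i.
- rewrite (_ : (fun _ => _) = (fun x : 'rV[R]_n => x ord0 j) \o snd).
    by apply: measurableT_comp => //; exact: measurable_coord.
  by apply/funext => z /=; rewrite mxE ij liftK.
- rewrite (_ : (fun _ => _) = fst) //.
  by apply/funext => z /=; rewrite mxE i0 unlift_none.
Qed.

Lemma measurable_rV_uncons n : measurable_fun setT (@rV_uncons n).
Proof.
apply: measurable_fun_pair => /=; first exact: measurable_coord.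
apply: measurable_fun_rV => i.
under eq_fun do rewrite mxE.
exact: measurable_coord.
Qed.

Section lebesgue_rVS.
Variables (n : nat) (mu : {sigma_finite_measure set 'rV[R]_n -> \bar R}).

Definition lebesgue_rVS : set 'rV[R]_n.+1 -> \bar R :=
  pushforward (@lebesgue_measure R \x mu)%E (@rV_cons n).

Let lebesgue_rVS0 : lebesgue_rVS set0 = 0%E.
Proof. by rewrite /lebesgue_rVS /pushforward preimage_set0 measure0. Qed.

Let lebesgue_rVS_ge0 A : (0 <= lebesgue_rVS A)%E.
Proof. by rewrite /lebesgue_rVS /pushforward; apply: integral_ge0 => *. Qed.

Let lebesgue_rVS_sigma_additive : semi_sigma_additive lebesgue_rVS.
Proof.
pose m : {measure set (measurableTypeR R * 'rV[R]_n) -> \bar R} :=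
  (@lebesgue_measure R \x mu)%E.
move=> F mF tF mUF; rewrite /lebesgue_rVS /pushforward preimage_bigcup.
have mpre A : measurable A -> measurable (@rV_cons n @^-1` A).
  by move=> mA; rewrite -[X in measurable X]setTI; exact: measurable_rV_cons.
apply: (@measure_semi_sigma_additive _ _ _ m).
- by move=> k; exact: mpre.
- apply/trivIsetP => /= i j _ _ ij; rewrite -preimage_setI.
  by move/trivIsetP : tF => /(_ _ _ _ _ ij) ->//; rewrite preimage_set0.
- by rewrite -preimage_bigcup; exact: mpre.
Qed.

HB.instance Definition _ := isMeasure.Build _ _ _ lebesgue_rVS
  lebesgue_rVS0 lebesgue_rVS_ge0 lebesgue_rVS_sigma_additive.

Lemma lebesgue_rVSE (A : set R) (B : set 'rV[R]_n) :
  measurable A -> measurable B ->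
  lebesgue_rVS (@rV_uncons n @^-1` (A `*` B)) = (lebesgue_measure A * mu B)%E.
Proof.
move=> mA mB; rewrite -product_measure1E// /lebesgue_rVS /pushforward.
by congr (product_measure1 _ _ _); rewrite -comp_preimage (_ : _ \o _ = idfun) //;
  apply/funext => z; exact: rV_consK.
Qed.

Let lebesgue_rVS_sigma_finite : sigma_finite setT lebesgue_rVS.
Proof.
have /sigma_finiteP [F [TF ndF mF]] := sigma_finiteT (@lebesgue_measure R).
have /sigma_finiteP [G [TG ndG mG]] := sigma_finiteT mu.
exists (fun k => @rV_uncons n @^-1` (F k `*` G k)).
  rewrite -preimage_bigcup; apply/seteqP; split => // x _.
  have [i _ Fi] : (\bigcup_i F i) (rV_uncons x).1 by rewrite -TF.
  have [j _ Gj] : (\bigcup_i G i) (rV_uncons x).2 by rewrite -TG.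
  exists (maxn i j) => //; split.
  - by have /subsetPset/(_ _ Fi) := ndF _ _ (leq_maxl i j).
  - by have /subsetPset/(_ _ Gj) := ndG _ _ (leq_maxr i j).
move=> k; have [mFk Fk] := mF k; have [mGk Gk] := mG k; split.
  rewrite -[X in measurable X]setTI.
  by apply: measurable_rV_uncons => //; exact: measurableX.
by rewrite lebesgue_rVSE// lte_mul_pinfty// ge0_fin_numE.
Qed.

HB.instance Definition _ := Measure_isSigmaFinite.Build _ _ _ lebesgue_rVS
  lebesgue_rVS_sigma_finite.

End lebesgue_rVS.

Fixpoint lebesgue_rV n : {sigma_finite_measure set 'rV[R]_n -> \bar R} :=
  if n is n'.+1 then lebesgue_rVS (lebesgue_rV n')
  else \d_(0 : 'rV[R]_0).

Lemma lebesgue_rV_box n (A : 'I_n -> set R) :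
  (forall i, measurable (A i)) ->
  lebesgue_rV n [set x : 'rV[R]_n | forall i, A i (x ord0 i)] =
  (\prod_(i < n) lebesgue_measure (A i))%E.
Proof.
elim: n A => [|n IHn] A mA.
  by rewrite big_ord0 /= diracE mem_set// => -[].
rewrite big_ord_recl /= -IHn // -lebesgue_rVSE //=.
  congr (lebesgue_rVS _ _); apply/seteqP; split=> x /=.
    by move=> Ax; split=> // i /=; rewrite mxE.
  move=> [A0 AS] i; have [j ->|->//] := unliftP ord0 i.
  by have := AS j; rewrite mxE.
have -> : (fun x : 'rV[R]_n => forall i, A (lift ord0 i) (x ord0 i)) =
    \bigcap_(i in [set: 'I_n])
      ((fun x : 'rV[R]_n => x ord0 i) @^-1` A (lift ord0 i)).
  by apply/seteqP; split=> x Ax i => [_|]; exact: Ax.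
apply: fin_bigcap_measurable => // i _; rewrite -[X in measurable X]setTI.
exact: measurable_coord.
Qed.

End lebesgue_rV.

Section sobolev.
Context {R : realType}.
Variable N : nat.
Implicit Types (f u phi : 'rV[R]_N -> R) (du dphi : 'rV[R]_N -> 'rV[R]_N).

Local Notation mu := (lebesgue_rV N).

Definition dotp (x y : 'rV[R]_N) : R := \sum_(i < N) x ord0 i * y ord0 i.

(* The library norm `|x| on 'rV[R]_N is the sup norm, whence this one. *)
Definition enorm (x : 'rV[R]_N) : R := Num.sqrt (dotp x x).

Definition grad f (x : 'rV[R]_N) : 'rV[R]_N :=
  \row_i 'D_(delta_mx ord0 i) f x.

Fixpoint Ck k f : Prop :=
  continuous f /\
  if k is k'.+1 then
    forall i : 'I_N, (forall x, derivable f x (delta_mx ord0 i)) /\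
                     Ck k' (fun x => 'D_(delta_mx ord0 i) f x)
  else True.

Definition test_function f : Prop :=
  (forall k, Ck k f) /\ compact (closure [set x | f x != 0]).

(* || . ||_X of the pair (u, du), du standing for the gradient of u *)
Definition normX (q : R) u du : \bar R :=
  (('N[mu]_2%:E [EFin \o (enorm \o du)] ^+ 2
    + 'N[mu]_2%:E [EFin \o u] ^+ 2
    + 'N[mu]_q%:E [EFin \o (enorm \o du)] ^+ 2) `^ 2^-1)%E.

Definition weak_gradient u du : Prop :=
  forall phi, test_function phi -> forall i : 'I_N,
    [/\ mu.-integrable setT (fun x => (u x * grad phi x ord0 i)%:E),
        mu.-integrable setT (fun x => (du x ord0 i * phi x)%:E) &
        (\int[mu]_x (u x * grad phi x ord0 i) =
         - \int[mu]_x (du x ord0 i * phi x))%R].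

(* u belongs to X, with gradient du. The completion of the test functions for
   || . ||_X is realized inside L^2(R^N): its elements are the (classes of) u
   such that phi_k -> u in L^2 and grad phi_k -> du in L^2 and L^q for some
   sequence phi_k of test functions. *)
Definition inX (q : R) u du : Prop :=
  [/\ measurable_fun setT u,
      measurable_fun setT du,
      weak_gradient u du &
      exists phi : nat -> 'rV[R]_N -> R,
        (forall k, test_function (phi k)) /\
        normX q (fun x => u x - phi k x) (fun x => du x - grad (phi k) x)
          @[k --> \oo] --> 0%E].

Definition weak_solution (q p : R) (b : R -> R) (lam : R) u du : Prop :=
  forall phi dphi, inX q phi dphi ->
    [/\ mu.-integrable setT
          (fun x => (b (enorm (du x) ^+ 2) * dotp (du x) (dphi x))%:E),
        mu.-integrable setT
          (fun x => ((`|u x| `^ (p - 2) * u x - lam * u x) * phi x)%:E) &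
        (\int[mu]_x (b (enorm (du x) ^+ 2) * dotp (du x) (dphi x)) =
         \int[mu]_x ((`|u x| `^ (p - 2) * u x - lam * u x) * phi x))%R].

Definition radial u : Prop := forall x y, enorm x = enorm y -> u x = u y.

Definition vanishes_at_infinity u : Prop :=
  forall e : R, 0 < e -> exists M : R, forall x, M < enorm x -> `|u x| < e.

End sobolev.

Section nonlinearity.
Context {R : realType}.
Implicit Types b : R -> R.

(* Only the values of b on [0, +oo[ matter; the difference quotient at 0 is
   one-sided. *)
Definition C1_on_nonneg b : Prop :=
  exists2 db : R -> R,
    (forall s, 0 <= s ->
      (b t - b s) / (t - s) @[t --> within [set t | 0 <= t] s^'] --> db s) &
    {within [set t | 0 <= t], continuous db}.

Definition primitive b (s : R) : R :=
  (\int[@lebesgue_measure R]_(t in `[0, s]) b t)%R.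

End nonlinearity.

(* Main.v *)
(** A radial u is determined by the derivative v of its profile: u = K v, where
    K v r is minus the integral of v from r to infinity. The energy of v is
    J v = int Phi v - (1/p) int |K v|^p, with Phi s = B(s^2)/2 and beta = Phi',
    on the ball int (K v)^2 <= rho^2.

    Linearizing the superquadratic term at h gives a strongly convex problem,
    whose minimizer over the ball is T h. By convexity T o K decreases the energy:
    J (T (K v)) <= J v - c |v - T (K v)|^2. A mass-preserving dilation, active only
    when the potential energy is large, also decreases J because p is mass
    supercritical; in the composition U of both, a step with a small drop of energy
    starts from a bounded function. U fixes 0 and keeps the functions of negative
    energy away from 0. On a path t w joining 0 to such a function, the intermediate
    value theorem yields points whose n-th iterate has a prescribed positive
    potential energy; J is bounded below along the n steps, so that one of them
    decreases it by O(1/n). This is a sequence with |v_n - T (K v_n)| -> 0, and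
    compactness of K produces v <> 0 with v = T (K v).

    The minimality of v reads
    beta (v t) = - kap t * int_(|x| <= t) (|u|^(p-2) u - lam u),
    with lam = 0 if the mass of u is less than rho^2. In that case the Nehari and
    Pohozaev identities contradict the strict inequality in (b3).

    A bootstrap at the origin gives |v t| <= C t, so that u and b(|grad u|^2) grad u
    are Lipschitz, and the weak formulation is an integration by parts. Test
    functions of the form Th(|x|^2) approximate u in X, where (b1) and the
    continuity of b at 0 force q >= 2, so that boundedness of v reduces the L^q
    estimates to L^2 ones. *)
From HB Require Import structures.
Require Import Defs.
From mathcomp Require Import all_boot all_order all_algebra.
From mathcomp Require Import all_classical all_reals all_analysis.
From mathcomp Require Import measurable_realfun.
From mathcomp Require Import ring lra.

Set Implicit Arguments.
Unset Strict Implicit.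
Unset Printing Implicit Defensive.

Import Order.TTheory GRing.Theory Num.Theory.
Import numFieldNormedType.Exports.

Local Open Scope classical_set_scope.
Local Open Scope ring_scope.

(** * Real-valued integrals *)

(** In the variable v the principal part is the integral of Phi(v), strongly convex with modulus b 0
    because b is nondecreasing and b 0 > 0, while the potential part sees only K v, which is bounded
    by a multiple of r^(-(N-2)/2). The condition p < 2^* reads (N-2)p/2 < N: it is the integrability
    of r^(-(N-2)p/2) at the origin. The sphere of mass rho^2 is relaxed to a ball because a ball is
    convex and stable under Fatou's lemma, so that minimizing sequences converge strongly by
    convexity alone; equality of the masses is recovered at the end. Iterating a continuous map
    takes the place of a deformation along a gradient flow. A bound on J does not bound v, since the
    two parts of J may compensate each other; this is the reason for the dilation. It multiplies the
    potential energy by s^gam with gam = N(p-2)/2, and the principal energy by at most s^chi with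
    chi = (N/2+1)(2/alpha) - N; the lower bound on alpha in (b3) is the inequality chi < gam. *)

Section RealIntegration.
Context d {T : measurableType d} {R : realType}.
Variables (mu : {measure set T -> \bar R}) (D : set T).
Hypothesis mD : measurable D.
Implicit Types (f g h : T -> R).

Definition rintegrable f := mu.-integrable D (EFin \o f).
Local Notation I f := (\int[mu]_(x in D) f x)%R.

Lemma rintegrable_measurable f : rintegrable f -> measurable_fun D f.
Proof. by move=> /measurable_int/measurable_EFinP. Qed.

Lemma rintegrable_le f g : measurable_fun D f -> rintegrable g ->
  (forall x, D x -> `|f x| <= g x) -> rintegrable f.
Proof.
move=> mf ig fg; apply: le_integrable ig => //; first exact/measurable_EFinP.
move=> x Dx /=; rewrite lee_fin (le_trans (fg x Dx))//.
exact: ler_norm.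
Qed.

Lemma rintegrableD f g : rintegrable f -> rintegrable g ->
  rintegrable (fun x => f x + g x).
Proof. by move=> i1 i2; exact: (integrableD mD i1 i2). Qed.

Lemma rintegrableB f g : rintegrable f -> rintegrable g ->
  rintegrable (fun x => f x - g x).
Proof. by move=> i1 i2; exact: (integrableB mD i1 i2). Qed.

Lemma rintegrableZ (k : R) f : rintegrable f -> rintegrable (fun x => k * f x).
Proof. by move=> i1; exact: (integrableZl mD k i1). Qed.

Lemma rintegrable0 : rintegrable (fun=> 0).
Proof. exact: integrable0. Qed.

Lemma rintegrable_norm f : rintegrable f -> rintegrable (fun x => `|f x|).
Proof. exact: integrable_norm. Qed.

Lemma eq_rintegrable f g : (forall x, D x -> f x = g x) -> rintegrable f ->
  rintegrable g.
Proof.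
by move=> fg; apply: eq_integrable => // x; rewrite inE => Dx /=; rewrite fg.
Qed.

Lemma eq_rint f g : (forall x, D x -> f x = g x) -> I f = I g.
Proof. by move=> fg; apply: eq_Rintegral => x; rewrite inE => /fg. Qed.

Lemma rint_lim f : rintegrable f -> (\int[mu]_(x in D) (f x)%:E)%E = (I f)%:E.
Proof. by move=> i1; rewrite /Rintegral fineK//; exact: integrable_fin_num. Qed.

Lemma rint_le_sub f g : rintegrable f -> rintegrable g ->
  (forall x, D x -> f x <= g x) -> I f <= I g.
Proof. exact: le_Rintegral. Qed.

Lemma rintegrable_ge0 f (C : R) : measurable_fun D f ->
  (forall x, D x -> 0 <= f x) -> (\int[mu]_(x in D) (f x)%:E <= C%:E)%E ->
  rintegrable f /\ I f <= C.
Proof.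
move=> mf f0 fC.
have i1 : rintegrable f.
  apply/integrableP; split; first exact/measurable_EFinP.
  apply: le_lt_trans (ltry C); apply: le_trans fC.
  rewrite le_eqVlt; apply/orP; left; apply/eqP; apply: eq_integral => x.
  by rewrite inE => Dx; rewrite /= ger0_norm// f0.
by split => //; rewrite -lee_fin -rint_lim.
Qed.

Lemma rint_le0_dom f g : measurable_fun D f -> rintegrable g ->
  (forall x, D x -> 0 <= f x <= g x) -> rintegrable f /\ I f <= I g.
Proof.
move=> mf ig fg; have i1 : rintegrable f.
  by apply: rintegrable_le ig _ => // x /fg /andP[? ?]; rewrite ger0_norm.
by split => //; apply: rint_le_sub => // x /fg /andP[].
Qed.

Lemma rint_ae_eq f g : measurable_fun D f -> measurable_fun D g ->
  {ae mu, forall x, D x -> f x = g x} -> I f = I g.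
Proof.
move=> mf mg fg; rewrite /Rintegral; congr fine.
apply: ae_eq_integral => //; [exact/measurable_EFinP|exact/measurable_EFinP|].
by apply: filterS fg => x /= h Dx; rewrite h.
Qed.

Lemma rintegrable_ae f g : measurable_fun D g ->
  {ae mu, forall x, D x -> f x = g x} -> rintegrable f -> rintegrable g.
Proof.
move=> mg fg i1; have mf := rintegrable_measurable i1.
move/integrableP : (i1) => [_ lty]; apply/integrableP; split.
  exact/measurable_EFinP.
suff <- : (\int[mu]_(x in D) `|(EFin \o f) x| = \int[mu]_(x in D) `|(EFin \o g) x|)%E by [].
apply: ae_eq_integral => //.
- by apply: measurableT_comp => //; exact/measurable_EFinP.
- by apply: measurableT_comp => //; exact/measurable_EFinP.
by apply: filterS fg => x /= h Dx; rewrite h.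
Qed.

(** Fatou's lemma in the form in which lower semicontinuity is used: integrability of the limit is
    part of the conclusion. *)
Lemma rint_fatou (f_ : nat -> T -> R) f (C : R) :
  (forall n, measurable_fun D (f_ n)) -> measurable_fun D f ->
  (forall n x, D x -> 0 <= f_ n x) -> (forall x, D x -> 0 <= f x) ->
  {ae mu, forall x, D x -> f_ n x @[n --> \oo] --> f x} ->
  (forall n, rintegrable (f_ n)) -> (forall n, I (f_ n) <= C) ->
  rintegrable f /\ I f <= C.
Proof.
move=> mf_ mf f_0 f0 cv i_ iC; apply: rintegrable_ge0 => //.
have -> : (\int[mu]_(x in D) (f x)%:E = \int[mu]_(x in D) limn_einf (fun n => (f_ n x)%:E))%E.
  apply: ae_eq_integral => //; first exact/measurable_EFinP.
    have -> : (fun x => limn_einf (fun n => (f_ n x)%:E)) =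
              (fun x => - limn_esup (fun n => - (f_ n x)%:E))%E.
      by apply/funext => x; rewrite /limn_einf.
    apply: measurableT_comp => //; apply: measurable_fun_limn_esup => n.
    by apply: measurableT_comp => //; exact/measurable_EFinP.
  apply: filterS cv => x /= h Dx.
  have h' : (f_ n x)%:E @[n --> \oo] --> (f x)%:E.
    by apply: cvg_EFin; [exact: nearW|exact: h].
  by rewrite (cvg_limn_einf_sup h').
apply: (le_trans (fatou mu mD _ _)).
- by move=> n; exact/measurable_EFinP.
- by move=> n x Dx; rewrite lee_fin f_0.
rewrite limn_einf_lim.
apply: lime_le; first exact: is_cvg_einfs.
apply: nearW => n; apply: (@le_trans _ _ (\int[mu]_(x in D) (f_ n x)%:E)%E).
  by apply: ereal_inf_lbound; exists n => /=.
by rewrite rint_lim// lee_fin.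
Qed.

Lemma rint_dct (f_ : nat -> T -> R) f g :
  (forall n, measurable_fun D (f_ n)) -> measurable_fun D f -> rintegrable g ->
  (forall n x, D x -> `|f_ n x| <= g x) ->
  {ae mu, forall x, D x -> f_ n x @[n --> \oo] --> f x} ->
  rintegrable f /\ (I (f_ n) @[n --> \oo] --> I f).
Proof.
move=> mf_ mf ig fg cv.
have [|||||i1 _ i3] := @dominated_convergence _ _ _ mu D mD
  (fun n x => (f_ n x)%:E) (EFin \o f) (EFin \o g).
- by move=> n; exact/measurable_EFinP.
- exact/measurable_EFinP.
- apply: filterS cv => x h Dx /=; apply: cvg_EFin; first exact: nearW.
  exact: h.
- exact: ig.
- by apply: aeW => x n Dx /=; rewrite lee_fin fg.
split => //; rewrite /Rintegral; apply: fine_cvg.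
by rewrite fineK//; exact: integrable_fin_num.
Qed.

Lemma rint_sqr_norm_le f g : measurable_fun D f -> measurable_fun D g ->
  rintegrable (fun x => f x ^+ 2) -> rintegrable (fun x => g x ^+ 2) ->
  rintegrable (fun x => f x * g x).
Proof.
move=> mf mg i1 i2; apply: rintegrable_le (rintegrableD i1 i2) _.
  exact: measurable_funM.
move=> x _; rewrite normrM -(real_normK (num_real (f x))).
rewrite -(real_normK (num_real (g x))).
by have := sqr_ge0 (`|f x| - `|g x|); have := sqr_ge0 (f x); have := sqr_ge0 (g x); 
  have := mulr_ge0 (normr_ge0 (f x)) (normr_ge0 (g x)); nra.
Qed.

Lemma cauchy_schwarz f g : measurable_fun D f -> measurable_fun D g ->
  rintegrable (fun x => f x ^+ 2) -> rintegrable (fun x => g x ^+ 2) ->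
  I (fun x => `|f x * g x|) <=
    Num.sqrt (I (fun x => f x ^+ 2)) * Num.sqrt (I (fun x => g x ^+ 2)).
Proof.
move=> mf mg i1 i2.
set a := Num.sqrt _; set b := Num.sqrt _.
have a0 : 0 <= a by exact: sqrtr_ge0.
have b0 : 0 <= b by exact: sqrtr_ge0.
have aE : I (fun x => f x ^+ 2) = a ^+ 2.
  by rewrite sqr_sqrtr// Rintegral_ge0// => x _; exact: sqr_ge0.
have bE : I (fun x => g x ^+ 2) = b ^+ 2.
  by rewrite sqr_sqrtr// Rintegral_ge0// => x _; exact: sqr_ge0.
(* Enlarging both norms by [e] avoids a division by zero. The weights satisfy s t = 1/4, so that s
   f^2 + t g^2 >= |f g|, and they balance the two integrals. *)
have key e : 0 < e -> I (fun x => `|f x * g x|) <= (a + e) * (b + e).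
  move=> e0; have ae : 0 < a + e by lra.
  have be : 0 < b + e by lra.
  pose s := (b + e) / (a + e) / 2; pose t := (a + e) / (b + e) / 2.
  have s0 : 0 < s by rewrite /s !divr_gt0.
  have t0 : 0 < t by rewrite /t !divr_gt0.
  have st : s * t = 1 / 4 by rewrite /s /t; field; rewrite !gt_eqF.
  apply: (@le_trans _ _ (I (fun x => s * f x ^+ 2 + t * g x ^+ 2))).
    apply: rint_le_sub; first exact/rintegrable_norm/rint_sqr_norm_le.
      by apply: rintegrableD; exact: rintegrableZ.
    move=> x _; rewrite normrM -[in leRHS](real_normK (num_real (f x))).
    rewrite -[in leRHS](real_normK (num_real (g x))).
    set u := `|f x|; set v := `|g x|.
    have : 0 <= (2 * s * u - v) ^+ 2 by exact: sqr_ge0.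
    have -> : (2 * s * u - v) ^+ 2 = 4 * s * (s * u ^+ 2 + (1 / 4) / s * v ^+ 2 - u * v).
      by field; rewrite gt_eqF.
    have -> : (1 / 4) / s = t by rewrite -st; field; rewrite gt_eqF.
    have s4 : 0 < 4 * s by lra.
    by rewrite (pmulr_rge0 _ s4) => ?; lra.
  rewrite RintegralD//; [|exact: rintegrableZ|exact: rintegrableZ].
  rewrite !RintegralZl// aE bE.
  apply: (@le_trans _ _ (s * (a + e) ^+ 2 + t * (b + e) ^+ 2)).
    by rewrite lerD// ler_wpM2l ?(ltW s0) ?(ltW t0)// lerXn2r ?nnegrE; lra.
  rewrite le_eqVlt; apply/orP; left; apply/eqP.
  by rewrite /s /t; field; rewrite !gt_eqF.
apply/ler_addgt0Pr => e e0.
pose e' := Num.min 1 (e / (a + b + 1)).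
have e'0 : 0 < e' by rewrite lt_min ltr01 divr_gt0//; lra.
have e'1 : e' <= 1 by rewrite ge_min lexx.
have e'2 : e' * (a + b + 1) <= e.
  by rewrite -ler_pdivlMr ?ge_min ?lexx ?orbT//; lra.
apply: le_trans (key _ e'0) _.
have -> : (a + e') * (b + e') = a * b + e' * (a + b + e') by ring.
rewrite lerD2l (le_trans _ e'2)// ler_wpM2l ?(ltW e'0)//; lra.
Qed.

Lemma cauchy_schwarz_sqr f g : measurable_fun D f -> measurable_fun D g ->
  rintegrable (fun x => f x ^+ 2) -> rintegrable (fun x => g x ^+ 2) ->
  `|I (fun x => f x * g x)| <=
    Num.sqrt (I (fun x => f x ^+ 2)) * Num.sqrt (I (fun x => g x ^+ 2)).
Proof.
move=> mf mg i1 i2; apply: le_trans (cauchy_schwarz mf mg i1 i2).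
by apply: le_normr_Rintegral => //; exact: rint_sqr_norm_le.
Qed.

Lemma rint_sqrD_le f g : measurable_fun D f -> measurable_fun D g ->
  rintegrable (fun x => f x ^+ 2) -> rintegrable (fun x => g x ^+ 2) ->
  rintegrable (fun x => (f x + g x) ^+ 2) /\
  I (fun x => (f x + g x) ^+ 2) <=
    2 * I (fun x => f x ^+ 2) + 2 * I (fun x => g x ^+ 2).
Proof.
move=> mf mg i1 i2; have i3 := rintegrableD (rintegrableZ 2 i1) (rintegrableZ 2 i2).
have i4 : rintegrable (fun x => (f x + g x) ^+ 2).
  apply: rintegrable_le i3 _.
    by apply: measurable_funX; exact: measurable_funD.
  move=> x _; rewrite ger0_norm ?sqr_ge0// -subr_ge0.
  have -> : 2 * f x ^+ 2 + 2 * g x ^+ 2 - (f x + g x) ^+ 2 = (f x - g x) ^+ 2 by ring.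
  exact: sqr_ge0.
split => //; rewrite -(RintegralZl 2 mD i1) -(RintegralZl 2 mD i2).
rewrite -RintegralD//; [|exact: rintegrableZ|exact: rintegrableZ].
apply: rint_le_sub => // x _; rewrite -subr_ge0.
have -> : 2 * f x ^+ 2 + 2 * g x ^+ 2 - (f x + g x) ^+ 2 = (f x - g x) ^+ 2 by ring.
  exact: sqr_ge0.
Qed.

(** Riesz-Fischer. Along a subsequence with squared increments at most 16^-j, the series of 4^j
    times these squares is integrable, hence finite almost everywhere, and the increments are
    O(2^-j) there. *)
Lemma L2_complete (z : nat -> T -> R) :
  (forall n, measurable_fun D (z n)) ->
  (forall n, rintegrable (fun x => z n x ^+ 2)) ->
  (forall e, 0 < e -> exists M, forall m n, (M <= m)%N -> (M <= n)%N ->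
     I (fun x => (z m x - z n x) ^+ 2) <= e) ->
  exists (w : T -> R) (k : nat -> nat),
    [/\ measurable_fun D w, rintegrable (fun x => w x ^+ 2),
        (forall n, (n <= k n)%N),
        {ae mu, forall x, D x -> z (k n) x @[n --> \oo] --> w x} &
        forall e, 0 < e -> exists M, forall n, (M <= n)%N ->
          I (fun x => (z n x - w x) ^+ 2) <= e].
Proof.
move=> mz iz cz.
have mzz m n : measurable_fun D (fun x => (z m x - z n x) ^+ 2).
  by apply: measurable_funX; exact: measurable_funB.
have izz m n : rintegrable (fun x => (z m x - z n x) ^+ 2).
  have := rint_sqrD_le (mz m) (measurableT_comp (@oppr_measurable _ setT) (mz n)).
  case=> //; apply: eq_rintegrable (iz n) => x _ /=; by rewrite sqrrN.
have /choice[M HM] : forall j : nat, exists M, forall m n, (M <= m)%N -> (M <= n)%N ->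
     I (fun x => (z m x - z n x) ^+ 2) <= ((16 : R) ^- j).
  by move=> j; apply: cz; rewrite invr_gt0 exprn_gt0.
(* The sum of all previous thresholds makes both [k j] and [k j.+1] exceed [M j]; the summand [j]
   makes [k] cofinal. *)
pose k j := (j + \sum_(i < j.+1) M i)%N.
have kM j : (M j <= k j)%N.
  by rewrite /k big_ord_recr/= addnA leq_addl.
have kM1 j : (M j <= k j.+1)%N.
  by rewrite /k big_ord_recr big_ord_recr/= addnC -!addnA addnCA leq_addr.
have kge n : (n <= k n)%N by rewrite leq_addr.
pose g j x := (4 : R) ^+ j * (z (k j.+1) x - z (k j) x) ^+ 2.
have mg j : measurable_fun D (g j).
  by apply: measurable_funM; [exact: measurable_cst|exact: mzz].
have g0 j x : 0 <= g j x by rewrite mulr_ge0 ?sqr_ge0 ?exprn_ge0.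
have ig j : rintegrable (g j) by exact: (rintegrableZ _ (izz _ _)).
have Ig j : I (g j) <= (4 : R) ^- j.
  rewrite (RintegralZl _ mD (izz _ _)).
  apply: (@le_trans _ _ ((4 : R) ^+ j * (16 : R) ^- j)).
    by rewrite ler_wpM2l ?exprn_ge0//; exact: HM.
  by rewrite -exprVn -exprMn -exprVn le_eqVlt; apply/orP; left; apply/eqP; congr (_ ^+ _); field.
have Gfin : {ae mu, forall x, D x -> (\sum_(0 <= j <oo) (g j x)%:E)%E \is a fin_num}.
  apply: (@integrable_ae _ _ _ mu D mD (fun x => (\sum_(0 <= j <oo) (g j x)%:E)%E)).
  apply/integrableP; split.
    apply: ge0_emeasurable_sum => [i x Dx _|i _]; first by rewrite lee_fin.
    exact/measurable_EFinP.
  rewrite (eq_integral (fun x => (\sum_(0 <= j <oo) (g j x)%:E)%E)); last first.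
    by move=> x _; rewrite gee0_abs// nneseries_ge0// => i _ _; rewrite lee_fin.
  rewrite (@integral_nneseries _ _ _ mu D mD (fun j x => (g j x)%:E));
    [|by move=> n; exact/measurable_EFinP|by move=> n x _; rewrite lee_fin].
  apply: (@le_lt_trans _ _ (\sum_(0 <= j <oo) ((4 : R) ^- j)%:E)%E).
    apply: lee_nneseries => [j _ _|j _]; last by rewrite rint_lim// lee_fin.
    by apply: integral_ge0 => x _; rewrite lee_fin.
  have cg : cvgn (series (geometric 1 ((4 : R)^-1))).
    by apply: is_cvg_geometric_series; rewrite ger0_norm; lra.
  have -> : (\sum_(0 <= j <oo) ((4 : R) ^- j)%:E)%E =
      (limn (series (geometric 1 ((4 : R)^-1))))%:E.
    rewrite -EFin_lim//; congr (limn _); apply/funext => n /=.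
    rewrite /series/= sumEFin; congr EFin; apply: eq_bigr => i _.
    by rewrite mul1r exprVn.
  exact: ltry.
(* The upper limit is measurable on the whole domain; where the subsequence diverges its value is
   immaterial. *)
pose w x := fine (limn_esup (fun n => (z (k n) x)%:E)).
have cw : {ae mu, forall x, D x -> z (k n) x @[n --> \oo] --> w x}.
  apply: filterS Gfin => x Gx Dx; have {}Gx := Gx Dx.
  set G := (\sum_(0 <= j <oo) _)%E in Gx.
  pose C := Num.sqrt (fine G).
  have dj j : `|z (k j.+1) x - z (k j) x| <= C * (2 : R) ^- j.
    have gj : g j x <= fine G.
      rewrite -lee_fin fineK//.
      apply: (@le_trans _ _ (\sum_(0 <= i < j.+1) (g i x)%:E)%E).
        by rewrite big_nat_recr//= leeDr// sume_ge0// => i _; rewrite lee_fin.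
      by apply: nneseries_lim_ge => i _ _; rewrite lee_fin.
    have G0 : 0 <= fine G by exact: le_trans (g0 j x) gj.
    rewrite -(@ler_pXn2r _ 2)// ?nnegrE ?mulr_ge0 ?sqrtr_ge0 ?invr_ge0 ?exprn_ge0//.
    rewrite real_normK ?num_real// exprMn sqr_sqrtr//.
    have -> : ((2 : R) ^- j) ^+ 2 = (4 ^+ j)^-1.
      by rewrite -!exprVn -exprM mulnC exprM; congr (_ ^+ _); field.
    by rewrite ler_pdivlMr ?exprn_gt0// mulrC.
  have cz' : cvgn (fun n => z (k n) x).
    have -> : (fun n => z (k n) x) = (fun n => z (k 0%N) x + series (fun j => z (k j.+1) x - z (k j) x) n).
      by apply/funext => n; rewrite /series/= telescope_sumr// addrC subrK.
    apply: is_cvgD; first exact: is_cvg_cst.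
    apply: normed_cvg; apply: (@series_le_cvg _ _ (geometric C (2^-1))) => //=.
    - by move=> n; rewrite mulr_ge0 ?sqrtr_ge0// exprn_ge0.
    - by move=> n; rewrite exprVn dj.
    - by apply: is_cvg_geometric_series; rewrite ger0_norm; lra.
  have cE : (z (k n) x)%:E @[n --> \oo] --> (limn (fun n => z (k n) x))%:E.
    by apply: cvg_EFin; [exact: nearW|exact: cz'].
  by have -> : w x = limn (fun n => z (k n) x) by rewrite /w (cvg_limn_einf_sup cE).2.
have mw : measurable_fun D w.
  apply: measurableT_comp => //; apply: measurable_fun_limn_esup => n.
  exact/measurable_EFinP.
have tail e : 0 < e -> exists M, forall n, (M <= n)%N ->
    rintegrable (fun x => (z n x - w x) ^+ 2) /\ I (fun x => (z n x - w x) ^+ 2) <= e.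
  move=> e0; have [L HL] := cz e e0; exists L => n Ln.
  apply: (@rint_fatou (fun j x => (z n x - z (k (L + j)%N) x) ^+ 2)) => //.
  - by apply: measurable_funX; exact: measurable_funB.
  - by move=> j x _; exact: sqr_ge0.
  - by move=> x _; exact: sqr_ge0.
  - apply: filterS cw => x h Dx; apply: (cvg_comp (fun j => z n x - z (k (L + j)%N) x) (fun y => y ^+ 2)); last exact: exprn_continuous.
    apply: cvgB; first exact: cvg_cst.
    have := h Dx; rewrite -(cvg_shiftn L); under eq_fun do rewrite addnC; exact.
  - by move=> j; apply: HL => //; exact: leq_trans (leq_addr j L) (kge _).
have iw : rintegrable (fun x => w x ^+ 2).
  have [L HL] := tail 1 ltr01; have [h _] := HL L (leqnn _).
  have h' : rintegrable (fun x => (w x - z L x) ^+ 2).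
    by apply: eq_rintegrable h => x _; rewrite -sqrrN opprB.
  have [|+ _] := rint_sqrD_le _ (mz L) h' (iz L); first exact: measurable_funB.
  by apply: eq_rintegrable => x _; rewrite subrK.
exists w, k; split => // e e0.
by have [L HL] := tail e e0; exists L => n /HL[].
Qed.

End RealIntegration.

Section ImageIntegral.
Context d1 d2 (X : measurableType d1) (Y : measurableType d2) (R : realType).
Variables (m1 : {measure set X -> \bar R}) (m2 : {measure set Y -> \bar R}).
Variable phi : X -> Y.
Hypothesis mphi : measurable_fun setT phi.
Hypothesis m12 : forall A, measurable A -> m2 A = m1 (phi @^-1` A).

(** Stated for any [m2] that agrees with the image of [m1], since the measures it is applied to
    (Lebesgue measure on R^n, the law of the radius) have their own constructions. *)
Lemma ge0_integral_image (f : Y -> \bar R) : measurable_fun setT f ->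
  (forall y, 0 <= f y)%E ->
  (\int[m2]_y f y = \int[m1]_x f (phi x))%E.
Proof.
move=> mf f0.
have := @ge0_integral_pushforward _ _ _ _ R phi mphi m1 setT f measurableT mf (fun y _ => f0 y).
rewrite preimage_setT => <-.
by apply: eq_measure_integral => A mA _; rewrite m12.
Qed.

Lemma exists_image_measure (psi : X -> Y) : measurable_fun setT psi ->
  exists m : {measure set Y -> \bar R}, forall A, m A = m1 (psi @^-1` A).
Proof.
move=> mpsi.
by exists (measure_function_pushforward__canonical__measure_function_Measure m1 mpsi).
Qed.

End ImageIntegral.

(** * The law of the radius *)

Section EuclideanMeasure.
Context {R : realType}.
Local Notation leb := (@lebesgue_measure R).

(** The sigma-algebra is generated by the coordinates and the topology by the sup norm; the link is
    that an open set is the union of the countably many rational boxes that it contains. *)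
Lemma continuous_measurable_rV n (f : 'rV[R]_n -> R) : continuous f ->
  measurable_fun setT f.
Proof.
move=> cf; apply: (measurability _ (RGenOInfty.measurableE R)) => // _ [_ [a ->] <-].
rewrite setTI; set U := f @^-1` _.
pose box (q : 'rV[rat]_n) (m : nat) : set 'rV[R]_n :=
  [set x | forall i, `|x ord0 i - ratr (q ord0 i)| < m.+1%:R^-1].
have mbox q m : measurable (box q m).
  have -> : box q m = \bigcap_(i in [set: 'I_n])
      ((fun x : 'rV[R]_n => x ord0 i) @^-1` [set t | `|t - ratr (q ord0 i)| < m.+1%:R^-1]).
    by apply/seteqP; split=> x Ax i => [_|]; exact: Ax.
  apply: fin_bigcap_measurable => // i _; rewrite -[X in measurable X]setTI.
  apply: measurable_coord => //.
  have -> : [set t : R | `|t - ratr (q ord0 i)| < m.+1%:R^-1] =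
      `]ratr (q ord0 i) - m.+1%:R^-1, ratr (q ord0 i) + m.+1%:R^-1[%classic.
    by apply/seteqP; split => t /=; rewrite in_itv/= ltr_distl.
  exact: measurable_itv.
(* The rational boxes are enumerated by their codes; boxes not contained in [U] are replaced by the
   empty set. *)
pose B k := if unpickle k is Some (q, m) then
  if pselect (box q m `<=` U) then box q m else set0 else set0.
have -> : U = \bigcup_k B k.
  apply/seteqP; split => [x Ux|x [k _]]; last first.
    rewrite /B; case: (unpickle k) => // -[q m]; case: pselect => // h.
    exact: h.
  have oU : open U by apply: open_comp => // *; exact: cf.
  have /nbhs_ballP[e /= e0 xeU] : nbhs x U by exact: open_nbhs_nbhs.
  have [m me] : exists m : nat, 2 * m.+1%:R^-1 < e.
    have [m] := @ltr_add_invr R 0 (e / 2) (divr_gt0 e0 (ltr0Sn _ _)).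
    by rewrite add0r => h; exists m; rewrite mulrC -ltr_pdivlMr.
  have /choice[q qP] : forall i : 'I_n, exists q : rat, `|x ord0 i - ratr q| < m.+1%:R^-1.
    move=> i; have lt1 : x ord0 i - m.+1%:R^-1 < x ord0 i + m.+1%:R^-1.
      by rewrite ltrD2l gtrN// invr_gt0.
    have [q] := rat_in_itvoo lt1.
    by rewrite in_itv/= => h; exists q; rewrite distrC ltr_distl.
  exists (pickle (\row_i q i, m)) => //; rewrite /B pickleK.
  case: pselect => [_ /=|]; first by move=> i; rewrite mxE.
  case=> y By; apply: xeU; split => // i j; rewrite (ord1 i) -ball_normE /=.
  have := By j; have := qP j; rewrite mxE => h1 h2.
  rewrite (_ : x ord0 j - y ord0 j = (x ord0 j - ratr (q j)) - (y ord0 j - ratr (q j))); last by ring.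
  by apply: le_lt_trans (ler_normB _ _) _; move: h1 h2 me; set r := _^-1 => h1 h2 me; lra.
apply: bigcupT_measurable => k; rewrite /B; case: (unpickle k) => // -[q m].
by case: pselect => h; [exact: mbox|exact: measurable0].
Qed.

Lemma lebesgue_scale (s : R) (g : R -> \bar R) : 0 < s ->
  measurable_fun setT g -> (forall t, 0 <= g t)%E ->
  (\int[leb]_t g (s * t)%R = (s^-1)%:E * \int[leb]_t g t)%E.
Proof.
move=> s0 mg g0.
have mphi : measurable_fun [set: measurableTypeR R] (fun t : measurableTypeR R => s * t : measurableTypeR R).
  by apply: measurable_funM => //.
have s00 : 0 <= s by rewrite ltW.
have [m mE] := exists_image_measure leb mphi.
(* Uniqueness of Lebesgue measure: s times its image under multiplication by s agrees with it on
   half-open intervals. *)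
have lebE A : measurable A -> leb A = mscale (NngNum s00) m A.
  move=> mA; apply: lebesgue_measure_unique => // X [[a b] _ <-] /=.
  rewrite /mscale/= mE.
  have -> : (fun t => s * t) @^-1` [set` `]a, b]] = [set` `]a / s, b / s]].
    apply/seteqP; split => t /=; rewrite !in_itv/= ltr_pdivrMr// ler_pdivlMr// mulrC;
      by move=> /andP[-> ->].
  rewrite lebesgue_measure_itv [X in (_ = _ * X)%E](lebesgue_measure_itv `]a / s, b / s])/= !lte_fin.
  have -> : (a / s < b / s) = (a < b) by rewrite ltr_pM2r ?invr_gt0.
  case: ifPn => _; last by rewrite mule0.
  by rewrite -!EFinB -EFinM; congr EFin; field; rewrite gt_eqF.
rewrite -(@ge0_integral_image _ _ _ _ _ leb m (fun t => s * t))//.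
have -> : (\int[leb]_t g t = \int[mscale (NngNum s00) m]_t g t)%E.
  by apply: eq_measure_integral => A mA _; exact: lebE.
rewrite ge0_integral_mscale// muleA -EFinM mulVf ?gt_eqF// mul1e.
by [].
Qed.

Local Notation mu := (@lebesgue_rV R).

Lemma scale_rV_cons n s (t : R) (x : 'rV[R]_n) :
  s *: rV_cons (t, x) = rV_cons (s * t, s *: x).
Proof. by apply/rowP => i; rewrite !mxE; case: unliftP => [j _|_] //=; rewrite mxE. Qed.

Lemma measurable_rV_scale n (s : R) : measurable_fun setT (fun x : 'rV[R]_n => s *: x).
Proof.
apply: measurable_fun_rV => i; under eq_fun do rewrite mxE.
by apply: measurable_funM => //; exact: measurable_coord.
Qed.

Lemma rV_tonelli n (g : 'rV[R]_n.+1 -> \bar R) : measurable_fun setT g ->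
  (forall x, 0 <= g x)%E ->
  (\int[mu n.+1]_x g x = \int[leb]_t \int[mu n]_x g (rV_cons (t, x)))%E.
Proof.
move=> mg g0.
pose m : {measure set (measurableTypeR R * 'rV[R]_n) -> \bar R} := (leb \x mu n)%E.
rewrite (@ge0_integral_image _ _ _ _ _ m (mu n.+1) (@rV_cons R n))//; last exact: measurable_rV_cons.
rewrite /m (@fubini_tonelli1 _ _ _ _ _ leb (mu n) (fun z => g (rV_cons z)))//.
by apply: measurableT_comp => //; exact: measurable_rV_cons.
Qed.

Lemma lebesgue_rV_scale n (s : R) (g : 'rV[R]_n -> \bar R) : 0 < s ->
  measurable_fun setT g -> (forall x, 0 <= g x)%E ->
  (\int[mu n]_x g (s *: x)%R = (s ^- n)%:E * \int[mu n]_x g x)%E.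
Proof.
move=> s0; elim: n g => [|n IH] g mg g0.
  rewrite expr0 invr1 mul1e; apply: eq_integral => x _; congr g.
  by apply/rowP => -[].
have mgs : measurable_fun setT (fun x : 'rV[R]_n.+1 => g (s *: x)).
  by apply: measurableT_comp => //; exact: measurable_rV_scale.
have mgc t : measurable_fun setT (fun x : 'rV[R]_n => g (rV_cons (t, x))).
  apply: (measurableT_comp mg); apply: (measurableT_comp (@measurable_rV_cons R n)).
  exact: measurable_pair1.
rewrite !rV_tonelli//.
under eq_integral => t _.
  under eq_integral do rewrite scale_rV_cons.
  rewrite (IH (fun x => g (rV_cons (s * t, x))))//.
  over.
have mG : measurable_fun setT (fun t => (\int[mu n]_x g (rV_cons (t, x)))%E).
  apply: (@measurable_fun_fubini_tonelli_F _ _ _ _ _ (mu n) (fun z => g (rV_cons z))) => //.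
  by apply: measurableT_comp => //; exact: measurable_rV_cons.
have G0 t : (0 <= \int[mu n]_x g (rV_cons (t, x)))%E by apply: integral_ge0.
rewrite ge0_integralZl//; last 2 first.
- apply: (measurableT_comp mG); exact: measurable_funM.
- by rewrite lee_fin invr_ge0 exprn_ge0// ltW.
rewrite (lebesgue_scale s0 mG G0) muleA -EFinM; congr (_%:E * _)%E.
by rewrite exprS invfM mulrC.
Qed.

Local Notation enorm := (@enorm R _).

Lemma measurable_enorm n : measurable_fun setT (@Defs.enorm R n).
Proof.
apply: (measurableT_comp (continuous_measurable_fun (@sqrt_continuous R))) => /=.
rewrite /dotp; apply: measurable_sum => i.
by apply: measurable_funM; exact: measurable_coord.
Qed.

Lemma enorm_ge0 n (x : 'rV[R]_n) : 0 <= enorm x.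
Proof. exact: sqrtr_ge0. Qed.

Lemma dotp_ge0 n (x : 'rV[R]_n) : 0 <= dotp x x.
Proof. by apply: sumr_ge0 => i _; rewrite -expr2 sqr_ge0. Qed.

Lemma sqr_enorm n (x : 'rV[R]_n) : enorm x ^+ 2 = dotp x x.
Proof. by rewrite sqr_sqrtr// dotp_ge0. Qed.

Lemma enormZ n (s : R) (x : 'rV[R]_n) : 0 <= s -> enorm (s *: x) = s * enorm x.
Proof.
move=> s0; rewrite /Defs.enorm.
have -> : dotp (s *: x) (s *: x) = s ^+ 2 * dotp x x.
  by rewrite /dotp mulr_sumr; apply: eq_bigr => i _; rewrite !mxE; ring.
by rewrite sqrtrM ?sqr_ge0// sqrtr_sqr ger0_norm.
Qed.

Lemma coord_le_enorm n (x : 'rV[R]_n) i : `|x ord0 i| <= enorm x.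
Proof.
rewrite -sqrtr_sqr ler_wsqrtr// /dotp (bigD1 i)//= -expr2 lerDl.
by apply: sumr_ge0 => j _; rewrite -expr2 sqr_ge0.
Qed.

Lemma sigma_finite_ballsP (m : {measure set (measurableTypeR R) -> \bar R}) :
  (forall k : nat, (m `[(- k%:R)%R, k%:R]%classic < +oo)%E) -> sigma_finite setT m.
Proof.
move=> mk; exists (fun k : nat => `[(- k%:R)%R, k%:R]%classic : set (measurableTypeR R)).
  apply/seteqP; split => // t _.
  have [k tk] : exists k : nat, `|t| < k%:R.
    by exists (Num.bound `|t|); apply: archi_boundP.
  by exists k => //=; rewrite in_itv/= -ler_norml ltW.
by move=> k; split => //; exact: measurable_itv.
Qed.

Section RadialMeasure.
Variable N : nat.
Hypothesis N0 : (0 < N)%N.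

(** Polar coordinates without a surface measure: integrals of radial functions become integrals
    against this law, which is c N t^(N-1) dt on the half-line, c being the volume of the unit
    ball. *)
Definition radial_measure (A : set (measurableTypeR R)) : \bar R :=
  mu N (@Defs.enorm R N @^-1` A).

Let radial0 : radial_measure set0 = 0%E.
Proof. by rewrite /radial_measure preimage_set0 measure0. Qed.

Let mpre (A : set (measurableTypeR R)) : measurable A -> measurable (@Defs.enorm R N @^-1` A).
Proof. by move=> mA; rewrite -[X in measurable X]setTI; exact: measurable_enorm. Qed.

Let radial_ge0 A : (0 <= radial_measure A)%E.
Proof. exact: measure_ge0. Qed.

Let radial_sigma_additive : semi_sigma_additive radial_measure.
Proof.
move=> F mF tF mUF; rewrite /radial_measure preimage_bigcup.
apply: measure_semi_sigma_additive.
- by move=> k; exact: mpre.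
- apply/trivIsetP => /= i j _ _ ij; rewrite -preimage_setI.
  by move/trivIsetP : tF => /(_ _ _ _ _ ij) ->//; rewrite preimage_set0.
- by rewrite -preimage_bigcup; exact: mpre.
Qed.

HB.instance Definition _ := isMeasure.Build _ _ _ radial_measure
  radial0 radial_ge0 radial_sigma_additive.

Definition cube (a b : R) : set 'rV[R]_N := [set x | forall i, a <= x ord0 i <= b].

Lemma measurable_cube a b : measurable (cube a b).
Proof.
have -> : cube a b = \bigcap_(i in [set: 'I_N]) ((fun x : 'rV[R]_N => x ord0 i) @^-1` `[a, b]%classic).
  apply/seteqP; split=> x Ax i => [_|].
    by have := Ax i; rewrite /= in_itv.
  by have := Ax i I; rewrite /= in_itv.
apply: fin_bigcap_measurable => // i _; rewrite -[X in measurable X]setTI.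
exact: measurable_coord.
Qed.

Lemma cube_measure (a b : R) : a <= b -> mu N (cube a b) = ((b - a) ^+ N)%:E.
Proof.
move=> ab.
have -> : cube a b = [set x | forall i, `[a, b]%classic (x ord0 i)].
  by apply/seteqP; split => x /= h i; have := h i; rewrite in_itv.
rewrite (@lebesgue_rV_box _ _ (fun=> `[a, b]%classic))//.
under eq_bigr do rewrite lebesgue_measure_itv/= lte_fin.
have -> : (if a < b then (b%:E + (- a)%:E)%E else 0%E) = (b - a)%:E.
  by case: ltP => // ba; rewrite (le_anti (introT andP (conj ab ba))) subrr.
rewrite prodEFin; congr EFin.
by rewrite big_const_ord iter_mulr_1.
Qed.

Definition ball_vol : R := fine (radial_measure `[0, 1]%classic).

Lemma radial_ball_fin (r : R) : (radial_measure `]-oo, r]%classic < +oo)%E.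
Proof.
have [r0|r0] := ltP r 0.
  have -> : radial_measure `]-oo, r]%classic = 0%E.
    rewrite /radial_measure (_ : _ @^-1` _ = set0) ?measure0//.
    apply/seteqP; split => // x /=; rewrite in_itv/= => h.
    by have := enorm_ge0 x; rewrite leNgt (le_lt_trans h r0).
  exact: ltry.
have rr : - r <= r by lra.
apply: (@le_lt_trans _ _ (mu N (cube (- r) r))).
  rewrite /radial_measure; apply: le_measure; rewrite ?inE.
  - by apply: mpre; exact: measurable_itv.
  - exact: measurable_cube.
  - move=> x /=; rewrite in_itv/= => xr i; rewrite -ler_norml.
    exact: le_trans (coord_le_enorm x i) xr.
by rewrite cube_measure// ltry.
Qed.

Let radial_sigma_finite : sigma_finite setT radial_measure.
Proof.
apply: sigma_finite_ballsP => k; apply: le_lt_trans (radial_ball_fin k%:R).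
apply: le_measure; rewrite ?inE; try exact: measurable_itv.
by move=> t /=; rewrite !in_itv/= => /andP[].
Qed.

HB.instance Definition _ := Measure_isSigmaFinite.Build _ _ _ radial_measure
  radial_sigma_finite.

Lemma ge0_integral_radial (g : R -> \bar R) : measurable_fun setT g ->
  (forall t, 0 <= g t)%E ->
  (\int[mu N]_x g (enorm x) = \int[radial_measure]_t g t)%E.
Proof.
move=> mg g0; symmetry.
by apply: (@ge0_integral_image _ _ _ _ _ (mu N) radial_measure (@Defs.enorm R N)) => //;
  exact: measurable_enorm.
Qed.

Lemma radial_scale (s : R) (g : R -> \bar R) : 0 < s ->
  measurable_fun setT g -> (forall t, 0 <= g t)%E ->
  (\int[radial_measure]_t g (s * t)%R = (s ^- N)%:E * \int[radial_measure]_t g t)%E.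
Proof.
move=> s0 mg g0.
rewrite -!ge0_integral_radial//; last by apply: (measurableT_comp mg); exact: measurable_funM.
rewrite -(lebesgue_rV_scale s0)//; last by apply: (measurableT_comp mg); exact: measurable_enorm.
by apply: eq_integral => x _; rewrite enormZ// ltW.
Qed.

Lemma radial_neg : radial_measure `]-oo, 0]%classic = 0%E.
Proof.
have -> : radial_measure `]-oo, 0]%classic = mu N (cube 0 0).
  rewrite /radial_measure; congr (mu N _); apply/seteqP; split => x /=.
    rewrite in_itv/= => x0 i.
    by have := le_trans (coord_le_enorm x i) x0; rewrite normr_le0 => /eqP ->; rewrite lexx.
  move=> h; rewrite in_itv/= /Defs.enorm /dotp big1 ?sqrtr0// => i _.
  by have /le_anti <- := h i; rewrite mulr0.
by rewrite cube_measure// subrr expr0n; case: (N) N0.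
Qed.

(** Homogeneity determines the law: [radial_scale] applied to the indicator of the ball of radius r
    compares it with the unit ball. *)
Lemma radial_ball (r : R) : 0 <= r ->
  radial_measure `]-oo, r]%classic = (ball_vol * r ^+ N)%:E.
Proof.
have m01 : radial_measure `[0, 1]%classic = radial_measure `]-oo, 1]%classic.
  rewrite /radial_measure; congr (mu N _); apply/seteqP; split => x /=;
   rewrite !in_itv/= ?enorm_ge0//; by move=> /andP[].
have fin1 : radial_measure `]-oo, 1]%classic \is a fin_num.
  by rewrite ge0_fin_numE ?radial_ge0//; exact: radial_ball_fin.
rewrite le_eqVlt => /predU1P[<-|r0].
  by rewrite radial_neg expr0n; case: (N) N0 => // n _; rewrite mulr0.
have h : (\int[radial_measure]_t (\1_(`]-oo, r]%classic) (r * t)%R)%:E =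
    (r ^- N)%:E * \int[radial_measure]_t (\1_(`]-oo, r]%classic) t)%:E)%E.
  apply: (@radial_scale r (fun t => (\1_(`]-oo, r]%classic) t)%:E)) => //.
  by apply/measurable_EFinP; apply: measurable_indic; exact: measurable_itv.
have e1 : (\int[radial_measure]_t (\1_(`]-oo, r]%classic) (r * t)%R)%:E = radial_measure `]-oo, 1%R]%classic)%E.
  rewrite -[RHS]/(radial_measure _) -[X in radial_measure X]setIT -integral_indic//.
  apply: eq_integral => t _; rewrite !indicE.
  suff -> : (r * t \in `]-oo, r]%classic) = (t \in `]-oo, 1%R]%classic) by [].
  by rewrite -[X in `]-oo, X]%classic]mulr1 !mem_setE !in_itv/= ler_pM2l.
have e2 : (\int[radial_measure]_t (\1_(`]-oo, r]%classic) t)%:E = radial_measure `]-oo, r]%classic)%E.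
  by rewrite integral_indic// setIT.
rewrite e1 e2 in h.
rewrite /ball_vol m01 EFinM fineK// h.
rewrite muleAC -EFinM mulVf ?mul1e// gt_eqF// exprn_gt0//.
Qed.

(** The cube of half-side 1/N lies in the unit ball. *)
Lemma ball_vol_gt0 : 0 < ball_vol.
Proof.
pose e : R := N%:R^-1.
have e0 : 0 < e by rewrite invr_gt0 ltr0n.
suff : (((e - (- e)) ^+ N)%:E <= (ball_vol * 1 ^+ N)%:E)%E.
  rewrite lee_fin expr1n mulr1; apply: lt_le_trans; rewrite exprn_gt0//; lra.
rewrite -radial_ball// -cube_measure; last lra.
rewrite /radial_measure; apply: le_measure; rewrite ?inE.
- exact: measurable_cube.
- by apply: mpre; exact: measurable_itv.
move=> x /= h; rewrite in_itv/= -(@ler_pXn2r _ 2)// ?nnegrE ?enorm_ge0// sqr_enorm expr1n.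
apply: (@le_trans _ _ (\sum_(i < N) e)).
  apply: ler_sum => i _; have := h i; rewrite -ler_norml => xe.
  rewrite -expr2 -(real_normK (num_real _)).
  have e1 : e <= 1 by rewrite invf_le1 ?ltr0n// ler1n.
  apply: (@le_trans _ _ (e * e)); first by rewrite expr2 ler_pM.
  by rewrite ger_pMr.
by rewrite sumr_const card_ord -mulr_natr mulVf// pnatr_eq0 -lt0n.
Qed.

Lemma radial_oc (a b : R) : 0 <= a -> a <= b ->
  radial_measure `]a, b]%classic = (ball_vol * (b ^+ N - a ^+ N))%:E.
Proof.
move=> a0 ab; have -> : `]a, b]%classic = `]-oo, b]%classic `\` `]-oo, a]%classic :> set R.
  by apply/seteqP; split => t /=; rewrite !in_itv/=; [move=> /andP[ta ->]; split => //; apply/negP; rewrite -ltNge|move=> [-> /negP]; rewrite -ltNge => ->].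
rewrite measureD; try exact: measurable_itv; last exact: radial_ball_fin.
rewrite setIidr; last by move=> t /=; rewrite !in_itv/= => ta; exact: le_trans ta ab.
transitivity (radial_measure `]-oo, b]%classic - radial_measure `]-oo, a]%classic)%E => //.
by rewrite !radial_ball// ?(le_trans a0 ab)// -EFinB mulrBr.
Qed.

End RadialMeasure.
End EuclideanMeasure.

(** * Domination by a geometric series *)

Section SeriesBound.
Context d (T : measurableType d) (R : realType).
Variables (mu : {measure set T -> \bar R}) (E : set T).
Hypothesis mE : measurable E.

(** Powers of the radius are integrated without an explicit density: they are dominated on dyadic
    shells by constants whose contributions form a geometric series. *)
Lemma rint_le_geometric (f : T -> R) (g : nat -> T -> R) (A q : R) :
  measurable_fun E f -> (forall t, E t -> 0 <= f t) ->
  (forall k, measurable_fun E (g k)) -> (forall k t, 0 <= g k t) ->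
  (forall t, E t -> exists k, f t <= g k t) ->
  0 <= q < 1 -> (forall k, \int[mu]_(t in E) (g k t)%:E <= (A * q ^+ k)%:E)%E ->
  rintegrable mu E f /\ \int[mu]_(t in E) f t <= A / (1 - q).
Proof.
move=> mf f0 mg g0 fg /andP[q0 q1] gA; apply: (rintegrable_ge0 mE) => //.
apply: (@le_trans _ _ (\int[mu]_(t in E) (\sum_(0 <= k <oo) (g k t)%:E))%E).
  apply: ge0_le_integral => //.
  - exact/measurable_EFinP.
  - apply: ge0_emeasurable_sum => [k t _ _|k _]; first by rewrite lee_fin.
    exact/measurable_EFinP.
  move=> t /fg[k fk]; apply: (@le_trans _ _ (\sum_(0 <= i < k.+1) (g i t)%:E)%E).
    rewrite big_nat_recr//=; apply: (@le_trans _ _ (g k t)%:E); first by rewrite lee_fin.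
    by rewrite leeDr// sume_ge0// => i _; rewrite lee_fin.
  by apply: nneseries_lim_ge => i _ _; rewrite lee_fin.
rewrite integral_nneseries//; last 2 first.
- by move=> n; exact/measurable_EFinP.
- by move=> n t _; rewrite lee_fin.
apply: (@le_trans _ _ (\sum_(0 <= k <oo) (A * q ^+ k)%:E)%E).
  by apply: lee_nneseries => [k _ _|k _]; [apply: integral_ge0 => t _; rewrite lee_fin|exact: gA].
have cg : series (geometric A q) @ \oo --> A / (1 - q).
  by apply: cvg_geometric_series; rewrite ger0_norm.
rewrite le_eqVlt; apply/orP; left; apply/eqP.
apply/cvg_lim => //.
have -> : (fun n => (\sum_(0 <= k < n) (A * q ^+ k)%:E)%E) = EFin \o series (geometric A q).
  by apply/funext => n; rewrite /= /series/= sumEFin.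
by apply: cvg_EFin; [exact: nearW|exact: cg].
Qed.

End SeriesBound.

(** * Radial primitives *)

Section RadialOperator.
Context {R : realType}.
Variable N : nat.
Hypothesis N3 : (3 <= N)%N.
Let N0 : (0 < N)%N. Proof. exact: leq_trans N3. Qed.
Local Notation nu := (@radial_measure R N).
Local Notation c := (@ball_vol R N).
Let c0 : 0 < c. Proof. exact: ball_vol_gt0. Qed.

Lemma radial_oc_le (a b : R) : 0 <= a -> a <= b ->
  (nu `]a, b]%classic <= (c * b ^+ N)%:E)%E.
Proof.
move=> a0 ab; rewrite radial_oc// lee_fin ler_wpM2l ?(ltW c0)//.
by rewrite gerBl exprn_ge0.
Qed.

Lemma dyadic_large (r t : R) : 0 < r -> r < t ->
  exists k : nat, `]r * 2 ^+ k, r * 2 ^+ k.+1]%classic t.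
Proof.
move=> r0 rt.
have ex : exists k : nat, t <= r * 2 ^+ k.+1.
  exists (Num.bound (t / r)); rewrite mulrC -ler_pdivrMr//.
  have h : t / r < (Num.bound (t / r))%:R by apply: archi_boundP; rewrite ltW// divr_gt0// (lt_trans r0).
  apply: ltW; apply: (lt_le_trans h); rewrite -natrX ler_nat.
  by rewrite (leq_trans (ltnW (ltn_expl _ (isT : 1 < 2)%N)))// leq_exp2l.
exists (ex_minn ex); case: ex_minnP => k tk kmin; rewrite /= in_itv/= tk andbT.
rewrite ltNge; apply/negP => h; case: k tk kmin h => [|k] tk kmin h.
  by move: h; rewrite expr0 mulr1 leNgt rt.
by have := kmin _ h; rewrite ltnn.
Qed.

Lemma dyadic_small (r t : R) : 0 < t -> t <= r ->
  exists k : nat, `]r * 2 ^- k.+1, r * 2 ^- k]%classic t.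
Proof.
move=> t0 tr.
have r0 : 0 < r := lt_le_trans t0 tr.
have ex : exists k : nat, r * 2 ^- k.+1 < t.
  exists (Num.bound (r / t)); rewrite ltr_pdivrMr ?exprn_gt0// mulrC -ltr_pdivrMr//.
  have h : r / t < (Num.bound (r / t))%:R by apply: archi_boundP; rewrite ltW// divr_gt0.
  apply: (lt_le_trans h); rewrite -natrX ler_nat.
  by rewrite (leq_trans (ltnW (ltn_expl _ (isT : 1 < 2)%N)))// leq_exp2l.
exists (ex_minn ex); case: ex_minnP => k tk kmin; rewrite /= in_itv/= tk/=.
rewrite leNgt; apply/negP => h; case: k tk kmin h => [|k] tk kmin h.
  by move: h; rewrite expr0 invr1 mulr1 ltNge tr.
by have := kmin _ h; rewrite ltnn.
Qed.

Lemma rint_powR_large (e : R) : N%:R < e -> exists2 C : R, 0 <= C &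
  forall r, 0 < r -> rintegrable nu `]r, +oo[ (fun t => t `^ (- e)) /\
    \int[nu]_(t in `]r, +oo[) t `^ (- e) <= C * (r `^ (- e) * r ^+ N).
Proof.
(* Passing to the next shell multiplies its volume by 2^N and the integrand by 2^-e. *)
move=> Ne; pose q : R := 2 ^+ N * 2 `^ (- e).
have e0 : 0 < e by apply: le_lt_trans Ne.
have q0 : 0 <= q by rewrite mulr_ge0 ?exprn_ge0 ?powR_ge0.
have q1 : q < 1.
  rewrite /q -powR_mulrn// -powRD ?pnatr_eq0 ?implybT//.
  rewrite -[ltRHS](powRr0 (2 : R)) /powR pnatr_eq0/= ltr_expR ltr_pM2r ?ln_gt0 ?ltr1n//.
  by rewrite subr_lt0.
exists (c * 2 ^+ N / (1 - q)).
  by rewrite divr_ge0 ?subr_ge0 ?(ltW q1)// mulr_ge0 ?exprn_ge0// ltW.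
move=> r r0.
pose g (k : nat) (t : R) := (r * 2 ^+ k) `^ (- e) * (\1_(`]r * 2 ^+ k, r * 2 ^+ k.+1]%classic) t : R).
have -> : c * 2 ^+ N / (1 - q) * (r `^ (- e) * r ^+ N) =
    (c * 2 ^+ N * (r `^ (- e) * r ^+ N)) / (1 - q) by ring.
apply: (rint_le_geometric (mu := nu) (measurable_itv _) (g := g)) => //.
- by apply: measurable_funTS; exact: measurable_powR.
- by move=> t _; exact: powR_ge0.
- by move=> k; apply: measurable_funM => //; apply: measurable_indic; exact: measurable_itv.
- by move=> k t; rewrite mulr_ge0 ?powR_ge0.
- move=> t; rewrite /= in_itv/= andbT => rt.
  have [k tk] := dyadic_large r0 rt; exists k; rewrite /g indicE mem_set// mulr1.
  move: tk; rewrite /= in_itv/= => /andP[h _].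
  rewrite !powRN lef_pV2 ?posrE ?powR_gt0 ?mulr_gt0 ?exprn_gt0 ?(lt_trans r0 rt)//.
  by apply: ge0_ler_powR; rewrite ?nnegrE ?mulr_ge0 ?exprn_ge0 ?(ltW e0) ?(ltW r0) ?(ltW (lt_trans r0 rt))// ltW.
- by rewrite q0.
move=> k; under eq_integral do rewrite EFinM.
rewrite ge0_integralZl_EFin//; do ?[exact: powR_ge0|
  by apply/measurable_EFinP; apply: measurable_indic; exact: measurable_itv].
rewrite integral_indic//; try exact: measurable_itv.
apply: (@le_trans _ _ (((r * 2 ^+ k) `^ (- e))%:E * (c * (r * 2 ^+ k.+1) ^+ N)%:E)%E).
  rewrite lee_pmul2l ?lte_fin ?powR_gt0 ?mulr_gt0 ?exprn_gt0//.
  apply: (@le_trans _ _ (nu `]r * 2 ^+ k, r * 2 ^+ k.+1]%classic)).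
    by apply: le_measure; rewrite ?inE//; apply: measurableI; exact: measurable_itv.
  by apply: radial_oc_le; rewrite ?mulr_ge0 ?exprn_ge0 ?(ltW r0)// ler_pM2l// exprS ler_peMl ?exprn_ge0// ler1n.
rewrite -EFinM lee_fin powRM ?(ltW r0) ?exprn_ge0// /q.
rewrite -(powR_mulrn k (ler0n R 2)) -powRrM mulrC (mulrC k%:R) powRrM powR_mulrn ?powR_ge0//.
rewrite le_eqVlt; apply/orP; left; apply/eqP.
rewrite !exprMn exprS -exprM -!exprMn. 
rewrite !exprMn -!exprM (mulnC k N); ring.
Qed.

Lemma rint_powR_small (e : R) : 0 <= e -> e < N%:R -> exists2 C : R, 0 <= C &
  forall r, 0 < r -> rintegrable nu `]0, r] (fun t => t `^ (- e)) /\
    \int[nu]_(t in `]0, r]) t `^ (- e) <= C * (r `^ (- e) * r ^+ N).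
Proof.
(* The shells now shrink to the origin, which inverts the ratio. *)
move=> e0 Ne; pose q : R := 2 `^ e * 2 ^- N.
have q0 : 0 <= q by rewrite mulr_ge0 ?invr_ge0 ?exprn_ge0 ?powR_ge0.
have q1 : q < 1.
  rewrite /q ltr_pdivrMr ?exprn_gt0// mul1r -powR_mulrn//.
  by rewrite /powR pnatr_eq0/= ltr_expR ltr_pM2r ?ln_gt0 ?ltr1n.
exists (c * 2 `^ e / (1 - q)).
  by rewrite divr_ge0 ?subr_ge0 ?(ltW q1)// mulr_ge0 ?powR_ge0// ltW.
move=> r r0.
pose g (k : nat) (t : R) := (r * 2 ^- k.+1) `^ (- e) * (\1_(`]r * 2 ^- k.+1, r * 2 ^- k]%classic) t : R).
have -> : c * 2 `^ e / (1 - q) * (r `^ (- e) * r ^+ N) =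
    (c * 2 `^ e * (r `^ (- e) * r ^+ N)) / (1 - q) by ring.
have p2 k : 0 < (2 : R) ^- k by rewrite invr_gt0 exprn_gt0.
apply: (rint_le_geometric (mu := nu) (measurable_itv _) (g := g)) => //.
- by apply: measurable_funTS; exact: measurable_powR.
- by move=> t _; exact: powR_ge0.
- by move=> k; apply: measurable_funM => //; apply: measurable_indic; exact: measurable_itv.
- by move=> k t; rewrite mulr_ge0 ?powR_ge0.
- move=> t; rewrite /= in_itv/= => /andP[t0 tr].
  have [k tk] := dyadic_small t0 tr; exists k; rewrite /g indicE mem_set// mulr1.
  move: tk; rewrite /= in_itv/= => /andP[h _].
  rewrite !powRN lef_pV2 ?posrE ?powR_gt0 ?mulr_gt0//.
  by apply: ge0_ler_powR; rewrite ?nnegrE ?mulr_ge0 ?(ltW r0) ?(ltW t0) ?(ltW (p2 _))// ltW.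
- by rewrite q0.
move=> k; under eq_integral do rewrite EFinM.
rewrite ge0_integralZl_EFin//; do ?[exact: powR_ge0|
  by apply/measurable_EFinP; apply: measurable_indic; exact: measurable_itv].
rewrite integral_indic//; try exact: measurable_itv.
apply: (@le_trans _ _ (((r * 2 ^- k.+1) `^ (- e))%:E * (c * (r * 2 ^- k) ^+ N)%:E)%E).
  rewrite lee_pmul2l ?lte_fin ?powR_gt0 ?mulr_gt0//.
  apply: (@le_trans _ _ (nu `]r * 2 ^- k.+1, r * 2 ^- k]%classic)).
    by apply: le_measure; rewrite ?inE//; apply: measurableI; exact: measurable_itv.
  apply: radial_oc_le; rewrite ?mulr_ge0 ?(ltW r0) ?(ltW (p2 _))// ler_pM2l//.
  by rewrite lef_pV2 ?posrE ?exprn_gt0// exprS ler_peMl ?exprn_ge0// ler1n.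
rewrite -EFinM lee_fin powRM ?(ltW r0) ?(ltW (p2 _))// /q.
have -> : ((2 : R) ^- k.+1) `^ (- e) = (2 `^ e) ^+ k.+1.
  rewrite -powR_invn// -powRrM mulrNN mulrC powRrM powR_mulrn// powR_ge0.
rewrite le_eqVlt; apply/orP; left; apply/eqP.
rewrite exprS !exprMn -!exprVn -!exprM (mulnC k N); ring.
Qed.

End RadialOperator.

Lemma powRDp {R : realType} (x r s : R) : 0 < x -> x `^ (r + s) = x `^ r * x `^ s.
Proof. by move=> x0; apply: powRD; apply/implyP => _; exact: lt0r_neq0. Qed.

(** * The operator [K]: radial decay, modulus of continuity, scaling *)

Section RadialPrimitive.
Context {R : realType}.
Variable N : nat.
Hypothesis N3 : (3 <= N)%N.
Let N0 : (0 < N)%N. Proof. exact: leq_trans N3. Qed.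
Local Notation nu := (@radial_measure R N).
Local Notation c := (@ball_vol R N).
Let c0 : 0 < c. Proof. exact: ball_vol_gt0. Qed.

Definition halfline : set (measurableTypeR R) := `]0, +oo[%classic.
Local Notation D := halfline.

Lemma measurable_halfline : measurable D. Proof. exact: measurable_itv. Qed.

Lemma halflineE r : D r <-> 0 < r.
Proof. by rewrite /halfline/= in_itv/= andbT. Qed.

Let mray (r : R) : measurable (`]r, +oo[%classic : set (measurableTypeR R)).
Proof. exact: measurable_itv. Qed.

Lemma ray_sub (r : R) : 0 <= r -> `]r, +oo[%classic `<=` D.
Proof. by move=> r0 t; rewrite halflineE /= in_itv/= andbT; exact: le_lt_trans. Qed.

Lemma ge0_integral_ray_scale (s r : R) (g : R -> \bar R) : 0 < s ->
  measurable_fun `]s * r, +oo[ g -> (forall t, s * r < t -> (0 <= g t)%E) ->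
  (\int[nu]_(t in `]r, +oo[) g (s * t)%R =
   (s ^- N)%:E * \int[nu]_(t in `](s * r)%R, +oo[) g t)%E.
Proof.
move=> s0 mg g0; rewrite integral_mkcond [in RHS]integral_mkcond.
rewrite -(radial_scale N s0).
- apply: eq_integral => t _; rewrite !patchE !mem_setE !in_itv/= !andbT.
  by rewrite ltr_pM2l.
- by apply/(measurable_restrictT _ (mray _)).
- by move=> t; rewrite patchE; case: ifPn => //; rewrite mem_setE in_itv/= andbT; exact: g0.
Qed.

Lemma rintegrable_ray_scale (s r : R) (g : R -> R) : 0 < s ->
  rintegrable nu `]s * r, +oo[ g ->
  rintegrable nu `]r, +oo[ (fun t => g (s * t)) /\
  \int[nu]_(t in `]r, +oo[) g (s * t) = s ^- N * \int[nu]_(t in `]s * r, +oo[) g t.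
Proof.
move=> s0 ig; have mg := rintegrable_measurable ig.
have mgE := proj2 (measurable_EFinP _ _) mg.
have sN : 0 < s ^- N by rewrite invr_gt0 exprn_gt0.
have hs : measurable_fun `]r, +oo[ (fun t => g (s * t)).
  apply: (@measurable_comp _ _ _ _ _ _ `]s * r, +oo[%classic g) => //.
  by move=> _ [t /= + <-]; rewrite !in_itv/= !andbT ltr_pM2l.
have igs : rintegrable nu `]r, +oo[ (fun t => g (s * t)).
  apply/integrableP; split; first exact/measurable_EFinP.
  rewrite (@ge0_integral_ray_scale s r (fun t => `|(g t)%:E|%E))//; last first.
    by apply: measurableT_comp.
  by case/integrableP : ig => _ h; rewrite lte_mul_pinfty// lee_fin ltW.
split => //; have fi := integrable_fin_num (mray _) ig.
have -> : s ^- N * \int[nu]_(t in `]s * r, +oo[) g t =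
    fine ((s ^- N)%:E * \int[nu]_(t in `](s * r)%R, +oo[) (g t)%:E) by rewrite fineM.
congr fine; rewrite integralE [in RHS]integralE.
rewrite muleBr//; last first.
  exact: (integrable_add_def (mray _) ig).
rewrite -(@ge0_integral_ray_scale s r _ s0 (measurable_funepos mgE)) => [|t _]; last exact: funepos_ge0.
rewrite -(@ge0_integral_ray_scale s r _ s0 (measurable_funeneg mgE)) => [|t _]; last exact: funeneg_ge0.
by rewrite (funepos_comp (EFin \o g) (fun t => s * t)) (funeneg_comp (EFin \o g) (fun t => s * t)).
Qed.

(* The inverse of the area of the sphere of radius t, so that kap t *: nu is dt. *)
Definition kap (t : R) : R := (c * N%:R)^-1 * t `^ (- (N%:R - 1)).

Lemma measurable_kap (E : set (measurableTypeR R)) : measurable_fun E kap.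
Proof.
apply: measurable_funTS; apply: measurable_funM => //; exact: measurable_powR.
Qed.

Lemma cN_gt0 : 0 < c * N%:R.
Proof. by rewrite mulr_gt0// ltr0n. Qed.

Lemma kap_ge0 t : 0 <= kap t.
Proof. by rewrite mulr_ge0 ?powR_ge0// invr_ge0 ltW// cN_gt0. Qed.

Lemma kap_le r t : 0 < r -> r <= t -> kap t <= kap r.
Proof.
move=> r0 rt; have t0 := lt_le_trans r0 rt.
rewrite ler_wpM2l ?invr_ge0 ?(ltW cN_gt0)// !powRN lef_pV2 ?posrE ?powR_gt0//.
apply: ge0_ler_powR; rewrite ?nnegrE ?(ltW r0) ?(ltW t0)//.
by rewrite subr_ge0 ler1n.
Qed.

Lemma kap_scale s t : 0 < s -> 0 < t -> kap t = s ^+ N * s^-1 * kap (s * t).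
Proof.
move=> s0 t0; rewrite /kap powRM ?(ltW s0) ?(ltW t0)//.
suff h : s ^+ N * s^-1 * s `^ (- (N%:R - 1)) = 1.
  transitivity (s ^+ N * s^-1 * s `^ (- (N%:R - 1)) * ((c * N%:R)^-1 * t `^ (- (N%:R - 1)))); last by ring.
  by rewrite h mul1r.
rewrite -powR_mulrn ?(ltW s0)// -powR_inv1 ?(ltW s0)// -!powRDp//.
have -> : N%:R - 1 - (N%:R - 1) = 0 :> R by ring.
by rewrite powRr0.
Qed.

(** The decay exponent of radial functions with square integrable gradient. *)
Definition half_exp : R := (N%:R - 2) / 2.
Local Notation a := half_exp.

Lemma half_exp_gt0 : 0 < a.
Proof. by rewrite divr_gt0// subr_gt0 ltr_nat. Qed.

(** The square of [kap] is of order t^-(2N-2) against a measure of order t^(N-1) dt, which leaves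
    r^-(N-2). *)
Lemma kap_sqr_integral : exists2 A : R, 0 <= A & forall r, 0 < r ->
  rintegrable nu `]r, +oo[ (fun t => kap t ^+ 2) /\
  \int[nu]_(t in `]r, +oo[) kap t ^+ 2 <= (A * r `^ (- a)) ^+ 2.
Proof.
pose e : R := 2 * N%:R - 2.
have Ne : N%:R < e by rewrite /e; have : (2 : R) < N%:R by [rewrite ltr_nat]; lra.
have [C C0 HC] := rint_powR_large N3 Ne.
exists ((c * N%:R)^-1 * Num.sqrt C) => [|r r0].
  by rewrite mulr_ge0 ?sqrtr_ge0// invr_ge0 ltW// cN_gt0.
have [i1 i2] := HC r r0.
have kE t : kap t ^+ 2 = (c * N%:R)^-1 ^+ 2 * t `^ (- e).
  rewrite /kap exprMn -(powR_mulrn 2 (powR_ge0 _ _)) -powRrM; congr (_ * _ `^ _).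
  by rewrite /e; ring.
have i3 : rintegrable nu `]r, +oo[ (fun t => kap t ^+ 2).
  by apply: eq_rintegrable (rintegrableZ _ ((c * N%:R)^-1 ^+ 2) i1) => // t _; rewrite kE.
split => //; under eq_rint do rewrite kE.
rewrite RintegralZl//.
have -> : ((c * N%:R)^-1 * Num.sqrt C * r `^ (- a)) ^+ 2 =
    (c * N%:R)^-1 ^+ 2 * (Num.sqrt C ^+ 2 * (r `^ (- a)) ^+ 2) by ring.
rewrite ler_wpM2l ?sqr_ge0//.
apply: le_trans i2 _; rewrite sqr_sqrtr// ler_wpM2l//.
rewrite -(powR_mulrn 2 (powR_ge0 _ _)) -powRrM -powR_mulrn ?(ltW r0)//.
have -> : r `^ (- e) * r `^ N%:R = r `^ (- a * 2).
  rewrite -powRDp//; suff -> : - e + N%:R = - a * 2 by [].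
  by rewrite /e /a; field.
exact: lexx.
Qed.

Definition Kcst : R := projT1 (cid2 kap_sqr_integral).

Lemma Kcst_ge0 : 0 <= Kcst.
Proof. by rewrite /Kcst; case: (cid2 _). Qed.

Lemma kap_sqr r : 0 < r ->
  rintegrable nu `]r, +oo[ (fun t => kap t ^+ 2) /\
  \int[nu]_(t in `]r, +oo[) kap t ^+ 2 <= (Kcst * r `^ (- a)) ^+ 2.
Proof. by rewrite /Kcst; case: (cid2 _) => A A0 /= h r0; exact: h. Qed.

Definition L2 (z : R -> R) := measurable_fun D z /\ rintegrable nu D (fun t => z t ^+ 2).
Definition nrm (z : R -> R) : R := Num.sqrt (\int[nu]_(t in D) z t ^+ 2).
Definition K (z : R -> R) (r : R) : R := - \int[nu]_(t in `]r, +oo[) (z t * kap t).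

Lemma nrm_ge0 z : 0 <= nrm z. Proof. exact: sqrtr_ge0. Qed.

Lemma sqr_nrm z : nrm z ^+ 2 = \int[nu]_(t in D) z t ^+ 2.
Proof. by rewrite sqr_sqrtr// Rintegral_ge0// => t _; exact: sqr_ge0. Qed.

Lemma L2_lin (x y : R) z w : L2 z -> L2 w -> L2 (fun t => x * z t + y * w t).
Proof.
move=> [mz iz] [mw iw]; have mD := measurable_halfline.
have mx : measurable_fun D (fun t => x * z t) by apply: measurable_funM.
have my : measurable_fun D (fun t => y * w t) by apply: measurable_funM.
split; first exact: measurable_funD.
apply: (rint_sqrD_le mD mx my _ _).1.
  by apply: eq_rintegrable (rintegrableZ mD (x ^+ 2) iz) => // t _; rewrite exprMn.
by apply: eq_rintegrable (rintegrableZ mD (y ^+ 2) iw) => // t _; rewrite exprMn.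
Qed.

Lemma nrmZ (x : R) z : L2 z -> nrm (fun t => x * z t) = `|x| * nrm z.
Proof.
move=> [_ iz]; have mD := measurable_halfline.
rewrite /nrm; under eq_rint do rewrite exprMn.
by rewrite RintegralZl// sqrtrM ?sqr_ge0// sqrtr_sqr.
Qed.

Lemma rintS (A B : set (measurableTypeR R)) (f : measurableTypeR R -> R) :
  measurable A -> measurable B -> A `<=` B ->
  rintegrable nu B f -> rintegrable nu A f.
Proof. by move=> mA mB AB; apply: integrableS. Qed.

Lemma rint_le_set (A B : set (measurableTypeR R)) (f : measurableTypeR R -> R) :
  measurable A -> measurable B -> A `<=` B ->
  rintegrable nu B f -> (forall t, B t -> 0 <= f t) ->
  \int[nu]_(t in A) f t <= \int[nu]_(t in B) f t.
Proof.
move=> mA mB AB i1 f0; have i2 := rintS mA mB AB i1.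
rewrite /Rintegral fine_le//; try exact: integrable_fin_num.
apply: (@ge0_subset_integral _ _ _ nu A B mA mB (fun t => (f t)%:E)) => //.
  by apply/measurable_EFinP; exact: (rintegrable_measurable i1).
Qed.

Lemma K_integrable z r : L2 z -> 0 < r -> rintegrable nu `]r, +oo[ (fun t => z t * kap t).
Proof.
move=> [mz iz] r0; have [k1 k2] := kap_sqr r0.
apply: rint_sqr_norm_le => //.
- exact: (measurable_funS measurable_halfline (ray_sub (ltW r0)) mz).
- exact: measurable_kap.
- by apply: rintS iz; [|exact: measurable_halfline|exact: (ray_sub (ltW r0))].
Qed.

(** The radial lemma, by Cauchy-Schwarz against [kap]. It gives decay at infinity and limits the
    singularity at the origin at the same time. *)
Lemma K_bound z r : L2 z -> 0 < r -> `|K z r| <= Kcst * r `^ (- a) * nrm z.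
Proof.
move=> [mz iz] r0; have [k1 k2] := kap_sqr r0.
have sub := ray_sub (ltW r0).
rewrite /K normrN; have mz' := measurable_funS measurable_halfline sub mz.
have iz' : rintegrable nu `]r, +oo[ (fun t => z t ^+ 2).
  by apply: rintS iz => //; exact: measurable_halfline.
have h := @cauchy_schwarz_sqr _ _ R nu _ (mray r) z kap mz' (@measurable_kap _) iz' k1.
apply: le_trans h _.
rewrite mulrC ler_pM ?sqrtr_ge0//.
  rewrite -[leRHS]ger0_norm ?mulr_ge0 ?Kcst_ge0 ?powR_ge0// -sqrtr_sqr.
  exact: ler_wsqrtr.
apply: ler_wsqrtr; apply: rint_le_set => //; first exact: measurable_halfline.
by move=> t _; exact: sqr_ge0.
Qed.

Lemma K_lin (x y : R) z w r : L2 z -> L2 w -> 0 < r ->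
  K (fun t => x * z t + y * w t) r = x * K z r + y * K w r.
Proof.
move=> lz lw r0; have iz := K_integrable lz r0; have iw := K_integrable lw r0.
rewrite /K.
have -> : \int[nu]_(t in `]r, +oo[) ((x * z t + y * w t) * kap t) =
    \int[nu]_(t in `]r, +oo[) (x * (z t * kap t) + y * (w t * kap t)).
  by apply: eq_rint => t _; ring.
rewrite RintegralD//; [|exact: rintegrableZ|exact: rintegrableZ].
by rewrite !RintegralZl//; ring.
Qed.

Lemma KZ (x : R) z r : L2 z -> 0 < r -> K (fun t => x * z t) r = x * K z r.
Proof.
move=> lz r0; have := K_lin x 0 lz lz r0; rewrite mul0r addr0 => <-.
by congr (K _ _); apply/funext => t; rewrite mul0r addr0.
Qed.

Lemma KB z w r : L2 z -> L2 w -> 0 < r -> K (fun t => z t - w t) r = K z r - K w r.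
Proof.
move=> lz lw r0; have := K_lin 1 (-1) lz lw r0; rewrite mul1r mulN1r => <-.
by congr (K _ _); apply/funext => t; rewrite mul1r mulN1r.
Qed.

Lemma K_ae z w r : L2 z -> L2 w -> 0 < r ->
  {ae nu, forall t, D t -> z t = w t} -> K z r = K w r.
Proof.
move=> [mz _] [mw _] r0 zw; rewrite /K; congr (- _).
have sub := ray_sub (ltW r0).
apply: rint_ae_eq => //.
- by apply: measurable_funM; [exact: (measurable_funS measurable_halfline sub mz)|exact: measurable_kap].
- by apply: measurable_funM; [exact: (measurable_funS measurable_halfline sub mw)|exact: measurable_kap].
by apply: filterS zw => t h /sub Dt; rewrite h.
Qed.

Lemma K_diff z r s : L2 z -> 0 < r -> r <= s ->
  K z s - K z r = \int[nu]_(t in `]r, s]) (z t * kap t).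
Proof.
move=> lz r0 rs; have i1 := K_integrable lz r0.
have E : `]r, +oo[%classic = `]r, s]%classic `|` `]s, +oo[%classic :> set R.
  apply/seteqP; split => t /=; rewrite !in_itv/= !andbT.
    by move=> ->; case: (leP t s) => _; [left|right].
  by case=> [/andP[]//|]; exact: le_lt_trans.
rewrite /K E Rintegral_setU//; first by ring.
- by rewrite -E.
rewrite disj_set2E; apply/eqP/seteqP; split => // t /=.
by rewrite !in_itv/= andbT => -[/andP[_ ts]]; rewrite ltNge ts.
Qed.

Lemma K_holder z r s : L2 z -> 0 < r -> r <= s ->
  `|K z s - K z r| <= nrm z * (kap r * Num.sqrt (c * (s ^+ N - r ^+ N))).
Proof.
move=> lz r0 rs; rewrite K_diff//; case: lz => mz iz.
have mI : measurable (`]r, s]%classic : set (measurableTypeR R)) by exact: measurable_itv.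
have sub : `]r, s]%classic `<=` D.
  by move=> t; rewrite halflineE /= in_itv/= => /andP[h _]; exact: lt_trans h.
have sN : 0 <= c * (s ^+ N - r ^+ N).
  by rewrite mulr_ge0 ?(ltW c0)// subr_ge0 lerXn2r ?nnegrE ?(ltW r0)// ltW// (lt_le_trans r0).
have nuI : nu `]r, s]%classic = (c * (s ^+ N - r ^+ N))%:E by apply: radial_oc => //; exact: ltW.
have [i1 _] : rintegrable nu `]r, s] (fun=> kap r ^+ 2) /\ \int[nu]_(t in `]r, s]) kap r ^+ 2 <= kap r ^+ 2 * (c * (s ^+ N - r ^+ N)).
  apply: (rintegrable_ge0 mI (C := kap r ^+ 2 * (c * (s ^+ N - r ^+ N)))) => //.
    by move=> t _; exact: sqr_ge0.
  rewrite (integral_cst nu mI (kap r ^+ 2)%:E).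
  by rewrite le_eqVlt; apply/orP; left; apply/eqP; rewrite [RHS]EFinM; congr (_ * _)%E; exact: nuI.
have [i2 i2le] : rintegrable nu `]r, s] (fun t => kap t ^+ 2) /\
    \int[nu]_(t in `]r, s]) kap t ^+ 2 <= \int[nu]_(t in `]r, s]) kap r ^+ 2.
  apply: rint_le0_dom => //; first by apply: measurable_funX; exact: measurable_kap.
  move=> t; rewrite /= in_itv/= => /andP[rt _]; rewrite sqr_ge0/=.
  by rewrite lerXn2r ?nnegrE ?kap_ge0// kap_le// ltW.
have mz' := measurable_funS measurable_halfline sub mz.
have iz' : rintegrable nu `]r, s] (fun t => z t ^+ 2).
  by apply: rintS iz => //; exact: measurable_halfline.
have h := @cauchy_schwarz_sqr _ _ R nu _ mI z kap mz' (@measurable_kap _) iz' i2.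
apply: le_trans h _.
apply: ler_pM; rewrite ?sqrtr_ge0//.
  apply: ler_wsqrtr; apply: rint_le_set => //; first exact: measurable_halfline.
  by move=> t _; exact: sqr_ge0.
rewrite -[X in X * _]ger0_norm ?kap_ge0// -sqrtr_sqr -sqrtrM ?sqr_ge0//.
apply: ler_wsqrtr; apply: le_trans i2le _.
by rewrite Rintegral_cst//= nuI.
Qed.

(** A symmetric form of the bound in [K_holder]. It does not depend on z: bounded sets of L^2 have
    equicontinuous images under [K] away from the origin. *)
Definition Kmod (r s : R) : R := kap (Num.min r s) * Num.sqrt (c * `|s ^+ N - r ^+ N|).

Lemma K_modulus z r s : L2 z -> 0 < r -> 0 < s -> `|K z s - K z r| <= nrm z * Kmod r s.
Proof.
move=> lz r0 s0; rewrite /Kmod; case: (leP r s) => rs.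
  rewrite (ger0_norm (x := s ^+ N - r ^+ N)); first exact: K_holder.
  by rewrite subr_ge0 lerXn2r ?nnegrE ?(ltW r0) ?(ltW s0).
rewrite distrC (ler0_norm (x := s ^+ N - r ^+ N)) ?opprB; first by apply: K_holder => //; exact: ltW.
by rewrite subr_le0 lerXn2r ?nnegrE ?(ltW r0) ?(ltW s0)// ltW.
Qed.

Lemma Kmod_cvg r : 0 < r -> Kmod r s @[s --> r] --> (0 : R).
Proof.
move=> r0.
have h : kap (r / 2) * Num.sqrt (c * `|s ^+ N - r ^+ N|) @[s --> r] --> (0 : R).
  have -> : (0 : R) = kap (r / 2) * Num.sqrt (c * `|r ^+ N - r ^+ N|).
    by rewrite subrr normr0 mulr0 sqrtr0 mulr0.
  apply: cvgM; first exact: cvg_cst.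
  have h1 : c * `|s ^+ N - r ^+ N| @[s --> r] --> c * `|r ^+ N - r ^+ N|.
    apply: cvgM; first exact: cvg_cst.
    apply: cvg_norm; apply: cvgB; last exact: cvg_cst.
    exact: exprn_continuous.
  exact: (cvg_comp _ _ h1 (@sqrt_continuous R _)).
apply: (@squeeze_cvgr _ _ _ _ (fun=> 0) _ _ _ _ (cvg_cst _) h).
near=> s; rewrite /Kmod.
have s2 : r / 2 < s by near: s; apply: lt_nbhsr; lra.
rewrite mulr_ge0 ?kap_ge0 ?sqrtr_ge0//= ler_wpM2r ?sqrtr_ge0//.
by apply: kap_le; [lra|rewrite le_min; lra].
Unshelve. all: by end_near. Qed.

Lemma K_continuous z r : L2 z -> 0 < r -> {for r, continuous (K z)}.
Proof.
move=> lz r0; apply/cvgrPdist_le => e e0.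
have h : nrm z * Kmod r s @[s --> r] --> (0 : R).
  by rewrite -[X in _ --> X](mulr0 (nrm z)); apply: cvgM; [exact: cvg_cst|exact: Kmod_cvg].
move/cvgrPdist_le : h => /(_ e e0) h.
near=> s; have s0 : 0 < s by near: s; apply: lt_nbhsr.
rewrite distrC; apply: le_trans (K_modulus lz r0 s0) _.
apply: le_trans (ler_norm _) _; rewrite -normrN -sub0r.
near: s; exact: h.
Unshelve. all: by end_near. Qed.

Lemma measurable_K z : L2 z -> measurable_fun D (K z).
Proof.
move=> lz; apply: open_continuous_measurable_fun; first exact: interval_open.
by move=> r; rewrite inE => /halflineE r0; exact: K_continuous.
Qed.

Lemma K_scale s z r : L2 z -> 0 < s -> 0 < r ->
  K (fun t => z (s * t)) r = s^-1 * K z (s * r).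
Proof.
move=> lz s0 r0; rewrite /K mulrN; congr (- _).
have ik := K_integrable lz (mulr_gt0 s0 r0).
have [i1 i2] := rintegrable_ray_scale s0 ik.
have -> : \int[nu]_(t in `]r, +oo[) (z (s * t) * kap t) =
    \int[nu]_(t in `]r, +oo[) (s ^+ N * s^-1 * (z (s * t) * kap (s * t))).
  apply: eq_rint => t; rewrite /= in_itv/= andbT => rt.
  by rewrite (kap_scale s0 (lt_trans r0 rt)); ring.
rewrite (RintegralZl _ (mray r) i1) i2 mulrA; congr (_ * _).
by rewrite mulrAC mulfV ?mul1r// expf_neq0// gt_eqF.
Qed.

Lemma L2_scale s z : L2 z -> 0 < s -> L2 (fun t => z (s * t)) /\
  nrm (fun t => z (s * t)) = Num.sqrt (s ^- N) * nrm z.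
Proof.
move=> [mz iz] s0.
have [i1 i2] : rintegrable nu D (fun t => z (s * t) ^+ 2) /\
   \int[nu]_(t in D) z (s * t) ^+ 2 = s ^- N * \int[nu]_(t in D) z t ^+ 2.
  have := @rintegrable_ray_scale s 0 (fun t => z t ^+ 2) s0; rewrite mulr0; exact.
split; first split => //.
  apply: (@measurable_comp _ _ _ _ _ _ D z) => //; first exact: measurable_halfline.
  by move=> _ [t /halflineE t0 <-]; apply/halflineE; rewrite mulr_gt0.
by rewrite /nrm i2 sqrtrM// invr_ge0 exprn_ge0// ltW.
Qed.

End RadialPrimitive.

(** * The nonlinearities *)

Section Nonlinearity.
Context {R : realType}.
Variables (b : R -> R) (alpha : R).
Hypothesis b_gt0 : forall s, 0 <= s -> 0 < b s.
Hypothesis b_C1 : C1_on_nonneg b.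
Hypothesis b_mono : forall s t, 0 <= s -> s <= t -> b s <= b t.
Hypothesis alpha_gt0 : 0 < alpha.
Hypothesis b_lower : forall s, 0 < s -> alpha * (b s * s) <= primitive b s.
Local Notation B := (primitive b).
Local Notation leb := (@lebesgue_measure R).

(** A convergent difference quotient is bounded near the point. The epsilon form respects the
    one-sided notion at 0. *)
Lemma b_cont s : 0 <= s -> forall e, 0 < e ->
  exists2 d, 0 < d & forall t, 0 <= t -> `|t - s| < d -> `|b t - b s| <= e.
Proof.
move=> s0 e e0; case: b_C1 => db h _.
have /cvgrPdist_le /(_ 1 ltr01) := h s s0.
rewrite near_withinE /dnbhs near_withinE => /nbhs_ballP[d /= d0 hd].
have M0 : 0 < `|db s| + 1 by rewrite ltr_pwDr.
exists (Num.min d (e / (`|db s| + 1))); first by rewrite lt_min d0 divr_gt0.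
move=> t t0; rewrite lt_min => /andP[td te].
have [->|ts] := eqVneq t s; first by rewrite subrr normr0 ltW.
have := hd t; rewrite /ball/= distrC => /(_ td ts t0) h1.
have ts0 : t - s != 0 by rewrite subr_eq0.
have h2 : `|(b t - b s) / (t - s)| <= `|db s| + 1.
  rewrite -[X in `|X|](subrKC (db s)); apply: le_trans (ler_normD _ _) _.
  by rewrite lerD2l distrC.
rewrite -[b t - b s](divfK ts0) normrM.
apply: (@le_trans _ _ ((`|db s| + 1) * `|t - s|)); first by rewrite ler_wpM2r.
by rewrite mulrC -ler_pdivlMr// ltW.
Qed.

(** Extending [b] by its value at 0 gives a function monotone on the whole line, hence
    measurable. *)
Let bx (t : R) := b (Num.max t 0).

Let bx_mono : {homo bx : s t / s <= t}.
Proof.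
move=> s t st; apply: b_mono; first by rewrite le_max lexx orbT.
by rewrite ge_max !le_max st lexx !orbT.
Qed.

Let bxE t : 0 <= t -> bx t = b t.
Proof. by move=> t0; rewrite /bx max_l. Qed.

Let mbx : measurable_fun setT bx.
Proof. exact: nondecreasing_measurable. Qed.

Let leb_fin (i j : bool) (s t : R) :
  (leb [set` Interval (BSide i s) (BSide j t)] < +oo)%E.
Proof. by rewrite lebesgue_measure_itv/=; case: ifP => // _; rewrite -EFinB ltry. Qed.

Lemma b_integrable s t : 0 <= s -> rintegrable leb `[s, t] b.
Proof.
move=> s0; apply: (@eq_rintegrable _ _ _ leb `[s, t]%classic (measurable_itv _) bx).
  by move=> x; rewrite /= in_itv/= => /andP[sx _]; rewrite bxE// (le_trans s0).
apply: measurable_bounded_integrable => //.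
- exact: leb_fin.
- exact: measurable_funTS.
exists (bx t); split; first exact: num_real.
move=> M tM x; rewrite /= in_itv/= => /andP[sx xt].
rewrite ger0_norm; first exact: le_trans (bx_mono xt) (ltW tM).
by rewrite ltW// bxE ?b_gt0// (le_trans s0).
Qed.

Lemma primitive0 : B 0 = 0.
Proof. by rewrite /primitive set_itv1 Rintegral_set1. Qed.

Let prim_diff s t : 0 <= s -> s <= t ->
  b s * (t - s) <= B t - B s <= b t * (t - s).
Proof.
move=> s0 st; rewrite le_eqVlt in st; case/predU1P: st => [<-|st].
  by rewrite !subrr !mulr0 lexx.
have i1 := b_integrable t (lexx 0).
have -> : B t - B s = \int[leb]_(x in `]s, t]) b x.
  rewrite /primitive (@Rintegral_itvB _ b (BLeft 0) (BRight t) s) => //;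
    by rewrite bnd_simp// ltW.
have mI : measurable (`]s, t]%classic : set (measurableTypeR R)) by exact: measurable_itv.
have i2 : rintegrable leb `]s, t] b.
  apply: integrableS i1 => //.
  by move=> x; rewrite /= !in_itv/= => /andP[sx ->]; rewrite (le_trans s0 (ltW sx)).
have leE : fine (leb `]s, t]%classic) = t - s.
  by rewrite lebesgue_measure_itv/= lte_fin st.
have ic (k : R) : rintegrable leb `]s, t] (fun=> k).
  apply: measurable_bounded_integrable => //.
    exact: leb_fin.
  by exists `|k|; split => // M kM x _; exact: ltW.
have ce (k : R) : k * (t - s) = \int[leb]_(x in `]s, t]) k.
  by rewrite Rintegral_cst// leE.
rewrite !ce; apply/andP; split.
  apply: (le_Rintegral mI (ic _) i2) => x.
  by rewrite /= in_itv/= => /andP[sx xt]; apply: b_mono => //; exact: ltW.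
apply: (le_Rintegral mI i2 (ic _)) => x.
rewrite /= in_itv/= => /andP[sx xt]; apply: b_mono => //.
exact: (le_trans s0 (ltW sx)).
Qed.

Lemma primitive_tangent s t : 0 <= s -> 0 <= t -> b s * (t - s) <= B t - B s.
Proof.
move=> s0 t0; case: (leP s t) => st; first by have /andP[] := prim_diff s0 st.
have /andP[_ h] := prim_diff t0 (ltW st); rewrite -lerN2 !opprB.
by apply: le_trans h _; rewrite -mulrN opprB.
Qed.

Lemma primitive_gt0 s : 0 < s -> 0 < B s.
Proof.
move=> s0; have := primitive_tangent (lexx 0) (ltW s0).
rewrite primitive0 !subr0; apply: lt_le_trans; rewrite mulr_gt0// b_gt0//.
Qed.

(** Monotonicity gives B 1 <= b 1, whereas (b3) gives alpha b 1 <= B 1. Hence the growth exponent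
    2/alpha of Phi is at least 2. *)
Lemma alpha_le1 : alpha <= 1.
Proof.
have h := b_lower ltr01; have := primitive_tangent ler01 (lexx 0).
rewrite primitive0 !sub0r mulrN mulr1 lerN2 => h2.
have b1 : 0 < b 1 by exact: b_gt0.
by move: (le_trans h h2); rewrite mulr1 ger_pMl.
Qed.

Let is_derive_primitive (s : R) : 0 < s -> is_derive s 1 B (b s).
Proof.
move=> s0; have s1 : s < s + 1 by rewrite ltrDl.
have i1 : leb.-integrable [set` Interval (BLeft 0) (BRight (s + 1))] (EFin \o b).
  exact: (b_integrable (s + 1) (lexx 0)).
have cs : {for s, continuous b}.
  apply/cvgrPdist_le => e e0; have [d d0 hd] := b_cont (ltW s0) e0.
  near=> t; rewrite distrC; apply: hd.
    by apply: ltW; near: t; exact: lt_nbhsr.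
  by rewrite distrC; near: t; apply/nbhs_ballP; exists d.
have [] := @continuous_FTC1_closed R b 0 s (s + 1) s1 i1 s0 cs.
move=> dB B'; apply: (DeriveDef dB).
by rewrite -derive1E; exact: B'.
Unshelve. all: by end_near. Qed.

(** The lower bound in (b3) says that ln B - alpha^-1 ln has nonpositive derivative. *)
Lemma primitive_scale tau s : 1 <= tau -> 0 <= s -> B (tau * s) <= tau `^ alpha^-1 * B s.
Proof.
rewrite le_eqVlt => /predU1P[<-|tau1] s0; first by rewrite mul1r powR1 mul1r.
move: s0; rewrite le_eqVlt => /predU1P[<-|s0]; first by rewrite mulr0 primitive0 mulr0.
have tau0 : 0 < tau by lra.
have ts : s < tau * s by rewrite ltr_pMl.
have ts0 : 0 < tau * s by rewrite mulr_gt0.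
pose G := (fun x => ln (B x) - alpha^-1 * ln x).
have dG (x : R) : 0 < x -> is_derive x 1 G ((B x)^-1 * b x - alpha^-1 * x^-1).
  move=> x0; have Bx0 := primitive_gt0 x0.
  have h1 : is_derive x 1 (@ln R \o B) ((B x)^-1 * b x).
    by apply: is_derive1_comp; [exact: is_derive1_ln|exact: is_derive_primitive].
  have h2 : is_derive x 1 (fun y => alpha^-1 * ln y) (alpha^-1 * x^-1).
    by apply: is_deriveZ; exact: is_derive1_ln.
  exact: is_deriveB.
have [||x xs GE] := @MVT R G (fun x => (B x)^-1 * b x - alpha^-1 * x^-1) s (tau * s) ts.
- by move=> x; rewrite in_itv/= => /andP[sx _]; apply: dG; exact: lt_trans sx.
- apply: derivable_within_continuous => x; rewrite in_itv/= => /andP[sx _].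
  by have [] := dG x (lt_le_trans s0 sx).
have x0 : 0 < x by move: xs; rewrite in_itv/= => /andP[sx _]; exact: lt_trans sx.
have Bx0 := primitive_gt0 x0.
have h : (B x)^-1 * b x - alpha^-1 * x^-1 <= 0.
  rewrite subr_le0 -invfM [leLHS]mulrC ler_pdivrMr// mulrC ler_pdivlMr ?mulr_gt0//.
  by move: (b_lower x0); rewrite mulrCA.
have {}GE : G (tau * s) <= G s.
  by rewrite -subr_le0 GE mulr_le0_ge0// subr_ge0 ltW.
rewrite -ler_ln ?posrE ?mulr_gt0 ?powR_gt0 ?primitive_gt0//.
rewrite lnM ?posrE ?powR_gt0 ?primitive_gt0// ln_powR.
move: GE; rewrite /G lnM ?posrE//; lra.
Qed.

Definition Phi (x : R) : R := B (x ^+ 2) / 2.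
Definition beta (x : R) : R := b (x ^+ 2) * x.

Lemma Phi0 : Phi 0 = 0.
Proof. by rewrite /Phi expr0n/= primitive0 mul0r. Qed.

Lemma Phi_norm x : Phi `|x| = Phi x.
Proof. by rewrite /Phi real_normK ?num_real. Qed.

Lemma beta_norm x : beta `|x| = `|beta x|.
Proof.
by rewrite /beta real_normK ?num_real// normrM (ger0_norm (ltW (b_gt0 (sqr_ge0 x)))).
Qed.

(** Strong convexity: in the tangent inequality of B between x^2 and y^2, write y^2 - x^2 = 2x(y -
    x) + (y - x)^2 and bound b(x^2) from below by b 0 in the last term. *)
Lemma Phi_tangent x y : beta x * (y - x) + b 0 / 2 * (y - x) ^+ 2 <= Phi y - Phi x.
Proof.
have h := primitive_tangent (sqr_ge0 x) (sqr_ge0 y).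
have h2 : b 0 <= b (x ^+ 2) by apply: b_mono => //; exact: sqr_ge0.
rewrite /Phi /beta; have h3 : b 0 * (y - x) ^+ 2 <= b (x ^+ 2) * (y - x) ^+ 2.
  by rewrite ler_wpM2r ?sqr_ge0.
have -> : B (y ^+ 2) / 2 - B (x ^+ 2) / 2 = (B (y ^+ 2) - B (x ^+ 2)) / 2 by ring.
nra.
Qed.

Lemma Phi_ge x : b 0 / 2 * x ^+ 2 <= Phi x.
Proof. by have := Phi_tangent 0 x; rewrite Phi0 /beta mulr0 mul0r add0r !subr0. Qed.

Lemma Phi_ge0 x : 0 <= Phi x.
Proof.
apply: le_trans (Phi_ge x); rewrite mulr_ge0 ?sqr_ge0// divr_ge0// ltW// b_gt0//.
Qed.

Lemma Phi_tangent1 x y : beta x * (y - x) <= Phi y - Phi x.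
Proof.
apply: le_trans (Phi_tangent x y); rewrite lerDl mulr_ge0 ?sqr_ge0//.
by rewrite divr_ge0// ltW// b_gt0.
Qed.

Lemma Phi_midpoint x y :
  Phi ((x + y) / 2) <= Phi x / 2 + Phi y / 2 - b 0 / 8 * (x - y) ^+ 2.
Proof.
have := Phi_tangent ((x + y) / 2) x; have := Phi_tangent ((x + y) / 2) y.
set m := beta _; set p := Phi ((x + y) / 2).
have -> : y - (x + y) / 2 = - ((x - y) / 2) by field.
have -> : x - (x + y) / 2 = (x - y) / 2 by field.
rewrite sqrrN; set u := (x - y) / 2.
have -> : x - y = 2 * u by rewrite /u; field.
nra.
Qed.

Lemma beta_scale x : beta x * x <= 2 / alpha * Phi x.
Proof.
rewrite /beta /Phi; have [->|x0] := eqVneq x 0.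
  by rewrite !mulr0 expr0n/= primitive0 mul0r mulr0.
have x2 : 0 < x ^+ 2 by rewrite exprn_even_gt0.
have := b_lower x2; rewrite -mulrA -expr2 => h.
have -> : 2 / alpha * (B (x ^+ 2) / 2) = B (x ^+ 2) / alpha by field; rewrite gt_eqF.
by rewrite ler_pdivlMr// mulrC.
Qed.

Lemma Phi_scale tau x : 1 <= tau -> Phi (tau * x) <= tau `^ (2 / alpha) * Phi x.
Proof.
move=> t1; rewrite /Phi exprMn mulrA ler_wpM2r ?invr_ge0//.
have t2 : 1 <= tau ^+ 2 by rewrite exprn_ege1.
apply: le_trans (primitive_scale t2 (sqr_ge0 x)) _.
have t0 : 0 <= tau by lra.
by rewrite -(powR_mulrn 2 t0) -powRrM.
Qed.

Lemma beta_mono x y : x <= y -> beta x <= beta y.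
Proof.
have pos u v : 0 <= u -> u <= v -> beta u <= beta v.
  move=> u0 uv; have v0 := le_trans u0 uv.
  rewrite /beta ler_pM ?(ltW (b_gt0 (sqr_ge0 _)))//.
  by apply: b_mono; rewrite ?sqr_ge0// lerXn2r.
have odd u : beta (- u) = - beta u by rewrite /beta sqrrN mulrN.
move=> xy; case: (leP 0 x) => x0; first exact: pos.
have bx0 : beta x <= 0 by rewrite /beta pmulr_rle0 ?b_gt0 ?sqr_ge0// ltW.
case: (leP 0 y) => y0.
  by apply: (le_trans bx0); rewrite mulr_ge0// ltW// b_gt0// sqr_ge0.
by rewrite -lerN2 -!odd; apply: pos; lra.
Qed.

Lemma betaN x : beta (- x) = - beta x.
Proof. by rewrite /beta sqrrN mulrN. Qed.

Lemma beta_ge x : 0 <= x -> b 0 * x <= beta x.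
Proof.
by move=> x0; rewrite /beta ler_wpM2r// b_mono// sqr_ge0.
Qed.

Lemma beta_continuous : continuous beta.
Proof.
move=> x; apply: cvgM; last exact: cvg_id.
apply/cvgrPdist_le => e e0; have [d d0 hd] := b_cont (sqr_ge0 x) e0.
have : y ^+ 2 @[y --> x] --> x ^+ 2 by exact: exprn_continuous.
move/cvgrPdist_lt => /(_ d d0) h; near=> y; rewrite distrC; apply: hd; first exact: sqr_ge0.
by rewrite distrC; near: y; exact: h.
Unshelve. all: by end_near. Qed.

Lemma Phi_continuous : continuous Phi.
Proof.
move=> x; apply/cvgrPdist_le => e e0.
pose M := beta (`|x| + 1) + 1.
have M0 : 0 < M.
  rewrite /M ltr_pwDr// mulr_ge0 ?addr_ge0// ltW// b_gt0// sqr_ge0//.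
have key y : `|y| <= `|x| + 1 -> `|beta y| <= M.
  by move=> h; rewrite -beta_norm (le_trans (beta_mono h))// lerDl.
near=> y.
have xy1 : `|x - y| < 1 by near: y; apply/nbhs_ballP; exists 1 => //=.
have yx : `|y| <= `|x| + 1.
  rewrite -[y](subKr x); apply: le_trans (ler_normB _ _) _; rewrite lerD2l ltW//.
have xyM : `|x - y| <= e / M.
  by apply: ltW; near: y; apply/nbhs_ballP; exists (e / M) => //=; exact: divr_gt0.
have h1 := Phi_tangent1 x y; have h2 := Phi_tangent1 y x.
have b1 : `|beta x * (y - x)| <= e.
  rewrite normrM distrC mulrC; apply: (@le_trans _ _ (e / M * M)); last by rewrite divfK// gt_eqF.
  by rewrite ler_pM// key// lerDl.
have b2 : `|beta y * (x - y)| <= e.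
  rewrite normrM mulrC; apply: (@le_trans _ _ (e / M * M)); last by rewrite divfK// gt_eqF.
  by rewrite ler_pM// key.
move: b1 b2; rewrite !ler_norml => /andP[? ?] /andP[? ?]; apply/andP; split; lra.
Unshelve. all: by end_near. Qed.

Lemma Phi_mono x y : `|x| <= `|y| -> Phi x <= Phi y.
Proof.
move=> xy; rewrite -(Phi_norm x) -(Phi_norm y) -subr_ge0.
apply: le_trans (Phi_tangent1 `|x| `|y|).
by rewrite mulr_ge0 ?subr_ge0// mulr_ge0// ltW// b_gt0// sqr_ge0.
Qed.

(** x + y is the midpoint of 2x and 2y; convexity combines with the doubling property. *)
Lemma Phi_add x y : Phi (x + y) <= 2 `^ (2 / alpha) * (Phi x + Phi y).
Proof.
have h := Phi_midpoint (2 * x) (2 * y).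
have -> : x + y = (2 * x + 2 * y) / 2 by field.
apply: (le_trans h); have h1 := Phi_scale x (ler1n R 2); have h2 := Phi_scale y (ler1n R 2).
have h3 : 0 <= b 0 / 8 * (2 * x - 2 * y) ^+ 2.
  by rewrite mulr_ge0 ?sqr_ge0// divr_ge0// ltW// b_gt0.
have := Phi_ge0 (2 * x); have := Phi_ge0 (2 * y).
set C := 2 `^ _ in h1 h2 *; nra.
Qed.

End Nonlinearity.

(** * The power nonlinearity *)

Section PowerNonlinearity.
Context {R : realType}.
Variable p : R.
Hypothesis p2 : 2 < p.

Lemma norm_powR_continuous (s : R) : 0 < s -> continuous (fun x : R => `|x| `^ s).
Proof.
move=> s0 x; have [->|x0] := eqVneq x 0.
  rewrite /continuous_at normr0 powR0 ?gt_eqF//; apply/cvgrPdist_le => e e0.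
  near=> y; rewrite sub0r normrN ger0_norm ?powR_ge0//.
  have ye : `|y| <= e `^ s^-1.
    apply: ltW; near: y; apply/nbhs_ballP; exists (e `^ s^-1); first exact: powR_gt0.
    by move=> y; rewrite /ball/= sub0r normrN.
  apply: (@le_trans _ _ ((e `^ s^-1) `^ s)).
    by apply: ge0_ler_powR => //; rewrite ?nnegrE ?powR_ge0// ltW.
  by rewrite -powRrM mulVf ?gt_eqF// powRr1// ltW.
have h : {for `|x|, continuous (fun y : R => y `^ s)}.
  apply: differentiable_continuous; apply/derivable1_diffP.
  by apply: derivable_powR; rewrite in_itv/= andbT normr_gt0.
exact: (cvg_comp _ _ (@norm_continuous _ _ x) h).
Unshelve. all: by end_near. Qed.

Definition fp (x : R) : R := `|x| `^ (p - 2) * x.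

Lemma fp_continuous : continuous fp.
Proof.
move=> x; apply: cvgM; last exact: cvg_id.
by apply: norm_powR_continuous; rewrite subr_gt0.
Qed.

Lemma powR_split (x : R) : 0 <= x -> x `^ (p - 1) = x `^ (p - 2) * x.
Proof.
rewrite le_eqVlt => /predU1P[<-|x0]; first by rewrite mulr0 powR0// gt_eqF//; have hp := p2; lra.
by rewrite -[X in _ * X](powRr1 (ltW x0)) -powRDp//; congr (_ `^ _); ring.
Qed.

Lemma powR_split1 (x : R) : 0 <= x -> x `^ p = x `^ (p - 1) * x.
Proof.
rewrite le_eqVlt => /predU1P[<-|x0]; first by rewrite mulr0 powR0// gt_eqF//; have hp := p2; lra.
by rewrite -[X in _ * X](powRr1 (ltW x0)) -powRDp//; congr (_ `^ _); ring.
Qed.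

Lemma fp_norm x : `|fp x| = `|x| `^ (p - 1).
Proof. by rewrite /fp normrM ger0_norm ?powR_ge0// powR_split. Qed.

Lemma fp_mul x : fp x * x = `|x| `^ p.
Proof.
rewrite powR_split1// powR_split// /fp -!mulrA; congr (_ * _).
by rewrite -expr2 -[RHS]expr2 real_normK ?num_real.
Qed.

Lemma fp0 : fp 0 = 0. Proof. by rewrite /fp mulr0. Qed.

(** Convexity of |.|^p, read off from Young's inequality with exponents p and p/(p-1) applied to |y|
    and |x|^(p-1). *)
Lemma powR_tangent x y : `|x| `^ p + p * (fp x * (y - x)) <= `|y| `^ p.
Proof.
have hp := p2; have p0 : 0 < p by lra.
have p1 : 0 < p - 1 by lra.
have q0 : 0 < p / (p - 1) by rewrite divr_gt0.
have Y := @conjugate_powR _ `|y| `|fp x| p (p / (p - 1)) (normr_ge0 _) (normr_ge0 _) p0 q0.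
have {}Y : `|y| * `|fp x| <= `|y| `^ p / p + `|x| `^ p / (p / (p - 1)).
  have -> : `|x| `^ p = `|fp x| `^ (p / (p - 1)).
    by rewrite fp_norm -powRrM mulrC divfK// gt_eqF.
  by apply: Y; field; rewrite !gt_eqF.
have h : fp x * y <= `|y| * `|fp x| by rewrite mulrC -normrM ler_norm.
have {}h := le_trans h Y.
rewrite mulrBr fp_mul.
have -> : `|y| `^ p = p * (`|y| `^ p / p) by field; rewrite gt_eqF.
have e1 : `|x| `^ p / (p / (p - 1)) = `|x| `^ p - `|x| `^ p / p by field; rewrite !gt_eqF.
rewrite e1 in h; move: h; set u := fp x * y; set v := _ / p; set w := _ / p => h.
have -> : `|x| `^ p + p * (u - `|x| `^ p) = p * (u - (`|x| `^ p - w)).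
  by rewrite /w; field; rewrite gt_eqF.
rewrite ler_pM2l//; lra.
Qed.

Lemma measurable_fp d (T : measurableType d) (E : set T) (h : T -> R) :
  measurable_fun E h -> measurable_fun E (fun t => fp (h t)).
Proof.
by move=> mh; apply: measurableT_comp => //; exact: continuous_measurable_fun fp_continuous.
Qed.

End PowerNonlinearity.

(** * Compactness of the potential term *)

Section Envelopes.
Context {R : realType}.
Variable N : nat.
Hypothesis N3 : (3 <= N)%N.
Let N0 : (0 < N)%N. Proof. exact: leq_trans N3. Qed.
Variables p : R.
Hypothesis p2 : 2 < p.
Local Notation nu := (@radial_measure R N).
Local Notation D := (@halfline R).
Local Notation a := (@half_exp R N).
Hypothesis apN : a * p < N%:R.
Local Notation f := (fp p).
Local Notation rig := (rintegrable nu D).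
Local Notation II g := (\int[nu]_(t in D) g t)%R.
Local Notation K := (@K R N).
Let mD := @measurable_halfline R.
Let a0 : 0 < a. Proof. exact: half_exp_gt0. Qed.
Let mlow (s : R) : measurable (`]0, s]%classic : set (measurableTypeR R)).
Proof. exact: measurable_itv. Qed.
Let mray (s : R) : measurable (`]s, +oo[%classic : set (measurableTypeR R)).
Proof. exact: measurable_itv. Qed.

Lemma halfline_split (s : R) : 0 < s -> D = `]0, s]%classic `|` `]s, +oo[%classic.
Proof.
move=> s0; apply/seteqP; split => t; rewrite /halfline /= !in_itv/= !andbT.
  by move=> ->; case: (leP t s) => _; [left|right].
by case=> [/andP[]//|]; exact: lt_trans.
Qed.

Lemma low_sub (s : R) : `]0, s]%classic `<=` D.
Proof. by move=> t; rewrite halflineE /= in_itv/= => /andP[]. Qed.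

Lemma rint_split (g : measurableTypeR R -> R) s : 0 < s -> rig g ->
  II g = \int[nu]_(t in `]0, s]) g t + \int[nu]_(t in `]s, +oo[) g t.
Proof.
move=> s0 ig; rewrite (halfline_split s0) Rintegral_setU//.
  by rewrite -halfline_split.
rewrite disj_set2E; apply/eqP/seteqP; split => // t /=.
by rewrite !in_itv/= andbT => -[/andP[_ ts]]; rewrite ltNge ts.
Qed.

(** The decay rate at infinity of |u|^(p-2). *)
Let tau := a * (p - 2).
Let tau0 : 0 < tau. Proof. by rewrite mulr_gt0// subr_gt0. Qed.
Let ap0 : 0 <= a * p. Proof. by have hp := p2; rewrite mulr_ge0// ltW//; lra. Qed.

Let low_int (s : R) : 0 < s -> rintegrable nu `]0, s] (fun t => t `^ (- (a * p))).
Proof. by move=> s0; have [C _ h] := rint_powR_small N3 ap0 apN; have [] := h s s0. Qed.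

(** Neither concentration nor escape of mass can occur: on ]0, s] the functions have a common
    integrable bound because a p < N, and their tails are uniformly small. In between, dominated
    convergence applies. *)
Lemma core_cvg (G : nat -> measurableTypeR R -> R) (A B : R) :
  (forall n, rig (G n)) ->
  (forall n r, 0 < r -> `|G n r| <= A * r `^ (- (a * p))) ->
  (forall n s, 0 < s -> \int[nu]_(t in `]s, +oo[) `|G n t| <= B * s `^ (- tau)) ->
  (forall r, 0 < r -> G n r @[n --> \oo] --> (0 : R)) ->
  forall e, 0 < e -> exists M, forall n, (M <= n)%N -> II (fun t => `|G n t|) <= e.
Proof.
move=> iG GA GB G0 e e0.
have B1 : 0 < `|B| + 1 by rewrite ltr_pwDr.
pose dl := e / (2 * (`|B| + 1)).
have dl0 : 0 < dl by rewrite divr_gt0// mulr_gt0.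
(* Chosen so that s^-tau = [dl], which makes the tail bound at most e/2. *)
pose s := dl `^ (- tau^-1).
have s0 : 0 < s by exact: powR_gt0.
have sE : s `^ (- tau) = dl.
  by rewrite /s -powRrM mulrNN mulVf ?gt_eqF// powRr1// ltW.
have tl n : \int[nu]_(t in `]s, +oo[) `|G n t| <= e / 2.
  apply: (le_trans (GB n s s0)); rewrite sE /dl.
  apply: (@le_trans _ _ ((`|B| + 1) * (e / (2 * (`|B| + 1))))).
    by rewrite ler_wpM2r ?(ltW dl0)// (le_trans (ler_norm B))// lerDl.
  by rewrite le_eqVlt; apply/orP; left; apply/eqP; field; rewrite gt_eqF.
have iGl n : rintegrable nu `]0, s] (G n).
  by apply: (rintS (mlow s) mD _ (iG n)); exact: low_sub.
have [_ cv] : rintegrable nu `]0, s] (fun=> 0 : R) /\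
    (\int[nu]_(t in `]0, s]) `|G n t| @[n --> \oo] --> \int[nu]_(t in `]0, s]) (0 : R)).
  apply: (rint_dct (mlow s) (f_ := fun n t => `|G n t|) (g := fun t => A * t `^ (- (a * p)))).
  - by move=> n; apply: measurableT_comp => //; exact: rintegrable_measurable (iGl n).
  - exact: measurable_cst.
  - by apply: rintegrableZ; [exact: mlow|exact: low_int].
  - by move=> n t; rewrite /= in_itv/= => /andP[t0 _]; rewrite normr_id; exact: GA.
  apply: aeW => t; rewrite /= in_itv/= => /andP[t0 _].
  by apply/norm_cvg0P; exact: (G0 t t0).
rewrite Rintegral_cst// mul0r in cv.
move/cvgrPdist_le : cv => /(_ (e / 2)) [|M _ HM]; first by rewrite divr_gt0.
exists M => n Mn; rewrite (rint_split s0); last exact: rintegrable_norm.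
rewrite [leRHS](splitr e); apply: lerD; last exact: tl.
have := HM n Mn; rewrite sub0r normrN ger0_norm//.
by apply: Rintegral_ge0 => t _.
Qed.

(** What the nonlinear terms need to know about K z for z in a ball of L^2. Pointwise limits inherit
    these bounds before they are known to be of the form K w. *)
Definition env (C m : R) (h : R -> R) := [/\ measurable_fun D h,
  forall r, 0 < r -> `|h r| <= C * r `^ (- a),
  rig (fun t => h t ^+ 2) & II (fun t => h t ^+ 2) <= m].

Lemma env_prod C1 C2 m h k : 0 <= C1 -> 0 <= C2 -> env C1 m h -> env C2 m k ->
  [/\ rig (fun t => f (h t) * k t),
   forall r, 0 < r -> `|f (h r) * k r| <= (C1 `^ (p - 1) * C2) * r `^ (- (a * p)) &
   forall s, 0 < s -> \int[nu]_(t in `]s, +oo[) `|f (h t) * k t| <=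
      (C1 `^ (p - 2) * m) * s `^ (- tau)].
Proof.
move=> C10 C20 [mh hC ih hm] [mk kC ik km].
have mfk : measurable_fun D (fun t => f (h t) * k t).
  by apply: measurable_funM => //; exact: measurable_fp.
have bnd r : 0 < r -> `|f (h r) * k r| <= (C1 `^ (p - 1) * C2) * r `^ (- (a * p)).
  move=> r0; rewrite normrM fp_norm//.
  apply: (@le_trans _ _ ((C1 * r `^ (- a)) `^ (p - 1) * (C2 * r `^ (- a)))).
    rewrite ler_pM ?powR_ge0//; last exact: kC.
    by apply: ge0_ler_powR; rewrite ?nnegrE ?mulr_ge0 ?powR_ge0//; [have hp := p2; lra|exact: hC].
  rewrite powRM ?powR_ge0// -powRrM mulrACA -powRDp//.
  suff -> : - a * (p - 1) - a = - (a * p) by [].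
  by ring.
(* On the tail only p - 2 of the p factors are spent on decay; the remaining two are integrated with
   the mass bound. *)
have tbnd s r : 0 < s -> s <= r -> `|f (h r) * k r| <=
    C1 `^ (p - 2) * s `^ (- tau) * ((h r ^+ 2 + k r ^+ 2) / 2).
  move=> s0 sr; have r0 := lt_le_trans s0 sr.
  rewrite normrM fp_norm// powR_split// -[leLHS]mulrA.
  apply: ler_pM; rewrite ?powR_ge0 ?mulr_ge0//.
    have -> : C1 `^ (p - 2) * s `^ (- tau) = (C1 * s `^ (- a)) `^ (p - 2).
      by rewrite powRM ?powR_ge0// -powRrM mulNr.
    apply: ge0_ler_powR; rewrite ?nnegrE ?mulr_ge0 ?powR_ge0//; first by have hp := p2; lra.
    apply: (le_trans (hC r r0)); rewrite ler_wpM2l//.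
    rewrite !powRN lef_pV2 ?posrE ?powR_gt0//.
    by apply: (ge0_ler_powR (ltW a0)); rewrite ?nnegrE ?(ltW s0) ?(ltW r0).
  rewrite -(real_normK (num_real (h r))) -(real_normK (num_real (k r))).
  by have := sqr_ge0 (`|h r| - `|k r|); nra.
have ihk : rig (fun t => h t ^+ 2 + k t ^+ 2) by exact: rintegrableD.
have iray s : 0 < s -> rintegrable nu `]s, +oo[ (fun t => f (h t) * k t).
  move=> s0; have sub := ray_sub (ltW s0).
  apply: (@rintegrable_le _ _ _ nu _ (mray s) _ (fun t => C1 `^ (p - 2) * s `^ (- tau) / 2 * (h t ^+ 2 + k t ^+ 2))).
  - exact: measurable_funS mfk.
  - by apply: rintegrableZ => //; apply: rintS ihk.
  - move=> r; rewrite /= in_itv/= andbT => sr; apply: le_trans (tbnd s r s0 (ltW sr)) _.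
    by rewrite le_eqVlt; apply/orP; left; apply/eqP; field.
split => //.
  rewrite /rintegrable (halfline_split ltr01).
  have := @rintegrable_le _ _ _ nu `]0, 1]%classic (mlow 1) (fun t => f (h t) * k t)
    (fun t => C1 `^ (p - 1) * C2 * t `^ (- (a * p))).
  move=> i1; apply/integrableP; split.
    by rewrite -halfline_split//; exact/measurable_EFinP.
  rewrite ge0_integral_setU//.
  - rewrite lte_add_pinfty//.
      have /integrableP[] // : rintegrable nu `]0, 1] (fun t => f (h t) * k t).
      apply: i1.
      + by apply: (measurable_funS mD) mfk; exact: low_sub.
      + by apply: rintegrableZ => //; exact: low_int.
      + by move=> r; rewrite /= in_itv/= => /andP[r0 _]; exact: bnd.
    by have /integrableP[] := iray 1 ltr01.
  - by rewrite -halfline_split//; apply: measurableT_comp => //; exact/measurable_EFinP.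
  rewrite disj_set2E; apply/eqP/seteqP; split => // t /=.
  by rewrite !in_itv/= andbT => -[/andP[_ ts]]; rewrite ltNge ts.
move=> s s0; have sub := ray_sub (ltW s0).
have ihk' := rintS (mray s) mD sub ihk.
apply: (@le_trans _ _ (\int[nu]_(t in `]s, +oo[) (C1 `^ (p - 2) * s `^ (- tau) / 2 * (h t ^+ 2 + k t ^+ 2)))).
  apply: le_Rintegral => //.
  - by apply: rintegrable_norm => //; exact: iray.
  - exact: rintegrableZ.
  - move=> r; rewrite /= in_itv/= andbT => sr; apply: le_trans (tbnd s r s0 (ltW sr)) _.
    by rewrite le_eqVlt; apply/orP; left; apply/eqP; field.
rewrite (RintegralZl _ (mray s) ihk').
have -> : C1 `^ (p - 2) * m * s `^ (- tau) = C1 `^ (p - 2) * s `^ (- tau) / 2 * (m + m) by field.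
apply: ler_wpM2l; first by rewrite divr_ge0// mulr_ge0 ?powR_ge0.
apply: (@le_trans _ _ (II (fun t => h t ^+ 2 + k t ^+ 2))).
  by apply: rint_le_set => // t _; rewrite addr_ge0 ?sqr_ge0.
by rewrite RintegralD// lerD.
Qed.

Definition hcv (h_ : nat -> R -> R) (h : R -> R) :=
  forall r, 0 < r -> h_ n r @[n --> \oo] --> h r.

Let small_norm (u : nat -> R) (v : nat -> R) : (forall n, `|u n| <= v n) ->
  (forall e, 0 < e -> exists M, forall n, (M <= n)%N -> v n <= e) ->
  u n @[n --> \oo] --> (0 : R).
Proof.
move=> uv h; apply/cvgrPdist_le => e e0; have [M HM] := h e e0.
by exists M => // n Mn; rewrite sub0r normrN (le_trans (uv n))// HM.
Qed.

(** The second factor need not converge. This matters when [k_] consists of images under the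
    minimizer map, whose convergence is yet to be proved. *)
Lemma ell_diff_cvg C m h_ h k_ : 0 <= C -> (forall n, env C m (h_ n)) -> env C m h ->
  (forall n, env C m (k_ n)) -> hcv h_ h ->
  II (fun t => (f (h_ n t) - f (h t)) * k_ n t) @[n --> \oo] --> (0 : R).
Proof.
move=> C0 eh_ eh ek_ hh.
have i1 n := env_prod C0 C0 (eh_ n) (ek_ n); have i2 n := env_prod C0 C0 eh (ek_ n).
have GE n t : (f (h_ n t) - f (h t)) * k_ n t = f (h_ n t) * k_ n t - f (h t) * k_ n t.
  by rewrite mulrBl.
have iG n : rig (fun t => (f (h_ n t) - f (h t)) * k_ n t).
  have [j1 _ _] := i1 n; have [j2 _ _] := i2 n.
  by apply: eq_rintegrable (rintegrableB mD j1 j2) => // t _; rewrite GE.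
apply: (small_norm (v := fun n => II (fun t => `|(f (h_ n t) - f (h t)) * k_ n t|))).
  by move=> n; apply: le_normr_Rintegral => //; exact: iG.
apply: (@core_cvg _ (2 * (C `^ (p - 1) * C)) (2 * (C `^ (p - 2) * m))) => //.
- move=> n r r0; have [_ j1 _] := i1 n; have [_ j2 _] := i2 n.
  rewrite GE; apply: le_trans (ler_normB _ _) _; rewrite -mulrA mulr2n mulrDl !mul1r.
  by rewrite lerD// ?j1 ?j2.
- move=> n s s0; have [j1 _ l1] := i1 n; have [j2 _ l2] := i2 n.
  have sub := ray_sub (ltW s0).
  have j1' := rintegrable_norm (rintS (mray s) mD sub j1).
  have j2' := rintegrable_norm (rintS (mray s) mD sub j2).
  apply: (@le_trans _ _ (\int[nu]_(t in `]s, +oo[) (`|f (h_ n t) * k_ n t| + `|f (h t) * k_ n t|))).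
    apply: le_Rintegral => //.
    + by apply: rintegrable_norm => //; apply: rintS (iG n).
    + exact: rintegrableD.
    + by move=> t _; rewrite GE; exact: ler_normB.
  rewrite RintegralD// -mulrA mulr2n mulrDl !mul1r.
  by rewrite lerD// ?l1 ?l2.
move=> r r0.
have Cr : 0 <= C * r `^ (- a) by rewrite mulr_ge0 ?powR_ge0.
apply: (small_norm (v := fun n => `|f (h_ n r) - f (h r)| * (C * r `^ (- a)))).
  by move=> n; rewrite normrM ler_wpM2l//; case: (ek_ n) => _ + _ _; exact.
move=> e e0; have Cr1 : 0 < C * r `^ (- a) + 1 by rewrite ltr_pwDr.
have := cvg_comp _ _ (hh r r0) (@fp_continuous R p p2 (h r)).
move/cvgrPdist_le => /(_ (e / (C * r `^ (- a) + 1)) (divr_gt0 e0 Cr1)) [M _ HM].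
exists M => n Mn; have := HM n Mn; rewrite /= distrC ler_pdivlMr// => h1.
by apply: le_trans h1; rewrite ler_wpM2l// lerDl.
Qed.

Lemma ell_cvg C m h k_ k : 0 <= C -> env C m h ->
  (forall n, env C m (k_ n)) -> env C m k -> hcv k_ k ->
  II (fun t => f (h t) * k_ n t) @[n --> \oo] --> II (fun t => f (h t) * k t).
Proof.
move=> C0 eh ek_ ek kk.
have i1 n := env_prod C0 C0 eh (ek_ n); have i2 := env_prod C0 C0 eh ek.
have GE n t : f (h t) * (k_ n t - k t) = f (h t) * k_ n t - f (h t) * k t.
  by rewrite mulrBr.
have iG n : rig (fun t => f (h t) * (k_ n t - k t)).
  have [j1 _ _] := i1 n; have [j2 _ _] := i2.
  by apply: eq_rintegrable (rintegrableB mD j1 j2) => // t _; rewrite GE.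
have : II (fun t => f (h t) * (k_ n t - k t)) @[n --> \oo] --> (0 : R).
  apply: (small_norm (v := fun n => II (fun t => `|f (h t) * (k_ n t - k t)|))).
    by move=> n; apply: le_normr_Rintegral => //; exact: iG.
  apply: (@core_cvg _ (2 * (C `^ (p - 1) * C)) (2 * (C `^ (p - 2) * m))) => //.
  - move=> n r r0; have [_ j1 _] := i1 n; have [_ j2 _] := i2.
    rewrite GE; apply: le_trans (ler_normB _ _) _; rewrite -mulrA mulr2n mulrDl !mul1r.
    by rewrite lerD// ?j1 ?j2.
  - move=> n s s0; have [j1 _ l1] := i1 n; have [j2 _ l2] := i2.
    have sub := ray_sub (ltW s0).
    have j1' := rintegrable_norm (rintS (mray s) mD sub j1).
    have j2' := rintegrable_norm (rintS (mray s) mD sub j2).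
    apply: (@le_trans _ _ (\int[nu]_(t in `]s, +oo[) (`|f (h t) * k_ n t| + `|f (h t) * k t|))).
      apply: le_Rintegral => //.
      + by apply: rintegrable_norm => //; apply: rintS (iG n).
      + exact: rintegrableD.
      + by move=> t _; rewrite GE; exact: ler_normB.
    rewrite RintegralD// -mulrA mulr2n mulrDl !mul1r.
    by rewrite lerD// ?l1 ?l2.
  move=> r r0; rewrite -[X in _ --> X](mulr0 (f (h r))); apply: cvgM; first exact: cvg_cst.
  by rewrite -[X in _ --> X](subrr (k r)); apply: cvgB; [exact: kk|exact: cvg_cst].
have [j2 _ _] := i2.
have -> : (fun n => II (fun t => f (h t) * (k_ n t - k t))) =
          (fun n => II (fun t => f (h t) * k_ n t) - II (fun t => f (h t) * k t)).
  apply/funext => n; have [j1 _ _] := i1 n.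
  by rewrite -RintegralB//; apply: eq_rint => t _; rewrite GE.
by move=> h1; apply/subr_cvg0.
Qed.

End Envelopes.

(** The interface between [b] and the variational argument: [c] is the modulus of strong convexity,
    b 0 in the application, and [th] the upper growth exponent, there 2/alpha. *)
Record growth {R : realType} (Phi beta : R -> R) (c th : R) : Prop := Growth {
  growth_c : 0 < c;
  growth_th : 2 <= th;
  growth0 : Phi 0 = 0;
  growth_tangent : forall x y,
    beta x * (y - x) + c / 2 * (y - x) ^+ 2 <= Phi y - Phi x;
  growth_ge : forall x, c / 2 * x ^+ 2 <= Phi x;
  growth_midpoint : forall x y,
    Phi ((x + y) / 2) <= Phi x / 2 + Phi y / 2 - c / 8 * (x - y) ^+ 2;
  growth_scale : forall tau x, 1 <= tau -> Phi (tau * x) <= tau `^ th * Phi x;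
  growth_mono : forall x y, `|x| <= `|y| -> Phi x <= Phi y;
  growth_add : forall x y, Phi (x + y) <= 2 `^ th * (Phi x + Phi y);
  growth_cont : continuous Phi;
  growth_beta : forall x, beta x * x <= th * Phi x;
  growth_beta_mono : forall x y, x <= y -> beta x <= beta y;
  growth_betaN : forall x, beta (- x) = - beta x;
  growth_beta_ge : forall x, 0 <= x -> c * x <= beta x;
  growth_beta_cont : continuous beta
}.

Lemma primitive_growth {R : realType} (b : R -> R) (alpha : R) :
  (forall s, 0 <= s -> 0 < b s) -> C1_on_nonneg b ->
  (forall s t, 0 <= s -> s <= t -> b s <= b t) -> 0 < alpha ->
  (forall s, 0 < s -> alpha * (b s * s) <= primitive b s) ->
  growth (Phi b) (beta b) (b 0) (2 / alpha).
Proof.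
move=> b0 bC bm al0 bl; split.
- exact: b0.
- have a1 := alpha_le1 b0 bm bl.
  by rewrite ler_pdivlMr// -subr_ge0; lra.
- exact: Phi0.
- by move=> x y; exact: Phi_tangent.
- by move=> x; exact: Phi_ge.
- by move=> x y; exact: Phi_midpoint.
- by move=> tau x; exact: Phi_scale.
- by move=> x y; exact: Phi_mono.
- by move=> x y; exact: Phi_add.
- exact: Phi_continuous.
- by move=> x; exact: beta_scale.
- by move=> x y; exact: beta_mono.
- by move=> x; exact: betaN.
- by move=> x; exact: beta_ge.
- exact: beta_continuous.
Qed.

Lemma near_minimizers {R : realType} (k s u v x y d e : R) : 0 < k ->
  y <= k * e -> x <= k * e -> v <= s + y -> u <= s + x ->
  s <= u / 2 + v / 2 - k * d -> d <= e.
Proof. by move=> k0 *; rewrite -(ler_pM2l k0); lra. Qed.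

Lemma minimizer_growth {R : realType} (c s x y d : R) :
  s <= x / 2 + y / 2 - c / 8 * d -> x <= s -> x + c / 4 * d <= y.
Proof. lra. Qed.

(** * The resolvent and its energy estimates *)

Section Minimization.
Context {R : realType}.
Variable N : nat.
Hypothesis N3 : (3 <= N)%N.
Variables p : R.
Hypothesis p2 : 2 < p.
Local Notation nu := (@radial_measure R N).
Local Notation D := (@halfline R).
Local Notation a := (@half_exp R N).
Hypothesis apN : a * p < N%:R.
Local Notation f := (fp p).
Local Notation rig := (rintegrable nu D).
Local Notation II g := (\int[nu]_(t in D) g t)%R.
Local Notation K := (@K R N).
Local Notation L2 := (@L2 R N).
Local Notation nrm := (@nrm R N).
Local Notation Kc := (@Kcst R N N3).
Variables (Phi beta : R -> R) (c th : R).
Hypothesis G : growth Phi beta c th.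
Variable m : R.
Hypothesis m0 : 0 <= m.
Let mD := @measurable_halfline R.
Let Phi_c0 := growth_c G.

Lemma L2B z w : L2 z -> L2 w -> L2 (fun t => z t - w t).
Proof.
move=> hz hw; have := @L2_lin R N 1 (- 1) _ _ hz hw.
by under eq_fun do rewrite mul1r mulN1r.
Qed.

Lemma L2Z x z : L2 z -> L2 (fun t => x * z t).
Proof.
move=> hz; have := @L2_lin R N x 0 _ _ hz hz.
by under eq_fun do rewrite mul0r addr0.
Qed.

Definition dist2 (z w : R -> R) : R := II (fun t => (z t - w t) ^+ 2).

Lemma dist2_ge0 z w : 0 <= dist2 z w.
Proof. by apply: Rintegral_ge0 => t _; rewrite sqr_ge0. Qed.

Lemma nrm_dist2 z w : nrm (fun t => z t - w t) = Num.sqrt (dist2 z w).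
Proof. by []. Qed.

Lemma dist2C z w : dist2 z w = dist2 w z.
Proof. by apply: eq_rint => t _; rewrite -sqrrN opprB. Qed.

Lemma K_dist2 z w r : L2 z -> L2 w -> 0 < r ->
  `|K z r - K w r| <= Kc * r `^ (- a) * Num.sqrt (dist2 z w).
Proof.
by move=> hz hw r0; rewrite -KB// -nrm_dist2; apply: K_bound => //; exact: L2B.
Qed.

Lemma env_le (C m1 C' m' : R) h : C <= C' -> m1 <= m' -> env N C m1 h -> env N C' m' h.
Proof.
move=> CC mm [mh hC ih hm]; split => //; last exact: le_trans mm.
by move=> r r0; apply: (le_trans (hC r r0)); rewrite ler_wpM2r ?powR_ge0.
Qed.

Lemma measurable_growth z : measurable_fun D z -> measurable_fun D (fun t => Phi (z t)).
Proof.
by move=> mz; apply: measurableT_comp => //; apply: continuous_measurable_fun;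
  exact: growth_cont G.
Qed.

(** A ball for the mass, not a sphere: the set is closed under midpoints, and Fatou's lemma
    preserves the constraint in the limit. *)
Definition adm z := [/\ L2 z, rig (fun t => Phi (z t)), rig (fun t => K z t ^+ 2) &
  II (fun t => K z t ^+ 2) <= m].

Lemma env_K z : adm z -> env N (Kc * nrm z) m (K z).
Proof.
move=> [hz _ ik km]; split => //; first exact: measurable_K.
by move=> r r0; rewrite mulrAC; exact: K_bound.
Qed.

Lemma K0 r : K (fun=> 0) r = 0.
Proof.
rewrite /K (_ : (fun t => 0 * kap N t) = (fun=> 0)); last first.
  by apply/funext => t; rewrite mul0r.
by rewrite Rintegral_cst ?mul0r ?oppr0//; exact: measurable_itv.
Qed.

Lemma L20 : L2 (fun=> 0).
Proof.
by split; [exact: measurable_cst|rewrite expr0n /=; exact: rintegrable0].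
Qed.

Lemma adm0 : adm (fun=> 0).
Proof.
split.
- exact: L20.
- by rewrite (growth0 G); exact: rintegrable0.
- by under eq_fun do rewrite K0 expr0n /=; exact: rintegrable0.
- by under eq_Rintegral do rewrite K0 expr0n /=; rewrite Rintegral_cst ?mul0r.
Qed.

Let low1 : rintegrable nu `]0, 1] (fun t => t `^ (- (a * p))).
Proof.
have ap0 : 0 <= a * p.
  by have hp := p2; have a0 := @half_exp_gt0 R N N3; rewrite mulr_ge0// ltW//; lra.
by have [C _ h] := rint_powR_small N3 ap0 apN; have [] := h 1 ltr01.
Qed.

Let L0 : R := \int[nu]_(t in `]0, 1]) t `^ (- (a * p)).

(** Near the origin the radial bound of K z is linear in [nrm z]; beyond 1 only the mass bound
    enters. The quadratic lower bound of Phi therefore dominates and [FF] is coercive. *)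
Lemma ell_bound C h z : 0 <= C -> env N C m h -> adm z ->
  rig (fun t => f (h t) * K z t) /\
  `|II (fun t => f (h t) * K z t)| <= C `^ (p - 1) * Kc * L0 * nrm z + C `^ (p - 2) * m.
Proof.
move=> C0 eh az; have C1 : 0 <= Kc * nrm z by rewrite mulr_ge0 ?Kcst_ge0 ?nrm_ge0.
have [ig low tl] := env_prod N3 p2 apN C0 C1 eh (env_K az).
have mlow : measurable (`]0, 1]%classic : set (measurableTypeR R)) by exact: measurable_itv.
split => //; apply: (le_trans (le_normr_Rintegral mD ig)).
rewrite (rint_split ltr01 (rintegrable_norm ig)); apply: lerD.
  have -> : C `^ (p - 1) * Kc * L0 * nrm z = C `^ (p - 1) * (Kc * nrm z) * L0 by ring.
  rewrite -(RintegralZl _ mlow low1).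
  apply: rint_le_sub => //.
  - by apply: rintegrable_norm; apply: rintS ig => //; exact: low_sub.
  - exact: rintegrableZ.
  - by move=> r; rewrite /= in_itv/= => /andP[r0 _]; exact: low.
by have := tl 1 ltr01; rewrite powR1 mulr1.
Qed.

Definition FF h z := II (fun t => Phi (z t)) - II (fun t => f (h t) * K z t).

Lemma II_Phi_ge z : L2 z -> rig (fun t => Phi (z t)) -> c / 2 * nrm z ^+ 2 <= II (fun t => Phi (z t)).
Proof.
move=> [mz iz] iP; rewrite sqr_nrm -(RintegralZl _ mD iz).
by apply: rint_le_sub => //; [exact: rintegrableZ|move=> t _; exact: growth_ge G _].
Qed.

Lemma FF_coercive C h z : 0 <= C -> env N C m h -> adm z ->
  c / 2 * nrm z ^+ 2 - (C `^ (p - 1) * Kc * L0 * nrm z + C `^ (p - 2) * m) <= FF h z.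
Proof.
move=> C0 eh az; have [_ hl] := ell_bound C0 eh az.
case: (az) => lz iP _ _; rewrite /FF lerB ?II_Phi_ge//.
exact: le_trans (ler_norm _) hl.
Qed.

Let sqr_half (x y : R) : ((x + y) / 2) ^+ 2 <= x ^+ 2 / 2 + y ^+ 2 / 2.
Proof. by have := sqr_ge0 (x - y); nra. Qed.

Lemma adm_midpoint z w : adm z -> adm w -> adm (fun t => (z t + w t) / 2) /\
  forall C h, 0 <= C -> env N C m h ->
  FF h (fun t => (z t + w t) / 2) <= FF h z / 2 + FF h w / 2 - c / 8 * dist2 z w.
Proof.
move=> az aw; case: (az) => hz iz kz mz; case: (aw) => hw iw kw mw.
have lE : (fun t => (z t + w t) / 2) = (fun t => 2^-1 * z t + 2^-1 * w t).
  by apply/funext => t; rewrite mulrDl ![_ / 2]mulrC.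
have hv : L2 (fun t => (z t + w t) / 2) by rewrite lE; exact: L2_lin.
have KE r : 0 < r -> K (fun t => (z t + w t) / 2) r = (K z r + K w r) / 2.
  by move=> r0; rewrite lE K_lin// mulrDl ![_ / 2]mulrC.
have ib : rig (fun t => 2^-1 * Phi (z t) + 2^-1 * Phi (w t)).
  by apply: rintegrableD => //; exact: rintegrableZ.
have [_ id2] := L2B hz hw.
have id : rig (fun t => 2^-1 * Phi (z t) + 2^-1 * Phi (w t) - c / 8 * (z t - w t) ^+ 2).
  by apply: rintegrableB => //; exact: rintegrableZ.
have [iv lv] : rig (fun t => Phi ((z t + w t) / 2)) /\
    II (fun t => Phi ((z t + w t) / 2)) <=
    II (fun t => 2^-1 * Phi (z t) + 2^-1 * Phi (w t) - c / 8 * (z t - w t) ^+ 2).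
  apply: rint_le0_dom => //.
    by apply: measurable_growth; case: hv.
  move=> t _; apply/andP; split.
    by apply: le_trans (growth_ge G _); rewrite mulr_ge0 ?sqr_ge0// ltW// divr_gt0.
  by apply: (le_trans (growth_midpoint G _ _)); rewrite ![_ / 2]mulrC.
have [ik lk] : rig (fun t => K (fun t => (z t + w t) / 2) t ^+ 2) /\
    II (fun t => K (fun t => (z t + w t) / 2) t ^+ 2) <=
    II (fun t => 2^-1 * K z t ^+ 2 + 2^-1 * K w t ^+ 2).
  apply: rint_le0_dom => //.
  - by apply: measurable_funX; exact: measurable_K.
  - by apply: rintegrableD => //; exact: rintegrableZ.
  - move=> t /halflineE t0; rewrite sqr_ge0 KE//=.
    by apply: le_trans (sqr_half _ _) _; rewrite ![_ / 2]mulrC.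
split.
  split; [exact: hv|exact: iv|exact: ik|apply: (le_trans lk)].
  rewrite RintegralD//; [|exact: rintegrableZ..].
  rewrite (RintegralZl _ mD kz) (RintegralZl _ mD kw).
  by move: mz mw; move: (Rintegral _ _ _) (Rintegral _ _ _) => x y xm ym; lra.
move=> C h C0 eh; have [j1 _] := ell_bound C0 eh az; have [j2 _] := ell_bound C0 eh aw.
rewrite /FF.
have -> : II (fun t => f (h t) * K (fun t => (z t + w t) / 2) t) =
    2^-1 * II (fun t => f (h t) * K z t) + 2^-1 * II (fun t => f (h t) * K w t).
  rewrite -(RintegralZl _ mD j1) -(RintegralZl _ mD j2) -RintegralD//; [|exact: rintegrableZ..].
  by apply: eq_rint => t /halflineE t0; rewrite KE//; field.
have eR : II (fun t => 2^-1 * Phi (z t) + 2^-1 * Phi (w t) - c / 8 * (z t - w t) ^+ 2) =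
    2^-1 * II (fun t => Phi (z t)) + 2^-1 * II (fun t => Phi (w t)) - c / 8 * dist2 z w.
  rewrite RintegralB//; last exact: rintegrableZ.
  rewrite RintegralD//; [|exact: rintegrableZ..].
  by rewrite (RintegralZl _ mD iz) (RintegralZl _ mD iw) (RintegralZl _ mD id2).
rewrite eR in lv; apply: (le_trans (lerB lv (lexx _))).
move: (Rintegral _ _ _) (Rintegral _ _ _) (Rintegral _ _ _) (Rintegral _ _ _) (dist2 _ _) => x1 x2 x3 x4 x5.
by rewrite le_eqVlt; apply/orP; left; apply/eqP; field.
Qed.

Lemma nrm_bound (A B C x : R) : 0 < A -> 0 <= B -> 0 <= C -> 0 <= x ->
  A * x ^+ 2 - B * x <= C -> x <= (B + C) / A + 1.
Proof.
move=> A0 B0 C0 x0 h; rewrite -lerBlDr ler_pdivlMr//.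
rewrite leNgt; apply/negP => h1; have x1 : 1 < x.
  rewrite ltNge; apply/negP => x1; suff : (x - 1) * A <= 0 by lra.
  by apply: mulr_le0_ge0; lra.
nra.
Qed.

Lemma FF_lower C h : 0 <= C -> env N C m h -> exists M, forall z, adm z -> M <= FF h z.
Proof.
move=> C0 eh; set A1 := C `^ (p - 1) * Kc * L0.
exists (- (A1 ^+ 2 / (2 * c)) - C `^ (p - 2) * m) => z az.
apply: le_trans (FF_coercive C0 eh az); rewrite -/A1.
suff : 0 <= c / 2 * nrm z ^+ 2 - A1 * nrm z + A1 ^+ 2 / (2 * c) by move: (_ / (2 * c)) => ?; lra.
have -> : c / 2 * nrm z ^+ 2 - A1 * nrm z + A1 ^+ 2 / (2 * c) = c / 2 * (nrm z - A1 / c) ^+ 2.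
  by field; rewrite gt_eqF.
by rewrite mulr_ge0 ?sqr_ge0// ltW// divr_gt0.
Qed.

Lemma FF_nrm_bound C B : 0 <= C -> exists2 Q, 0 <= Q &
  forall h z, env N C m h -> adm z -> FF h z <= B -> nrm z <= Q.
Proof.
move=> C0; set A1 := C `^ (p - 1) * Kc * L0.
have A10 : 0 <= A1.
  rewrite !mulr_ge0 ?powR_ge0 ?Kcst_ge0//.
  by apply: Rintegral_ge0 => t _; exact: powR_ge0.
have B0 : 0 <= `|B| + C `^ (p - 2) * m by rewrite addr_ge0// mulr_ge0 ?powR_ge0.
exists ((A1 + (`|B| + C `^ (p - 2) * m)) / (c / 2) + 1).
  apply: addr_ge0 => //; apply: divr_ge0; first exact: addr_ge0.
  by apply: ltW; rewrite divr_gt0.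
move=> h z eh az FB; apply: nrm_bound => //; first by rewrite divr_gt0.
  exact: nrm_ge0.
have := le_trans (FF_coercive C0 eh az) FB; rewrite -/A1.
have := ler_norm B; move: (C `^ _ * m) => ? ? ?; lra.
Qed.

(** The direct method without weak convergence: the gain at midpoints makes a minimizing sequence
    Cauchy in L^2. *)
Lemma FF_min C h : 0 <= C -> env N C m h -> exists2 z, adm z &
  forall w, adm w -> FF h z + c / 4 * dist2 z w <= FF h w.
Proof.
move=> C0 eh; have [M0 HM0] := FF_lower C0 eh.
pose S := [set FF h z | z in adm].
have hS : has_inf S.
  by split; [exists (FF h (fun=> 0)), (fun=> 0) => //; exact: adm0|exists M0 => _ [z az <-]; exact: HM0].
have infS z : adm z -> inf S <= FF h z by move=> az; apply: (ge_inf hS.2); exists z.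
have : forall n : nat, exists z, adm z /\ FF h z <= inf S + n.+1%:R^-1.
  move=> n; have [_ [z az <-] lz] := inf_adherent (harmonic_gt0 n) hS.
  by exists z; split => //; exact: ltW.
move=> /choice[z hz]; have az n : adm (z n) by case: (hz n).
have lz n : L2 (z n) by case: (az n).
have cau e : 0 < e -> exists M, forall i j, (M <= i)%N -> (M <= j)%N ->
     II (fun x => (z i x - z j x) ^+ 2) <= e.
  move=> e0; have e1 : 0 < c / 8 * e by rewrite mulr_gt0// divr_gt0.
  have /cvgrPdist_le /(_ _ e1) [M _ HM] := @cvg_harmonic R.
  exists M => i j Mi Mj; rewrite -/(dist2 _ _).
  have [am /(_ _ _ C0 eh) Fm] := adm_midpoint (az i) (az j).
  have := le_trans (infS _ am) Fm.
  have [_] := hz i; have [_] := hz j.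
  have c80 : 0 < c / 8 by rewrite divr_gt0.
  have := HM i Mi; have := HM j Mj; rewrite !sub0r !normrN !ger0_norm ?harmonic_ge0//.
  exact: near_minimizers c80.
have [w [k [mw iw kn aew cvw]]] :=
  L2_complete mD (fun n => (lz n).1) (fun n => (lz n).2) cau.
have lw : L2 w by [].
have [Q Q0 HQ] := FF_nrm_bound (inf S + 1) C0.
have zQ n : nrm (z n) <= Q.
  apply: (HQ _ _ eh (az n)); have [_ h1] := hz n; apply: (le_trans h1); rewrite lerD2l.
  by rewrite invf_le1 ?ltr0n// ler1n.
have Kcv r : 0 < r -> K (z (k n)) r @[n --> \oo] --> K w r.
  move=> r0; apply/cvgrPdist_le => e e0.
  have B0 : 0 < Kc * r `^ (- a) + 1 by rewrite ltr_pwDr// mulr_ge0 ?Kcst_ge0 ?powR_ge0.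
  have [M HM] := cvw ((e / (Kc * r `^ (- a) + 1)) ^+ 2) (exprn_gt0 _ (divr_gt0 e0 B0)).
  exists M => // n Mn; have /HM h1 := leq_trans Mn (kn n).
  rewrite distrC; apply: (le_trans (K_dist2 (lz _) lw r0)).
  have h2 : Num.sqrt (dist2 (z (k n)) w) <= e / (Kc * r `^ (- a) + 1).
    apply: (le_trans (ler_wsqrtr h1)).
    by rewrite sqrtr_sqr ger0_norm// divr_ge0// ltW.
  apply: (@le_trans _ _ ((Kc * r `^ (- a) + 1) * Num.sqrt (dist2 (z (k n)) w))).
    by rewrite ler_wpM2r ?sqrtr_ge0// lerDl.
  by rewrite mulrC -ler_pdivlMr.
have [ikw mkw] : rig (fun t => K w t ^+ 2) /\ II (fun t => K w t ^+ 2) <= m.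
  apply: (rint_fatou mD (f_ := fun n t => K (z (k n)) t ^+ 2)).
  - by move=> n; apply: measurable_funX; exact: measurable_K.
  - by apply: measurable_funX; exact: measurable_K.
  - by move=> n x _; exact: sqr_ge0.
  - by move=> x _; exact: sqr_ge0.
  - apply: aeW => t /halflineE t0; rewrite expr2; under eq_cvg do rewrite expr2.
    by apply: cvgM; exact: Kcv.
  - by move=> n; case: (az (k n)).
  - by move=> n; case: (az (k n)).
(* One envelope for [h], the minimizing sequence and its limit. *)
pose C' := Num.max C (Num.max (Kc * Q) (Kc * nrm w)).
have C'0 : 0 <= C' by rewrite le_max C0.
have eh' : env N C' m h by apply: env_le eh; rewrite // le_max lexx.
have ek n : env N C' m (K (z (k n))).
  apply: env_le (env_K (az (k n))) => //.
  by rewrite !le_max ler_wpM2l ?Kcst_ge0 ?orbT.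
have ew : env N C' m (K w).
  split => //; first exact: measurable_K.
  move=> r r0; apply: (le_trans (K_bound N3 lw r0)); rewrite mulrAC ler_wpM2r ?powR_ge0//.
  by rewrite !le_max lexx !orbT.
have lcv := ell_cvg N3 p2 apN C'0 eh' ek ew Kcv.
set lw' := II (fun t => f (h t) * K w t) in lcv.
(* Fatou's lemma on a tail of the subsequence, along which the linear term and the distance to the
   infimum each cost at most e/2. *)
have Fw e : 0 < e -> rig (fun t => Phi (w t)) /\ II (fun t => Phi (w t)) <= inf S + lw' + e.
  move=> e0; have e2 : 0 < e / 2 by rewrite divr_gt0.
  have /cvgrPdist_le /(_ _ e2) [M1 _ HM1] := lcv.
  have /cvgrPdist_le /(_ _ e2) [M2 _ HM2] := @cvg_harmonic R.
  apply: (rint_fatou mD (f_ := fun n t => Phi (z (k (n + maxn M1 M2)%N) t))).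
  - by move=> n; apply: measurable_growth; case: (lz (k (n + maxn M1 M2)%N)).
  - exact: measurable_growth.
  - by move=> n x _; apply: le_trans (growth_ge G _); rewrite mulr_ge0 ?sqr_ge0// ltW// divr_gt0.
  - by move=> x _; apply: le_trans (growth_ge G _); rewrite mulr_ge0 ?sqr_ge0// ltW// divr_gt0.
  - apply: filterS aew => t h1 Dt; have h2 := cvg_comp _ _ (h1 Dt) (@growth_cont _ _ _ _ _ G (w t)).
    by move: h2; rewrite -(cvg_shiftn (maxn M1 M2)).
  - by move=> n; case: (az (k (n + maxn M1 M2)%N)).
  move=> n; set j := (n + maxn M1 M2)%N.
  have [_] := hz (k j); rewrite /FF.
  have : (M1 <= j)%N /\ (M2 <= k j)%N.
    split; first by rewrite /j (leq_trans (leq_maxl M1 M2))// leq_addl.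
    by apply: leq_trans (kn j); rewrite /j (leq_trans (leq_maxr M1 M2))// leq_addl.
  move=> [/HM1 h1 /HM2]; rewrite sub0r normrN ger0_norm ?harmonic_ge0// /harmonic/=.
  move: h1; rewrite -/lw' => /ler_normlP[h1 _].
  move: (k j).+1%:R^-1 h1 => u; move: (Rintegral _ _ _) (Rintegral _ _ _).
  by move=> x y h1 h2 h3; lra.
have [iPw _] := Fw 1 ltr01.
have aw : adm w by [].
have Fwle : FF h w <= inf S.
  rewrite /FF -/lw'; apply/ler_addgt0Pr => e e0; by have [_] := Fw e e0; rewrite lerBlDr addrAC.
(* Minimality tested at the midpoint of [w] and [v] turns the gain c/8 into quadratic growth with
   constant c/4. *)
exists w => // v av; have [am /(_ _ _ C0 eh) Fm] := adm_midpoint aw av.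
exact: minimizer_growth (le_trans (infS _ am) Fm) Fwle.
Qed.

End Minimization.

Lemma sum_minimality {R : realType} (c d x1 x2 l11 l12 l21 l22 : R) :
  x1 - l11 + c / 4 * d <= x2 - l12 -> x2 - l22 + c / 4 * d <= x1 - l21 ->
  c / 2 * d <= (l11 - l21) - (l12 - l22).
Proof. lra. Qed.

Lemma close_from_bound {R : realType} (c e x y d : R) : 0 < c ->
  `|0 - x| <= c / 4 * e -> `|0 - y| <= c / 4 * e -> c / 2 * d <= y - x -> d <= e.
Proof.
rewrite !sub0r !normrN => c0 /ler_normlP[h1 _] /ler_normlP[_ h2] h3.
 rewrite -(ler_pM2l (divr_gt0 c0 (ltr0n R 2))); lra.
Qed.

Lemma tangent_drop {R : realType} (p x1 x2 l P' P Pv d : R) : 0 < p -> P' = P ->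
  x1 - l + d <= x2 - P' -> P + p * (l - P) <= Pv -> x1 - Pv / p + d <= x2 - P / p.
Proof.
move=> p0 -> h1 h2; have ip : 0 <= p^-1 by rewrite invr_ge0 ltW.
have {}h2 := ler_wpM2r ip h2.
have -> : P / p = (P + p * (l - P)) / p - (l - P) by field; rewrite gt_eqF.
lra.
Qed.

(** * The minimizer map and its continuity *)

Section Resolvent.
Context {R : realType}.
Variable N : nat.
Hypothesis N3 : (3 <= N)%N.
Variables p : R.
Hypothesis p2 : 2 < p.
Local Notation nu := (@radial_measure R N).
Local Notation D := (@halfline R).
Local Notation a := (@half_exp R N).
Hypothesis apN : a * p < N%:R.
Local Notation f := (fp p).
Local Notation rig := (rintegrable nu D).
Local Notation II g := (\int[nu]_(t in D) g t)%R.
Local Notation K := (@K R N).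
Local Notation L2 := (@L2 R N).
Local Notation nrm := (@nrm R N).
Local Notation Kc := (@Kcst R N N3).
Local Notation dist2 := (@dist2 R N).
Variables (Phi beta : R -> R) (c th : R).
Hypothesis G : growth Phi beta c th.
Variable m : R.
Hypothesis m0 : 0 <= m.
Let mD := @measurable_halfline R.
Local Notation adm := (@adm R N Phi m).
Local Notation FF := (@FF R N p Phi).
Local Notation env := (@env R N).

Definition is_min (h z : R -> R) := adm z /\
  forall w, adm w -> FF h z + c / 4 * dist2 z w <= FF h w.

(** The minimizer is chosen from [h] alone: the envelope constant [C] is only a witness, and
    different constants must give the same map. Functions without an envelope are sent to 0. *)
Lemma minimizer_map : exists T : (R -> R) -> (R -> R),
  forall C h, 0 <= C -> env C m h -> is_min h (T h).
Proof.
have H h : exists z, forall C, 0 <= C -> env C m h -> is_min h z.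
  have [[C [C0 eh]]|nC] := pselect (exists C, 0 <= C /\ env C m h).
    by have [z az hz] := FF_min N3 p2 apN G m0 C0 eh; exists z.
  by exists (fun=> 0) => C C0 eh; case: nC; exists C.
have [T HT] := choice H; exists T => C h C0 eh; exact: HT C0 eh.
Qed.

Definition TT : (R -> R) -> (R -> R) := projT1 (cid minimizer_map).

Lemma TTP C h : 0 <= C -> env C m h -> is_min h (TT h).
Proof. exact: (projT2 (cid minimizer_map)). Qed.

Definition PP (h : R -> R) := II (fun t => `|h t| `^ p).

Lemma PP_ge0 h : 0 <= PP h.
Proof. by apply: Rintegral_ge0 => t _; exact: powR_ge0. Qed.

Lemma env_PP C m1 h : 0 <= C -> env C m1 h -> rig (fun t => `|h t| `^ p) /\
  II (fun t => f (h t) * h t) = PP h.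
Proof.
move=> C0 eh; have [i1 _ _] := env_prod N3 p2 apN C0 C0 eh eh.
by split; [apply: eq_rintegrable i1 => //|apply: eq_rint] => t _; rewrite fp_mul.
Qed.

(** Each minimizer is a competitor for the other problem; adding the two inequalities cancels the
    energies and leaves only the linear terms. *)
Lemma TT_lipschitz C h h' : 0 <= C -> env C m h -> env C m h' ->
  c / 2 * dist2 (TT h) (TT h') <=
  II (fun t => (f (h t) - f (h' t)) * K (TT h) t) -
  II (fun t => (f (h t) - f (h' t)) * K (TT h') t).
Proof.
move=> C0 eh eh'; have [a1 m1] := TTP C0 eh; have [a2 m2] := TTP C0 eh'.
have := m1 _ a2; have := m2 _ a1; rewrite /FF dist2C.
have [i11 _] := ell_bound N3 p2 apN C0 eh a1; have [i12 _] := ell_bound N3 p2 apN C0 eh a2.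
have [i21 _] := ell_bound N3 p2 apN C0 eh' a1; have [i22 _] := ell_bound N3 p2 apN C0 eh' a2.
move=> h1 h2.
have E w : rig (fun t => f (h t) * K w t) -> rig (fun t => f (h' t) * K w t) ->
    II (fun t => (f (h t) - f (h' t)) * K w t) =
    II (fun t => f (h t) * K w t) - II (fun t => f (h' t) * K w t).
  by move=> j1 j2; rewrite -RintegralB//; apply: eq_rint => t _; rewrite mulrBl.
rewrite (E _ i11 i21) (E _ i12 i22).
exact: sum_minimality h2 h1.
Qed.

Lemma TT_nrm_bound C : 0 <= C -> exists2 Q, 0 <= Q &
  forall h, env C m h -> nrm (TT h) <= Q.
Proof.
move=> C0; have [Q Q0 HQ] := FF_nrm_bound N3 p2 apN G m0 0 C0.
exists Q => // h eh; have [a1 m1] := TTP C0 eh.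
apply: (HQ _ _ eh a1); have := m1 _ (adm0 N G m0).
have -> : FF h (fun=> 0) = 0.
  rewrite /FF; under eq_Rintegral do rewrite (growth0 G).
  under [X in _ - X]eq_Rintegral do rewrite K0 mulr0.
  by rewrite Rintegral_cst ?mul0r ?subrr.
move=> h1; apply: le_trans h1; rewrite lerDl mulr_ge0 ?dist2_ge0// divr_ge0//.
exact: ltW (growth_c G).
Qed.

(** Compactness: pointwise convergence in an envelope is improved to convergence of the minimizers
    in L^2. *)
Lemma TT_cvg C h_ h : 0 <= C -> (forall n, env C m (h_ n)) -> env C m h ->
  hcv h_ h -> forall e, 0 < e -> exists M, forall n, (M <= n)%N ->
  dist2 (TT (h_ n)) (TT h) <= e.
Proof.
move=> C0 eh_ eh hh e e0; have c0 := growth_c G.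
have [Q Q0 HQ] := TT_nrm_bound C0.
pose C' := Num.max C (Kc * Q).
have C'0 : 0 <= C' by rewrite le_max C0.
have CC : C <= C' by rewrite le_max lexx.
have eT g : env C m g -> env C' m (K (TT g)).
  move=> eg; have [ag _] := TTP C0 eg.
  apply: env_le (env_K N3 ag) => //.
  by rewrite le_max ler_wpM2l ?Kcst_ge0 ?orbT// HQ.
have eh_' n : env C' m (h_ n) by exact: env_le (eh_ n).
have eh' : env C' m h by exact: env_le eh.
have := ell_diff_cvg N3 p2 apN C'0 eh_' eh' (fun n => eT _ (eh_ n)) hh.
have := ell_diff_cvg N3 p2 apN C'0 eh_' eh' (fun n => eT _ eh) hh.
have e1 : 0 < c / 4 * e by rewrite mulr_gt0// divr_gt0.
move=> /cvgrPdist_le /(_ _ e1) [M1 _ HM1] /cvgrPdist_le /(_ _ e1) [M2 _ HM2].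
exists (maxn M1 M2) => n; rewrite geq_max => /andP[/HM1 h1 /HM2 h2].
exact: close_from_bound c0 h1 h2 (TT_lipschitz C0 (eh_ n) eh).
Qed.

Lemma PP_cvg C m1 h_ h : 0 <= C -> (forall n, env C m1 (h_ n)) -> env C m1 h ->
  hcv h_ h -> PP (h_ n) @[n --> \oo] --> PP h.
Proof.
move=> C0 eh_ eh hh.
have c1 := ell_diff_cvg N3 p2 apN C0 eh_ eh eh_ hh.
have c2 := ell_cvg N3 p2 apN C0 eh eh_ eh hh.
have [_ E] := env_PP C0 eh; rewrite -E -[X in _ --> X]add0r.
have -> : (fun n => PP (h_ n)) = (fun n => II (fun t => (f (h_ n t) - f (h t)) * h_ n t) +
    II (fun t => f (h t) * h_ n t)).
  apply/funext => n; have [_ <-] := env_PP C0 (eh_ n).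
  have [i1 _ _] := env_prod N3 p2 apN C0 C0 (eh_ n) (eh_ n).
  have [i2 _ _] := env_prod N3 p2 apN C0 C0 eh (eh_ n).
  have -> : II (fun t => (f (h_ n t) - f (h t)) * h_ n t) =
      II (fun t => f (h_ n t) * h_ n t) - II (fun t => f (h t) * h_ n t).
    by rewrite -RintegralB//; apply: eq_rint => t _; rewrite mulrBl.
  by rewrite subrK.
exact: cvgD.
Qed.

Lemma PP_tangent C1 C2 m1 h k : 0 <= C1 -> 0 <= C2 -> env C1 m1 h -> env C2 m1 k ->
  PP h + p * (II (fun t => f (h t) * k t) - PP h) <= PP k.
Proof.
move=> C10 C20 eh ek; have [ih Eh] := env_PP C10 eh; have [ik _] := env_PP C20 ek.
have [i1 _ _] := env_prod N3 p2 apN C10 C20 eh ek.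
have [i2 _ _] := env_prod N3 p2 apN C10 C10 eh eh.
rewrite -[X in _ * (_ - X)]Eh -RintegralB//.
have i3 := rintegrableB mD i1 i2.
rewrite -(RintegralZl _ mD i3) -RintegralD//; last exact: rintegrableZ.
apply: rint_le_sub => //.
  by apply: rintegrableD => //; exact: rintegrableZ.
by move=> t _; rewrite -mulrBr; exact: powR_tangent.
Qed.

Definition JJ z := II (fun t => Phi (z t)) - PP (K z) / p.

(** Up to a constant, the linearized functional at K z lies above J and touches it at z, so that
    minimizing it lowers J at least as much. *)
Lemma JJ_drop z : adm z -> JJ (TT (K z)) + c / 4 * dist2 (TT (K z)) z <= JJ z.
Proof.
move=> az; set v := TT (K z).
have ez := env_K N3 az; have Cz : 0 <= Kc * nrm z by rewrite mulr_ge0 ?Kcst_ge0 ?nrm_ge0.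
have [av /(_ _ az) mv] := TTP Cz ez; rewrite -/v in av mv.
have ev := env_K N3 av; have Cv : 0 <= Kc * nrm v by rewrite mulr_ge0 ?Kcst_ge0 ?nrm_ge0.
have p0 : 0 < p by apply: lt_trans p2.
have [_ Ez] := env_PP Cz ez.
exact: tangent_drop p0 Ez mv (PP_tangent Cz Cv ez ev).
Qed.

End Resolvent.

(** From ln y >= 1 - 1/y and exp x >= 1 + x. *)
Lemma powR_bernoulli {R : realType} (y t : R) : 1 <= y -> 1 <= t ->
  (t - 1) * (y - 1) <= y `^ t - y.
Proof.
move=> y1 t1; have y0 : 0 < y by apply: lt_le_trans y1.
have -> : y `^ t = y * y `^ (t - 1).
  by rewrite -[X in X * _](powRr1 (ltW y0)) -powRDp//; congr (_ `^ _); ring.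
have ln1 : 1 - y^-1 <= ln y.
  have : ln y^-1 <= y^-1 - 1.
    have := @le_ln1Dx R (y^-1 - 1).
    have -> : 1 + (y^-1 - 1) = y^-1 by ring.
    by apply; rewrite ltrBrDl subrr invr_gt0.
  by rewrite lnV ?posrE//; lra.
have : 1 + (t - 1) * ln y <= y `^ (t - 1).
  by rewrite /powR gt_eqF//; apply: expR_ge1Dx.
move=> h; apply: (@le_trans _ _ (y * (1 + (t - 1) * ln y) - y)); last first.
  by rewrite lerD2r ler_wpM2l// ltW.
have -> : y * (1 + (t - 1) * ln y) - y = (t - 1) * (y * ln y) by ring.
rewrite ler_wpM2l ?subr_ge0//.
have -> : y - 1 = y * (1 - y^-1) by field; rewrite gt_eqF.
by rewrite ler_wpM2l// ltW.
Qed.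

(** To be used with y = s^chi and t = gam/chi. The principal energy grows at most by y, the
    potential one by y^t. When P is above the threshold, (y^t - y) P/p is at least (y - 1)(cb + 1),
    whereas multiplying J by y costs at most (y - 1) cb. *)
Lemma dilation_energy {R : realType} (p t y E P P0 cb E' : R) : 0 < p -> 1 < t -> 1 <= y ->
  (1 < y -> P0 <= P) -> p * (cb + 1) / (t - 1) <= P0 -> E - P / p <= cb -> 0 <= P ->
  E' <= y * E -> E' - y `^ t * P / p <= E - P / p - (y - 1).
Proof.
move=> p0 t1 y1 yP hP0 hJ P0' hE'.
have t10 : 0 < t - 1 by rewrite subr_gt0.
have B := powR_bernoulli y1 (ltW t1).
have B2 : (y - 1) * (cb + 1) <= (y `^ t - y) * (P / p).
  have [->|y1'] := eqVneq y 1; first by rewrite subrr mul0r powR1 subrr mul0r.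
  have {}yP : P0 <= P by apply: yP; rewrite lt_neqAle eq_sym y1'.
  have h1 : (cb + 1) / (t - 1) <= P / p.
    rewrite ler_pdivlMr//; apply: le_trans yP; apply: le_trans hP0.
    by rewrite le_eqVlt; apply/orP; left; apply/eqP; ring.
  apply: (@le_trans _ _ ((t - 1) * (y - 1) * (P / p))).
    have -> : (y - 1) * (cb + 1) = (t - 1) * (y - 1) * ((cb + 1) / (t - 1)).
      by field; rewrite gt_eqF.
    by rewrite ler_wpM2l// mulr_ge0 ?subr_ge0// ltW.
  by rewrite ler_wpM2r// divr_ge0// ltW.
rewrite -mulrA; move: B2 hJ; move: (P / p) => w B2 hJ.
have : (y - 1) * (E - w) <= (y - 1) * cb by rewrite ler_wpM2l// subr_ge0.
move: hE' B2; move: (y `^ t) => z; nra.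
Qed.

Lemma mul_shift {R : realType} (k l g x : R) : k * l = g -> k * (l * x) = g * x.
Proof. by move=> <-; rewrite mulrA. Qed.

(** * Mass-preserving dilations and mountain-pass geometry *)

Section Descent.
Context {R : realType}.
Variable N : nat.
Hypothesis N3 : (3 <= N)%N.
Let N0 : (0 < N)%N. Proof. exact: leq_trans N3. Qed.
Variables p : R.
Hypothesis p2 : 2 < p.
Local Notation nu := (@radial_measure R N).
Local Notation D := (@halfline R).
Local Notation a := (@half_exp R N).
Hypothesis apN : a * p < N%:R.
Local Notation f := (fp p).
Local Notation rig := (rintegrable nu D).
Local Notation II g := (\int[nu]_(t in D) g t)%R.
Local Notation K := (@K R N).
Local Notation L2 := (@L2 R N).
Local Notation nrm := (@nrm R N).
Local Notation Kc := (@Kcst R N N3).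
Local Notation dist2 := (@dist2 R N).
Variables (Phi beta : R -> R) (c th : R).
Hypothesis G : growth Phi beta c th.
Variable m : R.
Hypothesis m0 : 0 <= m.
Let mD := @measurable_halfline R.
Local Notation adm := (@adm R N Phi m).
Local Notation FF := (@FF R N p Phi).
Local Notation env := (@env R N).
Local Notation PP := (@PP R N p).
Local Notation JJ := (@JJ R N p Phi).
Local Notation T := (TT N3 p2 apN G m0).
Let p0 : 0 < p. Proof. by apply: lt_trans p2. Qed.
Let c0 : 0 < c := growth_c G.

Lemma Phi_nonneg x : 0 <= Phi x.
Proof. by apply: le_trans (growth_ge G x); rewrite mulr_ge0 ?sqr_ge0// ltW// divr_gt0. Qed.

Lemma Kz_env z : adm z -> 0 <= Kc * nrm z /\ env (Kc * nrm z) m (K z).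
Proof. move=> az; split; last exact: (env_K N3 az).
by apply: mulr_ge0; [exact: Kcst_ge0|exact: nrm_ge0]. Qed.

Lemma adm_PP z : adm z -> rig (fun t => `|K z t| `^ p).
Proof. by move=> az; have [C0 ez] := Kz_env az; have [] := env_PP N3 p2 apN C0 ez. Qed.

Lemma adm_T z : adm z -> adm (T (K z)).
Proof. by move=> az; have [C0 ez] := Kz_env az; have [] := TTP N3 p2 apN G m0 C0 ez. Qed.

(** [gam] is the exponent by which a mass-preserving dilation changes the potential energy, and
    [chi] bounds that of the principal energy. The inequality [gam_chi] is mass supercriticality. *)
Definition gam : R := N%:R * (p - 2) / 2.
Definition chi : R := (N%:R / 2 + 1) * th - N%:R.
Hypothesis gam_chi : chi < gam.

Let ex : R := N%:R / 2 + 1.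
Let ex0 : 0 < ex. Proof. by rewrite addr_gt0// divr_gt0// ltr0n. Qed.

Lemma chi_ge2 : 2 <= chi.
Proof.
rewrite /chi; have := growth_th G; have : (0 : R) < N%:R by rewrite ltr0n.
by move: (N%:R : R) => n; nra.
Qed.

Let chi0 : 0 < chi. Proof. by have := chi_ge2; lra. Qed.
Let gam0 : 0 < gam. Proof. exact: lt_trans gam_chi. Qed.

(* K (dil s z) r = s^(N/2) * K z (s r), which has the same mass as K z. *)
Definition dil (s : R) (z : R -> R) (t : R) : R := s `^ ex * z (s * t).

Lemma D_scale s (g : R -> R) : 0 < s -> rig g ->
  rig (fun t => g (s * t)) /\ II (fun t => g (s * t)) = s ^- N * II g.
Proof.
move=> s0; have := @rintegrable_ray_scale R N s 0 g s0.
by rewrite mulr0; exact.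
Qed.

Lemma powR_half (s : R) : 0 < s -> s `^ (N%:R / 2) ^+ 2 * s ^- N = 1.
Proof.
move=> s0; rewrite expr2 -powRDp//.
have -> : N%:R / 2 + N%:R / 2 = N%:R :> R by field.
by rewrite powR_mulrn ?ltW// mulfV// expf_neq0 ?gt_eqF.
Qed.

Lemma powR_ex (s : R) : 0 < s -> s `^ ex = s `^ (N%:R / 2) * s.
Proof. by move=> s0; rewrite powRDp// powRr1// ltW. Qed.

Lemma dil_L2 s z : 0 < s -> L2 z -> L2 (dil s z) /\ nrm (dil s z) = s * nrm z.
Proof.
move=> s0 lz; have [l1 n1] := L2_scale lz s0.
split; first exact: L2Z.
rewrite nrmZ// n1 mulrA ger0_norm ?powR_ge0//; congr (_ * _).
have E : Num.sqrt (s ^- N) = s `^ (- (N%:R / 2)).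
  rewrite -[RHS]ger0_norm ?powR_ge0// -sqrtr_sqr; congr Num.sqrt.
  rewrite expr2 -powRDp//.
  have -> : - (N%:R / 2) - N%:R / 2 = - N%:R :> R by field.
  by rewrite powRN powR_mulrn// ltW.
rewrite E -powRDp//; have -> : ex - N%:R / 2 = 1 by rewrite /ex; ring.
by rewrite powRr1// ltW.
Qed.

Lemma K_dil s z r : 0 < s -> L2 z -> 0 < r -> K (dil s z) r = s `^ (N%:R / 2) * K z (s * r).
Proof.
move=> s0 lz r0; have [l1 _] := L2_scale lz s0.
by rewrite KZ// K_scale// powR_ex// mulrA mulfK ?gt_eqF.
Qed.

Lemma dil_Phi s z : 0 < s -> L2 z -> rig (fun t => Phi (z t)) ->
  rig (fun t => Phi (dil s z t)).
Proof.
move=> s0 lz iz; have [l1 _] := dil_L2 s0 lz.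
pose tau := Num.max 1 (s `^ ex).
have [i1 _] := D_scale s0 iz.
apply: (rintegrable_le mD (g := fun t => tau `^ th * Phi (z (s * t)))).
- by apply: (measurable_growth G); case: l1.
- exact: rintegrableZ.
move=> t _; rewrite ger0_norm ?Phi_nonneg//.
apply: (@le_trans _ _ (Phi (tau * z (s * t)))).
  apply: (growth_mono G); rewrite /dil !normrM ler_wpM2r//.
  by rewrite ger0_norm ?powR_ge0// (le_trans _ (ler_norm _))// le_max lexx orbT.
by apply: (growth_scale G); rewrite le_max lexx.
Qed.

Lemma dil_sqr s z : 0 < s -> L2 z -> rig (fun t => K z t ^+ 2) ->
  rig (fun t => K (dil s z) t ^+ 2) /\
  II (fun t => K (dil s z) t ^+ 2) = II (fun t => K z t ^+ 2).
Proof.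
move=> s0 lz iz; have [i1 e1] := D_scale s0 iz.
have E t : D t -> K (dil s z) t ^+ 2 = s `^ (N%:R / 2) ^+ 2 * K z (s * t) ^+ 2.
  by move=> /halflineE t0; rewrite K_dil// exprMn.
split; first by apply: eq_rintegrable (rintegrableZ mD _ i1) => // t Dt; rewrite E.
rewrite (eq_rint nu E) (RintegralZl _ mD i1) e1 mulrA powR_half// mul1r.
by [].
Qed.

Lemma dil_adm s z : 0 < s -> adm z -> adm (dil s z).
Proof.
move=> s0 [lz iP ik mk]; have [l1 _] := dil_L2 s0 lz; have [i2 e2] := dil_sqr s0 lz ik.
split; [exact: l1|exact: dil_Phi|exact: i2|by rewrite e2].
Qed.

Lemma dil_PP s z : 0 < s -> adm z -> PP (K (dil s z)) = s `^ gam * PP (K z).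
Proof.
move=> s0 az; case: (az) => lz _ _ _.
have [i1 e1] := D_scale s0 (adm_PP az).
have E t : D t -> `|K (dil s z) t| `^ p = (s `^ (N%:R / 2)) `^ p * `|K z (s * t)| `^ p.
  move=> /halflineE t0; rewrite K_dil// normrM powRM//.
  by rewrite ger0_norm ?powR_ge0.
rewrite /PP; apply: (etrans (eq_rint nu E)); apply: (etrans (RintegralZl _ mD i1)).
apply: (etrans (congr1 _ e1)); apply: mul_shift.
rewrite -powRrM -(powR_mulrn _ (ltW s0)) -powRN -powRDp//; congr (_ `^ _).
by rewrite /gam; field.
Qed.

Lemma dil_energy s z : 1 <= s -> adm z ->
  II (fun t => Phi (dil s z t)) <= s `^ chi * II (fun t => Phi (z t)).
Proof.
move=> s1 [lz iz _ _]; have s0 : 0 < s by apply: lt_le_trans s1.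
have [i1 e1] := D_scale s0 iz.
apply: (@le_trans _ _ (II (fun t => s `^ ex `^ th * Phi (z (s * t))))).
  apply: rint_le_sub => //; first exact: dil_Phi.
    exact: rintegrableZ.
  move=> t _; apply: (growth_scale G).
  by rewrite -[X in X <= _](powRr0 s) ler_powR// ltW.
rewrite (RintegralZl _ mD i1) e1 mulrA; apply: ler_wpM2r.
  by apply: Rintegral_ge0 => t _; exact: Phi_nonneg.
rewrite -powRrM -(powR_mulrn _ (ltW s0)) -powRN -powRDp//.
Qed.

Lemma nrm0_K z r : L2 z -> nrm z = 0 -> 0 < r -> K z r = 0.
Proof.
move=> lz nz r0; apply/eqP; rewrite -normr_eq0 eq_le normr_ge0 andbT.
by apply: (le_trans (K_bound N3 lz r0)); rewrite nz mulr0.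
Qed.

Lemma nrm0_PP z : L2 z -> nrm z = 0 -> PP (K z) = 0.
Proof.
move=> lz nz; rewrite /PP (@eq_rint _ _ _ nu D _ (fun=> 0)).
  by rewrite Rintegral_cst ?mul0r.
by move=> t /halflineE t0; rewrite nrm0_K// normr0 powR0// gt_eqF.
Qed.

(** A Gagliardo-Nirenberg inequality: dilating to [nrm] equal to 1 keeps the mass, [ell_bound]
    applies there, and scaling back produces the exponent [gam]. *)
Lemma PP_nrm : exists2 C, 0 < C & forall z, adm z -> PP (K z) <= C * nrm z `^ gam.
Proof.
pose L0 := \int[nu]_(t in `]0, 1]) t `^ (- (a * p)).
exists (Kc `^ (p - 1) * Kc * L0 + Kc `^ (p - 2) * m + 1).
  have L00 : 0 <= L0 by apply: Rintegral_ge0 => t _; exact: powR_ge0.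
  by rewrite ltr_pwDr// addr_ge0// !mulr_ge0 ?powR_ge0 ?Kcst_ge0.
move=> z az; case: (az) => lz _ _ _.
have [n0|n0] := eqVneq (nrm z) 0.
  by rewrite nrm0_PP// n0 powR0 ?mulr0// gt_eqF.
have {}n0 : 0 < nrm z by rewrite lt_neqAle eq_sym n0 nrm_ge0.
have s0 : 0 < (nrm z)^-1 by rewrite invr_gt0.
have aw := dil_adm s0 az; have [lw nw] := dil_L2 s0 lz.
have {}nw : nrm (dil (nrm z)^-1 z) = 1 by rewrite nw mulVf// gt_eqF.
have ew := env_K N3 aw; rewrite nw mulr1 in ew.
have [iw bw] := ell_bound N3 p2 apN (Kcst_ge0 N3) ew aw.
have [_ Ew] := env_PP N3 p2 apN (Kcst_ge0 N3) ew.
have := le_trans (ler_norm _) bw; rewrite Ew nw mulr1 dil_PP// -/L0.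
rewrite -powR_inv1 ?nrm_ge0// -powRrM mulN1r powRN mulrC.
move=> h; rewrite -ler_pdivrMr ?powR_gt0//; apply: (le_trans h).
by rewrite lerDl.
Qed.

(** The barrier is a level of the potential energy, not a sphere in L^2, because [PP] of K z is
    continuous under pointwise convergence in an envelope. *)
Lemma barrier : exists pi0 be : R, [/\ 0 < pi0, 0 < be & forall z, adm z ->
  (PP (K z) <= pi0 -> 0 <= JJ z) /\ (PP (K z) = pi0 -> be <= JJ z)].
Proof.
have [C C0 HC] := PP_nrm.
have g2 : 0 < gam - 2 by rewrite subr_gt0 (le_lt_trans chi_ge2).
(* Solves C n0^(gam-2) = c p/4: below the level C n0^gam the potential term consumes at most half of
   the lower bound (c/2) nrm^2. On the level itself [nrm] is at least [n0]. *)
pose n0 := (c * p / 4 / C) `^ (gam - 2)^-1.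
have cp : 0 < c * p / 4 / C by rewrite !divr_gt0// mulr_gt0.
have n00 : 0 < n0 by exact: powR_gt0.
have n0E : C * n0 `^ (gam - 2) = c * p / 4.
  rewrite /n0 -powRrM mulVf ?gt_eqF// powRr1 ?(ltW cp)//.
  by field; rewrite gt_eqF.
have spl n : 0 < n -> n `^ gam = n `^ (gam - 2) * n ^+ 2.
  by move=> n1; rewrite -(powR_mulrn _ (ltW n1)) -powRDp// subrK.
exists (C * n0 `^ gam), (c / 4 * n0 ^+ 2); split.
- by rewrite mulr_gt0 ?powR_gt0.
- by rewrite mulr_gt0 ?exprn_gt0// divr_gt0.
move=> z az; case: (az) => lz iz _ _.
have H : PP (K z) <= C * n0 `^ gam -> c / 4 * nrm z ^+ 2 <= JJ z.
  move=> hP; have hG := II_Phi_ge G lz iz.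
  have : PP (K z) / p <= c / 4 * nrm z ^+ 2.
    rewrite ler_pdivrMr//.
    have -> : c / 4 * nrm z ^+ 2 * p = c * p / 4 * nrm z ^+ 2 by ring.
    have [nn|nn] := leP (nrm z) n0.
      have [nz|nz] := eqVneq (nrm z) 0; first by rewrite nrm0_PP// nz expr0n mulr0.
      have {}nz : 0 < nrm z by rewrite lt_neqAle eq_sym nz nrm_ge0.
      apply: (le_trans (HC z az)); rewrite spl// mulrA ler_wpM2r ?sqr_ge0// -n0E.
      rewrite ler_wpM2l ?(ltW C0)//; apply: ge0_ler_powR; rewrite ?nnegrE ?(ltW g2)//.
      - exact: ltW.
      - exact: ltW.
    apply: (le_trans hP); rewrite spl// mulrA n0E ler_wpM2l//.
      by rewrite divr_ge0// mulr_ge0// ltW.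
    by rewrite ler_sqr ?nnegrE ?nrm_ge0 ?(ltW n00) ?(ltW nn).
  move: hG; rewrite /JJ; move: (PP _ / p) (Rintegral _ _ _) (nrm z ^+ 2) => x y w h1 h2.
  lra.
split=> [/H|hP].
  by apply: le_trans; rewrite mulr_ge0 ?sqr_ge0// divr_ge0// ltW.
apply: le_trans (H _); last by rewrite hP.
rewrite ler_wpM2l ?divr_ge0 ?(ltW c0)// ler_sqr ?nnegrE ?nrm_ge0 ?(ltW n00)//.
rewrite leNgt; apply/negP => nn.
have := HC z az; rewrite hP ler_pM2l// leNgt => /negP; apply.
by apply: gt0_ltr_powR; rewrite ?nnegrE ?nrm_ge0 ?(ltW n00).
Qed.

(** Its image under [K] is a nonzero constant on ]0, 1] and vanishes from 2 on. *)
Definition seed : R -> R := \1_(`]1, 2]%classic : set R).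

Let mI12 : measurable (`]1, 2]%classic : set (measurableTypeR R)).
Proof. exact: measurable_itv. Qed.
Let sub12 : `]1, 2]%classic `<=` D.
Proof. by move=> t; rewrite /= in_itv/= => /andP[t1 _]; apply/halflineE; exact: lt_trans t1. Qed.

Lemma seedE t : seed t = if (1 < t) && (t <= 2) then 1 else 0.
Proof. by rewrite /seed indicE mem_setE in_itv/=; case: ifP. Qed.

Let fin12 : (nu `]1%R, 2%R]%classic < +oo)%E.
Proof. by rewrite radial_oc ?ler01 ?ler1n// ltry. Qed.

Let pos12 : (0 < nu `]1%R, 2%R]%classic)%E.
Proof.
rewrite radial_oc ?ler01 ?ler1n// lte_fin mulr_gt0 ?ball_vol_gt0//.
by rewrite subr_gt0 expr1n exprn_egt1 ?ltr1n// -lt0n.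
Qed.

Lemma rint_seed (g : measurableTypeR R -> R) : measurable_fun D g ->
  (forall t, seed t = 0 -> g t = 0) -> (exists M, forall t, `|g t| <= M) -> rig g.
Proof.
move=> mg gs [M gM].
have -> : g = g \_ `]1, 2].
  apply/funext => t; rewrite patchE mem_setE in_itv/=; case: ifPn => // h.
  by apply: gs; rewrite seedE (negbTE h).
have : rintegrable nu `]1, 2] g.
  apply: measurable_bounded_integrable => //.
  - by apply: (measurable_funS mD) mg; exact: sub12.
  - by exists M; split; rewrite ?num_real// => x Mx t _; apply: le_trans (gM t) (ltW Mx).
rewrite /rintegrable => ig.
rewrite (_ : EFin \o _ = (EFin \o g) \_ `]1, 2]); last first.
  by apply/funext => t /=; rewrite !patchE; case: ifP.
by apply/(integrable_restrict _ mI12 mD); rewrite setIidr.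
Qed.

Lemma measurable_seed : measurable_fun D seed.
Proof. exact: measurable_indic. Qed.

Let seed01 t : 0 <= seed t <= 1.
Proof. by rewrite seedE; case: ifP; rewrite ?lexx ?ler01. Qed.

Lemma seed_L2 : L2 seed.
Proof.
split; first exact: measurable_seed.
apply: rint_seed.
- by apply: measurable_funX; exact: measurable_seed.
- by move=> t ->; rewrite expr0n.
- by exists 1 => t; have /andP[h0 h1] := seed01 t; rewrite ger0_norm ?sqr_ge0// expr_le1.
Qed.

Lemma K_far z d r : (forall t, d < t -> z t = 0) -> d <= r -> K z r = 0.
Proof.
move=> z0 dr; rewrite /K (@eq_rint _ _ _ nu _ _ (fun=> 0)).
  by rewrite Rintegral_cst ?mul0r ?oppr0//; exact: measurable_itv.
by move=> t; rewrite /= in_itv/= andbT => rt; rewrite z0 ?mul0r// (le_lt_trans dr).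
Qed.

Lemma seed_far t : 2 < t -> seed t = 0.
Proof. by move=> t2; rewrite seedE [t <= 2]leNgt t2/= andbF. Qed.

Lemma K_seed_near : exists2 k, 0 < k & forall r, 0 < r -> r <= 1 -> `|K seed r| = k.
Proof.
have i12 : rintegrable nu `]1, 2] (fun t => seed t * kap N t).
  apply: (rintS mI12 (measurable_itv _) _ (K_integrable N3 seed_L2 ltr01)).
  by move=> t; rewrite /= !in_itv/= => /andP[->].
exists `|K seed 1|.
  have := K_diff N3 seed_L2 ltr01 (ler1n R 2).
  rewrite (K_far seed_far (lexx 2)) sub0r => E.
  rewrite -normrN E; apply: lt_le_trans (ler_norm _).
  apply: (@lt_le_trans _ _ (\int[nu]_(t in `]1, 2]) kap N 2)).
    rewrite Rintegral_cst// mulr_gt0//.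
      by rewrite mulr_gt0 ?invr_gt0 ?powR_gt0// cN_gt0.
    by apply: fine_gt0; apply/andP; split; [exact: pos12|exact: fin12].
  apply: rint_le_sub => //.
  - apply: measurable_bounded_integrable => //.
    by exists `|kap N 2|; split; rewrite ?num_real// => x Mx t _; apply: ltW.
  - move=> t; rewrite /= in_itv/= => /andP[t1 t2].
    by rewrite seedE t1 t2/= mul1r; apply: kap_le => //; exact: lt_trans t1.
move=> r r0 r1; congr `|_|; apply/esym/eqP; rewrite -subr_eq0.
rewrite (K_diff N3 seed_L2 r0 r1) (@eq_rint _ _ _ nu _ _ (fun=> 0)).
  by rewrite Rintegral_cst ?mul0r//; exact: measurable_itv.
by move=> t; rewrite /= in_itv/= => /andP[_ t1]; rewrite seedE ltNge t1/= mul0r.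
Qed.

End Descent.

Lemma drop_sum {R : realType} (x1 x2 x3 d y : R) :
  x2 + d <= x1 -> x3 <= x2 - y -> x3 + (d + y) <= x1.
Proof. lra. Qed.

Lemma cvg_ext {R : realType} (u v : nat -> R) (l l' : R) : (forall n, u n = v n) ->
  l = l' -> v n @[n --> \oo] --> l' -> u n @[n --> \oo] --> l.
Proof. by move=> /funext -> ->. Qed.

(** * The descent map *)

Section Step.
Context {R : realType}.
Variable N : nat.
Hypothesis N3 : (3 <= N)%N.
Let N0 : (0 < N)%N. Proof. exact: leq_trans N3. Qed.
Variables p : R.
Hypothesis p2 : 2 < p.
Local Notation nu := (@radial_measure R N).
Local Notation D := (@halfline R).
Local Notation a := (@half_exp R N).
Hypothesis apN : a * p < N%:R.
Local Notation f := (fp p).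
Local Notation rig := (rintegrable nu D).
Local Notation II g := (\int[nu]_(t in D) g t)%R.
Local Notation K := (@K R N).
Local Notation L2 := (@L2 R N).
Local Notation nrm := (@nrm R N).
Local Notation Kc := (@Kcst R N N3).
Local Notation dist2 := (@dist2 R N).
Variables (Phi beta : R -> R) (c th : R).
Hypothesis G : growth Phi beta c th.
Variable m : R.
Hypothesis m0 : 0 < m.
Let mD := @measurable_halfline R.
Local Notation adm := (@adm R N Phi m).
Local Notation env := (@env R N).
Local Notation PP := (@PP R N p).
Local Notation JJ := (@JJ R N p Phi).
Local Notation T := (TT N3 p2 apN G (ltW m0)).
Local Notation gam := (@gam R N p).
Local Notation chi := (@chi R N th).
Local Notation dil := (@dil R N).
Hypothesis gam_chi : chi < gam.
Let p0 : 0 < p. Proof. by apply: lt_trans p2. Qed.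
Let c0 : 0 < c := growth_c G.
Let chi0 : 0 < chi. Proof. by have := chi_ge2 N3 G; lra. Qed.

Lemma rint_extend (A : set (measurableTypeR R)) (g : measurableTypeR R -> R) :
  measurable A -> A `<=` D -> (forall t, D t -> ~ A t -> g t = 0) ->
  rintegrable nu A g -> rig g.
Proof.
move=> mA AD g0 ig.
apply: (@eq_rintegrable _ _ _ nu _ mD (g \_ A)).
  move=> t Dt; rewrite patchE; case: ifPn => // /negP h.
  by rewrite g0// => At; apply: h; rewrite inE.
rewrite /rintegrable (_ : EFin \o _ = (EFin \o g) \_ A); last first.
  by apply/funext => t /=; rewrite !patchE; case: ifP.
by apply/(integrable_restrict _ mA mD); rewrite setIidr.
Qed.

Let mlow (s : R) : measurable (`]0, s]%classic : set (measurableTypeR R)).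
Proof. exact: measurable_itv. Qed.

(** By the radial bound the square is O(t^-(N-2)) near the origin, which is integrable. *)
Lemma sqr_K_compact z d : 0 < d -> L2 z -> (forall t, d < t -> z t = 0) ->
  rig (fun t => K z t ^+ 2).
Proof.
move=> d0 lz z0; have ap0 : 0 <= 2 * a by rewrite mulr_ge0// ltW// half_exp_gt0.
have apN' : 2 * a < N%:R by rewrite /half_exp mulrC divfK// ltrBlDr ltrDl.
have [C _ /(_ d d0)[i2 _]] := rint_powR_small N3 ap0 apN'.
apply: (rint_extend (mlow d) (@low_sub R d)).
  move=> t /halflineE t0 h; rewrite (K_far N z0) ?expr0n// leNgt; apply/negP => t2.
  by apply: h; rewrite /= in_itv/= t0 ltW.
apply: (rintegrable_le (mlow d) (g := fun t => (Kc * nrm z) ^+ 2 * t `^ (- (2 * a)))).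
- apply: (measurable_funS mD (@low_sub R d)).
  by apply: measurable_funX; exact: measurable_K.
- by apply: rintegrableZ.
move=> t; rewrite /= in_itv/= => /andP[t0 _].
rewrite ger0_norm ?sqr_ge0// -real_normK ?num_real//.
have := K_bound N3 lz t0; rewrite mulrAC => h.
have -> : t `^ (- (2 * a)) = (t `^ (- a)) ^+ 2.
  by rewrite expr2 -powRDp//; congr (_ `^ _); ring.
by rewrite -exprMn; apply: lerXn2r; rewrite ?nnegrE// !mulr_ge0 ?powR_ge0 ?Kcst_ge0 ?nrm_ge0.
Qed.

Let fin01 : (nu `]0%R, 1%R]%classic < +oo)%E.
Proof. by rewrite radial_oc// ltry. Qed.

Let pos01 : (0 < nu `]0%R, 1%R]%classic)%E.
Proof.
rewrite radial_oc// lte_fin expr1n expr0n gtn_eqF// subr0 mulr1.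
exact: ball_vol_gt0.
Qed.

Lemma adm_start : exists w, adm w /\ 0 < PP (K w).
Proof.
have ls := seed_L2 N3.
set M := II (fun t => K seed t ^+ 2).
have M0 : 0 <= M by apply: Rintegral_ge0 => t _; exact: sqr_ge0.
(* The factor brings the mass of the multiple of [seed] below [m]. *)
pose e := Num.sqrt (m / (M + 1)).
have M1 : 0 < M + 1 by rewrite ltr_pwDr.
have e0 : 0 < e by rewrite sqrtr_gt0 divr_gt0.
have e2 : e ^+ 2 = m / (M + 1) by rewrite sqr_sqrtr// divr_ge0// ltW.
have lw : L2 (fun t => e * seed t) by exact: L2Z.
have KE t : D t -> K (fun t => e * seed t) t ^+ 2 = e ^+ 2 * K seed t ^+ 2.
  by move=> /halflineE t0; rewrite KZ// exprMn.
have ik := sqr_K_compact (ltr0n R 2) (ls R) (@seed_far R).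
have aw : adm (fun t => e * seed t).
  split => //.
  - apply: (rint_seed N3).
    + by apply: (measurable_growth G); case: lw.
    + by move=> t ->; rewrite mulr0 (growth0 G).
    + exists (Phi e) => t; rewrite ger0_norm ?(Phi_nonneg G)//; apply: (growth_mono G).
      rewrite normrM -[X in _ <= X]mulr1 ler_wpM2l// seedE; case: ifP; rewrite ?normr1 ?normr0//.
  - by apply: eq_rintegrable (rintegrableZ mD (e ^+ 2) ik) => // t Dt; rewrite KE.
  rewrite (eq_rint nu KE); apply: (@le_trans _ _ (e ^+ 2 * M)).
    by rewrite /M -(RintegralZl _ mD ik).
  rewrite e2 mulrAC ler_pdivrMr// ler_wpM2l ?(ltW m0)//.
  by rewrite lerDl.
exists (fun t => e * seed t); split => //.
have [k k0 hk] := @K_seed_near R N N3.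
have iP := adm_PP N3 p2 apN aw.
apply: (@lt_le_trans _ _ (\int[nu]_(t in `]0, 1]) (e * k) `^ p)).
  rewrite Rintegral_cst// mulr_gt0 ?powR_gt0 ?mulr_gt0//.
  by apply: fine_gt0; apply/andP; split; [exact: pos01|exact: fin01].
apply: le_trans (rint_le_set (mlow 1) mD (@low_sub R 1) iP _); last first.
  by move=> t _; exact: powR_ge0.
apply: rint_le_sub => //.
- apply: measurable_bounded_integrable => //.
  + by exists `|(e * k) `^ p|; split; rewrite ?num_real// => x Mx t _; apply: ltW.
- by apply: rintS iP => //; exact: low_sub.
move=> t; rewrite /= in_itv/= => /andP[t0 t1].
by rewrite KZ// normrM hk// [`|e|]ger0_norm// ltW.
Qed.

Lemma PP_pos_JJ_neg z : adm z -> 0 < PP (K z) -> exists2 w, adm w & JJ w < 0.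
Proof.
move=> az P0; set E := II (fun t => Phi (z t)).
have E0 : 0 <= E by apply: Rintegral_ge0 => t _; exact: (Phi_nonneg G).
(* With s^(gam-chi) = 1 + pE/P, the potential energy after dilation exceeds p s^chi E by s^chi P,
   which makes J negative. *)
pose s := (1 + p * E / PP (K z)) `^ (gam - chi)^-1.
have gc : 0 < gam - chi by rewrite subr_gt0.
have b1 : 1 <= 1 + p * E / PP (K z) by rewrite lerDl divr_ge0 ?mulr_ge0// ltW.
have s1 : 1 <= s.
  by rewrite -[X in X <= _](powRr0 (1 + p * E / PP (K z))) ler_powR// ltW// invr_gt0.
have s0 : 0 < s by apply: lt_le_trans s1.
exists (dil s z); first exact: (dil_adm N3 G s0 az).
have h1 := dil_energy N3 G s1 az; rewrite -/E in h1.
have h2 := dil_PP N3 p2 apN s0 az.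
rewrite /JJ h2; apply: (le_lt_trans (lerB h1 (lexx _))).
have sE : s `^ (gam - chi) = 1 + p * E / PP (K z).
  by rewrite /s -powRrM mulVf ?gt_eqF// powRr1// (le_trans ler01).
have -> : s `^ gam = s `^ chi * (1 + p * E / PP (K z)).
  by rewrite -sE -powRDp// addrC subrK.
set q := PP (K z) in P0 *; set y := s `^ chi.
have -> : y * E - y * (1 + p * E / q) * q / p = - (y * q / p).
  by field; rewrite !gt_eqF.
by rewrite oppr_lt0 divr_gt0// mulr_gt0// powR_gt0.
Qed.

Lemma scale_adm t z : 0 <= t -> t <= 1 -> adm z -> adm (fun r => t * z r) /\
  II (fun r => Phi (t * z r)) <= II (fun r => Phi (z r)).
Proof.
move=> t0 t1 [lz iz ik mk].
have le x : Phi (t * x) <= Phi x.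
  by apply: (growth_mono G); rewrite normrM ger0_norm// ler_piMl.
have lw : L2 (fun r => t * z r) by exact: L2Z.
have [i1 l1] : rig (fun r => Phi (t * z r)) /\
    II (fun r => Phi (t * z r)) <= II (fun r => Phi (z r)).
  apply: rint_le0_dom => //; first by apply: (measurable_growth G); case: lw.
  by move=> r _; rewrite (Phi_nonneg G) le.
have KE r : D r -> K (fun t0 => t * z t0) r ^+ 2 = t ^+ 2 * K z r ^+ 2.
  by move=> /halflineE r0; rewrite KZ// exprMn.
split; last exact: l1.
split; [exact: lw|exact: i1|..].
  by apply: eq_rintegrable (rintegrableZ mD (t ^+ 2) ik) => // r Dr; rewrite KE.
rewrite (eq_rint nu KE) (RintegralZl _ mD ik).
apply: le_trans mk; rewrite -[X in _ <= X]mul1r; apply: ler_wpM2r.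
  by apply: Rintegral_ge0 => r _; exact: sqr_ge0.
by rewrite expr_le1.
Qed.

Definition clamp (x : R) : R := Num.min 1 (Num.max 0 x).

Lemma clamp_bounds x : 0 <= clamp x /\ clamp x <= 1.
Proof.
by rewrite /clamp; split; rewrite ?ge_min ?lexx// le_min ler01 le_max lexx.
Qed.

Lemma clamp_continuous : continuous clamp.
Proof.
move=> x; apply: continuous_min; first exact: cvg_cst.
by apply: continuous_max; [exact: cvg_cst|exact: cvg_id].
Qed.

Lemma clamp_id x : 0 <= x -> x <= 1 -> clamp x = x.
Proof. by move=> x0 x1; rewrite /clamp max_r// min_r. Qed.

Lemma clamp_gt0 x : 0 < clamp x -> 0 < x.
Proof.
by rewrite /clamp lt_min ltr01/= lt_max ltxx.
Qed.

Lemma clamp_lt1 x : clamp x < 1 -> x < 1.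
Proof. by rewrite /clamp gt_min ltxx/= gt_max => /andP[]. Qed.

Variable P0 : R.

(** The bound s^chi on the growth of the principal energy, for the dilation by s. It is 1 up to the
    threshold [P0] and 2 from [P0 + 1] on; hence a value below 2 certifies a bounded potential
    energy. *)
Definition infl (z : R -> R) : R := 1 + clamp (PP (K (T (K z))) - P0).
(* The dilation is active only while the potential energy of T (K z) exceeds the
   threshold P0, so that UU is continuous and coincides with T o K below it. *)
Definition UU (z : R -> R) : R -> R := dil (infl z `^ chi^-1) (T (K z)).

Lemma infl_ge1 z : 1 <= infl z.
Proof. by rewrite lerDl; have [] := clamp_bounds (PP (K (T (K z))) - P0). Qed.

Lemma infl_le2 z : infl z <= 2.
Proof. by have [] := clamp_bounds (PP (K (T (K z))) - P0); rewrite /infl; lra. Qed.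

Lemma infl_root z : 1 <= infl z `^ chi^-1 /\ infl z `^ chi^-1 <= 2.
Proof.
have i1 := infl_ge1 z; have i0 := lt_le_trans ltr01 i1.
split; first by rewrite -[X in X <= _](powRr0 (infl z)) ler_powR// ltW// invr_gt0.
apply: (@le_trans _ _ (infl z `^ 1)).
  rewrite ler_powR//; rewrite invf_le1//; have := chi_ge2 N3 G; lra.
by rewrite powRr1 ?infl_le2// ltW.
Qed.

Lemma UU_adm z : adm z -> adm (UU z).
Proof.
move=> az; have [s1 _] := infl_root z.
by apply: (dil_adm N3 G (lt_le_trans ltr01 s1)); exact: adm_T.
Qed.

Lemma UU_drop cb z : p * (cb + 1) / (gam / chi - 1) <= P0 -> adm z -> JJ z <= cb ->
  JJ (UU z) + (c / 4 * dist2 (T (K z)) z + (infl z - 1)) <= JJ z /\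
  JJ (UU z) <= JJ (T (K z)).
Proof.
move=> hP0 az hz; set v := T (K z).
have av : adm v by exact: adm_T.
have h1 := JJ_drop N3 p2 apN G (ltW m0) az; rewrite -/v in h1.
have d0 : 0 <= c / 4 * dist2 v z by rewrite mulr_ge0 ?dist2_ge0// divr_ge0// ltW.
have [s1 _] := infl_root z; have i1 := infl_ge1 z.
have i0 := lt_le_trans ltr01 i1; have s0 := lt_le_trans ltr01 s1.
have hE := dil_energy N3 G s1 av.
have iE : infl z `^ chi^-1 `^ chi = infl z.
  by rewrite -powRrM mulVf ?gt_eqF// powRr1// ltW.
rewrite iE in hE.
have t1 : 1 < gam / chi by rewrite ltr_pdivlMr// mul1r.
have yP : 1 < infl z -> P0 <= PP (K v).
  rewrite /infl ltrDl => /clamp_gt0; rewrite subr_gt0; exact: ltW.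
have hJ : JJ v <= cb by apply: le_trans hz; apply: le_trans h1; rewrite lerDl.
have E : infl z `^ (gam / chi) * PP (K v) = PP (K (UU z)).
  by rewrite /UU (dil_PP N3 p2 apN s0 av) -powRrM [chi^-1 * _]mulrC.
have h2 := dilation_energy p0 t1 i1 yP hP0 hJ (PP_ge0 N p (K v)) hE.
rewrite E in h2; split; first exact: drop_sum h1 h2.
by apply: (le_trans h2); rewrite gerBl subr_ge0.
Qed.

Lemma infl_PP z : infl z < 2 -> PP (K (T (K z))) <= P0 + 1.
Proof.
move=> h; have : clamp (PP (K (T (K z))) - P0) < 1 by move: h; rewrite /infl; lra.
by move=> /clamp_lt1; rewrite ltrBlDr addrC => /ltW.
Qed.

(** The convergence for which the potential energy and the descent map are both continuous:
    pointwise for the primitives, with bounded norms. *)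
Definition kcv (z_ : nat -> R -> R) (z : R -> R) : Prop :=
  [/\ forall n, adm (z_ n), adm z,
   exists Q, [/\ 0 <= Q, forall n, nrm (z_ n) <= Q & nrm z <= Q] &
   hcv (fun n => K (z_ n)) (K z)].

Lemma kcv_env z_ z : kcv z_ z -> exists C, [/\ 0 <= C,
  forall n, env C m (K (z_ n)) & env C m (K z)].
Proof.
move=> [az_ az [Q [Q0 q_ q]] _]; exists (Kc * Q); split.
- by rewrite mulr_ge0 ?Kcst_ge0.
- by move=> n; apply: env_le (env_K N3 (az_ n)) => //; rewrite ler_wpM2l ?Kcst_ge0.
- by apply: env_le (env_K N3 az) => //; rewrite ler_wpM2l ?Kcst_ge0.
Qed.

Lemma kcv_PP z_ z : kcv z_ z -> PP (K (z_ n)) @[n --> \oo] --> PP (K z).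
Proof.
move=> kz; have [C [C0 e_ e]] := kcv_env kz; case: kz => _ _ _ h.
exact: (PP_cvg N3 p2 apN C0 e_ e h).
Qed.

Lemma kcv_of_dist2 z_ z : (forall n, adm (z_ n)) -> adm z ->
  (exists Q, [/\ 0 <= Q, forall n, nrm (z_ n) <= Q & nrm z <= Q]) ->
  (forall e, 0 < e -> exists M, forall n, (M <= n)%N -> dist2 (z_ n) z <= e) ->
  kcv z_ z.
Proof.
move=> az_ az hQ hd; split => // r r0; case: az => lz _ _ _.
have B0 : 0 < Kc * r `^ (- a) + 1 by rewrite ltr_pwDr// mulr_ge0 ?Kcst_ge0 ?powR_ge0.
apply/cvgrPdist_le => e e0.
have [M HM] := hd ((e / (Kc * r `^ (- a) + 1)) ^+ 2) (exprn_gt0 _ (divr_gt0 e0 B0)).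
exists M => // n Mn; have lzn : L2 (z_ n) by case: (az_ n).
rewrite distrC; apply: (le_trans (K_dist2 N3 lzn lz r0)).
have h2 : Num.sqrt (dist2 (z_ n) z) <= e / (Kc * r `^ (- a) + 1).
  apply: (le_trans (ler_wsqrtr (HM n Mn))).
  by rewrite sqrtr_sqr ger0_norm// divr_ge0// ltW.
apply: (@le_trans _ _ ((Kc * r `^ (- a) + 1) * Num.sqrt (dist2 (z_ n) z))).
  by rewrite ler_wpM2r ?sqrtr_ge0// lerDl.
by rewrite mulrC -ler_pdivlMr.
Qed.

Lemma kcv_T z_ z : kcv z_ z ->
  (forall e, 0 < e -> exists M, forall n, (M <= n)%N ->
    dist2 (T (K (z_ n))) (T (K z)) <= e) /\
  kcv (fun n => T (K (z_ n))) (T (K z)).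
Proof.
move=> kz; have [C [C0 e_ e]] := kcv_env kz; case: kz => az_ az _ h.
have hd := TT_cvg N3 p2 apN G (ltW m0) C0 e_ e h.
have aT n := adm_T N3 p2 apN G (ltW m0) (az_ n).
have aT0 := adm_T N3 p2 apN G (ltW m0) az.
split; first exact: hd.
apply: (kcv_of_dist2 aT aT0 _ hd).
have [Q Q0 HQ] := TT_nrm_bound N3 p2 apN G (ltW m0) C0.
by exists Q; split; [exact: Q0|move=> n; exact: HQ (e_ n)|exact: HQ e].
Qed.

(** The evaluation points move since the dilation factor depends on n. The condition s <= 2 s_n
    keeps them beyond s/2, where the radial bound is uniform. *)
Lemma K_moving_cvg z_ z (s_ : nat -> R) s : L2 z -> (forall n, L2 (z_ n)) ->
  (forall e, 0 < e -> exists M, forall n, (M <= n)%N -> dist2 (z_ n) z <= e) ->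
  0 < s -> (forall n, s <= 2 * s_ n) -> s_ n @[n --> \oo] --> s ->
  K (z_ n) (s_ n) @[n --> \oo] --> K z s.
Proof.
move=> lz lz_ hd s0 ss scv.
have sn0 n : 0 < s_ n by rewrite -(pmulr_rgt0 _ (ltr0n R 2)) (lt_le_trans s0).
have h1 : K z (s_ n) @[n --> \oo] --> K z s.
  exact: (cvg_comp _ _ scv (K_continuous N3 lz s0)).
have a0 : 0 < a by exact: half_exp_gt0.
have B0 : 0 < Kc * (s / 2) `^ (- a) + 1 by rewrite ltr_pwDr// mulr_ge0 ?Kcst_ge0 ?powR_ge0.
have h2 : K (z_ n) (s_ n) - K z (s_ n) @[n --> \oo] --> (0 : R).
  apply/cvgrPdist_le => e e0.
  have [M HM] := hd ((e / (Kc * (s / 2) `^ (- a) + 1)) ^+ 2) (exprn_gt0 _ (divr_gt0 e0 B0)).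
  exists M => // n Mn; rewrite sub0r normrN.
  apply: (le_trans (K_dist2 N3 (lz_ n) lz (sn0 n))).
  have h2 : Num.sqrt (dist2 (z_ n) z) <= e / (Kc * (s / 2) `^ (- a) + 1).
    apply: (le_trans (ler_wsqrtr (HM n Mn))).
    by rewrite sqrtr_sqr ger0_norm// divr_ge0// ltW.
  apply: (@le_trans _ _ ((Kc * (s / 2) `^ (- a) + 1) * Num.sqrt (dist2 (z_ n) z))).
    rewrite ler_wpM2r ?sqrtr_ge0//; apply: (@le_trans _ _ (Kc * (s / 2) `^ (- a))); last by rewrite lerDl.
    rewrite ler_wpM2l ?Kcst_ge0// !powRN lef_pV2 ?posrE ?powR_gt0 ?divr_gt0//.
    apply: (ge0_ler_powR (ltW a0)); rewrite ?nnegrE ?(ltW (sn0 n)) ?divr_ge0 ?(ltW s0)//.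
    by rewrite ler_pdivrMr// mulrC.
  by rewrite mulrC -ler_pdivlMr.
have -> : (fun n => K (z_ n) (s_ n)) = (fun n => K (z_ n) (s_ n) - K z (s_ n) + K z (s_ n)).
  by apply/funext => n; rewrite subrK.
by rewrite -[X in _ --> X]add0r; exact: cvgD h2 h1.
Qed.

(** The dilation factors converge because the potential energies of the minimizers do, and the
    minimizers themselves converge in L^2. *)
Lemma kcv_UU z_ z : kcv z_ z -> kcv (fun n => UU (z_ n)) (UU z).
Proof.
move=> kz; have [hd kv] := kcv_T kz; case: (kz) => az_ az _ _.
case: (kv) => av_ av [Q [Q0 q_ q]] _.
have lv_ n : L2 (T (K (z_ n))) by case: (av_ n).
have lv : L2 (T (K z)) by case: av.
split.
- by move=> n; exact: UU_adm (az_ n).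
- exact: UU_adm az.
- exists (2 * Q); split; first by rewrite mulr_ge0.
  + move=> n; have [s1 s2] := infl_root (z_ n).
    rewrite /UU; have [_ ->] := dil_L2 (lt_le_trans ltr01 s1) (lv_ n).
    exact: (ler_pM (le_trans ler01 s1) (nrm_ge0 _ _) s2 (q_ n)).
  + have [s1 s2] := infl_root z.
    rewrite /UU; have [_ ->] := dil_L2 (lt_le_trans ltr01 s1) lv.
    exact: (ler_pM (le_trans ler01 s1) (nrm_ge0 _ _) s2 q).
have icv : infl (z_ n) @[n --> \oo] --> infl z.
  apply: cvgD; first exact: cvg_cst.
  have h : PP (K (T (K (z_ n)))) - P0 @[n --> \oo] --> PP (K (T (K z))) - P0.
    by apply: cvgB; [exact: (kcv_PP kv)|exact: cvg_cst].
  exact: (cvg_comp _ _ h (@clamp_continuous _)).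
have cvpow (e : R) (x_ : nat -> R) (x : R) : 0 < x -> x_ n @[n --> \oo] --> x ->
    x_ n `^ e @[n --> \oo] --> x `^ e.
  move=> x0 xcv; have h : {for x, continuous (fun y : R => y `^ e)}.
    apply: differentiable_continuous; apply/derivable1_diffP.
    by apply: derivable_powR; rewrite in_itv/= andbT.
  exact: (cvg_comp _ _ xcv h).
have i0 : 0 < infl z by apply: lt_le_trans (infl_ge1 z).
have scv := cvpow chi^-1 _ _ i0 icv.
move=> r r0; have [s1 s2] := infl_root z; have s0 := lt_le_trans ltr01 s1.
have s0_ n : 0 < infl (z_ n) `^ chi^-1.
  by have [t1 _] := infl_root (z_ n); exact: lt_le_trans t1.
have E n := K_dil N3 (s0_ n) (lv_ n) r0; have E0 := K_dil N3 s0 lv r0.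
apply: (cvg_ext E E0).
apply: cvgM; first by apply: cvpow.
apply: (K_moving_cvg lv lv_ hd (mulr_gt0 s0 r0)).
- move=> n; have [t1 t2] := infl_root (z_ n); rewrite mulrA ler_wpM2r ?(ltW r0)//.
  by exact: le_trans s2 (ler_peMr (ler0n R 2) t1).
- by apply: cvgM; [exact: scv|exact: cvg_cst].
Qed.

(** The fixed point 0 is described by its norm: a chosen minimizer is determined only up to null
    sets. Once K z = 0, the linearized functional is the integral of Phi. *)
Lemma UU_nrm0 z : adm z -> nrm z = 0 -> nrm (UU z) = 0.
Proof.
move=> az nz; have [C0 ez] := Kz_env N3 az.
have [av /(_ _ (adm0 N G (ltW m0))) mv] := TTP N3 p2 apN G (ltW m0) C0 ez.
set v := T (K z) in av mv.
have lz : L2 z by case: az.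
have F w : FF N p Phi (K z) w = II (fun t => Phi (w t)).
  rewrite /FF (@eq_rint _ _ _ nu D (fun t => f (K z t) * K w t) (fun=> 0)).
    by rewrite Rintegral_cst// mul0r subr0.
  by move=> t /halflineE t0; rewrite (nrm0_K N3)// fp0 mul0r.
have lv : L2 v by case: av.
have h2 : II (fun t => Phi (v t)) <= 0.
  move: mv; rewrite !F (@eq_rint _ _ _ nu D (fun=> Phi 0) (fun=> 0)); last first.
    by move=> t _; rewrite (growth0 G).
  rewrite Rintegral_cst// mul0r; apply: le_trans.
  by rewrite lerDl mulr_ge0 ?dist2_ge0// divr_ge0// ltW.
have h3 : c / 2 * nrm v ^+ 2 <= 0.
  by apply: le_trans h2; apply: (II_Phi_ge G lv); case: av.
have nv : nrm v = 0.
  apply/eqP; rewrite -sqrf_eq0 eq_le sqr_ge0 andbT.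
  by rewrite -(pmulr_rle0 _ (divr_gt0 c0 (ltr0n R 2))).
have [s1 _] := infl_root z.
by rewrite /UU; have [_ ->] := dil_L2 (lt_le_trans ltr01 s1) lv; rewrite nv mulr0.
Qed.

End Step.

Lemma sequentially_continuous {R : realType} (g : R -> R) :
  (forall (t_ : nat -> R) (t : R), t_ n @[n --> \oo] --> t -> g (t_ n) @[n --> \oo] --> g t) ->
  continuous g.
Proof.
move=> H t; apply/cvgrPdist_lt => e e0; apply: contrapT => nn.
have /choice[x_ hx] : forall n : nat, exists x : R, `|t - x| <= n.+1%:R^-1 /\ e <= `|g t - g x|.
  move=> n; apply: contrapT => ne; apply: nn.
  apply/nbhs_ballP; exists n.+1%:R^-1; first by rewrite /= invr_gt0 ltr0n.
  move=> x /= xn; rewrite ltNge; apply/negP => h; apply: ne; exists x.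
  by split; [exact: ltW xn|exact: h].
have xt : x_ n @[n --> \oo] --> t.
  apply/cvgrPdist_le => d d0.
  have /cvgrPdist_le/(_ _ d0) [M _ HM] := @cvg_harmonic R.
  exists M => // n Mn; have [h _] := hx n; apply: (le_trans h).
  by have := HM n Mn; rewrite sub0r normrN ger0_norm ?harmonic_ge0.
have /cvgrPdist_lt/(_ _ e0) [M _ HM] := H _ _ xt.
by have [_ h] := hx M; have := HM M (leqnn M); rewrite ltNge h.
Qed.

Lemma telescoping_pigeonhole {R : realType} (J_ d_ : nat -> R) (n : nat) (C : R) :
  (0 < n)%N -> (forall j, J_ j.+1 + d_ j <= J_ j) -> J_ 0%N <= C -> 0 <= J_ n ->
  exists2 j, (j < n)%N & d_ j <= C / n%:R.
Proof.
move=> n0 HJ J0 Jn; apply: contrapT => nex.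
have H : forall k, (k <= n)%N -> J_ k + k%:R * (C / n%:R) <= J_ 0%N.
  elim=> [|k IH] kn; first by rewrite mul0r addr0.
  have := IH (ltnW kn); have := HJ k.
  have : C / n%:R <= d_ k by rewrite leNgt; apply/negP => /ltW h; apply: nex; exists k.
  move: (C / n%:R) => y; rewrite -natr1 mulrDl mul1r; move: (k%:R * y) => x; lra.
have H' : J_ n + n%:R * (C / n%:R) < J_ 0%N.
  case: n n0 Jn nex H => // k _ Jk nex H.
  have := H k (leqnSn k); have := HJ k.
  have : C / k.+1%:R < d_ k by rewrite ltNge; apply/negP => h; apply: nex; exists k.
  move: (C / k.+1%:R) => y; rewrite -natr1 mulrDl mul1r; move: (k%:R * y) => x; lra.
move: H'; rewrite mulrCA mulfV ?mulr1 ?pnatr_eq0 -?lt0n//; lra.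
Qed.

Lemma half_lt2 {R : realType} (y : R) : y - 1 <= 2^-1 -> y < 2.
Proof. lra. Qed.

(** * Palais-Smale sequence and critical point *)

Section PalaisSmale.
Context {R : realType}.
Variable N : nat.
Hypothesis N3 : (3 <= N)%N.
Variables p : R.
Hypothesis p2 : 2 < p.
Local Notation nu := (@radial_measure R N).
Local Notation D := (@halfline R).
Local Notation a := (@half_exp R N).
Hypothesis apN : a * p < N%:R.
Local Notation rig := (rintegrable nu D).
Local Notation II g := (\int[nu]_(t in D) g t)%R.
Local Notation K := (@K R N).
Local Notation L2 := (@L2 R N).
Local Notation nrm := (@nrm R N).
Local Notation dist2 := (@dist2 R N).
Variables (Phi beta : R -> R) (c th : R).
Hypothesis G : growth Phi beta c th.
Variable m : R.
Hypothesis m0 : 0 < m.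
Let mD := @measurable_halfline R.
Local Notation adm := (@adm R N Phi m).
Local Notation PP := (@PP R N p).
Local Notation JJ := (@JJ R N p Phi).
Local Notation T := (TT N3 p2 apN G (ltW m0)).
Local Notation gam := (@gam R N p).
Local Notation chi := (@chi R N th).
Hypothesis gam_chi : chi < gam.
Local Notation U := (UU N3 p2 apN G m0).
Local Notation kcv := (@kcv R N Phi m).
Let c0 : 0 < c := growth_c G.

Lemma kcv_iter P0 n z_ z : kcv z_ z ->
  kcv (fun k => iter n (U P0) (z_ k)) (iter n (U P0) z).
Proof.
move=> h; elim: n => [//|n IH].
exact: (kcv_UU N3 p2 apN G m0 P0 IH).
Qed.

Lemma kcv_ray w (t_ : nat -> R) t : adm w -> t_ n @[n --> \oo] --> t ->
  kcv (fun n r => clamp (t_ n) * w r) (fun r => clamp t * w r).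
Proof.
move=> aw ht; case: (aw) => lw _ _ _.
have ad x : adm (fun r => clamp x * w r).
  by have [h1 h2] := clamp_bounds x; have [] := scale_adm N3 G h1 h2 aw.
have nw x : nrm (fun r => clamp x * w r) <= nrm w.
  have [h1 h2] := clamp_bounds x; rewrite nrmZ// ger0_norm//.
  by rewrite -[X in _ <= X]mul1r ler_wpM2r// nrm_ge0.
split=> [n|||]; [exact: ad|exact: ad| |].
  by exists (nrm w); split => [|n|]; [exact: nrm_ge0|exact: nw|exact: nw].
move=> r r0; apply: (cvg_ext (fun n => KZ N3 (clamp (t_ n)) lw r0) (KZ N3 (clamp t) lw r0)).
apply: cvgM; last exact: cvg_cst.
exact: (cvg_comp _ _ ht (@clamp_continuous _ t)).
Qed.

Lemma palais_smale : exists be cb P1 : R, 0 < be /\ forall e, 0 < e ->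
  exists u, [/\ adm u, dist2 (T (K u)) u <= e, be <= JJ (T (K u)),
    JJ (T (K u)) <= cb & PP (K (T (K u))) <= P1].
Proof.
have [w0 [aw0 Pw0]] := adm_start N3 p2 apN G m0.
have [w aw Jw] := PP_pos_JJ_neg N3 p2 apN G gam_chi aw0 Pw0.
have [pi0 [be [pi00 be0 bar]]] := barrier N3 p2 apN G (ltW m0) gam_chi.
pose cb := II (fun r => Phi (w r)).
have cb0 : 0 <= cb by apply: Rintegral_ge0 => r _; exact: (Phi_nonneg G).
pose P0 := p * (cb + 1) / (gam / chi - 1).
exists be, cb, (P0 + 1); split => // e e0.
pose z0 t : R -> R := fun r => clamp t * w r.
have az0 t : adm (z0 t).
  by have [h1 h2] := clamp_bounds t; have [] := scale_adm N3 G h1 h2 aw.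
have p0 : 0 < p by apply: lt_trans p2.
have Jz0 t : JJ (z0 t) <= cb.
  have [h1 h2] := clamp_bounds t; have [_ h3] := scale_adm N3 G h1 h2 aw.
  apply: le_trans h3; rewrite gerBl divr_ge0 ?PP_ge0//; exact: ltW.
have inv t j : adm (iter j (U P0) (z0 t)) /\ JJ (iter j (U P0) (z0 t)) <= cb.
  elim: j => [|j [ia iJ]]; first by split; [exact: az0|exact: Jz0].
  split; first exact: (UU_adm N3 p2 apN G m0 P0 ia).
  have [h _] := UU_drop N3 p2 apN G m0 gam_chi (lexx P0) ia iJ.
  apply: le_trans iJ; apply: le_trans h; rewrite lerDl addr_ge0//.
    by rewrite mulr_ge0 ?dist2_ge0// divr_ge0// ltW.
  by rewrite subr_ge0 infl_ge1.
have drop t j := UU_drop N3 p2 apN G m0 gam_chi (lexx P0) (inv t j).1 (inv t j).2.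
pose dd t j := c / 4 * dist2 (T (K (iter j (U P0) (z0 t)))) (iter j (U P0) (z0 t)) +
   (infl N3 p2 apN G m0 P0 (iter j (U P0) (z0 t)) - 1).
have dd0 t j : 0 <= dd t j.
  apply: addr_ge0; first by rewrite mulr_ge0 ?dist2_ge0// divr_ge0// ltW.
  by rewrite subr_ge0 infl_ge1.
(* The first bound makes the step short; the second forces [infl] below 2 and thereby bounds the
   potential energy of the step. *)
have [n n0 hn] : exists2 n, (0 < n)%N & cb / n%:R <= Num.min (c / 4 * e) 2^-1.
  have q0 : 0 < Num.min (c / 4 * e) 2^-1.
    by rewrite lt_min invr_gt0 ltr0n andbT mulr_gt0// divr_gt0.
  exists (Num.truncn (cb / Num.min (c / 4 * e) 2^-1)).+1 => //.
  rewrite ler_pdivrMr ?ltr0n// mulrC -ler_pdivrMr// ltW//.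
  by apply: truncnS_gt.
pose g t := PP (K (iter n (U P0) (z0 t))).
have gc : continuous g.
  apply: sequentially_continuous => t_ t ht.
  exact: (kcv_PP N3 p2 apN (kcv_iter P0 n (kcv_ray aw ht))).
have g0 : g 0 = 0.
  have nz j : nrm (iter j (U P0) (z0 0)) = 0.
    elim: j => [|j IH]; last first.
      have [ia _] := inv 0 j; exact: (UU_nrm0 N3 p2 apN G m0 P0 ia IH).
    have -> : iter 0 (U P0) (z0 0) = (fun r => 0 * w r).
      by apply/funext => r /=; rewrite /z0 clamp_id.
    by case: aw => lw _ _ _; rewrite nrmZ// normr0 mul0r.
  have [[ln _ _ _] _] := inv 0 n.
  exact: (nrm0_PP N3 p2 ln (nz n)).
(* Below the barrier level J would be nonnegative, whereas the iterates of the endpoint keep the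
   negative energy of [w]. *)
have g1 : pi0 <= g 1.
  rewrite leNgt; apply/negP => /ltW h.
  have [an _] := inv 1 n; have [/(_ h) h1 _] := bar _ an.
  have dec j : JJ (iter j (U P0) (z0 1)) <= JJ w.
    elim: j => [|j IH].
      have -> : iter 0 (U P0) (z0 1) = w.
        by apply/funext => r /=; rewrite /z0 clamp_id// mul1r.
      exact: lexx.
    have [h2 _] := drop 1 j; apply: le_trans IH; apply: le_trans h2.
    by rewrite lerDl; exact: (dd0 1 j).
  by have := lt_le_trans (le_lt_trans (dec n) Jw) h1; rewrite ltxx.
have [t _ gt] : exists2 t, t \in `[0, 1]%R & g t = pi0.
  apply: IVT => //.
    by apply: continuous_subspaceT.
  by rewrite g0 ge_min le_max (ltW pi00) g1 orbT.
have [an _] := inv t n; have [_ /(_ gt) Jn] := bar _ an.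
have Jn0 : 0 <= JJ (iter n (U P0) (z0 t)) by apply: le_trans Jn; exact: ltW.
have [j jn dj] := @telescoping_pigeonhole _ (fun j => JJ (iter j (U P0) (z0 t))) (dd t) n cb
  n0 (fun j => (drop t j).1) (Jz0 t) Jn0.
have {}dj := le_trans dj hn; rewrite le_min in dj; case/andP: dj => dj1 dj2.
set u := iter j (U P0) (z0 t).
have [au Ju] : adm u /\ JJ u <= cb := inv t j.
have d0 : 0 <= c / 4 * dist2 (T (K u)) u by rewrite mulr_ge0 ?dist2_ge0// divr_ge0// ltW.
have i0 : 0 <= infl N3 p2 apN G m0 P0 u - 1 by rewrite subr_ge0 infl_ge1.
exists u; split.
- exact: au.
- rewrite -(ler_pM2l (divr_gt0 c0 (ltr0n R 4))); apply: le_trans dj1.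
  by rewrite /dd lerDl.
(* The barrier bounds the last iterate from below; energies decrease along the iteration, so the
   bound reaches iterate j + 1, whose energy is at most that of T (K u). *)
- apply: (le_trans _ (drop t j).2); apply: (le_trans Jn).
  have dec k : JJ (iter (k + j.+1) (U P0) (z0 t)) <= JJ (iter j.+1 (U P0) (z0 t)).
    elim: k => [|k IH]; first exact: lexx.
    apply: le_trans IH; apply: le_trans (drop t (k + j.+1)%N).1.
    by rewrite lerDl; exact: (dd0 t (k + j.+1)%N).
  by rewrite -(subnK jn); exact: dec.
- apply: le_trans Ju; have := JJ_drop N3 p2 apN G (ltW m0) au.
  by apply: le_trans; rewrite lerDl.
apply: infl_PP; apply: half_lt2; apply: le_trans dj2; by rewrite /dd lerDr.
Qed.

End PalaisSmale.

(** * Pointwise compactness and the critical point *)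

Lemma seq_lim_le {R : realType} (u : nat -> R) (l C : R) : (forall n, u n <= C) ->
  u n @[n --> \oo] --> l -> l <= C.
Proof.
move=> uC ul; apply/ler_addgt0Pr => e e0.
have /cvgrPdist_le/(_ _ e0) [M _ HM] := ul.
have := HM M (leqnn M); have := uC M; rewrite ler_norml => h /andP[_ h2]; lra.
Qed.

Lemma seq_lim_ge {R : realType} (u : nat -> R) (l C : R) : (forall n, C <= u n) ->
  u n @[n --> \oo] --> l -> C <= l.
Proof.
move=> uC ul; apply/ler_addgt0Pr => e e0.
have /cvgrPdist_le/(_ _ e0) [M _ HM] := ul.
have := HM M (leqnn M); have := uC M; rewrite ler_norml => h /andP[h2 _]; lra.
Qed.

(** Tychonoff's theorem provides a cluster point in the product topology; its neighbourhoods control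
    finitely many arguments at a time. *)
Lemma cluster_points {R : realType} (h_ : nat -> R -> R) (M : R -> R) :
  (forall n r, `|h_ n r| <= M r) ->
  exists h : R -> R, forall (s : seq R) (e : R) (n : nat), 0 < e ->
    exists2 k, (n <= k)%N & forall x, x \in s -> `|h_ k x - h x| < e.
Proof.
move=> hM.
pose A (r : R) : set R := `[- M r, M r]%classic.
have cA : compact [set f : prod_topology (fun _ : R => R) | forall i, A i (f i)].
  by apply: tychonoff => i; exact: segment_compact.
pose F := (fun n => h_ n : prod_topology (fun _ : R => R)) @ \oo.
have [h [_ hh]] : [set f : prod_topology (fun _ : R => R) | forall i, A i (f i)] `&` cluster F !=set0.
  apply: cA; exists 0%N => // n _ r; rewrite /A /= in_itv/= -ler_norml.
  exact: hM.
exists h => s e n e0.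
pose B := nbhs (h : prod_topology (fun _ : R => R)).
have FB : Filter B by exact: nbhs_filter.
have near_s : B [set g | forall x, x \in s -> `|g x - h x| < e].
  elim: s => [|x s IH]; first by apply: filterE => g x; rewrite in_nil.
  have hx : B [set g | `|g x - h x| < e].
    have := @proj_continuous R (fun _ => R) x h.
    move=> /cvgrPdist_lt /(_ _ e0); apply: filterS => g; rewrite /proj distrC.
    exact.
  apply: (@filterS _ B FB _ _ _ (@filterI _ B FB _ _ hx IH)) => g [hgx hgs] y.
  by rewrite in_cons => /orP[/eqP ->//|]; exact: hgs.
have FA : F [set g | exists2 k, (n <= k)%N & g = h_ k].
  by exists n => // k nk; exists k.
have [g [[k nk ->] hk]] := hh _ _ FA near_s.
by exists k.
Qed.

(** An Arzela-Ascoli argument: the cluster point fixes the limit, a diagonal choice gives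
    convergence at the rationals, and the common modulus extends it to every r > 0. *)
Lemma equicontinuous_subsequence {R : realType} (h_ : nat -> R -> R) (M : R -> R)
    (w : R -> R -> R) :
  (forall n r, 0 < r -> `|h_ n r| <= M r) ->
  (forall n r s, 0 < r -> 0 < s -> `|h_ n s - h_ n r| <= w r s) ->
  (forall r, 0 < r -> w r s @[s --> r] --> (0 : R)) ->
  exists (k : nat -> nat) (h : R -> R), (forall n, (n <= k n)%N) /\
    hcv (fun n => h_ (k n)) h.
Proof.
move=> hM hw w0.
pose h'_ n (r : R) := if 0 < r then h_ n r else 0.
have [h Hh] : exists h : R -> R, forall (s : seq R) (e : R) (n : nat), 0 < e ->
    exists2 k, (n <= k)%N & forall x, x \in s -> `|h'_ k x - h x| < e.
  apply: (@cluster_points _ _ (fun r => if 0 < r then M r else 0)) => n r.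
  by rewrite /h'_; case: ifP => [r0|_]; [exact: hM|rewrite normr0].
have hwlim r s : 0 < r -> 0 < s -> `|h s - h r| <= w r s.
  move=> r0 s0; apply/ler_addgt0Pr => e e0.
  have e2 : 0 < e / 2 by rewrite divr_gt0.
  have [k _ hk] := Hh [:: r; s] _ 0%N e2.
  have := hk r; have := hk s; rewrite /h'_ r0 s0 !inE !eqxx orbT => /(_ isT) hs /(_ isT) hr.
  have := hw k r s r0 s0; move: hs hr; move: (h_ k r) (h_ k s) => x y.
  rewrite !ltr_norml !ler_norml => /andP[? ?] /andP[? ?] /andP[? ?]; apply/andP; split; lra.
pose q (i : nat) : R := ratr (odflt 0 (unpickle i) : rat).
(* The index [k n] serves the first n + 1 terms of the enumeration of the rationals with accuracy
   1/(n+1). *)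
have /choice[k hk] : forall n, exists k, (n <= k)%N /\
    forall i, (i <= n)%N -> `|h'_ k (q i) - h (q i)| < n.+1%:R^-1.
  move=> n; have n0 : (0 : R) < n.+1%:R^-1 by rewrite invr_gt0 ltr0n.
  have [k nk hk] := Hh [seq q i | i <- iota 0 n.+1] _ n n0.
  exists k; split => // i ni; apply: hk; apply/mapP; exists i => //.
  by rewrite mem_iota add0n ltnS.
exists k, h; split=> [n|r r0]; first by case: (hk n).
apply/cvgrPdist_le => e e0.
have e3 : 0 < e / 3 by rewrite divr_gt0.
have [d d0 hd] : exists2 d, 0 < d & forall s, `|s - r| < d -> `|w r s| <= e / 3.
  have /cvgrPdist_le/(_ _ e3)/nbhs_ballP[d d0 hd] := w0 r r0.
  exists d => // s sr; have := hd s; rewrite /ball/= distrC => /(_ sr).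
  by rewrite sub0r normrN.
have rd : Num.max (r / 2) (r - d) < r.
  by rewrite gt_max ltrBlDr ltrDl d0 andbT ltr_pdivrMr// ltr_pMr// ltr1n.
have [qr] := rat_in_itvoo rd; rewrite in_itv/= gt_max => /andP[/andP[q1 q2] q3].
pose i := pickle qr.
have qi : q i = ratr qr by rewrite /q pickleK.
have qi0 : 0 < q i by rewrite qi; apply: lt_trans q1; rewrite divr_gt0.
have wq : `|w r (q i)| <= e / 3.
  by apply: hd; rewrite qi ltr_norml; apply/andP; split; lra.
have /cvgrPdist_le/(_ _ e3) [M1 _ HM1] := @cvg_harmonic R.
exists (maxn M1 i) => // n; rewrite /= geq_max => /andP[/HM1 h1 ni].
have [nk /(_ i ni)] := hk n; rewrite /h'_ qi0 => h2.
have h3 := hw (k n) r (q i) r0 qi0; have h4 := hwlim r (q i) r0 qi0.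
rewrite sub0r normrN ger0_norm ?harmonic_ge0// /harmonic/= in h1.
have := le_trans h3 (le_trans (ler_norm _) wq).
have := le_trans h4 (le_trans (ler_norm _) wq).
have := lt_le_trans h2 h1.
move: (h_ (k n) (q i)) (h_ (k n) r) (h (q i)) (h r) => x y z t.
rewrite ltr_norml !ler_norml => /andP[? ?] /andP[? ?] /andP[? ?]; apply/andP; split; lra.
Qed.

Lemma critical_arith {R : realType} (p x l P d : R) : 0 <= P -> 0 < p -> 0 <= d ->
  x - l + d <= 0 -> x - P / p <= l.
Proof.
move=> P0 p0 d0 h; have : 0 <= P / p by rewrite divr_ge0// ltW.
by move: (P / p) => y; lra.
Qed.

Section CriticalPoint.
Context {R : realType}.
Variable N : nat.
Hypothesis N3 : (3 <= N)%N.
Variables p : R.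
Hypothesis p2 : 2 < p.
Local Notation nu := (@radial_measure R N).
Local Notation D := (@halfline R).
Local Notation a := (@half_exp R N).
Hypothesis apN : a * p < N%:R.
Local Notation f := (fp p).
Local Notation rig := (rintegrable nu D).
Local Notation II g := (\int[nu]_(t in D) g t)%R.
Local Notation K := (@K R N).
Local Notation L2 := (@L2 R N).
Local Notation nrm := (@nrm R N).
Local Notation Kc := (@Kcst R N N3).
Local Notation dist2 := (@dist2 R N).
Variables (Phi beta : R -> R) (c th : R).
Hypothesis G : growth Phi beta c th.
Variable m : R.
Hypothesis m0 : 0 < m.
Let mD := @measurable_halfline R.
Local Notation adm := (@adm R N Phi m).
Local Notation env := (@env R N).
Local Notation PP := (@PP R N p).
Local Notation JJ := (@JJ R N p Phi).
Local Notation FF := (@FF R N p Phi).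
Local Notation T := (TT N3 p2 apN G (ltW m0)).
Hypothesis gam_chi : @chi R N th < @gam R N p.
Let c0 : 0 < c := growth_c G.

Lemma nrm_triangle z w : L2 z -> L2 w -> nrm w <= 2 * (nrm z + Num.sqrt (dist2 z w)).
Proof.
move=> lz lw; have lzw := L2B lz lw.
have [_ h] := rint_sqrD_le mD lzw.1 lz.1 lzw.2 lz.2.
have e1 : nrm w ^+ 2 <= 2 * (nrm (fun t => z t - w t) ^+ 2) + 8 * nrm z ^+ 2 -> True by [].
have ld : L2 (fun t => 1 * z t + -1 * (z t - w t)) by exact: L2_lin.
have wE : (fun t => 1 * z t + -1 * (z t - w t)) = w.
  by apply/funext => t; ring.
have m1 : measurable_fun D (fun t => -1 * (z t - w t)) by have [] := L2Z (-1) lzw.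
have i1 : rig (fun t => (-1 * (z t - w t)) ^+ 2) by have [] := L2Z (-1) lzw.
have [_ h2] := rint_sqrD_le mD lz.1 m1 lz.2 i1.
have E1 : II (fun t => (z t + -1 * (z t - w t)) ^+ 2) = nrm w ^+ 2.
  by rewrite sqr_nrm; apply: eq_rint => t _; congr (_ ^+ 2); ring.
have E2 : II (fun t => (-1 * (z t - w t)) ^+ 2) = dist2 z w.
  by apply: eq_rint => t _; ring.
rewrite E1 E2 -sqr_nrm in h2.
have d0 : 0 <= dist2 z w by exact: dist2_ge0.
have : nrm w ^+ 2 <= (2 * (nrm z + Num.sqrt (dist2 z w))) ^+ 2.
  apply: (le_trans h2); rewrite -{1}(sqr_sqrtr d0).
  have := nrm_ge0 N z; have := sqrtr_ge0 (dist2 z w).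
  by move: (nrm z) (Num.sqrt _) => x y x0 y0; nra.
by rewrite ler_sqr ?nnegrE ?nrm_ge0// mulr_ge0// addr_ge0 ?nrm_ge0 ?sqrtr_ge0.
Qed.

Lemma K_diff_cvg0 (x_ y_ : nat -> R -> R) r : (forall n, L2 (x_ n)) ->
  (forall n, L2 (y_ n)) -> 0 < r ->
  (forall e, 0 < e -> exists M, forall n, (M <= n)%N -> dist2 (x_ n) (y_ n) <= e) ->
  K (x_ n) r - K (y_ n) r @[n --> \oo] --> (0 : R).
Proof.
move=> lx ly r0 hd.
have B0 : 0 < Kc * r `^ (- a) + 1 by rewrite ltr_pwDr// mulr_ge0 ?Kcst_ge0 ?powR_ge0.
apply/cvgrPdist_le => e e0.
have [M HM] := hd ((e / (Kc * r `^ (- a) + 1)) ^+ 2) (exprn_gt0 _ (divr_gt0 e0 B0)).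
exists M => // n Mn; rewrite sub0r normrN.
apply: (le_trans (K_dist2 N3 (lx n) (ly n) r0)).
have h2 : Num.sqrt (dist2 (x_ n) (y_ n)) <= e / (Kc * r `^ (- a) + 1).
  apply: (le_trans (ler_wsqrtr (HM n Mn))).
  by rewrite sqrtr_sqr ger0_norm// divr_ge0// ltW.
apply: (@le_trans _ _ ((Kc * r `^ (- a) + 1) * Num.sqrt (dist2 (x_ n) (y_ n)))).
  by rewrite ler_wpM2r ?sqrtr_ge0// lerDl.
by rewrite mulrC -ler_pdivlMr.
Qed.

Lemma FF_eqD h h' z : (forall t, 0 < t -> h t = h' t) -> FF h z = FF h' z.
Proof.
by move=> hh; rewrite /FF; congr (_ - _); apply: eq_rint => t /halflineE t0; rewrite hh.
Qed.

Lemma exists_critical : exists v, is_min N p Phi c m (K v) v /\ 0 < PP (K v).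
Proof.
have [be [cb [P1 [be0 PS]]]] := palais_smale N3 p2 apN G m0 gam_chi.
have /choice[u hu] : forall n : nat, exists u, [/\ adm u, dist2 (T (K u)) u <= n.+1%:R^-1,
    be <= JJ (T (K u)), JJ (T (K u)) <= cb & PP (K (T (K u))) <= P1].
  by move=> n; apply: PS; rewrite invr_gt0 ltr0n.
have p0 : 0 < p by apply: lt_trans p2.
have au n : adm (u n) by case: (hu n).
have lu n : L2 (u n) by case: (au n).
pose v n := T (K (u n)).
have av n : adm (v n) by exact: (adm_T N3 p2 apN G (ltW m0) (au n)).
have lv n : L2 (v n) by case: (av n).
(* Bounds on J and on the potential energy bound the principal energy, which is at least (c/2)
   nrm^2. *)
have vB n : nrm (v n) <= (0 + (`|cb| + `|P1| / p)) / (c / 2) + 1.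
  apply: (nrm_bound (divr_gt0 c0 (ltr0n R 2)) (lexx 0)); [|exact: nrm_ge0|].
    by rewrite addr_ge0// divr_ge0// ltW.
  rewrite mul0r subr0; have := II_Phi_ge G (lv n) (let: And4 _ h _ _ := av n in h).
  have [_ _ _ h1 h2] := hu n => h3; apply: (le_trans h3).
  have h4 : PP (K (v n)) / p <= `|P1| / p.
    by rewrite ler_pM2r ?invr_gt0// (le_trans h2)// ler_norm.
  by rewrite -lerBlDr; apply: le_trans (ler_norm cb); apply: le_trans h1; rewrite lerB.
set B := (0 + (`|cb| + `|P1| / p)) / (c / 2) + 1 in vB.
have B0 : 0 <= B := le_trans (nrm_ge0 N _) (vB 0%N).
have uB n : nrm (u n) <= 2 * (B + 1).
  apply: (le_trans (nrm_triangle (lv n) (lu n))); rewrite ler_pM2l//.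
  apply: lerD; first exact: vB.
  have [_ h _ _ _] := hu n; apply: (le_trans (ler_wsqrtr h)).
  rewrite -[X in _ <= X]sqrtr1 ler_wsqrtr// invf_le1 ?ltr0n// ler1n//.
set Q := 2 * (B + 1) in uB.
have Q0 : 0 <= Q by rewrite mulr_ge0// addr_ge0.
have [k [h [kn hcvh]]] : exists (k : nat -> nat) (h : R -> R), (forall n, (n <= k n)%N) /\
    hcv (fun n => K (u (k n))) h.
  apply: (@equicontinuous_subsequence _ (fun n => K (u n)) (fun r => Kc * r `^ (- a) * Q)
    (fun r s => Q * Kmod N r s)).
  - move=> n r r0; apply: (le_trans (K_bound N3 (lu n) r0)).
    by rewrite ler_wpM2l// mulr_ge0 ?Kcst_ge0 ?powR_ge0.
  - move=> n r s r0 s0; apply: (le_trans (K_modulus N3 (lu n) r0 s0)).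
    by rewrite ler_wpM2r// mulr_ge0 ?kap_ge0 ?sqrtr_ge0.
  - move=> r r0; rewrite -[X in _ --> X](mulr0 Q); apply: cvgM; first exact: cvg_cst.
    exact: Kmod_cvg.
pose C := Kc * Q.
have C0 : 0 <= C by rewrite mulr_ge0 ?Kcst_ge0.
have eu n : env C m (K (u (k n))).
  by apply: (env_le _ (lexx m) (env_K N3 (au (k n)))); rewrite ler_wpM2l ?Kcst_ge0.
have mh : measurable_fun D h.
  apply: (measurable_fun_cvg (h := fun n => K (u (k n)))).
  - by move=> n; case: (eu n).
  - by move=> t /halflineE t0; exact: hcvh.
have eh : env C m h.
  have [i1 l1] : rig (fun t => h t ^+ 2) /\ II (fun t => h t ^+ 2) <= m.
    apply: (rint_fatou mD (f_ := fun n t => K (u (k n)) t ^+ 2)).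
    - by move=> n; apply: measurable_funX; case: (eu n).
    - exact: measurable_funX.
    - by move=> n x _; exact: sqr_ge0.
    - by move=> x _; exact: sqr_ge0.
    - apply: aeW => t /halflineE t0; rewrite expr2; under eq_cvg do rewrite expr2.
      by apply: cvgM; exact: hcvh.
    - by move=> n; case: (eu n).
    - by move=> n; case: (eu n).
  split; [exact: mh| |exact: i1|exact: l1].
  move=> r r0; have hn : `|K (u (k n)) r| @[n --> \oo] --> `|h r| by apply: cvg_norm; exact: hcvh.
  by apply: (seq_lim_le _ hn) => n; case: (eu n) => _ + _ _; exact.
have vcv := TT_cvg N3 p2 apN G (ltW m0) C0 eu eh hcvh.
set w := T h in vcv.
have [aw mw] := TTP N3 p2 apN G (ltW m0) C0 eh.
have lw : L2 w by case: aw.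
have vw : hcv (fun n => K (v (k n))) (K w).
  have hQ : exists Q, [/\ 0 <= Q, forall n, nrm (v (k n)) <= Q & nrm w <= Q].
    exists (B + nrm w); split; first by rewrite addr_ge0 ?nrm_ge0.
    - by move=> n; apply: (le_trans (vB (k n))); rewrite lerDl nrm_ge0.
    - by rewrite lerDr.
  by case: (kcv_of_dist2 N3 (fun n => av (k n)) aw hQ vcv).
(* The short steps force both sequences to the same limit; hence h = K w on the half-line, while w =
   T h. *)
have uw : hcv (fun n => K (u (k n))) (K w).
  move=> r r0; have hd : K (v (k n)) r - K (u (k n)) r @[n --> \oo] --> (0 : R).
    apply: K_diff_cvg0 => // e e0.
    have /cvgrPdist_le/(_ _ e0) [M _ HM] := @cvg_harmonic R.
    exists M => n Mn; have [_ h1 _ _ _] := hu (k n); apply: (le_trans h1).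
    have := HM (k n) (leq_trans Mn (kn n)).
    by rewrite sub0r normrN ger0_norm ?harmonic_ge0.
  apply: (@cvg_ext _ _ (fun n => K (v (k n)) r - (K (v (k n)) r - K (u (k n)) r)) _ (K w r - 0)).
  - by move=> n; rewrite opprB addrC subrK.
  - by rewrite subr0.
  - exact: (cvgB (vw r r0) hd).
have hE r : 0 < r -> h r = K w r.
  by move=> r0; exact: (cvg_unique _ (hcvh r r0) (uw r r0)).
exists w; split.
  split; first exact: aw.
  by move=> z az; rewrite -!(FF_eqD _ hE); exact: mw.
(* Comparing each minimizer with 0 bounds its energy by the pairing of f (K u) with K v, which tends
   to the potential energy of [w]. If that were 0, the lower bound [be] would fail. *)
rewrite lt_neqAle eq_sym PP_ge0 andbT; apply/negP => /eqP P0.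
pose C' := Num.max C (Num.max (Kc * B) (Kc * nrm w)).
have C'0 : 0 <= C' by rewrite le_max C0.
have eu' n : env C' m (K (u (k n))) by apply: env_le (eu n) => //; rewrite le_max lexx.
have eh' : env C' m h by apply: env_le eh => //; rewrite le_max lexx.
have ev' n : env C' m (K (v (k n))).
  apply: (env_le _ (lexx m) (env_K N3 (av (k n)))).
  by rewrite !le_max (ler_wpM2l (Kcst_ge0 N3) (vB (k n))) orbT.
have ew' : env C' m (K w).
  by apply: (env_le _ (lexx m) (env_K N3 aw)); rewrite !le_max lexx !orbT.
have l1 := ell_diff_cvg N3 p2 apN C'0 eu' eh' ev' hcvh.
have l2 := ell_cvg N3 p2 apN C'0 eh' ev' ew' vw.
have E1 : II (fun t => f (h t) * K w t) = 0.
  have [_ E] := env_PP N3 p2 apN C'0 ew'.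
  rewrite -P0 -E; apply: eq_rint => t /halflineE t0; by rewrite hE.
rewrite E1 in l2.
have : be <= 0 + 0.
  apply: (seq_lim_ge _ (cvgD l1 l2)) => n.
  have [i1 _ _] := env_prod N3 p2 apN C'0 C'0 (eu' n) (ev' n).
  have [i2 _ _] := env_prod N3 p2 apN C'0 C'0 eh' (ev' n).
  have E2 : II (fun t => (f (K (u (k n)) t) - f (h t)) * K (v (k n)) t) +
      II (fun t => f (h t) * K (v (k n)) t) = II (fun t => f (K (u (k n)) t) * K (v (k n)) t).
    have -> : II (fun t => (f (K (u (k n)) t) - f (h t)) * K (v (k n)) t) =
      II (fun t => f (K (u (k n)) t) * K (v (k n)) t) - II (fun t => f (h t) * K (v (k n)) t).
      by rewrite -RintegralB//; apply: eq_rint => t _; rewrite mulrBl.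
    by rewrite subrK.
  rewrite E2; have [_ _ h1 _ _] := hu (k n); apply: (le_trans h1).
  have [_ /(_ _ (adm0 N G (ltW m0)))] := TTP N3 p2 apN G (ltW m0) C0 (eu n).
  have F0 : FF (K (u (k n))) (fun=> 0) = 0.
    rewrite /FF (@eq_rint _ _ _ nu D (fun=> Phi 0) (fun=> 0)); last first.
      by move=> t _; rewrite (growth0 G).
    rewrite (@eq_rint _ _ _ nu D (fun t => f (K (u (k n)) t) * K (fun=> 0) t) (fun=> 0)); last first.
      by move=> t _; rewrite K0 mulr0.
    by rewrite Rintegral_cst// mul0r subrr.
  rewrite F0 => h2; apply: (critical_arith (PP_ge0 N p (K (v (k n)))) p0 _ h2).
  by rewrite mulr_ge0 ?dist2_ge0// divr_ge0// ltW.
by rewrite addr0 leNgt be0.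
Qed.

End CriticalPoint.

Lemma lagrange_arith {R : realType} (m F Fv L : R) : 0 < m ->
  (forall d, 0 < d -> 0 <= F - (L / m + d) * Fv) -> L / m * Fv <= F.
Proof.
move=> m0 H; apply/ler_addgt0Pr => e e0.
have d0 : 0 < e / (`|Fv| + 1) by rewrite divr_gt0// ltr_pwDr.
have := H _ d0; rewrite mulrDl => h.
have : - e <= e / (`|Fv| + 1) * Fv.
  have h1 : `|e / (`|Fv| + 1) * Fv| <= e.
    rewrite normrM (ger0_norm (ltW d0)) mulrAC ler_pdivrMr ?ltr_pwDr//.
    by rewrite ler_wpM2l ?(ltW e0)// lerDl.
  by move: h1; rewrite ler_norml => /andP[].
by move: h; move: (e / _ * Fv) (L / m * Fv) => x y h1 h2; lra.
Qed.

Lemma lagrange_sign {R : realType} (m F Fv L : R) : L / m * Fv <= F ->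
  - L / m * Fv <= - F -> F = - - (Fv / m) * L.
Proof.
rewrite opprK => h1 h2; apply/eqP; rewrite eq_le.
have -> : Fv / m * L = L / m * Fv by ring.
by rewrite h1 andbT; rewrite !mulNr lerN2 in h2.
Qed.

Lemma variation_arith {R : realType} (x y l0 l1 e : R) :
  x - l0 <= y - (l0 + e * l1) -> e * l1 <= y - x.
Proof. lra. Qed.

Lemma quad_decrease {R : realType} (M m e L B : R) : M <= m -> 0 <= B -> 0 < e ->
  e * (B + 1) <= - L -> M + (2 * e * L + e ^+ 2 * B) <= m.
Proof. by move=> Mm B0 e0 h; have := ler_wpM2l (ltW e0) h; nra. Qed.

Lemma ler_norm_sandwich {R : realType} (x y w : R) : - w <= x -> x <= y -> `|x| <= `|y| + `|w|.
Proof.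
move=> h1 h2; rewrite ler_norml; apply/andP; split.
  by apply: le_trans h1; rewrite lerN2; apply: (le_trans (ler_norm w)); rewrite lerDr.
by apply: (le_trans h2); apply: (le_trans (ler_norm y)); rewrite lerDl.
Qed.

(** * The radial equation *)

Section EulerLagrange.
Context {R : realType}.
Variable N : nat.
Hypothesis N3 : (3 <= N)%N.
Variables p : R.
Hypothesis p2 : 2 < p.
Local Notation nu := (@radial_measure R N).
Local Notation D := (@halfline R).
Local Notation a := (@half_exp R N).
Hypothesis apN : a * p < N%:R.
Local Notation f := (fp p).
Local Notation rig := (rintegrable nu D).
Local Notation II g := (\int[nu]_(t in D) g t)%R.
Local Notation K := (@K R N).
Local Notation L2 := (@L2 R N).
Local Notation nrm := (@nrm R N).
Local Notation Kc := (@Kcst R N N3).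
Variables (Phi beta : R -> R) (c th : R).
Hypothesis G : growth Phi beta c th.
Let mD := @measurable_halfline R.
Local Notation env := (@env R N).
Let c0 : 0 < c := growth_c G.

(** The directions of variation: a vector space, by the doubling property of Phi, and without the
    mass bound. *)
Definition dom (z : R -> R) : Prop :=
  [/\ L2 z, rig (fun t => Phi (z t)) & rig (fun t => K z t ^+ 2)].

Lemma Phi_dilate x z : Phi (x * z) <= Num.max 1 `|x| `^ th * Phi z.
Proof.
apply: le_trans (growth_scale G _ _); last by rewrite le_max lexx.
apply: (growth_mono G); rewrite !normrM ler_wpM2r//.
by rewrite (le_trans _ (ler_norm _))// le_max lexx orbT.
Qed.

Lemma dom_lin x y z w : dom z -> dom w -> dom (fun t => x * z t + y * w t).
Proof.
move=> [lz iz kz] [lw iw kw]; have ll := L2_lin x y lz lw.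
split; first exact: ll.
- apply: (rintegrable_le mD (g := fun t => 2 `^ th *
     (Num.max 1 `|x| `^ th * Phi (z t) + Num.max 1 `|y| `^ th * Phi (w t)))).
  + by apply: (measurable_growth G); case: ll.
  + by apply: rintegrableZ => //; apply: rintegrableD => //; exact: rintegrableZ.
  move=> t _; rewrite ger0_norm ?(Phi_nonneg G)//.
  apply: (le_trans (growth_add G _ _)); rewrite ler_wpM2l ?powR_ge0//.
  by rewrite lerD ?Phi_dilate.
have mz : measurable_fun D (fun t => x * K z t).
  by apply: measurable_funM => //; exact: measurable_K.
have mw : measurable_fun D (fun t => y * K w t).
  by apply: measurable_funM => //; exact: measurable_K.
have iz2 : rig (fun t => (x * K z t) ^+ 2).
  by apply: eq_rintegrable (rintegrableZ mD (x ^+ 2) kz) => // t _; rewrite exprMn.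
have iw2 : rig (fun t => (y * K w t) ^+ 2).
  by apply: eq_rintegrable (rintegrableZ mD (y ^+ 2) kw) => // t _; rewrite exprMn.
have [i _] := rint_sqrD_le mD mz mw iz2 iw2.
by apply: eq_rintegrable i => // t /halflineE t0; rewrite K_lin.
Qed.

Lemma domD e z w : dom z -> dom w -> dom (fun t => z t + e * w t).
Proof.
move=> dz dw; have := dom_lin 1 e dz dw.
by under eq_fun do rewrite mul1r.
Qed.

Lemma growth_convex e x z : 0 <= e -> e <= 1 ->
  Phi (x + e * z) - Phi x <= e * (Phi (x + z) - Phi x).
Proof.
move=> e0 e1; set y := x + e * z.
have t1 := growth_tangent G y x; have t2 := growth_tangent G y (x + z).
have q1 : 0 <= c / 2 * (x - y) ^+ 2 by rewrite mulr_ge0 ?sqr_ge0// divr_ge0// ltW.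
have q2 : 0 <= c / 2 * (x + z - y) ^+ 2 by rewrite mulr_ge0 ?sqr_ge0// divr_ge0// ltW.
have s1 : beta y * (- (e * z)) <= Phi x - Phi y.
  have : x - y = - (e * z) by rewrite /y; ring.
  by move: t1 q1; move: (x - y) => d ? ? <-; lra.
have s2 : beta y * ((1 - e) * z) <= Phi (x + z) - Phi y.
  have : x + z - y = (1 - e) * z by rewrite /y; ring.
  by move: t2 q2; move: (x + z - y) => d ? ? <-; lra.
have h1 : (1 - e) * (beta y * (- (e * z))) <= (1 - e) * (Phi x - Phi y).
  by rewrite ler_wpM2l// subr_ge0.
have h2 : e * (beta y * ((1 - e) * z)) <= e * (Phi (x + z) - Phi y).
  by rewrite ler_wpM2l.
have : (1 - e) * (beta y * (- (e * z))) + e * (beta y * ((1 - e) * z)) = 0 by ring.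
by move: h1 h2; nra.
Qed.

Lemma tangent1 x y : beta x * (y - x) <= Phi y - Phi x.
Proof.
have := growth_tangent G x y; have : 0 <= c / 2 * (y - x) ^+ 2.
  by rewrite mulr_ge0 ?sqr_ge0// divr_ge0// ltW.
lra.
Qed.

Lemma quotient_bounds x z e : 0 < e ->
  beta x * z <= (Phi (x + e * z) - Phi x) / e <= beta (x + e * z) * z.
Proof.
move=> e0; have t1 := tangent1 x (x + e * z); have t2 := tangent1 (x + e * z) x.
rewrite ler_pdivlMr// ler_pdivrMr//; apply/andP; split.
  by apply: le_trans t1; rewrite [_ + _ - x]addrAC subrr add0r [e * z]mulrC mulrA.
have e1 : x - (x + e * z) = - (z * e) by ring.
by rewrite e1 mulrN mulrA in t2; move: t2; rewrite -[X in _ <= X]opprB lerN2.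
Qed.

Lemma measurable_beta z : measurable_fun D z -> measurable_fun D (fun t => beta (z t)).
Proof.
by move=> mz; apply: measurableT_comp => //; apply: continuous_measurable_fun;
  exact: growth_beta_cont G.
Qed.

Definition eps (n : nat) : R := n.+1%:R^-1.

Let eps0 n : 0 < eps n. Proof. by rewrite invr_gt0 ltr0n. Qed.
Let eps1 n : eps n <= 1. Proof. by rewrite invf_le1 ?ltr0n// ler1n. Qed.

Lemma eps_small d : 0 < d -> exists M, forall n, (M <= n)%N -> eps n <= d.
Proof.
move=> d0; have /cvgrPdist_le/(_ _ d0) [M _ HM] := @cvg_harmonic R.
by exists M => n Mn; have := HM n Mn; rewrite sub0r normrN ger0_norm ?harmonic_ge0.
Qed.

(** By convexity the quotients lie between the tangent slope and the increment for a full step. The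
    increment in the opposite direction bounds the slope from below, which completes an integrable
    bound. *)
Lemma growth_derivative v z : dom v -> dom z ->
  rig (fun t => beta (v t) * z t) /\
  II (fun t => (Phi (v t + eps n * z t) - Phi (v t)) / eps n) @[n --> \oo] -->
  II (fun t => beta (v t) * z t).
Proof.
move=> dv dz; case: (dv) => lv iv _; case: (dz) => lz iz _.
have [_ ip _] := domD 1 dv dz; have [_ im _] := domD (- 1) dv dz.
have mv := lv.1; have mz := lz.1.
have lo x y : beta x * y <= Phi (x + 1 * y) - Phi x.
  by apply: le_trans (tangent1 x _); rewrite mul1r addrAC subrr add0r.
have lo' x y : - (Phi (x + -1 * y) - Phi x) <= beta x * y.
  rewrite lerNl; apply: le_trans (tangent1 x _).
  by rewrite mulN1r addrAC subrr add0r mulrN.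
pose g t := `|Phi (v t + 1 * z t) - Phi (v t)| + `|Phi (v t + -1 * z t) - Phi (v t)|.
have ig : rig g.
  by apply: rintegrableD => //; apply: rintegrable_norm; exact: rintegrableB.
apply: (rint_dct mD (g := g)).
- move=> n; apply: measurable_funM => //; apply: measurable_funB.
    apply: (measurable_growth G); apply: measurable_funD => //.
    exact: measurable_funM.
  exact: (measurable_growth G).
- by apply: measurable_funM => //; exact: measurable_beta.
- exact: ig.
- move=> n t _; have e0 := eps0 n.
  have u1 : (Phi (v t + eps n * z t) - Phi (v t)) / eps n <= Phi (v t + 1 * z t) - Phi (v t).
    by rewrite ler_pdivrMr// mul1r [leRHS]mulrC; exact: growth_convex (ltW e0) (eps1 n).
  have /andP[l1 _] := quotient_bounds (v t) (z t) e0.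
  exact: ler_norm_sandwich (le_trans (lo' (v t) (z t)) l1) u1.
apply: aeW => t _.
apply: (@squeeze_cvgr _ _ _ _ (fun n => beta (v t) * z t) (fun n => beta (v t + eps n * z t) * z t)).
- by apply: nearW => n; exact: quotient_bounds.
- exact: cvg_cst.
apply: cvgM; last exact: cvg_cst.
have h : v t + eps n * z t @[n --> \oo] --> v t.
  rewrite -[X in _ --> X]addr0 -[X in _ --> _ + X](mul0r (z t)).
  by apply: cvgD; [exact: cvg_cst|apply: cvgM; [exact: cvg_harmonic|exact: cvg_cst]].
exact: (cvg_comp _ _ h (@growth_beta_cont _ _ _ _ _ G (v t))).
Qed.

Lemma dom_env z m1 : dom z -> II (fun t => K z t ^+ 2) <= m1 -> 0 <= Kc * nrm z /\ env (Kc * nrm z) m1 (K z).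
Proof. by move=> [lz iz kz] hm; apply: (Kz_env N3 (Phi := Phi)). Qed.

Lemma dom_pair z w : dom z -> dom w ->
  rig (fun t => f (K z t) * K w t) /\ rig (fun t => K z t * K w t).
Proof.
move=> dz dw; set m1 := Num.max (II (fun t => K z t ^+ 2)) (II (fun t => K w t ^+ 2)).
have [C1 e1] : 0 <= Kc * nrm z /\ env (Kc * nrm z) m1 (K z).
  by apply: (dom_env dz); rewrite le_max lexx.
have [C2 e2] : 0 <= Kc * nrm w /\ env (Kc * nrm w) m1 (K w).
  by apply: (dom_env dw); rewrite le_max lexx orbT.
split; first by have [] := env_prod N3 p2 apN C1 C2 e1 e2.
by case: e1 => ? _ ? _; case: e2 => ? _ ? _; apply: rint_sqr_norm_le.
Qed.

Variables (m : R) (v : R -> R).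
Hypothesis m0 : 0 < m.
Hypothesis vmin : is_min N p Phi c m (K v) v.
Local Notation u := (K v).

Lemma min_dom : dom v. Proof. by case: vmin => -[]. Qed.

Definition mass : R := II (fun t => u t ^+ 2).
Definition Lv (z : R -> R) : R := II (fun t => u t * K z t).
Definition Fv (z : R -> R) : R :=
  II (fun t => beta (v t) * z t) - II (fun t => f (u t) * K z t).

(** One-sided, since only directions pointing into the mass ball are allowed. *)
Lemma variation z : dom z -> (exists M, forall n, (M <= n)%N ->
    II (fun t => K (fun t => v t + eps n * z t) t ^+ 2) <= m) -> 0 <= Fv z.
Proof.
move=> dz [M HM]; have dv := min_dom; have [_ cvg_d] := growth_derivative dv dz.
have [_ iv _] := dv; have [i1 _] := dom_pair dv dz; have [i2 _] := dom_pair dv dv.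
rewrite subr_ge0.
have cvs := cvg_d; rewrite -(cvg_shiftn M) in cvs.
apply: (seq_lim_ge _ cvs) => n; set e := eps (n + M).
have e0 : 0 < e by exact: eps0.
have dn := domD e dv dz; have [_ iPn _] := dn.
have an : adm N Phi m (fun t => v t + e * z t).
  by case: dn => *; split => //; apply: HM; exact: leq_addl.
have [_ /(_ _ an) hm] := vmin.
have {}hm : FF N p Phi u v <= FF N p Phi u (fun t => v t + e * z t).
  by apply: le_trans hm; rewrite lerDl mulr_ge0 ?dist2_ge0// divr_ge0// ltW.
rewrite /FF in hm.
have lz : L2 z by case: dz. have lv : L2 v by case: dv.
have E1 : II (fun t => f (u t) * K (fun t => v t + e * z t) t) =
    II (fun t => f (u t) * u t) + e * II (fun t => f (u t) * K z t).
  rewrite -(RintegralZl _ mD i1) -RintegralD//; last exact: rintegrableZ.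
  apply: eq_rint => t /halflineE t0.
  have -> : (fun t => v t + e * z t) = (fun t => 1 * v t + e * z t).
    by apply/funext => s; rewrite mul1r.
  by rewrite K_lin//; ring.
have E2 : II (fun t => (Phi (v t + e * z t) - Phi (v t)) / e) =
    (II (fun t => Phi (v t + e * z t)) - II (fun t => Phi (v t))) / e.
  rewrite -RintegralB// mulrC -(RintegralZl _ mD); last exact: rintegrableB.
  by apply: eq_rint => t _; rewrite mulrC.
rewrite E1 in hm; rewrite E2 ler_pdivlMr// mulrC.
exact: variation_arith hm.
Qed.

Lemma mass_expand z e : dom z -> II (fun t => K (fun t => v t + e * z t) t ^+ 2) =
  mass + (2 * e * Lv z + e ^+ 2 * II (fun t => K z t ^+ 2)).
Proof.
move=> dz; have dv := min_dom; have [_ i1] := dom_pair dv dz.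
case: dv => lv _ kv; case: dz => lz _ kz.
rewrite /mass /Lv -(RintegralZl _ mD i1) -(RintegralZl _ mD kz).
have i2 := rintegrableZ mD (2 * e) i1; have i3 := rintegrableZ mD (e ^+ 2) kz.
rewrite -RintegralD// -RintegralD//; last exact: rintegrableD.
apply: eq_rint => t /halflineE t0.
have -> : (fun t => v t + e * z t) = (fun t => 1 * v t + e * z t).
  by apply/funext => s; rewrite mul1r.
by rewrite K_lin//; ring.
Qed.

Let small_quad (A B d : R) : 0 <= B -> 0 < d ->
  exists M, forall n, (M <= n)%N -> `|2 * eps n * A + eps n ^+ 2 * B| <= d.
Proof.
move=> B0 d0; pose S := 2 * `|A| + B + 1.
have S0 : 0 < S by rewrite ltr_pwDr// addr_ge0// mulr_ge0.
have [M HM] := eps_small (divr_gt0 d0 S0).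
exists M => n Mn; have := HM n Mn; have e0 := eps0 n; have e1 := eps1 n.
rewrite ler_pdivlMr// /S; apply: le_trans.
apply: (le_trans (ler_normD _ _)); rewrite normrM [`|2 * eps n|]ger0_norm; last first.
  by rewrite mulr_ge0// ltW.
have q0 : 0 <= eps n ^+ 2 * B by rewrite mulr_ge0// sqr_ge0.
rewrite (ger0_norm q0).
have : eps n ^+ 2 * B <= eps n * B by rewrite ler_wpM2r// expr2 ler_piMl// ltW.
by move: (eps n ^+ 2 * B) => q hq; nra.
Qed.

Lemma variation_slack z : dom z -> mass < m -> 0 <= Fv z.
Proof.
move=> dz hm; apply: variation => //.
have B0 : 0 <= II (fun t => K z t ^+ 2) by apply: Rintegral_ge0 => t _; exact: sqr_ge0.
have d0 : 0 < m - mass by rewrite subr_gt0.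
have [M HM] := small_quad (Lv z) B0 d0.
exists M => n Mn; rewrite mass_expand// -lerBrDl.
exact: le_trans (ler_norm _) (HM n Mn).
Qed.

(** A negative first-order change of the mass outweighs the second-order one for short steps. *)
Lemma variation_neg z : dom z -> Lv z < 0 -> 0 <= Fv z.
Proof.
move=> dz hL; apply: variation => //.
set B := II (fun t => K z t ^+ 2).
have B0 : 0 <= B by apply: Rintegral_ge0 => t _; exact: sqr_ge0.
have q0 : 0 < - Lv z / (B + 1) by rewrite divr_gt0 ?oppr_gt0// ltr_pwDr.
have [M HM] := eps_small q0.
have mm : mass <= m by case: vmin => -[].
exists M => n Mn; have := HM n Mn; have B1 : 0 < B + 1 by rewrite ltr_pwDr.
rewrite (ler_pdivlMr _ _ B1) => h.
rewrite mass_expand// -/B; exact: quad_decrease.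
Qed.

Lemma Fv_lin x y z w : dom z -> dom w ->
  Fv (fun t => x * z t + y * w t) = x * Fv z + y * Fv w.
Proof.
move=> dz dw; have dv := min_dom.
have [i1 _] := growth_derivative dv dz; have [i2 _] := growth_derivative dv dw.
have [j1 _] := dom_pair dv dz; have [j2 _] := dom_pair dv dw.
case: dz => lz _ _; case: dw => lw _ _.
have E1 : II (fun t => beta (v t) * (x * z t + y * w t)) =
    x * II (fun t => beta (v t) * z t) + y * II (fun t => beta (v t) * w t).
  rewrite -(RintegralZl _ mD i1) -(RintegralZl _ mD i2) -RintegralD//; [|exact: rintegrableZ..].
  by apply: eq_rint => t _; ring.
have E2 : II (fun t => f (u t) * K (fun t => x * z t + y * w t) t) =
    x * II (fun t => f (u t) * K z t) + y * II (fun t => f (u t) * K w t).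
  rewrite -(RintegralZl _ mD j1) -(RintegralZl _ mD j2) -RintegralD//; [|exact: rintegrableZ..].
  by apply: eq_rint => t /halflineE t0; rewrite K_lin//; ring.
by rewrite /Fv E1 E2; move: (Rintegral _ _ _) (Rintegral _ _ _) (Rintegral _ _ _) (Rintegral _ _ _) => *; ring.
Qed.

Lemma Lv_lin x y z w : dom z -> dom w ->
  Lv (fun t => x * z t + y * w t) = x * Lv z + y * Lv w.
Proof.
move=> dz dw; have dv := min_dom.
have [_ j1] := dom_pair dv dz; have [_ j2] := dom_pair dv dw.
case: dz => lz _ _; case: dw => lw _ _.
rewrite /Lv -(RintegralZl _ mD j1) -(RintegralZl _ mD j2) -RintegralD//; [|exact: rintegrableZ..].
by apply: eq_rint => t /halflineE t0; rewrite K_lin//; ring.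
Qed.

Lemma Lv_self : Lv v = mass.
Proof. by apply: eq_rint => t _; rewrite expr2. Qed.

(** If the constraint is active, correcting an arbitrary direction by a multiple of [v] makes it
    decrease the mass. The inequality obtained for z and for -z is an equality. *)
Lemma euler_lagrange_weak : exists lam, (mass < m -> lam = 0) /\
  forall z, dom z -> Fv z = - lam * Lv z.
Proof.
have dv := min_dom.
have negD z : dom z -> dom (fun t => -1 * z t + 0 * z t) by move=> dz; exact: dom_lin.
have FN z : dom z -> Fv (fun t => -1 * z t + 0 * z t) = - Fv z.
  by move=> dz; rewrite Fv_lin// mul0r addr0 mulN1r.
have LN z : dom z -> Lv (fun t => -1 * z t + 0 * z t) = - Lv z.
  by move=> dz; rewrite Lv_lin// mul0r addr0 mulN1r.
have [hm|hm] := ltP mass m.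
  exists 0; split => // z dz; rewrite oppr0 mul0r; apply/eqP; rewrite eq_le.
  rewrite (variation_slack dz hm) andbT.
  by have := variation_slack (negD z dz) hm; rewrite FN// oppr_ge0.
have mE : mass = m by apply/eqP; rewrite eq_le hm andbT; case: vmin => -[].
have half z : dom z -> Lv z / m * Fv v <= Fv z.
  move=> dz; apply: lagrange_arith => // d d0.
  (* Since Lv v = m, this direction changes the mass at first order by -d m < 0; d then tends to
     0. *)
  have := @variation_neg (fun t => 1 * z t + - (Lv z / m + d) * v t) (dom_lin _ _ dz dv).
  rewrite Lv_lin// Fv_lin// !mul1r Lv_self mE !mulNr; apply.
  rewrite mulrDl divfK ?gt_eqF// opprD addrA subrr sub0r oppr_lt0.
  exact: mulr_gt0.
exists (- (Fv v / m)); split; first by [].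
move=> z dz; have h1 := half z dz; have := half _ (negD z dz); rewrite FN// LN//.
exact: lagrange_sign.
Qed.

End EulerLagrange.

(** * Fubini on a triangle and derivatives of radial primitives *)

Section TriangleFubini.
Context {R : realType}.
Variable mu : {sigma_finite_measure set (measurableTypeR R) -> \bar R}.

Lemma rint_fubini_triangle (g z : measurableTypeR R -> R) :
  rintegrable mu setT g -> rintegrable mu setT z ->
  \int[mu]_r (g r * \int[mu]_(t in `]r, +oo[) z t) =
  \int[mu]_t (z t * \int[mu]_(r in `]-oo, t[) g r).
Proof.
move=> ig iz.
have mg := rintegrable_measurable ig; have mz := rintegrable_measurable iz.
pose pos : measurableTypeR R -> R := \1_(`]0, +oo[%classic : set R).
pose F (q : measurableTypeR R * measurableTypeR R) : R := g q.1 * z q.2 * pos (q.2 - q.1).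
have pos01 x : 0 <= pos x <= 1 by rewrite /pos indicE; case: (_ \in _); rewrite ?lexx ?ler01.
have mF : measurable_fun setT F.
  apply: measurable_funM.
    by apply: measurable_funM; apply: measurableT_comp.
  apply: (measurableT_comp (f := pos)); first exact: measurable_indic.
  exact: measurable_funB.
have ray r t : pos (t - r) = \1_(`]r, +oo[%classic : set R) t.
  by rewrite /pos !indicE !mem_setE !in_itv/= !andbT subr_gt0.
have low r t : pos (t - r) = \1_(`]-oo, t[%classic : set R) r.
  by rewrite /pos !indicE !mem_setE !in_itv/= !andbT subr_gt0.
pose C := \int[mu]_t `|z t|.
have iF : (mu \x mu)%E.-integrable setT (EFin \o F).
  apply/integrable12ltyP; first exact/measurable_EFinP.
  apply: (@le_lt_trans _ _ (\int[mu]_r (C * `|g r|)%:E)%E); last first.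
    have /integrableP[_] := rintegrableZ measurableT C (rintegrable_norm ig).
    apply: le_lt_trans; apply: ge0_le_integral => //.
    - by move=> r _; rewrite lee_fin mulr_ge0//; apply: Rintegral_ge0 => t _.
    - by apply/measurable_EFinP; apply: measurable_funM => //; exact: measurableT_comp.
    - apply/measurable_EFinP; apply: measurableT_comp => //.
      by apply: measurable_funM => //; exact: measurableT_comp.
    - by move=> r _; rewrite lee_fin ler_norm.
  apply: ge0_le_integral => //.
  - by move=> r _; apply: integral_ge0.
  - apply: (@measurable_fun_fubini_tonelli_F _ _ _ _ _ mu (fun q => `|(F q)%:E|%E)) => //.
    by apply: measurableT_comp => //; exact/measurable_EFinP.
  - by apply/measurable_EFinP; apply: measurable_funM => //; exact: measurableT_comp.
  move=> r _.
  have iz' := rintegrableZ measurableT `|g r| (rintegrable_norm iz).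
  rewrite mulrC -(RintegralZl _ measurableT (rintegrable_norm iz)) -(rint_lim measurableT iz').
  apply: ge0_le_integral => //.
  - apply: measurableT_comp => //; apply/measurable_EFinP.
    by apply: (measurableT_comp mF); exact: measurable_pair1.
  - by apply/measurable_EFinP; apply: measurable_funM => //; exact: measurableT_comp.
  move=> t _; rewrite /= lee_fin /F/= !normrM; have /andP[h0 h1] := pos01 (t - r).
  by rewrite (ger0_norm h0) -[X in _ <= X]mulr1 ler_wpM2l// mulr_ge0.
have E1 r : (\int[mu]_t (F (r, t))%:E = (g r * \int[mu]_(t in `]r, +oo[) z t)%:E)%E.
  have mI : measurable (`]r, +oo[%classic : set (measurableTypeR R)) by exact: measurable_itv.
  have izr : rintegrable mu `]r, +oo[ z by apply: integrableS iz.
  rewrite Rintegral_mkcond -(RintegralZl _ measurableT); last first.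
    by have := (integrable_mkcond (EFin \o z) mI).1 izr; apply: eq_integrable => // t _;
      rewrite /= !patchE; case: ifP.
  have izr' : rintegrable mu setT (z \_ `]r, +oo[).
    by have := (integrable_mkcond (EFin \o z) mI).1 izr; apply: eq_integrable => // t _;
      rewrite /= !patchE; case: ifP.
  rewrite -(rint_lim measurableT); last exact: rintegrableZ.
  apply: eq_integral => t _; rewrite /F/= ray indicE patchE.
  by case: (t \in _); rewrite ?mulr1 ?mulr0.
have E2 t : (\int[mu]_r (F (r, t))%:E = (z t * \int[mu]_(r in `]-oo, t[) g r)%:E)%E.
  have mI : measurable (`]-oo, t[%classic : set (measurableTypeR R)) by exact: measurable_itv.
  have igr : rintegrable mu `]-oo, t[ g by apply: integrableS ig.
  have igr' : rintegrable mu setT (g \_ `]-oo, t[).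
    by have := (integrable_mkcond (EFin \o g) mI).1 igr; apply: eq_integrable => // r _;
      rewrite /= !patchE; case: ifP.
  rewrite Rintegral_mkcond -(RintegralZl _ measurableT igr') -(rint_lim measurableT); last exact: rintegrableZ.
  apply: eq_integral => r _; rewrite /F/= low indicE patchE.
  by case: (r \in _); rewrite ?mulr1 ?mulr0// mulrC.
have := Fubini iF; rewrite /= => FE; congr fine.
under eq_integral => r _ do rewrite -E1; rewrite FE.
by apply: eq_integral => t _; exact: E2.
Qed.

End TriangleFubini.

Lemma powR_continuous_at {R : realType} (e r : R) : 0 < r ->
  {for r, continuous (fun x : R => x `^ e)}.
Proof.
move=> r0; apply: differentiable_continuous; apply/derivable1_diffP.
by apply: derivable_powR; rewrite in_itv/= andbT.
Qed.

Section RadialDerivative.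
Context {R : realType}.
Variable N : nat.
Hypothesis N3 : (3 <= N)%N.
Let N0 : (0 < N)%N. Proof. exact: leq_trans N3. Qed.
Local Notation nu := (@radial_measure R N).
Local Notation D := (@halfline R).
Local Notation cb := (@ball_vol R N).
Let mD := @measurable_halfline R.
Let moc (s t : R) : measurable (`]s, t]%classic : set (measurableTypeR R)).
Proof. exact: measurable_itv. Qed.

Lemma rint_oc_cst (x y k : R) : 0 <= x -> x <= y ->
  rintegrable nu `]x, y] (fun=> k) /\
  \int[nu]_(t in `]x, y]) k = k * (cb * (y ^+ N - x ^+ N)).
Proof.
move=> x0 xy.
have E : nu `]x, y]%classic = (cb * (y ^+ N - x ^+ N))%:E by rewrite radial_oc.
split; last by rewrite Rintegral_cst//; congr (_ * _); rewrite [X in fine X]E.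
apply: measurable_bounded_integrable => //.
- by have : (nu `]x, y]%classic < +oo)%E by rewrite E ltry.
- by exists `|k|; split; rewrite ?num_real// => z kz t _; exact: ltW.
Qed.

Lemma radial_pt (t : R) : 0 < t -> nu [set t] = 0%E.
Proof.
move=> t0; apply/eqP; rewrite eq_le measure_ge0 andbT.
apply/lee_addgt0Pr => e e0; rewrite add0e.
have cc : {for t, continuous (fun x : R => cb * (t ^+ N - x ^+ N))}.
  apply: cvgM; first exact: cvg_cst.
  by apply: cvgB; [exact: cvg_cst|exact: exprn_continuous].
have /nbhs_ballP[d d0 hd] : \forall x \near t, cb * (t ^+ N - x ^+ N) <= e.
  have /cvgrPdist_le/(_ _ e0) := cc; apply: filterS => x.
  by rewrite subrr mulr0 sub0r normrN => h; exact: le_trans (ler_norm _) h.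
pose s := Num.max (t / 2) (t - d / 2).
have s0 : 0 < s by rewrite lt_max divr_gt0.
have st : s < t.
  by rewrite gt_max ltrBlDr ltrDl divr_gt0// andbT ltr_pdivrMr// ltr_pMr// ltr1n.
apply: (@le_trans _ _ (nu `]s, t]%classic)).
  apply: le_measure; rewrite ?inE; [exact: measurable_set1|exact: moc|].
  by move=> _ ->; rewrite /= in_itv/= st lexx.
rewrite radial_oc ?(ltW s0) ?(ltW st)// lee_fin; apply: hd.
rewrite /ball/= ger0_norm ?subr_ge0 ?(ltW st)// ltrBlDr -ltrBlDl.
by rewrite lt_max; apply/orP; right; rewrite ltrD2l ltrN2 gtr_pMr// invf_lt1// ltr1n.
Qed.

(** The fundamental theorem of calculus against nu. Increments of F are compared with those of phi =
    c r^N, whose derivative is explicit; the Caratheodory form of differentiability transfers it. *)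
Lemma derive_nu (g F : R -> R) (r : R) : 0 < r ->
  (forall x y, 0 < x -> x <= y -> rintegrable nu `]x, y] g) ->
  (forall x y, 0 < x -> x <= y -> F y - F x = \int[nu]_(t in `]x, y]) g t) ->
  {for r, continuous g} -> is_derive r 1 F (g r * (cb * N%:R * r ^+ N.-1)).
Proof.
move=> r0 ig FE cg.
pose phi (x : R) := cb * x ^+ N.
have dphi : is_derive r 1 phi (cb * N%:R * r ^+ N.-1).
  have h : is_derive r 1 (fun x : R => x ^+ N) (N%:R * r ^+ N.-1).
    by apply: DeriveDef; [exact: exprn_derivable|rewrite exp_derive /GRing.scale/= mulr1].
  by have := is_deriveZ cb h; rewrite /GRing.scale/= mulrA.
have /is_derive1_caratheodory[q [qE qc qr]] := dphi.
have inc x y : 0 < x -> x < y -> phi x < phi y.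
  move=> x0 xy; rewrite /phi ltr_pM2l ?ball_vol_gt0//.
  by rewrite ltr_pXn2r -?lt0n// nnegrE ltW// (lt_trans x0).
have key e : 0 < e -> \forall y \near r, `|F y - F r - g r * (phi y - phi r)| <= e * `|phi y - phi r|.
  move=> e0; have /cvgrPdist_le/(_ _ e0)/nbhs_ballP[d d0 hd] := cg.
  have loc x y : 0 < x -> x <= y -> (forall t, x < t <= y -> `|r - t| < d) ->
      `|F y - F x - g r * (phi y - phi x)| <= e * (phi y - phi x).
    move=> x0 xy hl; have [i1 E1] := rint_oc_cst (g r) (ltW x0) xy.
    have [i2 E2] := rint_oc_cst e (ltW x0) xy.
    rewrite (FE _ _ x0 xy) /phi -mulrBr -E1 -E2 -RintegralB//; last exact: ig.
    apply: le_trans (le_normr_Rintegral _ _) _; [exact: moc| |].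
      apply: (rintegrableB (moc x y) _ i1); exact: ig.
    apply: (rint_le_sub (moc x y) _ i2).
      by apply: rintegrable_norm; apply: (rintegrableB (moc x y) _ i1); exact: ig.
    by move=> t; rewrite /= in_itv/= => h; rewrite distrC; apply: hd; exact: hl.
  near=> y.
  have yd : `|r - y| < d by near: y; apply/nbhs_ballP; exists d.
  have y0 : 0 < y.
    near: y; apply/nbhs_ballP; exists r => // y; rewrite /ball/= ltr_norml => /andP[_]; lra.
  have [ry|yr] := leP r y.
    rewrite [X in _ <= _ * X]ger0_norm; last first.
      by rewrite subr_ge0; move: ry; rewrite le_eqVlt => /predU1P[->//|ry]; apply: ltW; exact: inc.
    apply: loc => // t /andP[rt ty]; apply: le_lt_trans yd.
    rewrite !ler0_norm ?subr_le0//; last exact: ltW.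
    by rewrite lerN2 lerB.
  rewrite -normrN.
  have -> : - (F y - F r - g r * (phi y - phi r)) = F r - F y - g r * (phi r - phi y) by ring.
  rewrite [`|phi y - _|]distrC [`|phi r - phi y|]ger0_norm; last by rewrite subr_ge0 ltW// inc.
  apply: loc => //; first exact: ltW.
  move=> t /andP[yt tr]; apply: le_lt_trans yd.
  rewrite !ger0_norm ?subr_ge0//; last exact: ltW.
  by rewrite lerB// ltW.
apply/is_derive1_caratheodory.
pose h z := if z == r then g r * (cb * N%:R * r ^+ N.-1) else (F z - F r) / (z - r).
have hr : h r = g r * q r by rewrite /h eqxx qr.
exists h; split.
- by move=> z; rewrite /h; case: eqP => [->|/eqP zr]; rewrite ?subrr ?mulr0// divfK// subr_eq0.
- suff : h z @[z --> r] --> h r by [].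
  rewrite hr; apply/cvgrPdist_le => e e0.
  have qb : \forall z \near r, `|q r - q z| <= 1.
    by have /cvgrPdist_le/(_ _ ltr01) := qc.
  pose A := `|q r| + 1 + `|g r|.
  have A0 : 0 < A by rewrite ltr_wpDr// ltr_pwDr.
  have eA : 0 < e / (2 * A) by rewrite divr_gt0// mulr_gt0.
  have qe : \forall z \near r, `|q r - q z| <= e / (2 * A).
    by have /cvgrPdist_le/(_ _ eA) := qc.
  near=> z; rewrite /h; case: eqP => [_|/eqP zr].
    by rewrite -qr subrr normr0 ltW.
  have zr0 : z - r != 0 by rewrite subr_eq0.
  have : `|F z - F r - g r * (phi z - phi r)| <= e / (2 * A) * `|phi z - phi r|.
    by near: z; exact: key.
  rewrite qE; have -> : F z - F r - g r * (q z * (z - r)) = ((F z - F r) / (z - r) - g r * q z) * (z - r).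
    by field.
  rewrite !normrM mulrA ler_pM2r ?normr_gt0// => h1.
  have h2 : `|q r - q z| <= e / (2 * A) by near: z.
  have h3 : `|q r - q z| <= 1 by near: z.
  have h4 : `|q z| <= `|q r| + 1.
    have -> : q z = q r - (q r - q z) by ring.
    by apply: (le_trans (ler_normB _ _)); rewrite lerD2l.
  have -> : g r * q r - (F z - F r) / (z - r) =
      g r * (q r - q z) - ((F z - F r) / (z - r) - g r * q z) by ring.
  apply: (le_trans (ler_normB _ _)); rewrite normrM.
  apply: (@le_trans _ _ (`|g r| * (e / (2 * A)) + e / (2 * A) * (`|q r| + 1))).
    by apply: lerD; [rewrite ler_wpM2l|apply: (le_trans h1); rewrite ler_wpM2l// ltW].
  have -> : `|g r| * (e / (2 * A)) + e / (2 * A) * (`|q r| + 1) = e / 2.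
    by rewrite /A; field; move: A0; rewrite /A lt0r => /andP[].
  by rewrite ler_pdivrMr// ler_pMr// ler1n.
- by rewrite /h eqxx.
Unshelve. all: by end_near. Qed.

Section LowerPrimitive.
Variable g : R -> R.
Hypothesis ig : forall d, 0 < d -> rintegrable nu `]0, d] g.

Definition lowprim (t : R) : R := \int[nu]_(r in `]0, t]) g r.

Lemma lowprim_integrable x y : 0 < x -> x <= y -> rintegrable nu `]x, y] g.
Proof.
move=> x0 xy; apply: (rintS (moc x y) (moc 0 y) _ (ig (lt_le_trans x0 xy))).
by move=> t; rewrite /= !in_itv/= => /andP[xt ->]; rewrite (lt_trans x0).
Qed.

Lemma lowprim_diff x y : 0 < x -> x <= y ->
  lowprim y - lowprim x = \int[nu]_(t in `]x, y]) g t.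
Proof.
move=> x0 xy.
have E : `]0, y]%classic = `]0, x]%classic `|` `]x, y]%classic :> set R.
  apply/seteqP; split => t /=; rewrite !in_itv/=.
    by move=> /andP[-> ->]; case: (leP t x) => _; [left|right].
  case=> /andP[h1 h2]; first by rewrite h1 (le_trans h2).
  by rewrite h2 andbT (lt_trans x0).
rewrite /lowprim E Rintegral_setU//; first by ring.
- by rewrite -E; apply: ig; exact: lt_le_trans xy.
rewrite disj_set2E; apply/eqP/seteqP; split => // t /=.
by rewrite !in_itv/= => -[/andP[_ ts]]; rewrite ltNge ts.
Qed.

(** Exchanging the integrals on the triangle leaves an open interval; points are null sets. *)
Lemma lowprim_open t : 0 < t -> \int[nu]_(r in `]0, t[) g r = lowprim t.
Proof.
move=> t0; have mo : measurable (`]0, t[%classic : set (measurableTypeR R)) by exact: measurable_itv.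
have m1 : measurable ([set t] : set (measurableTypeR R)) by exact: measurable_set1.
have E : `]0, t]%classic = `]0, t[%classic `|` [set t] :> set R.
  apply/seteqP; split => x /=; rewrite !in_itv/=.
    by move=> /andP[-> ]; rewrite le_eqVlt => /predU1P[->|->]; [right|left].
  by case=> [/andP[-> /ltW]//|->]; rewrite t0 lexx.
have it : rintegrable nu [set t] g.
  by apply: (rintS m1 (moc 0 t) _ (ig t0)) => _ ->; rewrite /= in_itv/= t0 lexx.
rewrite /lowprim E Rintegral_setU//.
- suff -> : \int[nu]_(r in [set t]) g r = 0 by rewrite addr0.
  rewrite /Rintegral (null_set_integral m1 _ (radial_pt t0))//.
  by apply/measurable_EFinP; exact: rintegrable_measurable it.
- by rewrite -E; exact: ig.
rewrite disj_set2E; apply/eqP/seteqP; split => // x /=.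
by rewrite in_itv/= => -[/andP[_ xt] xE]; rewrite xE ltxx in xt.
Qed.

Lemma lowprim_derive t : 0 < t -> {for t, continuous g} ->
  is_derive t 1 lowprim (g t * (cb * N%:R * t ^+ N.-1)).
Proof.
by move=> t0 cg; apply: derive_nu => //; [exact: lowprim_integrable|exact: lowprim_diff].
Qed.

End LowerPrimitive.

Lemma kapE r : 0 < r -> kap N r * (cb * N%:R * r ^+ N.-1) = 1.
Proof.
move=> r0; rewrite /kap.
have -> : (N%:R - 1 : R) = N.-1%:R by rewrite -[in LHS](prednK N0) -natr1 addrK.
rewrite powRN powR_mulrn ?ltW// mulrACA !mulVf ?mulr1//.
  by rewrite expf_neq0// gt_eqF.
by rewrite gt_eqF// cN_gt0.
Qed.

Lemma K_derive (z : R -> R) (r : R) : L2 N z -> 0 < r -> {for r, continuous z} -> is_derive r 1 (K N z) (z r).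
Proof.
move=> lz r0 cz.
have ck : {for r, continuous (kap N : R -> R)}.
  by apply: cvgM; [exact: cvg_cst|exact: powR_continuous_at].
have := @derive_nu (fun t => z t * kap N t) (K N z) r r0.
rewrite -mulrA kapE// mulr1; apply.
- move=> x y x0 xy; apply: (rintS (moc x y) _ _ (K_integrable N3 lz x0)).
    exact: measurable_itv.
  by move=> t; rewrite /= !in_itv/= => /andP[->].
- by move=> x y x0 xy; exact: K_diff.
- exact: cvgM.
Qed.

End RadialDerivative.

(** * The pointwise radial equation *)

Section PointwiseEL.
Context {R : realType}.
Variable N : nat.
Hypothesis N3 : (3 <= N)%N.
Variables p : R.
Hypothesis p2 : 2 < p.
Local Notation nu := (@radial_measure R N).
Local Notation D := (@halfline R).
Local Notation a := (@half_exp R N).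
Hypothesis apN : a * p < N%:R.
Local Notation f := (fp p).
Local Notation rig := (rintegrable nu D).
Local Notation II g := (\int[nu]_(t in D) g t)%R.
Local Notation K := (@K R N).
Local Notation L2 := (@L2 R N).
Variables (Phi beta : R -> R) (c th : R).
Hypothesis G : growth Phi beta c th.
Let mD := @measurable_halfline R.
Variables (m : R) (v : R -> R) (lam : R).
Hypothesis m0 : 0 < m.
Hypothesis av : adm N Phi m v.
Local Notation u := (K v).
Let moc (s t : R) : measurable (`]s, t]%classic : set (measurableTypeR R)).
Proof. exact: measurable_itv. Qed.

Definition src (r : R) : R := f (u r) - lam * u r.

Lemma powR_le1p (x s : R) : 0 <= x -> 0 <= s -> s <= p -> x `^ s <= 1 + x `^ p.
Proof.
move=> x0 s0 sp; have [x1|x1] := leP x 1.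
  apply: (@le_trans _ _ 1); last by rewrite lerDl powR_ge0.
  have e1 : (1 : R) `^ s = 1 by rewrite powR1.
  by rewrite -[X in _ <= X]e1; apply: ge0_ler_powR; rewrite ?nnegrE.
by apply: (@le_trans _ _ (x `^ p)); [apply: ler_powR => //; exact: ltW|rewrite lerDr].
Qed.

Lemma src_low (d : R) : 0 < d -> rintegrable nu `]0, d] src.
Proof.
move=> d0; have iP := adm_PP N3 p2 apN av.
have lv : L2 v by case: av.
have mu_ : measurable_fun D u by exact: measurable_K.
have [i1 _] := rint_oc_cst N3 1 (lexx 0) (ltW d0).
have ip : rintegrable nu `]0, d] (fun t => `|u t| `^ p).
  by apply: rintS iP => //; exact: low_sub.
apply: (rintegrable_le (moc 0 d) (g := fun t => (1 + `|lam|) * (1 + `|u t| `^ p))).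
- apply: (measurable_funS mD (@low_sub R d)); apply: measurable_funB.
    by apply: measurable_fp.
  exact: measurable_funM.
- by apply: rintegrableZ => //; apply: rintegrableD.
move=> t _; apply: (le_trans (ler_normB _ _)); rewrite fp_norm// normrM mulrDl mul1r.
apply: lerD; first by have hp := p2; apply: powR_le1p => //; lra.
by have hp := p2; rewrite ler_wpM2l// -[X in X <= _](powRr1 (normr_ge0 _)) powR_le1p//; lra.
Qed.

Lemma src_continuous (t : R) : 0 < t -> {for t, continuous src}.
Proof.
move=> t0; have lv : L2 v by case: av.
have cu : u s @[s --> t] --> u t by exact: K_continuous.
apply: cvgB; first exact: (cvg_comp _ _ cu (fp_continuous p2 (x := u t))).
by apply: cvgM => //; exact: cvg_cst.
Qed.

Local Notation H := (lowprim N src).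

Lemma H_derive (t : R) : 0 < t -> is_derive t 1 H (src t * (ball_vol N * N%:R * t ^+ N.-1)).
Proof. by move=> t0; apply: lowprim_derive => //; [exact: src_low|exact: src_continuous]. Qed.

Lemma H_continuous (t : R) : 0 < t -> {for t, continuous H}.
Proof.
move=> t0; have dH := H_derive t0.
by apply: differentiable_continuous; apply/derivable1_diffP; case: dH.
Qed.

Lemma measurable_H : measurable_fun D H.
Proof.
apply: open_continuous_measurable_fun; first exact: interval_open.
by move=> r; rewrite inE => /halflineE r0; exact: H_continuous.
Qed.

(** Exhausts the half-line by intervals away from 0 and infinity, on which [kap] and the lower
    primitive are bounded. *)
Let window (n : nat) : set (measurableTypeR R) := `]n.+1%:R^-1, n.+1%:R]%classic.
Let mwindow n : measurable (window n). Proof. exact: measurable_itv. Qed.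
Let window_gt0 n t : window n t -> 0 < t.
Proof. by rewrite /window /= in_itv/= => /andP[h _]; apply: lt_trans h; rewrite invr_gt0 ltr0n. Qed.
Let window_le n t : window n t -> t <= n.+1%:R.
Proof. by rewrite /window /= in_itv/= => /andP[]. Qed.
Let windowD n : window n `<=` D.
Proof. by move=> t h; apply/halflineE; exact: window_gt0 h. Qed.

Let window_fin n k : rintegrable nu (window n) (fun=> k).
Proof.
have i0 : (0 : R) < n.+1%:R^-1 by rewrite invr_gt0 ltr0n.
have [|i _] := @rint_oc_cst R N N3 n.+1%:R^-1 n.+1%:R k (ltW i0); last exact: i.
by apply: (@le_trans _ _ 1); [rewrite invf_le1 ?ltr0n// ler1n|rewrite ler1n].
Qed.

Lemma window_bounded n (g : measurableTypeR R -> R) (B : R) : measurable_fun D g ->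
  (forall t, window n t -> `|g t| <= B) -> (forall t, D t -> ~ window n t -> g t = 0) -> rig g.
Proof.
move=> mg gB g0; apply: (rint_extend (mwindow n) (@windowD n) g0).
apply: (rintegrable_le (mwindow n) _ (window_fin n B)) => //.
exact: (measurable_funS mD (@windowD n) mg).
Qed.

Lemma dom_window n (z : measurableTypeR R -> R) (B : R) : measurable_fun D z -> (forall t, `|z t| <= B) ->
  (forall t, ~ window n t -> z t = 0) -> dom N Phi z.
Proof.
move=> mz zB z0; have lz : L2 z.
  split => //; apply: (@window_bounded n _ (B ^+ 2)).
  - exact: measurable_funX.
  - by move=> t _; rewrite normrX lerXn2r ?nnegrE// (le_trans _ (zB t)).
  - by move=> t _ h; rewrite z0// expr0n.
split => //.
  apply: (@window_bounded n _ (Phi B)).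
  - exact: (measurable_growth G).
  - move=> t _; rewrite ger0_norm ?(Phi_nonneg G)//; apply: (growth_mono G).
    exact: le_trans (zB t) (ler_norm _).
  - by move=> t _ h; rewrite z0// (growth0 G).
apply: (sqr_K_compact N3 (d := n.+1%:R)) => // t nt.
by apply: z0 => h; have := window_le h; rewrite leNgt nt.
Qed.

(** Transposes [K]: the integral from r to infinity moves to the source term as an integral from
    0. *)
Lemma fubini_K n (z : measurableTypeR R -> R) (B : R) : measurable_fun D z -> (forall t, `|z t| <= B) ->
  (forall t, ~ window n t -> z t = 0) ->
  rig (fun t => z t * (kap N t * H t)) /\
  II (fun t => src t * K z t) = - II (fun t => z t * (kap N t * H t)).
Proof.
move=> mz zB z0; set d : R := n.+1%:R.
have d0 : 0 < d by rewrite ltr0n.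
have i0 : (0 : R) < n.+1%:R^-1 by rewrite invr_gt0 ltr0n.
have [lz _ _] := dom_window mz zB z0.
have zfar t : d < t -> z t = 0.
  by move=> dt; apply: z0 => h; have := window_le h; rewrite leNgt dt.
pose Hb := \int[nu]_(r in `]0, d]) `|src r|.
have Hb0 : 0 <= Hb by apply: Rintegral_ge0 => t _.
have B0 : 0 <= B by apply: le_trans (zB 0).
have bH t : window n t -> `|kap N t * H t| <= kap N n.+1%:R^-1 * Hb.
  move=> wt; rewrite normrM [`|kap N t|]ger0_norm ?kap_ge0//; apply: ler_pM => //.
  - by rewrite kap_ge0.
  - by apply: (kap_le N3 i0); move: wt; rewrite /window /= in_itv/= => /andP[/ltW].
  have t0 := window_gt0 wt; have td := window_le wt.
  have sub : `]0, t]%classic `<=` `]0, d]%classic.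
    by move=> s; rewrite /= !in_itv/= => /andP[-> st]; exact: le_trans td.
  apply: (le_trans (le_normr_Rintegral (moc 0 t) (src_low t0))).
  apply: rint_le_set => //.
  by apply: rintegrable_norm; exact: src_low.
have mkH : measurable_fun D (fun t => kap N t * H t).
  by apply: measurable_funM; [exact: measurable_kap|exact: measurable_H].
have izH : rig (fun t => z t * (kap N t * H t)).
  apply: (@window_bounded n _ (B * (kap N n.+1%:R^-1 * Hb))).
  - exact: measurable_funM.
  - by move=> t wt; rewrite normrM ler_pM// bH.
  - by move=> t _ h; rewrite z0// mul0r.
split; first exact: izH.
(* [K z] vanishes from [d] on, so the source may be cut there; this makes it integrable. *)
pose g' := src \_ `]0, d]%classic.
pose z' t := z t * kap N t.
have z'0 t : ~ D t -> z' t = 0 by move=> h; rewrite /z' z0 ?mul0r// => /windowD.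
have rT (g : measurableTypeR R -> R) (A : set (measurableTypeR R)) : measurable A -> rintegrable nu A g ->
    rintegrable nu setT (g \_ A).
  move=> mA ig; have := (integrable_mkcond (EFin \o g) mA).1 ig.
  by apply: eq_integrable => // t _; rewrite /= !patchE; case: ifP.
have ig' : rintegrable nu setT g' by apply: rT => //; exact: src_low.
have z'E : z' = z' \_ D.
  by apply/funext => t; rewrite patchE; case: ifPn => // /negP h; apply: z'0 => Dt; apply: h; rewrite inE.
have iz' : rintegrable nu setT z'.
  rewrite z'E; apply: rT => //; apply: (@window_bounded n _ (B * kap N n.+1%:R^-1)).
  - by apply: measurable_funM => //; exact: measurable_kap.
  - move=> t wt; rewrite /z' normrM [`|kap N t|]ger0_norm ?kap_ge0// ler_pM ?kap_ge0//.
    by apply: (kap_le N3 i0); move: wt; rewrite /window /= in_itv/= => /andP[/ltW].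
  - by move=> t _ h; rewrite /z' z0// mul0r.
have F := rint_fubini_triangle ig' iz'.
have dv : dom N Phi v by case: av.
have [j1 j2] := dom_pair N3 p2 apN dv (dom_window mz zB z0).
have iQ : rig (fun t => src t * K z t).
  apply: eq_rintegrable (rintegrableB mD j1 (rintegrableZ mD lam j2)) => // t _.
  by rewrite /src mulrBl mulrA.
have E1 : II (fun t => src t * K z t) = - \int[nu]_r (g' r * \int[nu]_(t in `]r, +oo[) z' t).
  have -> : (fun r => g' r * \int[nu]_(t in `]r, +oo[) z' t) =
      (fun r => - 1 * ((fun t => src t * K z t) \_ D) r).
    apply/funext => r; rewrite patchE; case: ifPn => [|/negP h].
      rewrite inE => /halflineE r0; rewrite /g' patchE; case: ifPn => [_|/negP h].
        by rewrite /K mulrN mulN1r opprK.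
      rewrite (K_far N zfar) ?mulr0 ?mul0r ?mulr0// leNgt; apply/negP => rd.
      by apply: h; rewrite inE /= in_itv/= r0 ltW.
    rewrite /g' patchE; case: ifPn => [|_]; last by rewrite mul0r mulr0.
    by rewrite inE => hr; exfalso; apply: h; rewrite inE; exact: low_sub hr.
  rewrite (RintegralZl _ measurableT (rT _ _ mD iQ)) mulN1r opprK.
  exact: Rintegral_mkcond.
rewrite E1 F; congr (- _); rewrite [RHS]Rintegral_mkcond; apply: eq_rint => t _.
rewrite patchE; case: ifPn => [|/negP h]; last first.
  by rewrite z'0 ?mul0r// => Dt; apply: h; rewrite inE.
rewrite inE => /halflineE t0; have [td|td] := leP t d; last by rewrite /z' zfar// !mul0r.
rewrite /z' -mulrA; congr (_ * (_ * _)); rewrite -(lowprim_open N3 src_low t0).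
rewrite Rintegral_mkcond [RHS]Rintegral_mkcond; apply: eq_rint => r _.
rewrite /g' !patchE !mem_setE !in_itv/=; case: (ltP r t) => rt; rewrite ?andbF ?andbT//.
by rewrite (le_trans (ltW rt) td) andbT.
Qed.

Definition resid (t : R) : R := beta (v t) + kap N t * H t.

Lemma measurable_resid : measurable_fun D resid.
Proof.
apply: measurable_funD; first by apply: (measurable_beta G); case: av => -[].
by apply: measurable_funM; [exact: measurable_kap|exact: measurable_H].
Qed.

Hypothesis EL : forall z, dom N Phi z -> Fv N p beta v z = - lam * Lv N v z.

(** The residual divided by 1 + |resid| and cut to a window is bounded, hence an admissible
    direction; tested against the residual it gives a nonnegative function of zero integral. *)
Lemma resid_ae : {ae nu, forall t, D t -> resid t = 0}.
Proof.
have dv : dom N Phi v by case: av.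
have Hn n : {ae nu, forall t, D t -> window n t -> resid t = 0}.
  pose q t := resid t / (1 + `|resid t|).
  have q1 t : 0 < 1 + `|resid t| by rewrite ltr_pwDl.
  have mq : measurable_fun D q.
    apply: measurable_funM; first exact: measurable_resid.
    apply: (measurableT_comp (f := fun x : R => (1 + `|x|)^-1)); last exact: measurable_resid.
    apply: continuous_measurable_fun => x; apply: cvgV.
      by rewrite gt_eqF// ltr_pwDl.
    by apply: cvgD; [exact: cvg_cst|exact: norm_continuous].
  pose z := q \_ (window n).
  have mz : measurable_fun D z.
    rewrite /z (_ : q \_ _ = fun t => q t * \1_(window n) t); last first.
      by apply/funext => t; rewrite patchE indicE; case: (_ \in _); rewrite ?mulr1 ?mulr0.
    by apply: measurable_funM => //; exact: measurable_indic.
  have zB t : `|z t| <= 1.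
    rewrite /z patchE; case: ifP => _; last by rewrite normr0.
    rewrite /q normrM normfV [`|1 + _|]gtr0_norm// ler_pdivrMr// mul1r.
    by rewrite lerDr.
  have z0 t : ~ window n t -> z t = 0.
    by rewrite /z patchE; case: ifPn => // /[!inE].
  have dz := dom_window mz zB z0.
  have [i1 E1] := fubini_K mz zB z0.
  have [i2 _] := growth_derivative N3 G dv dz.
  have [j1 j2] := dom_pair N3 p2 apN dv dz.
  have E2 : II (fun t => beta (v t) * z t) = II (fun t => src t * K z t).
    have -> : II (fun t => src t * K z t) = II (fun t => f (u t) * K z t) - lam * Lv N v z.
      rewrite /Lv -(RintegralZl _ mD j2) -RintegralB//; last exact: rintegrableZ.
      by apply: eq_rint => t _; rewrite /src mulrBl mulrA.
    have := EL dz; rewrite /Fv mulNr => /eqP; rewrite subr_eq addrC => /eqP ->.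
    by [].
  have E3 : II (fun t => resid t * z t) = 0.
    have -> : II (fun t => resid t * z t) =
        II (fun t => beta (v t) * z t) + II (fun t => z t * (kap N t * H t)).
      by rewrite -RintegralD//; apply: eq_rint => t _; rewrite /resid; ring.
    by rewrite E2 E1 addNr.
  have irz : rig (fun t => resid t * z t).
    by apply: eq_rintegrable (rintegrableD mD i2 i1) => // t _; rewrite /resid; ring.
  have rz0 t : 0 <= resid t * z t.
    rewrite /z patchE; case: ifP => _; last by rewrite mulr0.
    by rewrite /q mulrA divr_ge0 -?expr2 ?sqr_ge0// ltW.
  have : ae_eq nu D (fun t => (resid t * z t)%:E) (cst 0%E).
    apply/ae_eq_integral_abs => //.
      by apply/measurable_EFinP; exact: rintegrable_measurable irz.
    transitivity (\int[nu]_(t in D) (resid t * z t)%:E)%E.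
      by apply: eq_integral => t _; rewrite /= ger0_norm.
    by rewrite (rint_lim mD irz) E3.
  apply: filterS => t h Dt wt; have := h Dt; rewrite /z patchE mem_set// => -[].
  rewrite /q mulrA => /eqP; rewrite mulf_eq0 invr_eq0 (gt_eqF (q1 t)) orbF.
  by rewrite mulf_eq0 orbb => /eqP.
have /ae_foralln := Hn; apply: filterS => t h Dt.
have t0 : 0 < t by apply/halflineE.
have [n hn] : exists n, window n t.
  exists (Num.truncn (Num.max t t^-1)).
  have := truncnS_gt (Num.max t t^-1); rewrite gt_max => /andP[h1 h2].
  rewrite /window /= in_itv/= (ltW h1) andbT.
  by rewrite -[X in _ < X]invrK ltf_pV2// posrE ?ltr0n// invr_gt0.
exact: h n Dt hn.
Qed.

End PointwiseEL.

(** * Inverting the flux *)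

Section InverseFlux.
Context {R : realType}.
Variables (Phi beta : R -> R) (c th : R).
Hypothesis G : growth Phi beta c th.
Let c0 : 0 < c := growth_c G.

Lemma beta_strong x y : c * (x - y) ^+ 2 <= (beta x - beta y) * (x - y).
Proof.
have := growth_tangent G x y; have := growth_tangent G y x.
have -> : (y - x) ^+ 2 = (x - y) ^+ 2 by ring.
nra.
Qed.

Lemma beta_expand x y : c * `|x - y| <= `|beta x - beta y|.
Proof.
have [->|xy] := eqVneq x y; first by rewrite !subrr normr0 mulr0.
have n0 : 0 < `|x - y| by rewrite normr_gt0 subr_eq0.
rewrite -(ler_pM2r n0) -normrM -mulrA -expr2 real_normK ?num_real//.
exact: le_trans (beta_strong x y) (ler_norm _).
Qed.

Lemma beta_zero : beta 0 = 0.
Proof. by have := growth_betaN G 0; rewrite oppr0 => h; lra. Qed.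

Lemma beta_surj y : exists x, beta x = y.
Proof.
pose M := `|y| / c + 1.
have M0 : 0 < M by rewrite ltr_pwDr// divr_ge0// ltW.
have hM : `|y| <= beta M.
  apply: le_trans (growth_beta_ge G (ltW M0)).
  by rewrite /M mulrDr mulrC divfK ?gt_eqF// lerDl mulr1 ltW.
have hN : beta (- M) <= - `|y| by rewrite (growth_betaN G) lerN2.
have MM : - M <= M by rewrite (le_trans _ (ltW M0))// oppr_le0 ltW.
have [] := @IVT R beta (- M) M y MM.
- by apply: continuous_subspaceT; exact: growth_beta_cont G.
- have y1 := ler_norm y; have y2 : - `|y| <= y by rewrite lerNl -normrN ler_norm.
  by rewrite ge_min le_max (le_trans hN y2)/= (le_trans y1 hM) orbT.
- by move=> x _ <-; exists x.
Qed.

(** Strong monotonicity makes this inverse Lipschitz, so that continuity of the flux passes to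
    [v]. *)
Definition binv : R -> R := projT1 (choice beta_surj).

Lemma binvK y : beta (binv y) = y.
Proof. exact: (projT2 (choice beta_surj)). Qed.

Lemma binv_lip x y : `|binv x - binv y| <= c^-1 * `|x - y|.
Proof. by rewrite -ler_pdivrMl ?invr_gt0// invrK -[x in leRHS]binvK -[y in leRHS]binvK beta_expand. Qed.

Lemma betaK x : binv (beta x) = x.
Proof.
apply/eqP; rewrite -subr_eq0 -normr_le0.
by rewrite -(pmulr_rle0 _ c0) (le_trans (beta_expand _ _))// binvK subrr normr0.
Qed.

Lemma binv_continuous : continuous binv.
Proof.
move=> x; apply/cvgrPdist_le => e e0.
have ce : 0 < c * e by rewrite mulr_gt0.
apply/nbhs_ballP; exists (c * e) => //= y; rewrite /ball/= => h.
by apply: (le_trans (binv_lip _ _)); rewrite ler_pdivrMl// ltW.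
Qed.

End InverseFlux.

Section RadialSolution.
Context {R : realType}.
Variable N : nat.
Hypothesis N3 : (3 <= N)%N.
Variables p : R.
Hypothesis p2 : 2 < p.
Local Notation nu := (@radial_measure R N).
Local Notation D := (@halfline R).
Local Notation a := (@half_exp R N).
Hypothesis apN : a * p < N%:R.
Local Notation f := (fp p).
Local Notation rig := (rintegrable nu D).
Local Notation II g := (\int[nu]_(t in D) g t)%R.
Local Notation K := (@K R N).
Local Notation L2 := (@L2 R N).
Variables (Phi beta : R -> R) (c th : R).
Hypothesis G : growth Phi beta c th.
Variable m : R.
Hypothesis m0 : 0 < m.
Let mD := @measurable_halfline R.
Local Notation adm := (@adm R N Phi m).
Local Notation PP := (@PP R N p).
Local Notation H lam v := (lowprim N (src N p v lam)).
Hypothesis gam_chi : @chi R N th < @gam R N p.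

Definition solves (lam : R) (v : R -> R) : Prop :=
  forall t, 0 < t -> beta (v t) = - (kap N t * H lam v t).

Lemma solves_continuous lam v : adm v -> solves lam v -> forall t, 0 < t -> {for t, continuous v}.
Proof.
move=> av sv t t0.
have E s : 0 < s -> v s = binv G (- (kap N s * H lam v s)).
  by move=> s0; rewrite -sv// betaK.
have cq : - (kap N s * H lam v s) @[s --> t] --> - (kap N t * H lam v t).
  apply: cvgN; apply: cvgM; last exact: (H_continuous N3 p2 apN av t0).
  by apply: cvgM; [exact: cvg_cst|exact: powR_continuous_at].
have cb := cvg_comp _ _ cq (@binv_continuous _ _ _ _ _ G _).
suff : v s @[s --> t] --> v t by [].
rewrite (E t t0); apply: cvg_trans cb; apply: near_eq_cvg.
near=> s; rewrite /= -E//; near: s.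
by apply: lt_nbhsr.
Unshelve. all: by end_near. Qed.

(** The last property is the Nehari identity, the weak equation tested with the solution itself. *)
Lemma exists_radial_solution : exists lam v, [/\ adm v, 0 < PP (K v), solves lam v,
  mass N v < m -> lam = 0 & lam = 0 -> II (fun t => beta (v t) * v t) = PP (K v)].
Proof.
have [w [mw Pw]] := exists_critical N3 p2 apN G m0 gam_chi.
have aw : adm w by case: mw.
have dw : dom N Phi w by case: aw.
have [lam [lam0 EL]] := euler_lagrange_weak N3 p2 apN G m0 mw.
have ae := resid_ae N3 p2 apN G aw EL.
(* The continuous representative of the critical point: equal to [w] almost everywhere, with the
   same image under [K] on the half-line. *)
pose v t := binv G (- (kap N t * H lam w t)).
have wv : {ae nu, forall t, D t -> w t = v t}.
  apply: filterS ae => t h Dt; have := h Dt; rewrite /resid /v => /eqP.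
  by rewrite addr_eq0 => /eqP <-; rewrite betaK.
have mv : measurable_fun D v.
  apply: open_continuous_measurable_fun; first exact: interval_open.
  move=> t; rewrite inE => /halflineE t0.
  have cq : - (kap N s * H lam w s) @[s --> t] --> - (kap N t * H lam w t).
    apply: cvgN; apply: cvgM; last exact: (H_continuous N3 p2 apN aw t0).
    by apply: cvgM; [exact: cvg_cst|exact: powR_continuous_at].
  exact: (cvg_comp _ _ cq (@binv_continuous _ _ _ _ _ G _)).
have [[lw iw2] iw iK mK] := aw.
have lv : L2 v.
  split => //; apply: (rintegrable_ae mD _ _ iw2); first exact: measurable_funX.
  by apply: filterS wv => t h Dt; rewrite (h Dt).
have KE r : 0 < r -> K v r = K w r by move=> r0; apply/esym; apply: K_ae => //.
have iv : rig (fun t => Phi (v t)).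
  apply: (rintegrable_ae mD _ _ iw); first exact: (measurable_growth G).
  by apply: filterS wv => t h Dt; rewrite (h Dt).
have av : adm v.
  split; [exact: lv|exact: iv| |].
    by apply: eq_rintegrable iK => // t /halflineE t0; rewrite KE.
  apply: le_trans mK; rewrite le_eqVlt; apply/orP; left; apply/eqP.
  by apply: eq_rint => t /halflineE t0; rewrite KE.
have PE : PP (K v) = PP (K w) by apply: eq_rint => t /halflineE t0; rewrite KE.
exists lam, v; split.
- exact: av.
- by rewrite PE.
- move=> t t0; rewrite [LHS]binvK; congr (- (_ * _)); apply: eq_rint => r.
  by rewrite /= in_itv/= => /andP[r0 _]; rewrite /src KE.
- move=> h; apply: lam0; apply: le_lt_trans h; rewrite le_eqVlt; apply/orP; left; apply/eqP.
  by apply: eq_rint => t /halflineE t0; rewrite KE.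
move=> lamE; have := EL w dw; rewrite lamE oppr0 mul0r /Fv => /eqP; rewrite subr_eq0 => /eqP E1.
have [C0 ew] := Kz_env N3 aw.
have [_ E2] := env_PP N3 p2 apN C0 ew.
rewrite PE -E2 -E1; clearbody v; apply/esym; apply: (rint_ae_eq mD).
- exact: (measurable_funM (measurable_beta G lw) lw).
- exact: (measurable_funM (measurable_beta G mv) mv).
- by apply: filterS wv => t h Dt; rewrite (h Dt).
Qed.

End RadialSolution.

(** * Pohozaev identity *)

Section Derivatives.
Context {R : realType}.
Implicit Types (f g : R -> R) (t a b : R).

Lemma derive_add f g t a b : is_derive t 1 f a -> is_derive t 1 g b ->
  is_derive t 1 (fun s => f s + g s) (a + b).
Proof. by move=> ? ?; exact: is_deriveD. Qed.

Lemma derive_mul f g t a b : is_derive t 1 f a -> is_derive t 1 g b ->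
  is_derive t 1 (fun s => f s * g s) (f t * b + a * g t).
Proof.
move=> df dg; have := is_deriveM df dg; rewrite /GRing.scale/= [g t * a]mulrC.
exact.
Qed.

Lemma derive_scale f t a b : is_derive t 1 f a -> is_derive t 1 (fun s => b * f s) (b * a).
Proof. by move=> df; exact: is_deriveZ. Qed.

Lemma derive_exp (n : nat) t : is_derive t 1 (fun s : R => s ^+ n) (n%:R * t ^+ n.-1).
Proof. by apply: DeriveDef; [exact: exprn_derivable|rewrite exp_derive /GRing.scale/= mulr1]. Qed.

Lemma derive_eq f t a b : is_derive t 1 f a -> a = b -> is_derive t 1 f b.
Proof. by move=> ? <-. Qed.

Lemma derive_near f g t a : (\forall s \near t, f s = g s) -> is_derive t 1 f a -> is_derive t 1 g a.
Proof.
move=> fg df; have gt : g t = f t by rewrite (nbhs_singleton fg).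
move/is_derive1_caratheodory : df => [h [fE hc ht]].
apply/is_derive1_caratheodory.
exists (fun z => if z == t then a else (g z - g t) / (z - t)); split.
- by move=> z; case: eqP => [->|/eqP zr]; rewrite ?subrr ?mulr0// divfK// subr_eq0.
- suff : (fun z => if z == t then a else (g z - g t) / (z - t)) z @[z --> t] -->
    (if t == t then a else (g t - g t) / (t - t)) by [].
  rewrite eqxx -ht; apply: cvg_trans hc; apply: near_eq_cvg.
  apply: filterS fg => z fgz; case: eqP => [->//|/eqP zr].
  by rewrite -fgz gt fE mulfK// subr_eq0.
- by rewrite eqxx.
Qed.

(** The subgradient inequalities at the two points enclose each difference quotient between values
    of [phi]. *)
Lemma subgradient_derive (F phi : R -> R) (x : R) :
  (forall x y, phi x * (y - x) <= F y - F x) -> {for x, continuous phi} ->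
  is_derive x 1 F (phi x).
Proof.
move=> sub pc; apply/is_derive1_caratheodory.
pose h z := if z == x then phi x else (F z - F x) / (z - x).
have hx : h x = phi x by rewrite /h eqxx.
exists h; split => //.
- by move=> z; rewrite /h; case: eqP => [->|/eqP zr]; rewrite ?subrr ?mulr0// divfK// subr_eq0.
suff : h z @[z --> x] --> h x by [].
rewrite hx; apply/cvgrPdist_le => e e0.
have /cvgrPdist_le/(_ _ e0) := pc; apply: filterS => z /ler_normlP[h1 h2].
rewrite /h; case: eqP => [_|/eqP zx]; first by rewrite subrr normr0 ltW.
have l1 := sub x z; have l2 := sub z x.
have {}l2 : F z - F x <= phi z * (z - x) by move: l2; rewrite -(opprB z x) -(opprB (F z)) mulrN lerN2.
move: zx; rewrite neq_lt => /orP[zx|zx].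
  have n0 : z - x < 0 by rewrite subr_lt0.
  have q1 : (F z - F x) / (z - x) <= phi x by rewrite ler_ndivrMr.
  have q2 : phi z <= (F z - F x) / (z - x) by rewrite ler_ndivlMr.
  by move: q1 q2; move: (_ / _) => q *; apply/ler_normlP; split; lra.
have n0 : 0 < z - x by rewrite subr_gt0.
have q1 : phi x <= (F z - F x) / (z - x) by rewrite ler_pdivlMr.
have q2 : (F z - F x) / (z - x) <= phi z by rewrite ler_pdivrMr.
by move: q1 q2; move: (_ / _) => q *; apply/ler_normlP; split; lra.
Qed.

Lemma derive0_const f : (forall t, 0 < t -> is_derive t 1 f 0) ->
  forall r s, 0 < r -> 0 < s -> f r = f s.
Proof.
move=> df; suff H r s : 0 < r -> r < s -> f r = f s.
  move=> r s r0 s0; have [rs|sr|->//] := ltgtP r s; first exact: H.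
  by apply/esym; exact: H.
move=> r0 rs; have [||x xs] := @MVT R f (fun=> 0) r s rs.
- by move=> x; rewrite in_itv/= => /andP[rx _]; apply: df; exact: lt_trans rx.
- apply: continuous_in_subspaceT => x; rewrite inE/= in_itv/= => /andP[rx _].
  have dx := df x (lt_le_trans r0 rx).
  by apply: differentiable_continuous; apply/derivable1_diffP; case: dx.
by rewrite mul0r => /eqP; rewrite subr_eq0 => /eqP ->.
Qed.

End Derivatives.

Section Pohozaev.
Context {R : realType}.
Variable N : nat.
Hypothesis N3 : (3 <= N)%N.
Let N0 : (0 < N)%N. Proof. exact: leq_trans N3. Qed.
Variables p : R.
Hypothesis p2 : 2 < p.
Local Notation nu := (@radial_measure R N).
Local Notation D := (@halfline R).
Local Notation a := (@half_exp R N).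
Hypothesis apN : a * p < N%:R.
Local Notation f := (fp p).
Local Notation rig := (rintegrable nu D).
Local Notation II g := (\int[nu]_(t in D) g t)%R.
Local Notation K := (@K R N).
Local Notation L2 := (@L2 R N).
Local Notation cb := (@ball_vol R N).
Variables (Phi beta : R -> R) (c th : R).
Hypothesis G : growth Phi beta c th.
Variable m : R.
Hypothesis m0 : 0 < m.
Let mD := @measurable_halfline R.
Local Notation adm := (@adm R N Phi m).
Local Notation PP := (@PP R N p).
Let moc (s t : R) : measurable (`]s, t]%classic : set (measurableTypeR R)).
Proof. exact: measurable_itv. Qed.

Lemma lowprim_cvg (q : R -> R) (r_ : nat -> R) (g : R -> R) :
  rig q -> (forall t, 0 < t -> \forall n \near \oo, (q \_ `]0, r_ n]) t = g t) ->
  measurable_fun D g -> lowprim N q (r_ n) @[n --> \oo] --> II g.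
Proof.
move=> iq h mg; have mq := rintegrable_measurable iq.
have E n : lowprim N q (r_ n) = II (q \_ `]0, r_ n]).
  rewrite /lowprim Rintegral_mkcond [RHS]Rintegral_mkcond; apply: eq_rint => t _.
  rewrite !patchE; case: ifPn => [|_]; last by case: ifP.
  by rewrite inE => /low_sub h1; rewrite mem_set.
have [_ ] : rig g /\ (II (q \_ `]0, r_ n]) @[n --> \oo] --> II g).
  apply: (rint_dct mD (f_ := fun n => q \_ `]0, r_ n]) (g := fun t => `|q t|)).
  - move=> n; apply/(measurable_restrict _ _ _).
      exact: moc.
      exact: mD.
    by apply: (measurable_funS mD) mq => t [].
  - exact: mg.
  - exact: rintegrable_norm.
  - by move=> n t _; rewrite patchE; case: ifP => _; rewrite ?normr0.
  apply: aeW => t /halflineE t0.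
  by apply: cvg_near_cst; exact: h.
by under eq_cvg do rewrite -E.
Qed.

(** Otherwise e would be at least (I0 + eta) / nu(]r, 2r]) on the whole shell, I0 being its integral
    there. The factor 2^N replaces s^N by (2r)^N, and c(2^N - 1) r^N is the volume of the shell. *)
Lemma mean_point (e : R -> R) (r eta : R) : 0 < r -> 0 < eta ->
  (forall t, 0 < t -> 0 <= e t) -> rintegrable nu `]r, (2 * r)] e ->
  exists s, [/\ r < s, s <= 2 * r & s ^+ N * e s <=
    2 ^+ N / (cb * (2 ^+ N - 1)) * (\int[nu]_(t in `]r, (2 * r)]) e t + eta)].
Proof.
move=> r0 eta0 e0 ie; set I0 := \int[nu]_(t in _) e t.
have cb0 : 0 < cb by exact: ball_vol_gt0.
have p21 : 0 < (2 : R) ^+ N - 1 by rewrite subr_gt0 exprn_egt1 ?ltr1n// -lt0n.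
apply: contrapT => nex.
have rr : r <= 2 * r by lra.
set A := 2 ^+ N / (cb * (2 ^+ N - 1)) * (I0 + eta).
have H t : r < t <= 2 * r -> A / (2 * r) ^+ N <= e t.
  move=> /andP[rt tr]; rewrite leNgt; apply/negP => h; apply: nex; exists t; split => //.
  rewrite -/A; have t0 : 0 < t by exact: lt_trans rt.
  have r20 : 0 < (2 * r) ^+ N by rewrite exprn_gt0// mulr_gt0.
  apply: (@le_trans _ _ ((2 * r) ^+ N * e t)); last by rewrite mulrC -ler_pdivlMr// ltW.
  by apply: ler_wpM2r; [exact: e0|apply: lerXn2r => //; rewrite nnegrE; lra].
have [i1 E1] := rint_oc_cst N3 (A / (2 * r) ^+ N) (ltW r0) rr.
have : \int[nu]_(t in `]r, (2 * r)]) (A / (2 * r) ^+ N) <= I0.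
  by apply: (rint_le_sub (moc _ _) i1 ie) => t; rewrite /= in_itv/=; exact: H.
rewrite E1; have -> : A / (2 * r) ^+ N * (cb * ((2 * r) ^+ N - r ^+ N)) = I0 + eta.
  rewrite /A exprMn; field.
  by rewrite !gt_eqF//= exprn_gt0.
by rewrite gerDl leNgt eta0.
Qed.

Let half_pow (n : nat) : R := 2^-1 ^+ n.
Let half_pow0 n : 0 < half_pow n. Proof. by rewrite exprn_gt0. Qed.
Let half_pow_cvg : half_pow n @[n --> \oo] --> (0 : R).
Proof. by apply: cvg_expr; rewrite ger0_norm// invf_lt1// ltr1n. Qed.

Let half_pow_small t : 0 < t -> \forall n \near \oo, half_pow n < t.
Proof.
move=> t0; have /cvgrPdist_lt/(_ _ t0) := half_pow_cvg; apply: filterS => n.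
by rewrite sub0r normrN ger0_norm// ltW.
Qed.

Lemma lowprim0_cvg q (r_ : nat -> R) : rig q -> (forall t, 0 < t -> \forall n \near \oo, r_ n < t) ->
  lowprim N q (r_ n) @[n --> \oo] --> (0 : R).
Proof.
move=> iq h; have := @lowprim_cvg q r_ (fun=> 0) iq; rewrite Rintegral_cst// mul0r; apply.
  move=> t t0; apply: filterS (h t t0) => n rt; rewrite patchE; case: ifPn => //.
  by rewrite inE /= in_itv/= => /andP[_]; rewrite leNgt rt.
exact: measurable_cst.
Qed.

Lemma lowprimT_cvg q (r_ : nat -> R) : rig q -> (forall t, 0 < t -> \forall n \near \oo, t < r_ n) ->
  lowprim N q (r_ n) @[n --> \oo] --> II q.
Proof.
move=> iq h; apply: lowprim_cvg => //; last exact: rintegrable_measurable iq.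
move=> t t0; apply: filterS (h t t0) => n rt; rewrite patchE mem_set//.
by rewrite /= in_itv/= t0 ltW.
Qed.

Let low_int q d : rig q -> 0 < d -> rintegrable nu `]0, d] q.
Proof. by move=> iq d0; apply: rintS iq => //; exact: low_sub. Qed.

(* A nonnegative function with finite integral against r^(N-1) dr takes values
   o(r^-N) along suitable sequences tending to 0 and to infinity. *)
Lemma boundary_sequences (e : R -> R) : (forall t, 0 < t -> 0 <= e t) -> rig e ->
  exists r_ s_ : nat -> R, [/\ forall n, 0 < r_ n /\ 0 < s_ n,
    forall t, 0 < t -> (\forall n \near \oo, r_ n < t) /\ (\forall n \near \oo, t < s_ n),
    r_ n ^+ N * e (r_ n) @[n --> \oo] --> (0 : R) &
    s_ n ^+ N * e (s_ n) @[n --> \oo] --> (0 : R)].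
Proof.
move=> e0 ie; set C : R := 2 ^+ N / (cb * (2 ^+ N - 1)).
have C0 : 0 <= C.
  by rewrite divr_ge0 ?exprn_ge0// mulr_ge0 ?ltW ?ball_vol_gt0// subr_gt0 exprn_egt1 ?ltr1n// -lt0n.
have iel r : 0 < r -> rintegrable nu `]r, (2 * r)] e.
  move=> r0; apply: (rintS (moc _ _) mD _ ie) => t; rewrite /= in_itv/= => /andP[rt _].
  by apply/halflineE; exact: lt_trans rt.
have main (q_ : nat -> R) : (forall n, 0 < q_ n) ->
    (lowprim N e (2 * q_ n) - lowprim N e (q_ n) @[n --> \oo] --> (0 : R)) ->
    exists r_ : nat -> R, (forall n, q_ n < r_ n <= 2 * q_ n) /\
      (r_ n ^+ N * e (r_ n) @[n --> \oo] --> (0 : R)).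
  move=> q0 hq; have /choice[r_ hr] : forall n, exists s, [/\ q_ n < s, s <= 2 * q_ n &
      s ^+ N * e s <= C * (\int[nu]_(t in `]q_ n, (2 * q_ n)]) e t + half_pow n)].
    by move=> n; exact: (mean_point (q0 n) (half_pow0 n) e0 (iel _ (q0 n))).
  exists r_; split; first by move=> n; have [-> ->] := hr n.
  have U : C * ((lowprim N e (2 * q_ n) - lowprim N e (q_ n)) + half_pow n) @[n --> \oo] --> (0 : R).
    rewrite -[X in _ --> X](mulr0 C); apply: cvgM; first exact: cvg_cst.
    by rewrite -[X in _ --> X]addr0; apply: cvgD.
  apply: (@squeeze_cvgr _ _ _ _ (fun=> 0) _ _ _ _ _ U); last exact: cvg_cst.
  apply: nearW => n; have [h1 h2 h3] := hr n; have r0 : 0 < r_ n by exact: lt_trans h1.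
  rewrite mulr_ge0 ?exprn_ge0 ?(ltW r0) ?e0//=; apply: (le_trans h3).
  rewrite lowprim_diff//; first by move=> d d0; exact: low_int.
  by have := q0 n; lra.
have lim0 : lowprim N e (2 * half_pow n) - lowprim N e (half_pow n) @[n --> \oo] --> (0 : R).
  rewrite -[X in _ --> X](subrr 0); apply: cvgB; apply: lowprim0_cvg => // t t0.
  have t2 : 0 < t / 2 by rewrite divr_gt0.
  by apply: filterS (half_pow_small t2) => n; rewrite ltr_pdivlMr// mulrC.
have [r_ [hr rc]] := main half_pow half_pow0 lim0.
have dbl0 n : 0 < (half_pow n)^-1 by rewrite invr_gt0.
have dbl t : 0 < t -> \forall n \near \oo, t < (half_pow n)^-1.
  move=> t0; have t1 : 0 < t^-1 by rewrite invr_gt0.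
  apply: filterS (half_pow_small t1) => n h.
  by rewrite -[X in X < _]invrK ltf_pV2 ?posrE.
have limT : lowprim N e (2 * (half_pow n)^-1) - lowprim N e (half_pow n)^-1 @[n --> \oo] --> (0 : R).
  rewrite -[X in _ --> X](subrr (II e)); apply: cvgB; apply: lowprimT_cvg => // t t0.
  by apply: filterS (dbl t t0) => n h; apply: (lt_trans h); rewrite ltr_pMl// ltr1n.
have [s_ [hs sc]] := main (fun n => (half_pow n)^-1) dbl0 limT.
exists r_, s_; split => //.
- move=> n; have /andP[h1 _] := hr n; have /andP[h2 _] := hs n.
  by split; [exact: lt_trans h1|exact: lt_trans h2].
move=> t t0; split.
  have t2 : 0 < t / 2 by rewrite divr_gt0.
  apply: filterS (half_pow_small t2) => n; rewrite ltr_pdivlMr// mulrC => h.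
  by have /andP[_ h2] := hr n; exact: le_lt_trans h.
apply: filterS (dbl t t0) => n h; have /andP[h2 _] := hs n.
exact: lt_trans h2.
Qed.

Section Identity.
Variable v : R -> R.
Hypothesis av : adm v.
Hypothesis sv : solves N p beta 0 v.
Local Notation u := (K v).
Local Notation H := (lowprim N (src N p v 0)).
Local Notation y t := (beta (v t)).

Let lv : L2 v. Proof. by case: av. Qed.
Let dv : dom N Phi v. Proof. by case: av. Qed.
Let cv (t : R) : 0 < t -> {for t, continuous v}.
Proof. by move=> t0; apply: (solves_continuous N3 p2 apN G av sv). Qed.

Let du (t : R) : 0 < t -> is_derive t 1 u (v t).
Proof. by move=> t0; apply: K_derive => //; exact: cv. Qed.

Lemma flux_derive (t : R) : 0 < t -> is_derive t 1 (fun s => y s) (- (N%:R - 1) / t * y t - f (u t)).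
Proof.
move=> t0; have dH := H_derive N3 p2 apN 0 av t0.
have dk : is_derive t 1 (kap N : R -> R) (- (N%:R - 1) / t * kap N t).
  have h : is_derive t 1 (fun s : R => s `^ (- (N%:R - 1))) (- (N%:R - 1) * t `^ (- (N%:R - 1) - 1)).
    by apply: is_derive1_powR.
  apply: derive_eq (derive_scale ((cb * N%:R)^-1) h) _.
  rewrite /kap powRDp// powR_inv1 ?ltW//; ring.
have h := derive_scale (-1) (derive_mul dk dH).
apply: (@derive_near _ (fun s => -1 * (kap N s * H s))).
  near=> s; rewrite mulN1r -sv//; near: s; exact: lt_nbhsr.
apply: derive_eq h _.
have -> : y t = - (kap N t * H t) by exact: sv.
rewrite [kap N t * (src _ _ _ _ _ * _)]mulrCA kapE// mulr1 /src mul0r subr0.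
by ring.
Unshelve. all: by end_near. Qed.

(** The convex conjugate of Phi, with derivative [binv]. It lets y v - Phi(v) be differentiated
    through the flux y, without differentiating [v]. *)
Let legendre (z : R) : R := binv G z * z - Phi (binv G z).

Let legendre_sub x z : binv G x * (z - x) <= legendre z - legendre x.
Proof.
rewrite /legendre; have := tangent1 G (binv G z) (binv G x); rewrite binvK; lra.
Qed.

(** [e] is the Hamiltonian of the radial equation, and t^(N-1) [q] the derivative of t^N [e]; the
    vanishing integral of [q] is the Pohozaev identity. *)
Let e (t : R) : R := y t * v t - Phi (v t) + `|u t| `^ p / p.
Let q (t : R) : R := y t * v t - N%:R * Phi (v t) + N%:R * `|u t| `^ p / p.

Lemma pohozaev_derive (t : R) : 0 < t -> is_derive t 1 (fun s => s ^+ N * e s) (t ^+ N.-1 * q t).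
Proof.
move=> t0; have p0 : 0 < p by apply: lt_trans p2.
have dL : is_derive t 1 (fun s => legendre (y s)) (v t * (- (N%:R - 1) / t * y t - f (u t))).
  have d1 : is_derive (y t) 1 legendre (v t).
    have := @subgradient_derive _ legendre (binv G) (y t) legendre_sub (@binv_continuous _ _ _ _ _ G _).
    by rewrite betaK.
  exact: (is_derive1_comp d1 (flux_derive t0)).
have dP : is_derive t 1 (fun s => `|u s| `^ p / p) (f (u t) * v t).
  have d1 : is_derive (u t) 1 (fun x : R => `|x| `^ p / p) (f (u t)).
    apply: subgradient_derive; last exact: fp_continuous.
    move=> x z; have := powR_tangent p2 x z.
    rewrite -mulrBl ler_pdivlMr// => h; rewrite mulrC; lra.
  exact: (is_derive1_comp d1 (du t0)).
have := derive_mul (derive_exp N t) (derive_add dL dP).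
have E s : legendre (y s) = y s * v s - Phi (v s) by rewrite /legendre betaK mulrC.
under eq_fun do rewrite E; move=> h; apply: derive_eq h _.
rewrite E /q -[in t ^+ N](prednK N0) exprS.
have t1 : t != 0 by rewrite gt_eqF.
by field; rewrite t1 gt_eqF.
Qed.

Let iy : rig (fun t => y t * v t).
Proof. by have [] := growth_derivative N3 G dv dv. Qed.
Let iF : rig (fun t => Phi (v t)). Proof. by case: dv. Qed.
Let iP : rig (fun t => `|u t| `^ p). Proof. exact: (adm_PP N3 p2 apN av). Qed.

Lemma pohozaev : II (fun t => y t * v t) - N%:R * II (fun t => Phi (v t)) + N%:R / p * PP u = 0.
Proof.
have p0 : 0 < p by apply: lt_trans p2.
have iP' : rig (fun t => `|u t| `^ p / p).
  by apply: eq_rintegrable (rintegrableZ mD p^-1 iP) => // t _; rewrite mulrC.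
have ie : rig e by apply: rintegrableD => //; exact: rintegrableB.
have iNF := rintegrableZ mD N%:R iF; have iNP := rintegrableZ mD (N%:R / p) iP.
have iyF := rintegrableB mD iy iNF.
have qE t : q t = y t * v t - N%:R * Phi (v t) + N%:R / p * `|u t| `^ p.
  by rewrite /q mulrAC.
have iq : rig q.
  by apply: eq_rintegrable (rintegrableD mD iyF iNP) => // t _; rewrite qE.
have IIq : II q = II (fun t => y t * v t) - N%:R * II (fun t => Phi (v t)) + N%:R / p * PP u.
  rewrite -(RintegralZl _ mD iF) -(RintegralZl _ mD iP) -RintegralB// -RintegralD//.
  by apply: eq_rint => t _; rewrite qE.
have e0 t : 0 < t -> 0 <= e t.
  move=> t0; rewrite addr_ge0 ?divr_ge0 ?powR_ge0 ?(ltW p0)//.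
  have := tangent1 G (v t) 0; rewrite (growth0 G); lra.
have [r_ [s_ [rs0 rs_lim rc sc]]] := boundary_sequences e0 ie.
have cq t : 0 < t -> {for t, continuous q}.
  move=> t0; have cu : u s @[s --> t] --> u t by exact: K_continuous.
  have cvt : v s @[s --> t] --> v t by exact: cv.
  have cy := cvg_comp _ _ cvt (@growth_beta_cont _ _ _ _ _ G (v t)).
  have cF := cvg_comp _ _ cvt (@growth_cont _ _ _ _ _ G (v t)).
  have cP := cvg_comp _ _ cu (@norm_powR_continuous _ p p0 (u t)).
  apply: cvgD.
    by apply: cvgB; [exact: cvgM|apply: cvgM; [exact: cvg_cst|exact: cF]].
  by apply: cvgM; [apply: cvgM; [exact: cvg_cst|exact: cP]|exact: cvg_cst].
pose k := (cb * N%:R)^-1.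
have k0 : cb * N%:R != 0 by rewrite gt_eqF// cN_gt0.
(* [lowprim] differentiates with the density c N t^(N-1), which [k] normalizes. The constant thus
   found is evaluated along the two boundary sequences. *)
have dW (t : R) : 0 < t -> is_derive t 1 (fun s => s ^+ N * e s + (- k) * lowprim N q s) 0.
  move=> t0; have dl := lowprim_derive N3 (fun d d0 => low_int iq d0) t0 (cq t t0).
  apply: derive_eq (derive_add (pohozaev_derive t0) (derive_scale (- k) dl)) _.
  by rewrite /k; move: k0; move: (cb * N%:R) => x x0; field.
have cst := derive0_const dW.
have c0 : lowprim N q (r_ n) @[n --> \oo] --> (0 : R).
  by apply: (lowprim0_cvg iq) => t t0; have [] := rs_lim t t0.
have c1 : lowprim N q (s_ n) @[n --> \oo] --> II q.
  by apply: (lowprimT_cvg iq) => t t0; have [] := rs_lim t t0.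
have L0 : r_ n ^+ N * e (r_ n) + - k * lowprim N q (r_ n) @[n --> \oo] --> 0 + - k * 0.
  by apply: cvgD; [exact: rc|apply: cvgM; [exact: cvg_cst|exact: c0]].
have L1 : s_ n ^+ N * e (s_ n) + - k * lowprim N q (s_ n) @[n --> \oo] --> 0 + - k * II q.
  by apply: cvgD; [exact: sc|apply: cvgM; [exact: cvg_cst|exact: c1]].
have E : (fun n => r_ n ^+ N * e (r_ n) + - k * lowprim N q (r_ n)) =
    (fun n => s_ n ^+ N * e (s_ n) + - k * lowprim N q (s_ n)).
  by apply/funext => n; have [h1 h2] := rs0 n; exact: cst.
rewrite E in L0.
have UE : 0 + - k * 0 = 0 + - k * II q by exact: (cvg_unique _ L0 L1).
move: UE; rewrite IIq mulr0 !add0r => /esym/eqP; rewrite mulf_eq0 oppr_eq0 invr_eq0 (negbTE k0)/=.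
by move=> /eqP.
Qed.

End Identity.

Hypothesis beta_upper : forall x, x != 0 -> N%:R * Phi x < (1 + N%:R / p) * (beta x * x).

Lemma mass_full lam v : adm v -> 0 < PP (K v) -> solves N p beta lam v ->
  (mass N v < m -> lam = 0) -> (lam = 0 -> II (fun t => beta (v t) * v t) = PP (K v)) ->
  mass N v = m.
Proof.
move=> av P0 sv lam0 neh; have mm : mass N v <= m by case: av.
apply/eqP; rewrite eq_le mm leNgt; apply/negP => ml.
have l0 := lam0 ml; rewrite l0 in sv; have nE := neh l0.
have poh := pohozaev av sv; rewrite -nE in poh.
have dv : dom N Phi v by case: av.
have [iy _] := growth_derivative N3 G dv dv; have iF : rig (fun t => Phi (v t)) by case: dv.
have lv : L2 v by case: av.
(* Nehari turns the potential term of Pohozaev into the integral of beta(v) v, so that this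
   nonnegative function has zero integral; strictness in (b3) then forces v = 0 almost
   everywhere. *)
pose w t := (1 + N%:R / p) * (beta (v t) * v t) - N%:R * Phi (v t).
have i1 := rintegrableZ mD (1 + N%:R / p) iy; have i2 := rintegrableZ mD N%:R iF.
have iw : rig w by exact: rintegrableB.
have w0 t : 0 <= w t.
  rewrite subr_ge0; have [->|vn] := eqVneq (v t) 0; last exact: ltW (beta_upper vn).
  by rewrite (growth0 G) !mulr0.
have Iw : II w = 0.
  rewrite RintegralB// (RintegralZl _ mD iy) (RintegralZl _ mD iF).
  move: poh; move: (Rintegral _ _ _) (Rintegral _ _ _) => x z h.
  by rewrite -[RHS]h; ring.
have : ae_eq nu D (fun t => (w t)%:E) (cst 0%E).
  apply/ae_eq_integral_abs => //.
    by apply/measurable_EFinP; exact: rintegrable_measurable iw.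
  transitivity (\int[nu]_(t in D) (w t)%:E)%E.
    by apply: eq_integral => t _; rewrite /= ger0_norm.
  by rewrite (rint_lim mD iw) Iw.
move=> wae; have v0 : {ae nu, forall t, D t -> v t = 0}.
  apply: filterS wae => t h Dt; have [//|vn] := eqVneq (v t) 0.
  have [wt] := h Dt; have := beta_upper vn; rewrite -subr_gt0 -/(w t) wt ltxx.
  by [].
have K0' r : 0 < r -> K v r = 0.
  by move=> r0; rewrite (K_ae lv (L20 N) r0 v0) K0.
have : PP (K v) = 0.
  rewrite /PP (@eq_rint _ _ _ nu D _ (fun=> 0)).
    by rewrite Rintegral_cst ?mul0r.
  by move=> t /halflineE t0; rewrite K0'// normr0 powR0// gt_eqF// (lt_trans _ p2).
by move=> PE; rewrite PE ltxx in P0.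
Qed.

End Pohozaev.

(** * Regularity at the origin *)

Section Regularity.
Context {R : realType}.
Variable N : nat.
Hypothesis N3 : (3 <= N)%N.
Let N0 : (0 < N)%N. Proof. exact: leq_trans N3. Qed.
Variables p : R.
Hypothesis p2 : 2 < p.
Local Notation nu := (@radial_measure R N).
Local Notation D := (@halfline R).
Local Notation a := (@half_exp R N).
Hypothesis apN : a * p < N%:R.
Local Notation f := (fp p).
Local Notation rig := (rintegrable nu D).
Local Notation II g := (\int[nu]_(t in D) g t)%R.
Local Notation K := (@K R N).
Local Notation L2 := (@L2 R N).
Local Notation nrm := (@nrm R N).
Local Notation Kc := (@Kcst R N N3).
Local Notation cb := (@ball_vol R N).
Variables (Phi beta : R -> R) (c th : R).
Hypothesis G : growth Phi beta c th.
Variable m : R.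
Hypothesis m0 : 0 < m.
Let mD := @measurable_halfline R.
Local Notation adm := (@adm R N Phi m).
Let moc (s t : R) : measurable (`]s, t]%classic : set (measurableTypeR R)).
Proof. exact: measurable_itv. Qed.
Variables (lam : R) (v : R -> R).
Hypothesis av : adm v.
Hypothesis sv : solves N p beta lam v.
Local Notation u := (K v).
Local Notation g := (src N p v lam).
Local Notation H := (lowprim N g).
Let c0 : 0 < c := growth_c G.
Let a0 : 0 < a. Proof. exact: half_exp_gt0. Qed.
Let aE : 2 * a = N%:R - 2. Proof. by rewrite /half_exp mulrC divfK. Qed.
Let lv : L2 v. Proof. by case: av. Qed.
Let kc : R := (cb * N%:R)^-1.
Let kc0 : 0 < kc. Proof. by rewrite invr_gt0 cN_gt0. Qed.

Lemma solution_continuous (t : R) : 0 < t -> {for t, continuous v}.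
Proof. by move=> t0; apply: (solves_continuous N3 p2 apN G av sv). Qed.

Lemma v_flux t : 0 < t -> `|v t| <= c^-1 * (kap N t * `|H t|).
Proof.
move=> t0; have := beta_expand G (v t) 0; rewrite (beta_zero G) !subr0 sv//.
by rewrite normrN normrM [`|kap N t|]ger0_norm ?kap_ge0// -ler_pdivlMl.
Qed.

(** The singularity of u at the origin has order at most s. The bootstrap lowers s from (N-2)/2 to
    0. *)
Let near0 (s : R) := exists2 C, 0 <= C & forall r, 0 < r -> r <= 1 -> `|u r| <= C * r `^ (- s).

Lemma powR_anti (t x y : R) : 0 < t -> t <= 1 -> y <= x -> t `^ x <= t `^ y.
Proof.
move=> t0 t1 yx; have -> : x = y + (x - y) by ring.
rewrite powRDp// -[X in _ <= X]mulr1 ler_wpM2l ?powR_ge0//.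
have e1 : (1 : R) `^ (x - y) = 1 by rewrite powR1.
by rewrite -e1; apply: ge0_ler_powR; rewrite ?nnegrE ?subr_ge0// ltW.
Qed.

(** The source is O(r^(-s(p-1))); its integral over the ball of radius t divided by the area of the
    sphere gains one power of t. *)
Lemma near0_flux s : 0 <= s -> s * (p - 1) < N%:R -> near0 s ->
  exists2 C, 0 <= C & forall t, 0 < t -> t <= 1 -> `|v t| <= C * t `^ (1 - s * (p - 1)).
Proof.
move=> s0 sN [C C0 hC]; have hp := p2.
have e0 : 0 <= s * (p - 1) by rewrite mulr_ge0//; lra.
have [C2 C20 h2] := rint_powR_small N3 e0 sN.
pose C1 := C `^ (p - 1) + `|lam| * C.
have C10 : 0 <= C1 by rewrite addr_ge0 ?powR_ge0// mulr_ge0.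
have gb r : 0 < r -> r <= 1 -> `|g r| <= C1 * r `^ (- (s * (p - 1))).
  move=> r0 r1; have hu := hC r r0 r1; rewrite /src; apply: (le_trans (ler_normB _ _)).
  rewrite fp_norm// normrM /C1 mulrDl; apply: lerD.
    rewrite -mulNr powRrM -powRM ?powR_ge0//; apply: ge0_ler_powR; rewrite ?nnegrE ?mulr_ge0 ?powR_ge0//.
    lra.
  rewrite -mulrA ler_wpM2l//; apply: (le_trans hu); rewrite ler_wpM2l//.
  by apply: powR_anti => //; rewrite lerN2 ler_peMr//; lra.
exists (c^-1 * (kc * (C1 * C2))).
  by apply: mulr_ge0; [rewrite invr_ge0; exact: ltW c0|apply: mulr_ge0; [exact: ltW kc0|exact: mulr_ge0]].
move=> t t0 t1; apply: (le_trans (v_flux t0)); rewrite -!mulrA ler_wpM2l ?invr_ge0 ?(ltW c0)//.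
rewrite /kap -?mulrA ler_wpM2l ?(ltW kc0)//.
have [i2 l2] := h2 t t0.
have hH : `|H t| <= C1 * (C2 * (t `^ (- (s * (p - 1))) * t ^+ N)).
  apply: (le_trans (le_normr_Rintegral (moc 0 t) (src_low N3 p2 apN lam av t0))).
  apply: (@le_trans _ _ (\int[nu]_(r in `]0, t]) (C1 * r `^ (- (s * (p - 1)))))).
    apply: (rint_le_sub (moc 0 t)).
    - by apply: rintegrable_norm; exact: (src_low N3 p2 apN lam av t0).
    - by apply: rintegrableZ.
    move=> r; rewrite /= in_itv/= => /andP[r0 rt]; apply: gb => //.
    exact: le_trans t1.
  by rewrite (RintegralZl _ (moc 0 t) i2) ler_wpM2l.
apply: (@le_trans _ _ (t `^ (- (N%:R - 1)) * (C1 * (C2 * (t `^ (- (s * (p - 1))) * t ^+ N))))).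
  by rewrite ler_wpM2l ?powR_ge0.
have -> : t `^ (1 - s * (p - 1)) = t `^ (- (N%:R - 1)) * (t `^ (- (s * (p - 1))) * t ^+ N).
  rewrite -powR_mulrn ?ltW// -!powRDp//; congr (_ `^ _); ring.
by rewrite le_eqVlt; apply/orP; left; apply/eqP; ring.
Qed.

Let K_incr (r : R) : 0 < r -> r <= 1 -> `|u r| <= `|u 1| + \int[nu]_(t in `]r, 1]) `|v t * kap N t|.
Proof.
move=> r0 r1; have E := K_diff N3 lv r0 r1.
have -> : u r = u 1 - (u 1 - u r) by ring.
apply: (le_trans (ler_normB _ _)); rewrite lerD2l E.
apply: le_normr_Rintegral => //; apply: (rintS _ _ _ (K_integrable N3 lv r0)) => //.
by move=> t; rewrite /= !in_itv/= => /andP[->].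
Qed.

Let vk_int (r : R) : 0 < r -> rintegrable nu `]r, 1] (fun t => `|v t * kap N t|).
Proof.
move=> r0; apply: rintegrable_norm; apply: (rintS _ _ _ (K_integrable N3 lv r0)) => //.
by move=> t; rewrite /= !in_itv/= => /andP[->].
Qed.

Lemma flux_near0 s C : 0 < s -> 0 <= C ->
  (forall t, 0 < t -> t <= 1 -> `|v t| <= C * t `^ (- 1 - s)) -> near0 s.
Proof.
move=> s0 C0 hC; have sN : N%:R < N%:R + s by rewrite ltrDl.
have [C3 C30 h3] := rint_powR_large N3 sN.
exists (`|u 1| + C * kc * C3); first by rewrite addr_ge0// !mulr_ge0// ltW.
move=> r r0 r1; apply: (le_trans (K_incr r0 r1)); rewrite mulrDl; apply: lerD.
  rewrite -[X in X <= _]mulr1 ler_wpM2l//.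
  by rewrite -[X in X <= _](powRr0 r); apply: powR_anti => //; rewrite oppr_le0 ltW.
have [i3 l3] := h3 r r0.
have sub : `]r, 1]%classic `<=` `]r, +oo[%classic.
  by move=> t; rewrite /= !in_itv/= => /andP[->].
have mray : measurable (`]r, +oo[%classic : set (measurableTypeR R)) by exact: measurable_itv.
have i3' := rintS (moc r 1) mray sub i3.
apply: (@le_trans _ _ (\int[nu]_(t in `]r, 1]) (C * kc * t `^ (- (N%:R + s))))).
  apply: (rint_le_sub (moc r 1) (vk_int r0)); first exact: rintegrableZ.
  move=> t; rewrite /= in_itv/= => /andP[rt t1]; have t0 := lt_trans r0 rt.
  rewrite normrM [`|kap N t|]ger0_norm ?kap_ge0// /kap -/kc.
  have -> : t `^ (- (N%:R + s)) = t `^ (- 1 - s) * t `^ (- (N%:R - 1)).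
    by rewrite -powRDp//; congr (_ `^ _); ring.
  have -> : C * kc * (t `^ (- 1 - s) * t `^ (- (N%:R - 1))) =
      C * t `^ (- 1 - s) * (kc * t `^ (- (N%:R - 1))) by ring.
  by apply: ler_wpM2r; [rewrite mulr_ge0 ?powR_ge0// ltW|exact: hC].
rewrite (RintegralZl _ (moc r 1) i3') -mulrA; apply: ler_wpM2l; first by rewrite mulr_ge0// ltW.
apply: (@le_trans _ _ (\int[nu]_(t in `]r, +oo[) t `^ (- (N%:R + s)))).
  by apply: rint_le_set => // t _; exact: powR_ge0.
apply: (le_trans l3); rewrite ler_wpM2l// -(powR_mulrn _ (ltW r0)) -powRDp//.
by rewrite le_eqVlt; apply/orP; left; apply/eqP; congr (_ `^ _); ring.
Qed.

(** One round of the bootstrap replaces s by s(p-1) - 2, a gain of 2 - s(p-2), at least [del] for s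
    <= a. Since 2a = N - 2, positivity of [del] is a p < N. *)
Let del : R := 2 - a * (p - 2).
Let del0 : 0 < del. Proof. by rewrite /del; have := apN; have := aE; nra. Qed.
(** A positive floor avoids the logarithm at exponent 0. At order 1/(p-1) or less the flux is
    bounded near the origin; the cap by [a] lets the induction start at [a]. *)
Let sig : R := Num.min a (p - 1)^-1.
Let sig0 : 0 < sig. Proof. by have hp := p2; rewrite lt_min a0 invr_gt0; lra. Qed.

Let near0_iter n : near0 (Num.max (a - n%:R * del) sig).
Proof.
have hp := p2; elim: n => [|n IH].
  rewrite mul0r subr0 max_l; last by rewrite ge_min lexx.
  exists (Kc * nrm v); first by rewrite mulr_ge0 ?Kcst_ge0 ?nrm_ge0.
  by move=> r r0 _; rewrite mulrAC; exact: K_bound.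
set s := Num.max (a - n%:R * del) sig in IH.
have s0 : 0 < s by rewrite lt_max sig0 orbT.
have sa : s <= a.
  by rewrite ge_max gerBl mulr_ge0 ?(ltW del0)//= ge_min lexx.
have sN : s * (p - 1) < N%:R.
  apply: (@le_lt_trans _ _ (a * (p - 1))); first by rewrite ler_wpM2r//; lra.
  by apply: lt_trans apN; rewrite ltr_pM2l//; lra.
have [C C0 hC] := near0_flux (ltW s0) sN IH.
set s' := Num.max (a - n.+1%:R * del) sig.
have s'0 : 0 < s' by rewrite lt_max sig0 orbT.
have ss : s - del <= s'.
  rewrite lerBlDr /s ge_max; apply/andP; split.
    rewrite -lerBlDr; have -> : a - n%:R * del - del = a - n.+1%:R * del by rewrite -natr1; ring.
    by rewrite /s' le_max lexx.
  apply: (@le_trans _ _ s'); first by rewrite le_max lexx orbT.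
  by rewrite lerDl ltW.
apply: (flux_near0 s'0 C0) => t t0 t1; apply: (le_trans (hC t t0 t1)); rewrite ler_wpM2l//.
apply: powR_anti => //.
have : s * (p - 2) <= a * (p - 2) by rewrite ler_wpM2r//; lra.
by move: ss; rewrite /del; nra.
Qed.

Let near0_sig : near0 sig.
Proof.
have := near0_iter (Num.truncn (a / del)).+1; rewrite max_r//.
have := truncnS_gt (a / del); rewrite ltr_pdivrMr// => h.
by apply: (@le_trans _ _ 0); [rewrite subr_le0 ltW|exact: ltW].
Qed.

Lemma solution_bounded_near0 : near0 0.
Proof.
have hp := p2; have p10 : 0 < p - 1 by lra.
have s1 : sig * (p - 1) <= 1.
  apply: (@le_trans _ _ ((p - 1)^-1 * (p - 1))); last by rewrite mulVf// gt_eqF.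
  by rewrite ler_wpM2r ?(ltW p10)// ge_min lexx orbT.
have N1 : (1 : R) < N%:R by rewrite ltr1n (leq_trans _ N3).
have [C C0 hC] := near0_flux (ltW sig0) (le_lt_trans s1 N1) near0_sig.
have e0 : 0 <= (N%:R - 1 : R) by rewrite subr_ge0 ltW.
have eN : (N%:R - 1 : R) < N%:R by rewrite ltrBlDr ltrDl.
have [C3 C30 /(_ 1 ltr01)[i3 l3]] := rint_powR_small N3 e0 eN.
exists (`|u 1| + C * kc * C3); first by rewrite addr_ge0// !mulr_ge0// ltW.
move=> r r0 r1; rewrite oppr0 powRr0 mulr1; apply: (le_trans (K_incr r0 r1)); rewrite lerD2l.
have sub : `]r, 1]%classic `<=` `]0, 1]%classic.
  by move=> t; rewrite /= !in_itv/= => /andP[rt ->]; rewrite (lt_trans r0).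
have i3' := rintS (moc r 1) (moc 0 1) sub i3.
apply: (@le_trans _ _ (\int[nu]_(t in `]r, 1]) (C * kc * t `^ (- (N%:R - 1))))).
  apply: (rint_le_sub (moc r 1) (vk_int r0)); first exact: rintegrableZ.
  move=> t; rewrite /= in_itv/= => /andP[rt t1]; have t0 := lt_trans r0 rt.
  rewrite normrM [`|kap N t|]ger0_norm ?kap_ge0// /kap -/kc -mulrA.
  apply: ler_wpM2r; first by rewrite mulr_ge0 ?powR_ge0// ltW.
  apply: (le_trans (hC t t0 t1)); rewrite -[X in _ <= X]mulr1 ler_wpM2l//.
  by rewrite -[X in _ <= X](powRr0 t); apply: powR_anti => //; rewrite subr_ge0.
rewrite (RintegralZl _ (moc r 1) i3') -!mulrA; apply: ler_wpM2l => //.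
have : \int[nu]_(t in `]r, 1]) t `^ (- (N%:R - 1)) <= \int[nu]_(t in `]0, 1]) t `^ (- (N%:R - 1)).
  by apply: rint_le_set => // t _; exact: powR_ge0.
rewrite powR1 expr1n !mulr1 in l3.
by move=> h; apply: ler_wpM2l; [exact: ltW|exact: le_trans l3].
Qed.

Lemma flux_linear : exists2 C, 0 <= C & forall t, 0 < t -> t <= 1 -> `|v t| <= C * t.
Proof.
have N0' : 0 * (p - 1) < N%:R :> R by rewrite mul0r ltr0n.
have [C C0 hC] := near0_flux (lexx 0) N0' solution_bounded_near0.
exists C => // t t0 t1; have := hC t t0 t1.
by rewrite mul0r subr0 powRr1// ltW.
Qed.

(** For t > 1, Cauchy-Schwarz and the mass bound give a lower primitive of order t^(N/2), and N - 1
    >= N/2. *)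
Lemma flux_bounded : exists2 V, 0 <= V & forall t, 0 < t -> `|v t| <= V.
Proof.
have [C C0 hC] := flux_linear.
pose M := Kc * nrm v.
have M0 : 0 <= M by rewrite mulr_ge0 ?Kcst_ge0 ?nrm_ge0.
pose A := M `^ (p - 2) + `|lam|.
have A0 : 0 <= A by rewrite addr_ge0 ?powR_ge0.
pose B := c^-1 * (kc * (`|H 1| + A * (Num.sqrt cb * Num.sqrt m))).
have B0 : 0 <= B.
  apply: mulr_ge0; first by rewrite invr_ge0; exact: ltW c0.
  apply: mulr_ge0; first exact: ltW kc0.
  by apply: addr_ge0 => //; apply: mulr_ge0 => //; apply: mulr_ge0; exact: sqrtr_ge0.
exists (Num.max C B); first by rewrite le_max C0.
move=> t t0; have [t1|t1] := leP t 1.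
  by apply: (le_trans (hC t t0 t1)); rewrite le_max ler_piMr.
apply: (@le_trans _ _ B); last by rewrite le_max lexx orbT.
have sub : `]1, t]%classic `<=` D.
  by move=> s; rewrite /= in_itv/= => /andP[s1 _]; apply/halflineE; exact: lt_trans s1.
have [[mv _] _ iu mu_] := av.
have mu1 : measurable_fun `]1, t] u.
  by apply: (measurable_funS mD sub); exact: measurable_K.
have iu2 : rintegrable nu `]1, t] (fun r => u r ^+ 2) by apply: rintS iu.
have [i1 E1] := rint_oc_cst N3 1 ler01 (ltW t1).
have i1' : rintegrable nu `]1, t] (fun r => (1 : R) ^+ 2) by rewrite expr1n.
have iu1 : rintegrable nu `]1, t] (fun r => u r * 1).
  exact: (rint_sqr_norm_le (moc 1 t) mu1 (measurable_cst _) iu2 i1').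
have cs := cauchy_schwarz (moc 1 t) mu1 (measurable_cst (1 : R)) iu2 i1'.
have hu : \int[nu]_(r in `]1, t]) `|u r * 1| <= Num.sqrt m * (Num.sqrt cb * t `^ (N%:R / 2)).
  apply: (le_trans cs); apply: ler_pM; rewrite ?sqrtr_ge0//.
    apply: ler_wsqrtr; apply: le_trans mu_; apply: rint_le_set => // r _; exact: sqr_ge0.
  have -> : \int[nu]_(r in `]1, t]) (1 : R) ^+ 2 = cb * (t ^+ N - 1 ^+ N).
    by rewrite expr1n E1 mul1r.
  rewrite -[t `^ _]ger0_norm ?powR_ge0// -sqrtr_sqr -sqrtrM ?(ltW (ball_vol_gt0 _))//.
  apply: ler_wsqrtr; rewrite ler_wpM2l ?(ltW (ball_vol_gt0 _))//.
  rewrite expr2 -powRDp//; have -> : N%:R / 2 + N%:R / 2 = N%:R :> R by field.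
  by rewrite powR_mulrn ?(ltW t0)// gerBl expr1n.
have gb r : 1 < r -> `|g r| <= A * `|u r * 1|.
  move=> r1; have r0 := lt_trans ltr01 r1.
  have -> : A * `|u r * 1| = M `^ (p - 2) * `|u r| + `|lam| * `|u r| by rewrite (mulr1 (u r)) /A mulrDl.
  rewrite -(normrM lam); apply: (le_trans (ler_normB _ _)); apply: lerD => //.
  rewrite fp_norm// powR_split// ler_wpM2r//.
  apply: ge0_ler_powR; rewrite ?nnegrE//; first by have hp := p2; lra.
  apply: (le_trans (K_bound N3 lv r0)); rewrite mulrAC -[X in _ <= X]mulr1 ler_wpM2l//.
  rewrite powRN invf_le1 ?powR_gt0//.
  by rewrite -[X in X <= _](powRr0 r) ler_powR// ltW.
have hH : `|H t| <= `|H 1| + A * (Num.sqrt m * (Num.sqrt cb * t `^ (N%:R / 2))).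
  have -> : H t = H 1 + (H t - H 1) by ring.
  apply: (le_trans (ler_normD _ _)); rewrite lerD2l.
  have ig := src_low N3 p2 apN lam av.
  have igt := lowprim_integrable ig ltr01 (ltW t1).
  rewrite (lowprim_diff ig ltr01 (ltW t1)); apply: (le_trans (le_normr_Rintegral (moc 1 t) igt)).
  apply: (@le_trans _ _ (\int[nu]_(r in `]1, t]) (A * `|u r * 1|))).
    apply: (rint_le_sub (moc 1 t) (rintegrable_norm igt)).
      by apply: rintegrableZ => //; exact: rintegrable_norm.
    by move=> r; rewrite /= in_itv/= => /andP[r1 _]; exact: gb.
  by rewrite (RintegralZl _ (moc 1 t) (rintegrable_norm iu1)) ler_wpM2l.
apply: (le_trans (v_flux t0)); rewrite /B ler_wpM2l ?invr_ge0 ?(ltW c0)//.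
rewrite /kap -/kc -mulrA ler_wpM2l ?(ltW kc0)//.
apply: (@le_trans _ _ (t `^ (- (N%:R / 2)) * `|H t|)).
  apply: ler_wpM2r => //; apply: ler_powR; first exact: ltW.
  rewrite lerN2; have : (3 : R) <= N%:R by rewrite ler_nat.
  by move: (N%:R : R) => n; lra.
apply: (@le_trans _ _ (t `^ (- (N%:R / 2)) * (`|H 1| + A * (Num.sqrt m * (Num.sqrt cb * t `^ (N%:R / 2)))))).
  by rewrite ler_wpM2l ?powR_ge0.
rewrite mulrDr; apply: lerD.
  rewrite -[X in _ <= X]mul1r ler_wpM2r// powRN invf_le1 ?powR_gt0//.
  by rewrite -[X in X <= _](powRr0 t) ler_powR// ?divr_ge0// ltW.
rewrite powRN; have tp : t `^ (N%:R / 2) != 0 by rewrite gt_eqF// powR_gt0.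
by rewrite le_eqVlt; apply/orP; left; apply/eqP; field.
Qed.

Lemma solution_bounded : exists2 U, 0 <= U & forall r, 0 < r -> `|u r| <= U.
Proof.
have [C C0 hC] := solution_bounded_near0.
have M0 : 0 <= Kc * nrm v by rewrite mulr_ge0 ?Kcst_ge0 ?nrm_ge0.
exists (Num.max C (Kc * nrm v)); first by rewrite le_max C0.
move=> r r0; have [r1|r1] := leP r 1.
  by apply: (le_trans (hC r r0 r1)); rewrite oppr0 powRr0 mulr1 le_max lexx.
apply: (le_trans (K_bound N3 lv r0)); rewrite le_max; apply/orP; right.
rewrite mulrAC -[X in _ <= X]mulr1 ler_wpM2l// powRN invf_le1 ?powR_gt0//.
by rewrite -[X in X <= _](powRr0 r) ler_powR// ltW.
Qed.

Lemma flux_le_linear : exists2 C, 0 <= C & forall t, 0 < t -> `|v t| <= C * t.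
Proof.
have [C C0 hC] := flux_linear; have [V V0 hV] := flux_bounded.
exists (Num.max C V); first by rewrite le_max C0.
move=> t t0; have [t1|t1] := leP t 1.
  by apply: (le_trans (hC t t0 t1)); rewrite ler_wpM2r ?(ltW t0)// le_max lexx.
apply: (le_trans (hV t t0)); apply: (@le_trans _ _ (Num.max C V)); first by rewrite le_max lexx orbT.
by rewrite ler_peMr ?(ltW t1)// le_max C0.
Qed.

(** [K v 0] is minus the integral over the whole half-line, which converges because of the linear
    bound on v; the profile therefore already has the right value at the origin. *)
Lemma solution_near0 : exists2 C, 0 <= C & forall r, 0 < r -> `|u r - u 0| <= C * r ^+ 2.
Proof.
have [C C0 hC] := flux_le_linear.
have e0 : 0 <= (N%:R - 2 : R).
  by rewrite subr_ge0 ler_nat (leq_trans _ N3).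
have eN : (N%:R - 2 : R) < N%:R by rewrite ltrBlDr ltrDl.
have [C3 C30 h3] := rint_powR_small N3 e0 eN.
have bd t : 0 < t -> `|v t * kap N t| <= C * kc * t `^ (- (N%:R - 2)).
  move=> t0; rewrite normrM [`|kap N t|]ger0_norm ?kap_ge0// /kap -/kc.
  have -> : t `^ (- (N%:R - 2)) = t * t `^ (- (N%:R - 1)).
    rewrite -{2}(powRr1 (ltW t0)) -powRDp//; congr (_ `^ _); ring.
  have -> : C * kc * (t * t `^ (- (N%:R - 1))) = C * t * (kc * t `^ (- (N%:R - 1))) by ring.
  by apply: ler_wpM2r; [rewrite mulr_ge0 ?powR_ge0// ltW|exact: hC].
have ck t : 0 < t -> {for t, continuous (fun t => v t * kap N t)}.
  move=> t0; apply: cvgM; first exact: solution_continuous.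
  by apply: cvgM; [exact: cvg_cst|exact: powR_continuous_at].
have mk : measurable_fun D (fun t => v t * kap N t).
  apply: open_continuous_measurable_fun; first exact: interval_open.
  by move=> r; rewrite inE => /halflineE r0; exact: ck.
have sub0 r : 0 < r -> `]0, r]%classic `<=` D.
  by move=> r0 s; rewrite /= in_itv/= => /andP[s0 _]; apply/halflineE.
have i0 r : 0 < r -> rintegrable nu `]0, r] (fun t => v t * kap N t).
  move=> r0; have [i3 _] := h3 r r0; apply: (@rintegrable_le _ _ _ _ _ (moc 0 r) _ (fun t => C * kc * t `^ (- (N%:R - 2)))).
  - exact: (measurable_funS mD (sub0 r r0)).
  - exact: rintegrableZ.
  - by move=> t; rewrite /= in_itv/= => /andP[t0 _]; exact: bd.
exists (C * kc * C3); first by rewrite !mulr_ge0// ltW.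
move=> r r0; have [i3 l3] := h3 r r0.
have E : u r - u 0 = \int[nu]_(t in `]0, r]) (v t * kap N t).
  have mray : measurable (`]r, +oo[%classic : set (measurableTypeR R)) by exact: measurable_itv.
  have raysub : `]r, +oo[%classic `<=` D.
    by move=> t; rewrite /= in_itv/= andbT => rt; apply/halflineE; exact: lt_trans rt.
  have iA : rig (fun t => if t <= r then v t * kap N t else 0).
    apply: (rint_extend (moc 0 r) (sub0 r r0)).
      by move=> t /halflineE t0; rewrite /= in_itv/= t0 /=; case: ifP.
    by apply: eq_rintegrable (i0 r r0) => // t; rewrite /= in_itv/= => /andP[_ ->].
  have iB : rig (fun t => if t <= r then 0 else v t * kap N t).
    apply: (rint_extend mray raysub).
      by move=> t /halflineE t0; rewrite /= in_itv/= andbT ltNge; case: (t <= r).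
    by apply: eq_rintegrable (K_integrable N3 lv r0) => // t; rewrite /= in_itv/= andbT ltNge => /negbTE ->.
  have iD : rig (fun t => v t * kap N t).
    apply: eq_rintegrable (rintegrableD mD iA iB) => // t _.
    by case: ifP; rewrite ?addr0 ?add0r.
  have -> : u 0 = - \int[nu]_(t in D) (v t * kap N t) by [].
  rewrite (halfline_split r0) Rintegral_setU//; first by rewrite /K; ring.
    by rewrite -(halfline_split r0).
  rewrite disj_set2E; apply/eqP/seteqP; split => // t /=.
  by rewrite !in_itv/= andbT => -[/andP[_ ts]]; rewrite ltNge ts.
rewrite E; apply: (le_trans (le_normr_Rintegral (moc 0 r) (i0 r r0))).
apply: (@le_trans _ _ (\int[nu]_(t in `]0, r]) (C * kc * t `^ (- (N%:R - 2))))).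
  apply: (rint_le_sub (moc 0 r) (rintegrable_norm (i0 r r0))); first exact: rintegrableZ.
  by move=> t; rewrite /= in_itv/= => /andP[t0 _]; exact: bd.
rewrite (RintegralZl _ (moc 0 r) i3) -[X in _ <= X]mulrA; apply: ler_wpM2l; first by rewrite mulr_ge0// ltW.
apply: (le_trans l3); rewrite ler_wpM2l// -(powR_mulrn N (ltW r0)) -powRDp//.
have -> : - (N%:R - 2) + N%:R = 2%:R :> R by ring.
by rewrite powR_mulrn ?(ltW r0).
Qed.

End Regularity.

(** * Integration by parts in R^N *)

Section Translation.
Context {R : realType}.
Local Notation leb := (@lebesgue_measure R).
Local Notation mu := (@lebesgue_rV R).

Lemma lebesgue_shift (s : R) (g : R -> \bar R) :
  measurable_fun setT g -> (forall t, 0 <= g t)%E ->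
  (\int[leb]_t g (s + t)%R = \int[leb]_t g t)%E.
Proof.
move=> mg g0.
have mphi : measurable_fun [set: measurableTypeR R] (fun t : measurableTypeR R => s + t : measurableTypeR R).
  exact: measurable_funD.
have [m mE] := exists_image_measure leb mphi.
have lebE A : measurable A -> leb A = m A.
  move=> mA; apply: lebesgue_measure_unique => // X [[a b] _ <-] /=.
  rewrite mE.
  have -> : (fun t => s + t) @^-1` [set` `]a, b]] = [set` `]a - s, b - s]].
    by apply/seteqP; split => t /=; rewrite !in_itv/= ltrBlDl lerBrDl.
  rewrite lebesgue_measure_itv [X in (_ = X)%E](lebesgue_measure_itv `]a - s, b - s])/= !lte_fin.
  rewrite ltrD2r; case: ifPn => _ //.
  by rewrite -!EFinB; congr EFin; ring.
rewrite -(@ge0_integral_image _ _ _ _ _ leb m (fun t => s + t))//.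
by apply: eq_measure_integral => A mA _; rewrite -lebE.
Qed.

Lemma measurable_rV_shift n (a : 'rV[R]_n) : measurable_fun setT (fun x : 'rV[R]_n => a + x).
Proof.
apply: measurable_fun_rV => i; under eq_fun do rewrite mxE.
by apply: measurable_funD => //; exact: measurable_coord.
Qed.

Lemma shift_rV_cons n (h t : R) (x : 'rV[R]_n) (i : 'I_n.+1) :
  h *: delta_mx ord0 i + rV_cons (t, x) =
  if unlift ord0 i is Some j then rV_cons (t, h *: delta_mx ord0 j + x) else rV_cons (h + t, x).
Proof.
case: unliftP => [j ->|->]; apply/rowP => k; rewrite !mxE; case: unliftP => [l ->|->] /=.
- by rewrite !mxE eqxx (inj_eq lift_inj).
- by rewrite mulr0 add0r.
- by rewrite mulr0 add0r.
- by rewrite mulr1.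
Qed.

(** Shifts along one axis suffice for partial derivatives; by Tonelli the axis is either the first
    factor or handled by induction in the second. *)
Lemma lebesgue_rV_shift n (i : 'I_n) (h : R) (g : 'rV[R]_n -> \bar R) :
  measurable_fun setT g -> (forall x, 0 <= g x)%E ->
  (\int[mu n]_x g (h *: delta_mx ord0 i + x)%R = \int[mu n]_x g x)%E.
Proof.
elim: n i g => [[]//|n IH] i g mg g0.
have ms := measurableT_comp mg (measurable_rV_shift (h *: delta_mx ord0 i)).
rewrite rV_tonelli// [RHS]rV_tonelli//.
have mc : measurable_fun setT (fun z : R * 'rV[R]_n => g (rV_cons z)).
  exact: measurableT_comp mg (@measurable_rV_cons R n).
case E : (unlift ord0 i) => [j|].
  apply: eq_integral => t _.
  under eq_integral do rewrite shift_rV_cons E.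
  by rewrite (IH j (fun x => g (rV_cons (t, x))))//; exact: measurableT_comp mc (measurable_pair1 _).
under eq_integral => t _ do under eq_integral do rewrite shift_rV_cons E.
apply: (lebesgue_shift h (g := fun t => (\int[mu n]_x g (rV_cons (t, x)))%E)).
  by apply: (@measurable_fun_fubini_tonelli_F _ _ _ _ _ (mu n) (fun z => g (rV_cons z))).
by move=> t; apply: integral_ge0.
Qed.

Lemma integral_rV_shift n (i : 'I_n) (h : R) (f : 'rV[R]_n -> R) :
  measurable_fun setT f ->
  \int[mu n]_x f (h *: delta_mx ord0 i + x) = \int[mu n]_x f x.
Proof.
move=> mf; rewrite /Rintegral integralE [in RHS]integralE.
have mE : measurable_fun setT (EFin \o f) by exact/measurable_EFinP.
congr fine; congr (_ - _)%E.
  transitivity (\int[mu n]_x ((EFin \o f)^\+ (h *: delta_mx ord0 i + x)%R))%E; first by apply: eq_integral => x _; rewrite !funeposE.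
  by rewrite (lebesgue_rV_shift i h (measurable_funepos mE)).
transitivity (\int[mu n]_x ((EFin \o f)^\- (h *: delta_mx ord0 i + x)%R))%E; first by apply: eq_integral => x _; rewrite !funenegE.
by rewrite (lebesgue_rV_shift i h (measurable_funeneg mE)).
Qed.

End Translation.

Section LineDerivative.
Context {R : realType}.
Variable n : nat.
Implicit Types (f : 'rV[R]_n -> R) (x v : 'rV[R]_n).

Lemma derive_line f x v (h df : R) : is_derive (h *: v + x) v f df ->
  is_derive h 1 (fun h => f (h *: v + x)) df.
Proof.
have E : (fun k => k^-1 *: (((fun h => f (h *: v + x)) \o shift h) (k *: 1) - f (h *: v + x))) =
    (fun k => k^-1 *: ((f \o shift (h *: v + x)) (k *: v) - f (h *: v + x))).
  by apply/funext => k /=; rewrite addrA -scalerDl [k *: 1]mulr1.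
by case=> d e; split; rewrite /derivable /derive E.
Qed.

Lemma line_derive f x v (df : R) : is_derive (0 : R) 1 (fun h => f (h *: v + x)) df ->
  is_derive x v f df.
Proof.
have E : (fun k => k^-1 *: (((fun h => f (h *: v + x)) \o shift 0) (k *: 1) - f (0 *: v + x))) =
    (fun k => k^-1 *: ((f \o shift x) (k *: v) - f x)).
  by apply/funext => k /=; rewrite scale0r add0r addr0 [k *: 1]mulr1.
by case=> d e; split; [move: d|rewrite -e]; rewrite /derivable /derive E.
Qed.

End LineDerivative.

Section IntegrationByParts.
Context {R : realType}.
Local Notation mu := (@lebesgue_rV R).

(** Continuity bridges the exceptional point: the mean value theorem applies on either side of
    it. *)
Lemma lipschitz_except (f f' : R -> R) (M z : R) : continuous f ->
  (forall t, t != z -> is_derive t 1 f (f' t)) -> (forall t, `|f' t| <= M) ->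
  forall a b, a <= b -> `|f b - f a| <= M * (b - a).
Proof.
move=> cf df bf.
have H a b : a <= b -> ~ (a < z < b) -> `|f b - f a| <= M * (b - a).
  rewrite le_eqVlt => /orP[/eqP ->|ab] nz; first by rewrite !subrr normr0 mulr0.
  have [t tab|t _ ->] := @MVT R f f' a b ab _ (continuous_subspaceT cf).
    by apply: df; apply/eqP => tz; apply: nz; move: tab; rewrite tz in_itv.
  by rewrite normrM [`|b - a|]ger0_norm ?subr_ge0 ?(ltW ab)// ler_wpM2r// subr_ge0 ltW.
move=> a b ab; case: (pselect (a < z < b)) => [/andP[az zb]|]; last exact: H.
have h1 : `|f z - f a| <= M * (z - a) by apply: H; rewrite ?ltW// ltxx andbF => -[].
have h2 : `|f b - f z| <= M * (b - z) by apply: H; rewrite ?ltW// ltxx => -[].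
have -> : f b - f a = (f z - f a) + (f b - f z) by ring.
apply: (le_trans (ler_normD _ _)); apply: (le_trans (lerD h1 h2)).
by rewrite -mulrDr; have -> : z - a + (b - z) = b - a by ring.
Qed.

Variables (n : nat) (i : 'I_n).
Local Notation e := (delta_mx ord0 i : 'rV[R]_n).
Local Notation rig := (rintegrable (mu n) setT).

Lemma cube_integrable (f : 'rV[R]_n -> R) (L M : R) : measurable_fun setT f ->
  (forall x, ~ cube (- L) L x -> f x = 0) -> (forall x, `|f x| <= M) -> rig f.
Proof.
move=> mf f0 fM.
have L0 : - `|L| <= `|L| by rewrite ge0_cp.
have sub : cube (- L) L `<=` @cube R n (- `|L|) `|L|.
  move=> x cx j; have := cx j; rewrite -!ler_norml => h; apply: (le_trans h); exact: ler_norm.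
have mc := @measurable_cube R n (- `|L|) `|L|.
have i1 : rig (fun x => M * \1_(cube (- `|L|) `|L|) x).
  apply: rintegrableZ => //; apply/integrableP; split.
    by apply/measurable_EFinP; exact: measurable_indic.
  under eq_integral do rewrite /= ger0_norm//.
  rewrite integral_indic// setIT.
  apply: (@le_lt_trans _ _ ((`|L| - - `|L|) ^+ n)%:E); last exact: ltry.
  by rewrite -(cube_measure n L0); exact: lexx.
apply: (rintegrable_le measurableT mf i1) => x _.
rewrite indicE; case: (pselect (cube (- `|L|) `|L| x)) => h.
  by rewrite mem_set// mulr1.
by rewrite f0 ?normr0 ?memNset// ?mulr0// => /sub.
Qed.

Lemma null_point : {ae mu n, forall x, x != 0}.
Proof.
exists (@cube R n 0 0); split; first exact: measurable_cube.
  rewrite (cube_measure n (lexx 0)) subrr expr0n.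
  by have [|//] := eqVneq n 0%N; case: n i => // -[].
by move=> x /= /negP; rewrite negbK => /eqP -> j; rewrite mxE lexx.
Qed.

(* Difference quotients have zero integral by translation invariance; dominated
   convergence transfers this to F'. Lines through 0 lose at most one point. *)
Lemma integral_derive0 (F F' : 'rV[R]_n -> R) (L M : R) : continuous F ->
  measurable_fun setT F' -> (forall x, ~ cube (- L) L x -> F x = 0) ->
  (forall x, ~ cube (- L) L x -> F' x = 0) -> (forall x, x != 0 -> is_derive x e F (F' x)) ->
  (forall x, `|F' x| <= M) -> rig F' /\ \int[mu n]_x F' x = 0.
Proof.
move=> cF mF' F0 F'0 dF bF'.
have M0 : 0 <= M by apply: le_trans (bF' 0).
have lip x h : 0 <= h -> `|F (h *: e + x) - F x| <= M * h.
  move=> h0; rewrite -[in X in _ - F X](add0r x) -(scale0r e) -[in X in _ <= M * X](subr0 h).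
  apply: (@lipschitz_except (fun h => F (h *: e + x)) (fun h => F' (h *: e + x)) M (- x ord0 i)) => //.
    move=> t; apply: continuous_comp; last exact: cF.
    by apply: cvgD; [apply: cvgZl; exact: cvg_id|exact: cvg_cst].
  move=> t tx; apply: derive_line; apply: dF; apply/eqP => /rowP/(_ i); rewrite !mxE !eqxx mulr1.
  by move/eqP; rewrite addr_eq0 (negbTE tx).
pose h k : R := k.+1%:R^-1.
have h0 k : 0 < h k by rewrite invr_gt0.
pose Q k x := (h k)^-1 * (F (h k *: e + x) - F x).
have mF : measurable_fun setT F by exact: continuous_measurable_rV.
have mS k : measurable_fun setT (fun x => F (h k *: e + x)).
  exact: measurableT_comp mF (measurable_rV_shift _).
have mQ k : measurable_fun setT (Q k) by apply: measurable_funM => //; exact: measurable_funB.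
(* A shift by 2|L| + 1 along the axis leaves the support, so the Lipschitz bound along lines bounds
   F itself. *)
have FM : exists MF, forall x, `|F x| <= MF.
  exists (M * (2 * `|L| + 1)) => x.
  have hL0 : 0 <= 2 * `|L| + 1 by rewrite addr_ge0// mulr_ge0.
  case: (pselect (cube (- L) L x)) => cx; last by rewrite F0// normr0 mulr_ge0.
  have nF : F ((2 * `|L| + 1) *: e + x) = 0.
    apply: F0 => cx'; have := cx i; have := cx' i; rewrite !mxE !eqxx mulr1.
    by have := ler_norm L; lra.
  by have := lip x _ hL0; rewrite nF sub0r normrN.
have [MF FMF] := FM.
have h1 k : h k <= 1 by rewrite invf_le1// ler1n.
have shiftout k x : ~ cube (- (L + 1)) (L + 1) x -> ~ cube (- L) L (h k *: e + x).
  move=> nc cx; apply: nc => j; have := cx j; rewrite !mxE eqxx /= => /andP[l1 l2].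
  have := h1 k; have := ltW (h0 k); move: l1 l2; move: (h k) => hk; case: (j == i) => /=; rewrite ?mulr1 ?mulr0 => *; apply/andP; split; lra.
have out x : ~ cube (- (L + 1)) (L + 1) x -> ~ cube (- L) L x.
  move=> nc cx; apply: nc => j; have := cx j => /andP[l1 l2]; apply/andP; split; lra.
have iS k : rig (fun x => F (h k *: e + x)).
  by apply: (@cube_integrable _ (L + 1) MF) => // x /shiftout sx; exact: F0.
have iF : rig F by exact: (@cube_integrable _ L MF).
have Q0 k : \int[mu n]_x Q k x = 0.
  rewrite (RintegralZl _ measurableT (rintegrableB measurableT (iS k) iF)) RintegralB//; last exact: iS.
  by rewrite integral_rV_shift// subrr mulr0.
have ig : rig (fun x => M * \1_(cube (- (L + 1)) (L + 1)) x).
  apply: (@cube_integrable _ (L + 1) M).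
  - by apply: measurable_funM => //; exact: measurable_indic (measurable_cube _ _).
  - by move=> x nx; rewrite indicE memNset// mulr0.
  - by move=> x; rewrite indicE; case: (_ \in _); rewrite ?mulr1 ?mulr0 ?normr0// ger0_norm.
have QM (k : nat) x : setT x -> `|Q k x| <= M * \1_(cube (- (L + 1)) (L + 1)) x.
  move=> _; rewrite indicE /Q; case: (pselect (cube (- (L + 1)) (L + 1) x)) => cx.
    rewrite mem_set// mulr1 normrM ger0_norm ?invr_ge0 ?(ltW (h0 k))//.
    by rewrite ler_pdivrMl// mulrC; exact: lip (ltW (h0 k)).
  by rewrite memNset// mulr0 F0 ?F0 ?subrr ?mulr0 ?normr0//; [exact: out|exact: shiftout].
have Qc : {ae mu n, forall x, setT x -> Q k x @[k --> \oo] --> F' x}.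
  apply: filterS null_point => x x0 _; have [d E] := dF x x0.
  have hc : h k @[k --> \oo] --> (0 : R)^'.
    move=> A nA; have nA' : \forall k \near \oo, h k != 0 -> A (h k) := cvg_harmonic nA.
    by apply: filterS nA' => k; apply; rewrite gt_eqF.
  have dc : (fun k => k^-1 *: ((F \o shift x) (k *: e) - F x)) k @[k --> (0 : R)^'] --> F' x.
    by rewrite -E; exact: d.
  exact: (cvg_comp _ _ hc dc).
have [iF' lF'] := rint_dct measurableT mQ mF' ig QM Qc.
split=> //; rewrite -(cvg_lim (@Rhausdorff R) lF').
by under eq_fun do rewrite Q0; exact: lim_cst.
Qed.

End IntegrationByParts.

Section TestFunctions.
Context {R : realType}.
Variable n : nat.
Local Notation mu := (@lebesgue_rV R n).
Local Notation rig := (rintegrable mu setT).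
Local Notation e i := (delta_mx ord0 i : 'rV[R]_n).
Implicit Types (phi : 'rV[R]_n -> R) (x : 'rV[R]_n).

Lemma line_continuous (x v : 'rV[R]_n) : continuous (fun h : R => h *: v + x).
Proof. by move=> h; apply: cvgD; [apply: cvgZl; exact: cvg_id|exact: cvg_cst]. Qed.

Lemma test_is_derive phi x i : test_function phi -> is_derive x (e i) phi (grad phi x ord0 i).
Proof.
move=> [cph _]; have [_ /(_ i)[d _]] := cph 1%N.
by rewrite mxE; split.
Qed.

Lemma test_grad_continuous phi i : test_function phi -> continuous (fun x => grad phi x ord0 i).
Proof.
move=> [cph _]; have [_ /(_ i)[_ [c _]]] := cph 1%N.
by under eq_fun do rewrite mxE.
Qed.

Lemma test_continuous phi : test_function phi -> continuous phi.
Proof. by move=> [cph _]; case: (cph 0%N). Qed.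

Lemma bounded_real_set (A : set R) : compact A -> exists2 B, 0 <= B & forall a, A a -> `|a| <= B.
Proof.
move=> cA; have [M [_ hM]] := compact_bounded cA.
by exists (`|M| + 1); [rewrite addr_ge0|apply: hM; rewrite (le_lt_trans (ler_norm M))// ltrDl].
Qed.

Lemma test_bounds phi : test_function phi -> exists L B : R, [/\ 0 <= B,
  forall x, ~ cube (- L) L x -> phi x = 0 /\ forall i, grad phi x ord0 i = 0,
  forall x, `|phi x| <= B & forall x i, `|grad phi x ord0 i| <= B].
Proof.
move=> tp; have [_ cS] := tp; pose S := closure [set x | phi x != 0].
have cpt (f : 'rV[R]_n -> R) : continuous f -> compact (f @` S).
  by move=> cf; apply: continuous_compact => //; exact: continuous_subspaceT.
have /choice[Lf hLf] : forall j, exists M, forall x, S x -> `|x ord0 j| <= M.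
  move=> j; have [M _ hM] := bounded_real_set (cpt _ (@coord_continuous R 1 n ord0 j)).
  by exists M => x Sx; apply: hM; exists x.
have sumL j : Lf j <= \sum_j `|Lf j|.
  by apply: (le_trans (ler_norm _)); rewrite (bigD1 j)//= lerDl sumr_ge0.
have Sc x : ~ S x -> phi x = 0.
  by move=> nS; apply/eqP/negPn/negP => px; apply: nS; exact: subset_closure.
have Sg x i : ~ S x -> grad phi x ord0 i = 0.
  move=> nS; have d := test_is_derive x i tp.
  have d1 : is_derive (0 : R) 1 (fun h => phi (h *: e i + x)) (grad phi x ord0 i).
    by apply: derive_line; rewrite scale0r add0r.
  have oS : open (~` S) by apply: closed_openC; exact: closed_closure.
  (* The complement of the closed support is open, so phi vanishes on a short segment through x. *)
  have nb : \forall h \near (0 : R), phi (h *: e i + x) = 0.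
    have : nbhs (0 *: e i + x) (~` S) by rewrite scale0r add0r; exact: open_nbhs_nbhs.
    move=> nS'; have nS2 : \forall h \near (0 : R), (~` S) (h *: e i + x) := @line_continuous x (e i) 0 _ nS'.
    by apply: filterS nS2 => h; exact: Sc.
  have d0 := derive_near nb d1.
  by case: d0 => _ <-; exact: derive_cst.
have [B0 B00 hB0] := bounded_real_set (cpt _ (test_continuous tp)).
have /choice[Bf hBf] : forall j, exists M, forall x, S x -> `|grad phi x ord0 j| <= M.
  move=> j; have [M _ hM] := bounded_real_set (cpt _ (@test_grad_continuous phi j tp)).
  by exists M => x Sx; apply: hM; exists x.
have s0 : 0 <= \sum_j `|Bf j| by apply: sumr_ge0.
exists (\sum_j `|Lf j|), (B0 + \sum_j `|Bf j|); split; first exact: addr_ge0.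
- move=> x nc; have nS : ~ S x.
    move=> Sx; apply: nc => j; rewrite -ler_norml; exact: le_trans (hLf j x Sx) (sumL j).
  by split=> [|i]; [exact: Sc|exact: Sg].
- move=> x; case: (pselect (S x)) => Sx; last by rewrite Sc// normr0 addr_ge0.
  by apply: (@le_trans _ _ B0); [apply: hB0; exists x|rewrite lerDl].
- move=> x i; case: (pselect (S x)) => Sx; last by rewrite Sg// normr0 addr_ge0.
  apply: (le_trans (hBf i x Sx)); apply: (le_trans (ler_norm _)).
  rewrite (bigD1 i)//= -[X in X <= _]add0r; apply: lerD => //.
  by rewrite lerDl sumr_ge0.
Qed.

Lemma ibp_test (i : 'I_n) (w dw phi : 'rV[R]_n -> R) (Bw Bd : R) :
  continuous w -> measurable_fun setT dw -> (forall x, x != 0 -> is_derive x (e i) w (dw x)) ->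
  (forall x, `|w x| <= Bw) -> (forall x, `|dw x| <= Bd) -> test_function phi ->
  [/\ rig (fun x => w x * grad phi x ord0 i), rig (fun x => dw x * phi x) &
      \int[mu]_x (w x * grad phi x ord0 i) = - \int[mu]_x (dw x * phi x)].
Proof.
move=> cw mdw dd bw bd tp; have [L [B [B0 out pB gB]]] := test_bounds tp.
have mw := continuous_measurable_rV cw.
have mp := continuous_measurable_rV (test_continuous tp).
have mg := continuous_measurable_rV (@test_grad_continuous phi i tp).
have Bw0 : 0 <= Bw by apply: le_trans (bw 0).
have Bd0 : 0 <= Bd by apply: le_trans (bd 0).
have b1 x : `|w x * grad phi x ord0 i| <= Bw * B by rewrite normrM ler_pM.
have b2 x : `|dw x * phi x| <= Bd * B by rewrite normrM ler_pM.
have i1 : rig (fun x => w x * grad phi x ord0 i).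
  apply: (@cube_integrable R n _ L (Bw * B)) => //; first exact: measurable_funM.
  by move=> x /out[_ ->]; rewrite mulr0.
have i2 : rig (fun x => dw x * phi x).
  apply: (@cube_integrable R n _ L (Bd * B)) => //; first exact: measurable_funM.
  by move=> x /out[-> _]; rewrite mulr0.
split=> //; apply/eqP; rewrite -addr_eq0 -RintegralD//; apply/eqP.
apply: (proj2 (@integral_derive0 R n i (fun x => w x * phi x) _ L (Bw * B + Bd * B) _ _ _ _ _ _)).
- move=> x; have c1 : w y @[y --> x] --> w x := cw x.
  have c2 : phi y @[y --> x] --> phi x := test_continuous tp (x := x).
  exact: cvgM c1 c2.
- by apply: measurable_funD; exact: measurable_funM.
- by move=> x /out[-> _]; rewrite mulr0.
- by move=> x /out[-> ->]; rewrite !mulr0 addr0.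
- move=> x x0; apply: line_derive.
  have d1 : is_derive (0 : R) 1 (fun h => w (h *: e i + x)) (dw x).
    by apply: derive_line; rewrite scale0r add0r; exact: dd.
  have d2 : is_derive (0 : R) 1 (fun h => phi (h *: e i + x)) (grad phi x ord0 i).
    by apply: derive_line; rewrite scale0r add0r; exact: test_is_derive.
  apply: derive_eq (derive_mul d1 d2) _.
  by rewrite !scale0r !add0r; ring.
- by move=> x; apply: (le_trans (ler_normD _ _)); exact: lerD.
Qed.

End TestFunctions.

Lemma sum_continuous {R : realType} (T : topologicalType) (I : Type) (s : seq I) (F : I -> T -> R) :
  (forall i, continuous (F i)) -> continuous (fun x => \sum_(i <- s) F i x).
Proof.
move=> cF; elim: s => [|i s IH].
  by rewrite (_ : (fun x => _) = fun=> 0); [exact: cst_continuous|apply/funext => x; rewrite big_nil].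
rewrite (_ : (fun x => _) = fun x => F i x + \sum_(j <- s) F j x).
  by move=> x; apply: cvgD; [exact: cF|exact: IH].
by apply/funext => x; rewrite big_cons.
Qed.

Lemma mul_continuous_at {R : realType} (T : topologicalType) (f g : T -> R) (x : T) :
  {for x, continuous f} -> {for x, continuous g} -> {for x, continuous (fun y => f y * g y)}.
Proof. by move=> cf cg; apply: cvgM; [exact: cf|exact: cg]. Qed.

Lemma sub_continuous_at {R : realType} (T : topologicalType) (f g : T -> R) (x : T) :
  {for x, continuous f} -> {for x, continuous g} -> {for x, continuous (fun y => f y - g y)}.
Proof. by move=> cf cg; apply: cvgB; [exact: cf|exact: cg]. Qed.

Lemma dominated_continuous_at {R : realType} (T : topologicalType) (w k : T -> R) (x : T) :
  {for x, continuous k} -> k x = 0 -> (forall y, `|w y - w x| <= k y) -> {for x, continuous w}.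
Proof.
move=> ck k0 wk; apply/cvgrPdist_le => eps eps0.
have /cvgrPdist_le/(_ _ eps0) := ck; apply: filterS => y; rewrite k0 sub0r normrN => hy.
by rewrite distrC; apply: (le_trans (wk y)); exact: le_trans (ler_norm _) hy.
Qed.

(** * The solution on R^N *)

Section RadialFunctions.
Context {R : realType}.
Variable n : nat.
Local Notation e i := (delta_mx ord0 i : 'rV[R]_n).
Local Notation enorm := (@Defs.enorm R n).
Implicit Types x y : 'rV[R]_n.

Lemma enorm0 : enorm 0 = 0.
Proof. by rewrite -(scale0r 0) enormZ// mul0r. Qed.

Lemma enorm_gt0 x : x != 0 -> 0 < enorm x.
Proof.
move=> x0; rewrite lt_def enorm_ge0 andbT; apply: contra x0 => /eqP h.
apply/eqP/rowP => i; rewrite mxE; apply/eqP; rewrite -normr_le0 -h; exact: coord_le_enorm.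
Qed.

Lemma dotp_line x i (h : R) :
  dotp (h *: e i + x) (h *: e i + x) = dotp x x + (2 * x ord0 i * h + h * h).
Proof.
rewrite /dotp (bigD1 i)//= [in RHS](bigD1 i)//=.
rewrite !mxE !eqxx mulr1 (eq_bigr (fun j => x ord0 j * x ord0 j)); last first.
  by move=> j ji; rewrite !mxE (negbTE ji) mulr0 add0r.
by set s := \sum_(_ | _) _; ring.
Qed.

Lemma dotp_line_derive x i :
  is_derive (0 : R) 1 (fun h => dotp (h *: e i + x) (h *: e i + x)) (2 * x ord0 i).
Proof.
rewrite (_ : (fun h => _) = fun h => dotp x x + (2 * x ord0 i * h + h * h)); last first.
  by apply/funext => h; exact: dotp_line.
have di := @is_derive_id R R 0 1.
apply: derive_eq (derive_add (is_derive_cst _ _ _) (derive_add (derive_scale (2 * x ord0 i) di) (derive_mul di di))) _.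
by ring.
Qed.

Lemma enorm_continuous : continuous enorm.
Proof.
move=> x; rewrite /Defs.enorm.
have c1 : dotp y y @[y --> x] --> dotp x x.
  apply: (@sum_continuous R _ _ _ (fun i y => y ord0 i * y ord0 i)) => i y.
  by apply: mul_continuous_at; exact: coord_continuous.
exact: (cvg_comp _ _ c1 (@sqrt_continuous R _)).
Qed.

Lemma radial_derive (f : R -> R) (df : R) x i : x != 0 -> is_derive (enorm x) 1 f df ->
  is_derive x (e i) (fun y => f (enorm y)) (df * (x ord0 i / enorm x)).
Proof.
move=> x0 d; have t0 := enorm_gt0 x0; apply: line_derive.
have q0 : 0 < dotp (0 *: e i + x) (0 *: e i + x).
  by rewrite scale0r add0r -sqr_enorm exprn_gt0.
have ds := @is_derive1_comp R Num.sqrt _ 0 _ _ (is_derive1_sqrt q0) (dotp_line_derive x i).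
have d' : is_derive (Num.sqrt (dotp (0 *: e i + x) (0 *: e i + x))) 1 f df.
  by rewrite scale0r add0r.
have := @is_derive1_comp R f _ 0 _ _ d' ds.
move=> /derive_eq; apply; rewrite scale0r add0r.
have -> : Num.sqrt (dotp x x) = enorm x by [].
by field; rewrite gt_eqF.
Qed.

Lemma radial_continuous (f : R -> R) x : {for enorm x, continuous f} ->
  {for x, continuous (fun y => f (enorm y))}.
Proof. by move=> cf; exact: (cvg_comp _ _ (enorm_continuous (x := x)) cf). Qed.

Lemma continuous_at0 (w : 'rV[R]_n -> R) (h : R -> R) x : {for 0, continuous h} -> h 0 = 0 ->
  enorm x = 0 -> (forall y, `|w y - w x| <= h (enorm y)) -> {for x, continuous w}.
Proof.
move=> ch h0 ex wh; apply: (@dominated_continuous_at R _ w (fun y => h (enorm y))) => //.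
  by apply: radial_continuous; rewrite ex.
by rewrite ex.
Qed.

Lemma measurable_radial (f : measurableTypeR R -> R) : measurable_fun setT f ->
  measurable_fun setT (fun x : 'rV[R]_n => f (enorm x)).
Proof.
move=> mf; have me : @measurable_fun _ _ 'rV[R]_n (measurableTypeR R) setT enorm := @measurable_enorm R n.
exact: measurableT_comp mf me.
Qed.

Lemma enorm_scale_le (a : R) x : enorm (a *: x) = `|a| * enorm x.
Proof.
rewrite -sqrtr_sqr /Defs.enorm -sqrtrM ?sqr_ge0//; congr Num.sqrt.
by rewrite /dotp mulr_sumr; apply: eq_bigr => i _; rewrite !mxE; ring.
Qed.

End RadialFunctions.

Section RadialSolution.
Context {R : realType}.
Variable N : nat.
Hypothesis N3 : (3 <= N)%N.
Let N0 : (0 < N)%N. Proof. exact: leq_trans N3. Qed.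
Variables p : R.
Hypothesis p2 : 2 < p.
Local Notation nu := (@radial_measure R N).
Local Notation D := (@halfline R).
Local Notation a := (@half_exp R N).
Hypothesis apN : a * p < N%:R.
Local Notation K := (@K R N).
Local Notation L2 := (@L2 R N).
Local Notation cb := (@ball_vol R N).
Local Notation mu := (@lebesgue_rV R N).
Local Notation rigN := (rintegrable mu setT).
Local Notation e i := (delta_mx ord0 i : 'rV[R]_N).
Local Notation enorm := (@Defs.enorm R N).
Variables (Phi beta : R -> R) (c th : R).
Hypothesis G : growth Phi beta c th.
Variable b : R -> R.
Hypothesis betaE : forall x, beta x = b (x ^+ 2) * x.
Hypothesis b_ge0 : forall s, 0 <= s -> 0 <= b s.
Hypothesis b_mono : forall s t, 0 <= s -> s <= t -> b s <= b t.
Variable m : R.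
Hypothesis m0 : 0 < m.
Local Notation adm := (@adm R N Phi m).
Variables (lam : R) (v : R -> R).
Hypothesis av : adm v.
Hypothesis sv : solves N p beta lam v.
Local Notation u := (K v).
Local Notation g := (src N p v lam).
Local Notation H := (lowprim N g).
Let lv : L2 v. Proof. by case: av. Qed.
Implicit Types x y : 'rV[R]_N.

Definition sol x : R := u (enorm x).
(** [v] is controlled on the open half-line only; the zero extension makes the bounds hold at the
    origin too. *)
Definition flux (t : R) : R := if 0 < t then v t else 0.
Definition sol_grad x : 'rV[R]_N := (flux (enorm x) / enorm x) *: x.
(** The vector field b(|grad u|^2) grad u is slope(|x|) x, and [dslope i] is the i-th derivative of
    its i-th component, rewritten with the radial equation. *)
Definition slope (t : R) : R := beta (flux t) / t.
Definition dslope i x : R :=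
  slope (enorm x) - (g (enorm x) + N%:R * slope (enorm x)) * (x ord0 i / enorm x) ^+ 2.

Lemma sol_grad_coord x i : sol_grad x ord0 i = flux (enorm x) / enorm x * x ord0 i.
Proof. by rewrite mxE. Qed.

Lemma coord_ratio x i : `|x ord0 i / enorm x| <= 1.
Proof.
have [->|x0] := eqVneq x 0; first by rewrite enorm0 invr0 mulr0 normr0.
rewrite normrM normfV [`|enorm x|]ger0_norm ?enorm_ge0// ler_pdivrMr ?enorm_gt0// mul1r.
exact: coord_le_enorm.
Qed.

Lemma sol_continuous : continuous sol.
Proof.
move=> x; have [->|x0] := eqVneq x 0; last first.
  by apply: radial_continuous; apply: (K_continuous N3 lv); exact: enorm_gt0.
have [C C0 hC] := solution_near0 N3 p2 apN G av sv.
apply: (@continuous_at0 _ _ sol (fun r => C * r ^+ 2) 0 _ _ (enorm0 N)).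
- by apply: cvgM; [exact: cvg_cst|exact: exprn_continuous].
- by rewrite expr0n mulr0.
move=> y; rewrite /sol enorm0; have [->|y0] := eqVneq y 0; last exact: hC (enorm_gt0 y0).
by rewrite enorm0 subrr normr0 expr0n mulr0.
Qed.

Lemma sol_bounded : exists2 U, 0 <= U & forall x, `|sol x| <= U.
Proof.
have [U U0 hU] := solution_bounded N3 p2 apN G av sv.
exists (U + `|u 0|); first exact: addr_ge0.
move=> x; rewrite /sol; have [->|x0] := eqVneq x 0; first by rewrite enorm0 lerDr.
by apply: (le_trans (hU _ (enorm_gt0 x0))); rewrite lerDl.
Qed.

Lemma measurable_flux : measurable_fun setT (fun x => flux (enorm x)).
Proof.
apply: (@measurable_radial R N flux).
have -> : flux = v \_ D :> (measurableTypeR R -> R).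
  apply/funext => x; rewrite /flux /= /patch; case: ifPn => h.
    by rewrite mem_set//; apply/halflineE.
  by rewrite memNset// => /halflineE; apply/negP.
by apply/(measurable_restrictT v (@measurable_halfline R)); case: lv.
Qed.

Lemma measurable_inv_enorm : measurable_fun setT (fun x => (enorm x)^-1).
Proof.
rewrite (_ : (fun x => _) = fun x => enorm x `^ -1).
  by apply: (@measurable_radial R N (fun t => t `^ -1)); exact: measurable_powR.
by apply/funext => x; rewrite powR_inv1 ?enorm_ge0.
Qed.

Lemma measurable_sol_grad : measurable_fun setT sol_grad.
Proof.
apply: measurable_fun_rV => i; under eq_fun do rewrite sol_grad_coord.
apply: measurable_funM; last exact: measurable_coord.
apply: measurable_funM; first exact: measurable_flux.
exact: measurable_inv_enorm.
Qed.

Lemma flux_bound : exists2 V, 0 <= V & forall t, `|flux t| <= V.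
Proof.
have [V V0 hV] := flux_bounded N3 p2 apN G av sv.
by exists V => // t; rewrite /flux; case: ifP => [|_]; [exact: hV|rewrite normr0].
Qed.

Lemma sol_grad_bounded : exists2 V, 0 <= V & forall x i, `|sol_grad x ord0 i| <= V.
Proof.
have [V V0 hV] := flux_bound; exists V => // x i.
rewrite sol_grad_coord -mulrA [_^-1 * _]mulrC normrM -[V]mulr1.
by apply: ler_pM => //; exact: coord_ratio.
Qed.

Lemma sol_derive x i : x != 0 -> is_derive x (e i) sol (sol_grad x ord0 i).
Proof.
move=> x0; have t0 := enorm_gt0 x0.
have dk : is_derive (enorm x) 1 u (v (enorm x)).
  by apply: (K_derive N3 lv t0); exact: (solution_continuous N3 p2 apN G av sv).
have -> : sol_grad x ord0 i = v (enorm x) * (x ord0 i / enorm x) by rewrite sol_grad_coord /flux t0; ring.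
exact: radial_derive.
Qed.

Lemma sol_weak_gradient : weak_gradient sol sol_grad.
Proof.
move=> phi tp i; have [U _ hU] := sol_bounded; have [V _ hV] := sol_grad_bounded.
apply: (ibp_test (w := sol) (dw := fun x => sol_grad x ord0 i) sol_continuous _ _ hU _ tp).
- exact: measurableT_comp (measurable_coord i) measurable_sol_grad.
- by move=> x; exact: sol_derive.
- by move=> x; exact: hV.
Qed.

Lemma beta_flux_le : exists2 C, 0 <= C & forall t, `|beta (flux t)| <= C * `|flux t|.
Proof.
have [V V0 hV] := flux_bound; exists (b (V ^+ 2)); first by apply: b_ge0; exact: sqr_ge0.
move=> t; rewrite betaE normrM ger0_norm ?b_ge0 ?sqr_ge0// ler_wpM2r//.
by apply: b_mono; rewrite ?sqr_ge0// -real_normK ?num_real// lerXn2r ?nnegrE.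
Qed.

Lemma slope_bound : exists2 C, 0 <= C & forall t, 0 <= t -> `|slope t| <= C.
Proof.
have [C C0 hC] := beta_flux_le; have [L L0 hL] := flux_le_linear N3 p2 apN G av sv.
exists (C * L); first exact: mulr_ge0.
move=> t; rewrite le_eqVlt => /orP[/eqP <-|t0].
  by rewrite /slope invr0 mulr0 normr0 mulr_ge0.
rewrite /slope normrM normfV [`|t|]gtr0_norm// ler_pdivrMr//.
apply: (le_trans (hC t)); rewrite -mulrA ler_wpM2l// /flux t0; exact: hL.
Qed.

Lemma src_bound : exists2 C, 0 <= C & forall x, `|g (enorm x)| <= C.
Proof.
have [U U0 hU] := sol_bounded; exists (U `^ (p - 1) + `|lam| * U).
  by rewrite addr_ge0 ?powR_ge0// mulr_ge0.
move=> x; rewrite /src; apply: (le_trans (ler_normB _ _)); apply: lerD.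
  rewrite fp_norm//; have p1 : 0 <= p - 1 by have hp := p2; lra.
  by apply: (ge0_ler_powR p1); rewrite ?nnegrE//; exact: (hU x).
by rewrite normrM ler_wpM2l//; exact: hU.
Qed.

Lemma src_sol_continuous : continuous (fun x => g (enorm x)).
Proof.
move=> x; have cs : sol y @[y --> x] --> sol x := sol_continuous (x := x).
rewrite /src; apply: (@sub_continuous_at R _ (fun y => fp p (sol y)) (fun y => lam * sol y) x); first exact: (cvg_comp _ _ cs (fp_continuous p2 (x := sol x))).
by apply: (@mul_continuous_at R _ (fun=> lam) sol x); [exact: cst_continuous|exact: cs].
Qed.

(** By the radial equation slope is -H/(c N t^N), which is differentiable whether or not [v] is. *)
Lemma slope_derive (t : R) : 0 < t -> is_derive t 1 slope (- (g t + N%:R * slope t) / t).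
Proof.
move=> t0; have cb0 : 0 < cb * N%:R by rewrite mulr_gt0 ?ball_vol_gt0// ltr0n.
have E s : 0 < s -> slope s = - (H s * (cb * N%:R * s ^+ N)^-1).
  move=> s0; rewrite /slope /flux s0 sv//; have := kapE N3 s0.
  have sN : s ^+ N = s ^+ N.-1 * s by rewrite -exprSr (prednK N0).
  have s1 : s ^+ N.-1 != 0 by rewrite expf_neq0// gt_eqF.
  move/(canRL (mulfK _)) => ->; last by rewrite mulf_neq0// gt_eqF.
  rewrite sN; move: (H s) (s ^+ N.-1) s1 cb0 => h k k0; move: (cb * N%:R) => q q0.
  by field; rewrite k0 !gt_eqF.
have dH := H_derive N3 p2 apN lam av t0.
have tN0 : cb * N%:R * t ^+ N != 0 by rewrite mulf_neq0 ?expf_neq0// gt_eqF.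
have dV : is_derive t 1 (fun s => (cb * N%:R * s ^+ N)^-1) (- (cb * N%:R * t ^+ N) ^- 2 *: (cb * N%:R * (N%:R * t ^+ N.-1))).
  by apply: is_deriveV => //; exact: derive_scale (derive_exp N t).
have d := derive_scale (-1) (derive_mul dH dV).
have dd : is_derive t 1 slope (-1 * (H t * (- (cb * N%:R * t ^+ N) ^- 2 *: (cb * N%:R * (N%:R * t ^+ N.-1))) +
    g t * (cb * N%:R * t ^+ N.-1) * (cb * N%:R * t ^+ N)^-1)).
  apply: derive_near d; have : \forall s \near t, 0 < s by exact: lt_nbhsr.
  by apply: filterS => s s0; rewrite (E s s0) mulN1r.
apply: derive_eq dd _; rewrite (E t t0) /GRing.scale/=.
have sN : t ^+ N = t ^+ N.-1 * t by rewrite -exprSr (prednK N0).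
have s1 : t ^+ N.-1 != 0 by rewrite expf_neq0// gt_eqF.
have N1 : (N%:R : R) != 0 by rewrite pnatr_eq0 -lt0n.
have cb1 : cb != 0 by rewrite gt_eqF// ball_vol_gt0.
rewrite sN; move: s1 N1 cb1; move: (H t) (t ^+ N.-1) (N%:R : R) cb (g t) => h k q z gt k0 q0 z0.
by field; rewrite k0 q0 z0 gt_eqF.
Qed.

Lemma measurable_slope : measurable_fun setT (fun x => slope (enorm x)).
Proof.
rewrite /slope; apply: measurable_funM.
  apply: measurableT_comp measurable_flux; apply: continuous_measurable_fun; exact: growth_beta_cont G.
exact: measurable_inv_enorm.
Qed.

Lemma stress_ibp i phi : test_function phi ->
  [/\ rigN (fun x => slope (enorm x) * x ord0 i * grad phi x ord0 i),
      rigN (fun x => dslope i x * phi x) &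
      \int[mu]_x (slope (enorm x) * x ord0 i * grad phi x ord0 i) = - \int[mu]_x (dslope i x * phi x)].
Proof.
move=> tp; have [C C0 hC] := slope_bound; have [S S0 hS] := src_bound.
have [Cb Cb0 hCb] := beta_flux_le; have [V V0 hV] := flux_bound.
have csq x : (x ord0 i / enorm x) ^+ 2 <= 1.
  by rewrite -real_normK ?num_real// expr_le1// coord_ratio.
apply: (@ibp_test R N i (fun x => slope (enorm x) * x ord0 i) (dslope i) phi (Cb * V) (C + (S + N%:R * C))) => //.
- move=> x; have [->|x0] := eqVneq x 0; last first.
    apply: (@mul_continuous_at R _ (fun y => slope (enorm y)) (fun y => y ord0 i) x); last exact: coord_continuous.
    apply: (@radial_continuous _ _ slope); apply: differentiable_continuous; apply/derivable1_diffP.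
    by case: (slope_derive (enorm_gt0 x0)).
  apply: (@continuous_at0 _ _ _ (fun r => C * r) 0 _ _ (enorm0 N)).
  + by apply: cvgM; [exact: cvg_cst|exact: cvg_id].
  + by rewrite mulr0.
  move=> y; rewrite mxE mulr0 subr0 normrM; apply: ler_pM => //; last exact: coord_le_enorm.
  by apply: hC; exact: enorm_ge0.
- apply: measurable_funB; first exact: measurable_slope.
  apply: measurable_funM.
    apply: measurable_funD; first exact: continuous_measurable_rV src_sol_continuous.
    by apply: measurable_funM => //; exact: measurable_slope.
  apply: measurable_funX; apply: measurable_funM; first exact: measurable_coord.
  exact: measurable_inv_enorm.
- move=> x x0; have t0 := enorm_gt0 x0; apply: line_derive.
  have d1 : is_derive (0 : R) 1 (fun h => slope (enorm (h *: e i + x)))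
      (- (g (enorm x) + N%:R * slope (enorm x)) / enorm x * (x ord0 i / enorm x)).
    apply: (@derive_line R N (fun y => slope (enorm y))); rewrite scale0r add0r; exact: (radial_derive i x0 (slope_derive t0)).
  have d2 : is_derive (0 : R) 1 (fun h => (h *: e i + x) ord0 i) 1.
    have -> : (fun h => (h *: e i + x) ord0 i) = (fun h => x ord0 i + 1 * h).
      by apply/funext => h; rewrite !mxE !eqxx mulr1 addrC mul1r.
    apply: derive_eq (derive_add (is_derive_cst _ _ _) (derive_scale 1 (is_derive_id _ _))) _.
    by rewrite mulr1 add0r.
  apply: derive_eq (derive_mul d1 d2) _.
  by rewrite !scale0r !add0r /dslope; field; rewrite gt_eqF.
- move=> x; have -> : slope (enorm x) * x ord0 i = beta (flux (enorm x)) * (x ord0 i / enorm x).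
    by rewrite /slope; ring.
  rewrite normrM -[Cb * V]mulr1; apply: ler_pM => //; last exact: coord_ratio.
  by apply: (le_trans (hCb _)); rewrite ler_wpM2l.
- move=> x; rewrite /dslope; apply: (le_trans (ler_normB _ _)).
  have hs := hC _ (enorm_ge0 x); apply: lerD => //.
  rewrite normrM -[X in _ <= X]mulr1; apply: ler_pM => //; last by rewrite ger0_norm ?sqr_ge0.
  apply: (le_trans (ler_normD _ _)); apply: lerD => //.
  by rewrite normrM normr_nat ler_wpM2l.
Qed.

Lemma dslope_sum x : x != 0 -> \sum_(i < N) dslope i x = - g (enorm x).
Proof.
move=> x0; have t0 := enorm_gt0 x0; rewrite /dslope sumrB sumr_const card_ord -mulr_sumr.
have -> : \sum_(i < N) (x ord0 i / enorm x) ^+ 2 = 1.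
  have -> : \sum_(i < N) (x ord0 i / enorm x) ^+ 2 = (enorm x ^+ 2)^-1 * dotp x x.
    rewrite /dotp mulr_sumr; apply: eq_bigr => i _; rewrite -expr2 expr_div_n mulrC //.
  by rewrite -sqr_enorm mulVf// expf_neq0// gt_eqF.
by rewrite mulr1 -mulr_natl; ring.
Qed.

Lemma rintegrable_sum (F : 'I_N -> 'rV[R]_N -> R) : (forall i, rigN (F i)) ->
  rigN (fun x => \sum_(i < N) F i x) /\
  \int[mu]_x (\sum_(i < N) F i x) = \sum_(i < N) \int[mu]_x F i x.
Proof.
move=> iF; elim: (index_enum _) => [|i s [i1 E1]].
  split; first by apply: eq_rintegrable (rintegrable0 mu setT) => // x _; rewrite big_nil.
  by rewrite big_nil -(eq_rint mu (f := fun=> 0)) ?Rintegral_cst ?mul0r// => x _; rewrite big_nil.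
split; first by apply: eq_rintegrable (rintegrableD measurableT (iF i) i1) => // x _; rewrite big_cons.
rewrite big_cons -E1 -RintegralD//; last exact: iF.
by apply: eq_rint => x _; rewrite big_cons.
Qed.

Lemma weak_equation_test phi : test_function phi ->
  [/\ rigN (fun x => slope (enorm x) * dotp x (grad phi x)),
      rigN (fun x => g (enorm x) * phi x) &
      \int[mu]_x (slope (enorm x) * dotp x (grad phi x)) = \int[mu]_x (g (enorm x) * phi x)].
Proof.
move=> tp.
have S1 : rigN (fun x => \sum_(i < N) slope (enorm x) * x ord0 i * grad phi x ord0 i) /\
    \int[mu]_x (\sum_(i < N) slope (enorm x) * x ord0 i * grad phi x ord0 i) =
    \sum_(i < N) \int[mu]_x (slope (enorm x) * x ord0 i * grad phi x ord0 i).
  apply: rintegrable_sum => i; by have [] := stress_ibp i tp.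
have S2 : rigN (fun x => \sum_(i < N) dslope i x * phi x) /\
    \int[mu]_x (\sum_(i < N) dslope i x * phi x) = \sum_(i < N) \int[mu]_x (dslope i x * phi x).
  apply: rintegrable_sum => i; by have [] := stress_ibp i tp.
have E1 x : \sum_(i < N) slope (enorm x) * x ord0 i * grad phi x ord0 i = slope (enorm x) * dotp x (grad phi x).
  by rewrite /dotp mulr_sumr; apply: eq_bigr => i _; rewrite mulrA.
have mg : measurable_fun setT (fun x => g (enorm x) * phi x).
  apply: measurable_funM; first exact: continuous_measurable_rV src_sol_continuous.
  exact: continuous_measurable_rV (test_continuous tp).
have E2 : {ae mu, forall x, setT x -> -1 * (\sum_(i < N) dslope i x * phi x) = g (enorm x) * phi x}.
  apply: filterS (null_point (Ordinal N0)) => x x0 _.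
  by rewrite -mulr_suml dslope_sum// mulN1r mulNr opprK.
have i3 := rintegrableZ measurableT (-1) (proj1 S2).
have i4 := rintegrable_ae measurableT mg E2 i3.
have I4 := rint_ae_eq measurableT (rintegrable_measurable i3) mg E2.
split => //; first by apply: eq_rintegrable (proj1 S1) => // x _; exact: E1.
rewrite -I4 (RintegralZl _ measurableT (proj1 S2)) (proj2 S2) mulN1r -sumrN.
rewrite -(eq_rint mu (D := setT) (fun x _ => E1 x)) (proj2 S1).
by apply: eq_bigr => i _; have [_ _ ->] := stress_ibp i tp.
Qed.

End RadialSolution.

(** * The norm of X and extension of the weak formulation *)

Section NormX.
Context {R : realType}.
Variable N : nat.
Local Notation mu := (@lebesgue_rV R N).
Local Notation rigN := (rintegrable mu setT).
Local Notation enorm := (@Defs.enorm R N).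
Implicit Types (f : 'rV[R]_N -> R) (df : 'rV[R]_N -> 'rV[R]_N).

Lemma Lnorm_le (r eps : R) f : 0 < r -> 0 <= eps -> rigN (fun x => `|f x| `^ r) ->
  \int[mu]_x `|f x| `^ r <= eps `^ r -> ('N[mu]_r%:E [EFin \o f] <= eps%:E)%E.
Proof.
move=> r0 e0 i1 l1; rewrite unlock.
have -> : (\int[mu]_x `|(EFin \o f) x| `^ r)%E = (\int[mu]_x `|f x| `^ r)%:E by rewrite -rint_lim.
rewrite poweR_EFin lee_fin; have r1 : 0 <= r^-1 by rewrite invr_ge0 ltW.
have I0 : 0 <= \int[mu]_x `|f x| `^ r by apply: Rintegral_ge0 => x _; exact: powR_ge0.
have -> : eps = (eps `^ r) `^ r^-1 by rewrite -powRrM mulfV ?gt_eqF// powRr1.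
by apply: (ge0_ler_powR r1); rewrite ?nnegrE ?powR_ge0.
Qed.

Lemma Lnorm2_sqr (eps : R) f : 0 <= eps -> measurable_fun setT f ->
  ('N[mu]_2%:E [EFin \o f] <= eps%:E)%E -> rigN (fun x => f x ^+ 2) /\ \int[mu]_x f x ^+ 2 <= eps ^+ 2.
Proof.
move=> e0 mf h; have n2 : (2 : R) != 0 by rewrite pnatr_eq0.
apply: rintegrable_ge0 => //; first exact: measurable_funX.
  by move=> x _; exact: sqr_ge0.
have -> : (\int[mu]_x (f x ^+ 2)%:E = 'N[mu]_2%:E [EFin \o f] `^ 2)%E.
  rewrite powR_Lnorm//; apply: eq_integral => x _ /=.
  by rewrite -real_normK ?num_real// powR_mulrn.
have := Lnorm_ge0 mu 2%:E (EFin \o f); move: h; case: ('N[mu]_2%:E [EFin \o f])%E => [y| |]//=.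
rewrite !lee_fin => ye y0; rewrite powR_mulrn//.
by rewrite lerXn2r ?nnegrE.
Qed.

Lemma normX_le q u du (eps : R) : 0 <= eps ->
  ('N[mu]_2%:E [EFin \o (enorm \o du)] <= eps%:E)%E -> ('N[mu]_2%:E [EFin \o u] <= eps%:E)%E ->
  ('N[mu]_q%:E [EFin \o (enorm \o du)] <= eps%:E)%E -> (normX q u du <= (2 * eps)%:E)%E.
Proof.
move=> e0; rewrite /normX.
have := Lnorm_ge0 mu 2%:E (EFin \o (enorm \o du)).
have := Lnorm_ge0 mu 2%:E (EFin \o u).
have := Lnorm_ge0 mu q%:E (EFin \o (enorm \o du)).
case: ('N[mu]_2%:E [EFin \o (enorm \o du)])%E => [x| |]//.
case: ('N[mu]_2%:E [EFin \o u])%E => [y| |]//.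
case: ('N[mu]_q%:E [EFin \o (enorm \o du)])%E => [z| |]//.
rewrite !lee_fin => z0 y0 x0 xe ye ze.
change (((x ^+ 2 + y ^+ 2 + z ^+ 2)%:E `^ 2^-1 <= (2 * eps)%:E)%E).
rewrite poweR_EFin lee_fin.
rewrite powR12_sqrt; last by rewrite !addr_ge0 ?sqr_ge0.
have -> : 2 * eps = Num.sqrt ((2 * eps) ^+ 2) by rewrite sqrtr_sqr ger0_norm// mulr_ge0.
apply: ler_wsqrtr.
have h (t : R) : 0 <= t -> t <= eps -> t ^+ 2 <= eps ^+ 2 by move=> t0 te; rewrite lerXn2r ?nnegrE.
have := h x x0 xe; have := h y y0 ye; have := h z z0 ze; have := sqr_ge0 eps.
rewrite exprMn; move: (x ^+ 2) (y ^+ 2) (z ^+ 2) (eps ^+ 2) => *; lra.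
Qed.

Lemma normX_ge q u du (eps : R) : 0 <= eps -> (normX q u du <= eps%:E)%E ->
  ('N[mu]_2%:E [EFin \o (enorm \o du)] <= eps%:E)%E /\ ('N[mu]_2%:E [EFin \o u] <= eps%:E)%E.
Proof.
move=> e0; rewrite /normX.
have := Lnorm_ge0 mu 2%:E (EFin \o (enorm \o du)).
have := Lnorm_ge0 mu 2%:E (EFin \o u).
have := Lnorm_ge0 mu q%:E (EFin \o (enorm \o du)).
have n2 : (2^-1 : R) != 0 by rewrite invr_eq0 pnatr_eq0.
case: ('N[mu]_2%:E [EFin \o (enorm \o du)])%E => [x| |]//;
case: ('N[mu]_2%:E [EFin \o u])%E => [y| |]//;
case: ('N[mu]_q%:E [EFin \o (enorm \o du)])%E => [z| |]//; try by rewrite /= (negbTE n2).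
rewrite !lee_fin => z0 y0 x0.
change ((((x ^+ 2 + y ^+ 2 + z ^+ 2)%:E `^ 2^-1 <= eps%:E)%E) -> x <= eps /\ y <= eps).
rewrite poweR_EFin lee_fin.
rewrite powR12_sqrt; last by rewrite !addr_ge0 ?sqr_ge0.
move=> h; split; apply: le_trans h.
  have {1}-> : x = Num.sqrt (x ^+ 2) by rewrite sqrtr_sqr ger0_norm.
  by apply: ler_wsqrtr; rewrite -addrA lerDl addr_ge0 ?sqr_ge0.
have {1}-> : y = Num.sqrt (y ^+ 2) by rewrite sqrtr_sqr ger0_norm.
by apply: ler_wsqrtr; rewrite addrAC lerDr addr_ge0 ?sqr_ge0.
Qed.

Lemma dotp_le (x y : 'rV[R]_N) : `|dotp x y| <= N%:R * (enorm x * enorm y).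
Proof.
apply: (le_trans (ler_norm_sum _ _ _)); rewrite -[N in N%:R]card_ord mulr_natl -sumr_const.
by apply: ler_sum => i _; rewrite normrM ler_pM ?coord_le_enorm.
Qed.

Lemma measurable_dotp (f g : 'rV[R]_N -> 'rV[R]_N) : measurable_fun setT f -> measurable_fun setT g ->
  measurable_fun setT (fun x => dotp (f x) (g x)).
Proof.
move=> mf mg; apply: measurable_sum => i; apply: measurable_funM.
  exact: measurableT_comp (measurable_coord i) mf.
exact: measurableT_comp (measurable_coord i) mg.
Qed.

Lemma test_measurable_grad (phi : 'rV[R]_N -> R) : test_function phi -> measurable_fun setT (grad phi).
Proof.
move=> tp; apply: measurable_fun_rV => i.
exact: continuous_measurable_rV (@test_grad_continuous R N phi i tp).
Qed.

Lemma dotpBr (x y z : 'rV[R]_N) : dotp x (y - z) = dotp x y - dotp x z.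
Proof. by rewrite /dotp -sumrB; apply: eq_bigr => i _; rewrite !mxE mulrBr. Qed.

(* Cauchy-Schwarz lets the L^2 part of || . ||_X control both sides. *)
Lemma weak_extend q (W : 'rV[R]_N -> 'rV[R]_N) (g : 'rV[R]_N -> R) phi dphi :
  measurable_fun setT W -> measurable_fun setT g ->
  rigN (fun x => enorm (W x) ^+ 2) -> rigN (fun x => g x ^+ 2) ->
  (forall psi, test_function psi ->
     [/\ rigN (fun x => dotp (W x) (grad psi x)), rigN (fun x => g x * psi x) &
        \int[mu]_x dotp (W x) (grad psi x) = \int[mu]_x (g x * psi x)]) ->
  inX q phi dphi ->
  [/\ rigN (fun x => dotp (W x) (dphi x)), rigN (fun x => g x * phi x) &
      \int[mu]_x dotp (W x) (dphi x) = \int[mu]_x (g x * phi x)].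
Proof.
move=> mW mg iW ig wt [mp mdp _ [psi [tpsi cv]]].
have meW : measurable_fun setT (fun x => enorm (W x)) by exact: measurableT_comp (@measurable_enorm R N) mW.
have H (eps : R) : 0 < eps -> exists k,
  [/\ rigN (fun x => dotp (W x) (dphi x - grad (psi k) x)), rigN (fun x => g x * (phi x - psi k x)),
   `|\int[mu]_x dotp (W x) (dphi x - grad (psi k) x)| <= N%:R * (Num.sqrt (\int[mu]_x enorm (W x) ^+ 2) * eps) &
   `|\int[mu]_x (g x * (phi x - psi k x))| <= Num.sqrt (\int[mu]_x g x ^+ 2) * eps].
  move=> eps0; have [k _ hk] : \forall k \near \oo, (normX q (fun x => (phi x - psi k x)%R) (fun x => (dphi x - grad (psi k) x)%R) < eps%:E)%E.
    have /fine_cvgP[fn /cvgrPdist_lt/(_ _ eps0) fc] := cv.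
    apply: filterS2 fn fc => k fk; rewrite /= sub0r normrN => /(le_lt_trans (ler_norm _)) hk.
    by rewrite -(fineK fk) lte_fin.
  exists k; have [h1 h2] := normX_ge (ltW eps0) (ltW (hk k (leqnn k))).
  have mz : measurable_fun setT (fun x => dphi x - grad (psi k) x).
    apply: measurable_fun_rV => i; under eq_fun do rewrite mxE mxE.
    apply: measurable_funB; first exact: measurableT_comp (measurable_coord i) mdp.
    exact: measurableT_comp (measurable_coord i) (test_measurable_grad (tpsi k)).
  have me : measurable_fun setT (fun x => enorm (dphi x - grad (psi k) x)).
    exact: measurableT_comp (@measurable_enorm R N) mz.
  have mk : measurable_fun setT (fun x => phi x - psi k x).
    by apply: measurable_funB => //; exact: continuous_measurable_rV (test_continuous (tpsi k)).
  have [i1 l1] := Lnorm2_sqr (ltW eps0) me h1; have [i2 l2] := Lnorm2_sqr (ltW eps0) mk h2.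
  have j1 := rint_sqr_norm_le measurableT meW me iW i1.
  have sq (x : R) : x <= eps ^+ 2 -> Num.sqrt x <= eps.
    by move=> h; rewrite -[eps]ger0_norm ?(ltW eps0)// -sqrtr_sqr ler_wsqrtr.
  have bd x : setT x -> `|dotp (W x) (dphi x - grad (psi k) x)| <= N%:R * (enorm (W x) * enorm (dphi x - grad (psi k) x)).
    by move=> _; exact: dotp_le.
  have k1 : rigN (fun x => dotp (W x) (dphi x - grad (psi k) x)).
    apply: (rintegrable_le measurableT _ _ bd); first exact: measurable_dotp.
    exact: rintegrableZ.
  split => //.
  - exact: rint_sqr_norm_le.
  - apply: (le_trans (le_normr_Rintegral measurableT k1)).
    apply: (le_trans (rint_le_sub measurableT (rintegrable_norm k1) (rintegrableZ measurableT N%:R j1) bd)).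
    rewrite (RintegralZl _ measurableT j1) ler_wpM2l//.
    apply: (le_trans (ler_norm _)); apply: (le_trans (cauchy_schwarz_sqr measurableT meW me iW i1)).
    by apply: ler_wpM2l; [exact: sqrtr_ge0|exact: sq].
  - apply: (le_trans (cauchy_schwarz_sqr measurableT mg mk ig i2)).
    by apply: ler_wpM2l; [exact: sqrtr_ge0|exact: sq].
have E1 k x : dotp (W x) (dphi x) = dotp (W x) (dphi x - grad (psi k) x) + dotp (W x) (grad (psi k) x).
  by rewrite dotpBr subrK.
have E2 k x : g x * phi x = g x * (phi x - psi k x) + g x * psi k x by ring.
have [k0 [a1 a2 _ _]] := H 1 ltr01; have [w1 w2 w3] := wt _ (tpsi k0).
split.
- by apply: eq_rintegrable (rintegrableD measurableT a1 w1) => // x _; rewrite -E1.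
- by apply: eq_rintegrable (rintegrableD measurableT a2 w2) => // x _; rewrite -E2.
pose C := N%:R * Num.sqrt (\int[mu]_x enorm (W x) ^+ 2) + Num.sqrt (\int[mu]_x g x ^+ 2).
apply/eqP; rewrite -subr_eq0 -normr_le0; apply/ler_addgt0Pl => eps eps0; rewrite addr0.
have C1 : 0 < C + 1 by rewrite ltr_wpDl// addr_ge0 ?mulr_ge0 ?sqrtr_ge0.
have [k [b1 b2 l1 l2]] := H (eps / (C + 1)) (divr_gt0 eps0 C1); have [z1 z2 z3] := wt _ (tpsi k).
rewrite (eq_rint mu (fun x _ => E1 k x)) (eq_rint mu (fun x _ => E2 k x)) !RintegralD// z3.
set A := \int[mu]_x dotp _ _ in l1 *; set B := \int[mu]_x (g x * (phi x - psi k x)) in l2 *.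
set Z := \int[mu]_x _; have -> : A + Z - (B + Z) = A - B by ring.
apply: (le_trans (ler_normB _ _)); apply: (le_trans (lerD l1 l2)).
have -> : N%:R * (Num.sqrt (\int[mu]_x enorm (W x) ^+ 2) * (eps / (C + 1))) + Num.sqrt (\int[mu]_x g x ^+ 2) * (eps / (C + 1)) = C * (eps / (C + 1)).
  by rewrite /C mulrDl mulrA.
rewrite mulrCA -[X in _ <= X]mulr1 ler_wpM2l ?(ltW eps0)// ler_pdivrMr// mul1r.
by rewrite lerDl.
Qed.

End NormX.

Section RadialIntegral.
Context {R : realType}.
Variable N : nat.
Hypothesis N0 : (0 < N)%N.
Local Notation mu := (@lebesgue_rV R N).
Local Notation nu := (@radial_measure R N).
Local Notation D := (@halfline R).
Local Notation enorm := (@Defs.enorm R N).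

Lemma radial_integral (F : 'rV[R]_N -> R) (f : R -> R) : measurable_fun setT F ->
  (forall x, x != 0 -> F x = f (enorm x)) -> measurable_fun D f -> (forall t, 0 < t -> 0 <= f t) ->
  rintegrable nu D f -> rintegrable mu setT F /\ \int[mu]_x F x = \int[nu]_(t in D) f t.
Proof.
move=> mF FE mf f0 i1; pose h : measurableTypeR R -> R := f \_ D.
have mD := @measurable_halfline R.
have mh : measurable_fun setT h by apply/(measurable_restrictT f mD).
have hE (t : R) : 0 < t -> h t = f t by move=> t0; rewrite /h /patch mem_set//; apply/halflineE.
have h0 t : 0 <= h t.
  rewrite /h /patch; case: ifPn => // /set_mem /halflineE; exact: f0.
have E : (\int[mu]_x (h (enorm x))%:E = (\int[nu]_(t in D) f t)%:E)%E.
  rewrite (@ge0_integral_radial R N (EFin \o h)) //; last by apply/measurable_EFinP.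
  rewrite -rint_lim// [RHS]integral_mkcond; apply: eq_integral => t _ /=.
  by rewrite /h /patch; case: ifP.
have mr : measurable_fun setT (fun x : 'rV[R]_N => h (enorm x)) := measurable_radial mh.
have le : (\int[mu]_x (h (enorm x))%:E <= (\int[nu]_(t in D) f t)%:E)%E by rewrite E.
have [i2 _] := rintegrable_ge0 measurableT mr (fun x _ => h0 (enorm x)) le.
have ae : {ae mu, forall x, setT x -> h (enorm x) = F x}.
  apply: filterS (null_point (Ordinal N0)) => x x0 _; rewrite FE// hE//; exact: enorm_gt0.
split; first exact: rintegrable_ae ae i2.
by rewrite -(rint_ae_eq measurableT mr mF ae) /Rintegral E.
Qed.

End RadialIntegral.

(** * Density of test functions *)

Section Smooth1.
Context {R : realType}.
Implicit Types f g : R -> R.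

Fixpoint smooth (k : nat) f : Prop :=
  if k is k'.+1 then exists2 f', forall t : R, is_derive t 1 f (f' t) & smooth k' f'
  else continuous f.

Lemma derive_continuous f f' : (forall t : R, is_derive t 1 f (f' t)) -> continuous f.
Proof. by move=> df t; apply: differentiable_continuous; apply/derivable1_diffP; case: (df t). Qed.

Lemma smooth_continuous k f : smooth k f -> continuous f.
Proof. by case: k => [//|k] [f' df _]; exact: derive_continuous df. Qed.

Lemma smoothS k f : smooth k.+1 f -> smooth k f.
Proof.
elim: k f => [f|k IH f [f' df sf]]; first exact: smooth_continuous.
by exists f' => //; exact: IH.
Qed.

Lemma smooth_cst k (c : R) : smooth k (fun=> c).
Proof.
elim: k c => [c|k IH c]; first exact: cst_continuous.
by exists (fun=> 0) => // t; exact: is_derive_cst.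
Qed.

Lemma smooth_add k f g : smooth k f -> smooth k g -> smooth k (fun t => f t + g t).
Proof.
elim: k f g => [f g cf cg t|k IH f g [f' df sf] [g' dg sg]].
  by apply: cvgD; [exact: cf|exact: cg].
by exists (fun t => f' t + g' t); [move=> t; exact: derive_add|exact: IH].
Qed.

Lemma smooth_mul k f g : smooth k f -> smooth k g -> smooth k (fun t => f t * g t).
Proof.
elim: k f g => [f g cf cg t|k IH f g sf sg].
  by apply: cvgM; [exact: cf|exact: cg].
have [f' df sf'] := sf; have [g' dg sg'] := sg.
exists (fun t => f t * g' t + f' t * g t); first by move=> t; exact: derive_mul.
by apply: smooth_add; apply: IH => //; exact: smoothS.
Qed.

Lemma smooth_affine k f (a b : R) : smooth k f -> smooth k (fun t => f (a * t + b)).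
Proof.
have da (t : R) : is_derive t 1 (fun t => a * t + b) a.
  by apply: derive_eq (derive_add (derive_scale a (is_derive_id _ _)) (is_derive_cst _ _ _)) _; rewrite mulr1 addr0.
elim: k f => [f cf t|k IH f [f' df sf]].
  by apply: continuous_comp; [exact: (derive_continuous da)|exact: cf].
exists (fun t => f' (a * t + b) * a); last by apply: smooth_mul; [exact: IH|exact: smooth_cst].
by move=> t; exact: (@is_derive1_comp R f (fun t => a * t + b) t _ _ (df _) (da t)).
Qed.

Lemma smooth_sum k n (F : nat -> R -> R) : (forall i, smooth k (F i)) ->
  smooth k (fun t => \sum_(i < n) F i t).
Proof.
move=> sF; elim: n => [|n IH].
  by rewrite (_ : (fun t => _) = fun=> 0); [exact: smooth_cst|apply/funext => t; rewrite big_ord0].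
rewrite (_ : (fun t => _) = fun t => \sum_(i < n) F i t + F n t); first exact: smooth_add.
by apply/funext => t; rewrite big_ord_recr.
Qed.

Lemma poly_exp_bound (P : {poly R}) : exists2 C, 0 <= C & forall y, 0 <= y -> `|P.[y]| <= C * expR y.
Proof.
exists (\sum_(i < size P) `|P`_i| * i`!%:R); first by apply: sumr_ge0 => i _; rewrite mulr_ge0.
move=> y y0; rewrite horner_coef mulr_suml; apply: (le_trans (ler_norm_sum _ _ _)).
apply: ler_sum => i _; rewrite normrM -mulrA ler_wpM2l// ger0_norm ?exprn_ge0//.
case: (nat_of_ord i) => [|j]; first by rewrite expr0 fact0 mul1r -expR0 ler_expR.
have f0 : 0 < j.+1`!%:R :> R by rewrite ltr0n fact_gt0.
rewrite mulrC -ler_pdivrMr//; apply: le_trans (expR_ge1Dxn j y0).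
by rewrite lerDr.
Qed.

(** With a polynomial factor in 1/x the family is closed under differentiation, P being replaced by
    X^2 (P - P'); smoothness follows by induction. *)
Definition flat (P : {poly R}) (x : R) : R := if 0 < x then P.[x^-1] * expR (- x^-1) else 0.

Lemma flat_derive P (x : R) : is_derive x 1 (flat P) (flat ('X^2 * (P - P^`())) x).
Proof.
have [x0|x0|->] := ltrgtP x 0.
- rewrite [X in is_derive _ _ _ X]/flat ltNge ltW//=.
  have nb : \forall s \near x, 0 = flat P s.
    have : nbhs x [set s : R | s < 0] by apply: open_nbhs_nbhs; split => //; exact: open_lt.
    by apply: filterS => s s0; rewrite /flat ltNge ltW.
  by apply: derive_near nb _; exact: is_derive_cst.
- rewrite [X in is_derive _ _ _ X]/flat x0.
  have nb : \forall s \near x, P.[s^-1] * expR (- s^-1) = flat P s.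
    have : \forall s \near x, 0 < s by exact: lt_nbhsr.
    by apply: filterS => s s0; rewrite /flat s0.
  apply: derive_near nb _.
  have xn : x != 0 by rewrite gt_eqF.
  have di := @is_deriveV R id x 1 1 xn (is_derive_id _ _).
  have dP : is_derive x^-1 1 (horner P) (P^`()).[x^-1].
    by split; [exact: derivable_horner|rewrite derivE derive1E].
  have dPi := @is_derive1_comp R (horner P) (fun s => s^-1) x _ _ dP di.
  have dN := derive_scale (-1) di.
  have dE := @is_derive1_comp R expR (fun s => -1 * s^-1) x _ _ (is_derive_expR _) dN.
  have dE' : is_derive x 1 (fun s => expR (- s^-1)) (expR (-1 * x^-1) * (-1 * (- x ^- 2 *: 1))).
    rewrite (_ : (fun s => _) = expR \o (fun s => -1 * s^-1))//.
    by apply/funext => s /=; rewrite mulN1r.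
  apply: derive_eq (derive_mul dPi dE') _.
  rewrite hornerM hornerXn hornerD hornerN mulN1r /GRing.scale/= exprVn.
  move: (expR _) (P.[_]) (P^`().[_]) => e r r'; ring.
rewrite [X in is_derive _ _ _ X]/flat ltxx.
have [C C0 hC] := poly_exp_bound ('X^2 * P).
(* The exponential absorbs the polynomial and two further powers of 1/h, which gives the derivative
   0 at the origin. *)
have bd (h : R) : `|flat P h| <= C * h ^+ 2.
  rewrite /flat; case: ifPn => h0; last by rewrite normr0 mulr_ge0 ?sqr_ge0.
  have hi : 0 <= h^-1 by rewrite invr_ge0 ltW.
  have := hC _ hi; rewrite hornerM hornerXn normrM exprVn normrM expRN.
  rewrite [`|(h ^+ 2)^-1|]ger0_norm ?invr_ge0 ?sqr_ge0// ler_pdivrMl ?exprn_gt0// => l.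
  rewrite [`|_^-1|]ger0_norm ?invr_ge0 ?expR_ge0// ler_pdivrMr ?expR_gt0//.
  by have -> : C * h ^+ 2 * expR h^-1 = h ^+ 2 * (C * expR h^-1) by ring.
apply/is_derive1_caratheodory; exists (fun z => flat P z / z); split.
- move=> z; rewrite subr0 {2}/flat ltxx subr0; have [->|z0] := eqVneq z 0.
    by rewrite mulr0 /flat ltxx.
  by rewrite divfK.
- apply: (@dominated_continuous_at R _ (fun z => flat P z / z) (fun z => C * `|z|) 0).
  + by apply: cvgM; [exact: cvg_cst|apply: cvg_norm; exact: cvg_id].
  + by rewrite normr0 mulr0.
  move=> z; rewrite [X in _ - X](_ : _ = 0) ?subr0; last by rewrite /flat ltxx mul0r.
  have [->|z0] := eqVneq z 0; first by rewrite invr0 !mulr0 normr0 mulr0.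
  rewrite normrM normfV ler_pdivrMr ?normr_gt0//; apply: (le_trans (bd z)).
  by rewrite -mulrA -expr2 real_normK// num_real.
- by rewrite /flat ltxx mul0r.
Qed.

Lemma smooth_flat k P : smooth k (flat P).
Proof.
elim: k P => [P|k IH P]; first exact: derive_continuous (flat_derive P).
by exists (flat ('X^2 * (P - P^`()))); [exact: flat_derive|exact: IH].
Qed.

Lemma primitive_compact f (A B : R) : continuous f -> (forall x, x <= A -> f x = 0) ->
  (forall x, B <= x -> f x = 0) ->
  exists F, (forall x : R, is_derive x 1 F (f x)) /\ forall x, x <= A -> F x = 0.
Proof.
move=> cf fA fB; pose F x := \int[@lebesgue_measure R]_(t in `]-oo, x]) f t.
have mf : measurable_fun (setT : set (measurableTypeR R)) f by exact: continuous_measurable_fun.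
have AB : A <= Num.max A B by rewrite le_max lexx.
have [M M0 hM] : exists2 M, 0 <= M & forall x, `|f x| <= M.
  have cpt : compact (f @` `[A, Num.max A B]).
    by apply: continuous_compact; [exact: continuous_subspaceT|exact: segment_compact].
  have [M M0 hM] := bounded_real_set cpt; exists M => // x.
  have [xA|xA] := leP x A; first by rewrite fA// normr0.
  have [xB|xB] := leP B x; first by rewrite fB// normr0.
  by apply: hM; exists x => //=; rewrite in_itv/= (ltW xA) le_max (ltW xB) orbT.
have iT : rintegrable (@lebesgue_measure R) setT f.
  have i1 : rintegrable (@lebesgue_measure R) (setT : set (measurableTypeR R)) (fun x => M * \1_(`[A, Num.max A B]%classic : set R) x).
    apply: rintegrableZ => //; apply/integrableP; split.
      by apply/measurable_EFinP; exact: measurable_indic.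
    under eq_integral do rewrite /= ger0_norm//.
    by rewrite integral_indic// setIT/= lebesgue_measure_itv/=; case: ifP => _; rewrite ltry.
  apply: (rintegrable_le measurableT mf i1) => x _; rewrite indicE.
  have [xA|xA] := leP x A; first by rewrite fA// normr0 mulr_ge0.
  have [xB|xB] := leP B x; first by rewrite fB// normr0 mulr_ge0.
  by rewrite mem_set ?mulr1//= in_itv/= (ltW xA) le_max (ltW xB) orbT.
exists F; split=> [x|x xA]; last first.
  rewrite /F (@eq_rint _ _ _ (@lebesgue_measure R) _ _ (fun=> 0)); last first.
    by move=> t; rewrite /= in_itv/= => tx; apply: fA; exact: le_trans xA.
  by rewrite Rintegral_cst//= mul0r.
have iu : (@lebesgue_measure R).-integrable [set` Interval -oo%O (BRight (x + 1))] (EFin \o f).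
  by apply: (integrableS measurableT _ _ iT) => //; exact: measurable_itv.
have x1 : x < x + 1 by rewrite ltrDl.
have [|d e] := @continuous_FTC1 R f (BInfty R true) x (x + 1) x1 iu _ (cf x); first by rewrite /= ltNyr.
by split; [exact: d|rewrite -derive1E; exact: e].
Qed.

Lemma nondecreasing_primitive (F f : R -> R) : (forall x : R, is_derive x 1 F (f x)) ->
  (forall x, 0 <= f x) -> forall x y, x <= y -> F x <= F y.
Proof.
move=> dF f0 x y; rewrite le_eqVlt => /orP[/eqP -> //|xy].
have [c _ E] := MVT xy (fun z _ => dF z) (continuous_subspaceT (derive_continuous dF)).
by rewrite -subr_ge0 E mulr_ge0// subr_ge0 ltW.
Qed.

Lemma constant_primitive (F f : R -> R) (B : R) : (forall x : R, is_derive x 1 F (f x)) ->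
  (forall x, B <= x -> f x = 0) -> forall x, B <= x -> F x = F B.
Proof.
move=> dF f0 x; rewrite le_eqVlt => /orP[/eqP -> //|xy].
have [c /[!in_itv]/= /andP[Bc _] E] := MVT xy (fun z _ => dF z) (continuous_subspaceT (derive_continuous dF)).
by apply/eqP; rewrite -subr_eq0 E f0 ?mul0r ?eqxx// ltW.
Qed.

(** The normalized primitive of the bump exp(-1/x) exp(-1/(1-x)) on ]0, 1[. *)
Lemma smooth_step : exists sg : R -> R, [/\ forall k, smooth k sg, forall x, x <= 0 -> sg x = 0,
  forall x, 1 <= x -> sg x = 1 & forall x y, x <= y -> sg x <= sg y].
Proof.
pose f x : R := flat 1 x * flat 1 (-1 * x + 1).
have sf k : smooth k f by apply: smooth_mul; [|apply: smooth_affine]; exact: smooth_flat.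
have fl (x : R) : 0 <= flat 1 x.
  by rewrite /flat; case: ifP => // _; rewrite hornerC mul1r expR_ge0.
have fA x : x <= 0 -> f x = 0 by move=> x0; rewrite /f /flat ltNge x0 mul0r.
have fB x : 1 <= x -> f x = 0.
  by move=> x1; rewrite /f [X in _ * X]/flat mulN1r addrC subr_gt0 ltNge x1 mulr0.
have f0 x : 0 <= f x by exact: mulr_ge0.
have [F [dF FA]] := primitive_compact (smooth_continuous (sf 0%N)) fA fB.
have mF := nondecreasing_primitive dF f0.
(* Otherwise the monotone primitive would vanish up to 1 and the bump would be 0 at 1/2. *)
have F1 : 0 < F 1.
  rewrite lt_neqAle -{2}(FA 0 (lexx 0)) (mF 0 1 ler01) andbT eq_sym; apply/eqP => F10.
  have nb : \forall x \near (2^-1 : R), 0 = F x.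
    have : nbhs (2^-1 : R) [set s : R | s < 1].
      by apply: open_nbhs_nbhs; split; [exact: open_lt|rewrite /= invf_lt1 ?ltr1n].
    apply: filterS => x /= x1; apply/eqP; rewrite eq_le; apply/andP; split.
      have [x0|x0] := leP x 0; first by rewrite FA.
      by rewrite -(FA 0 (lexx 0)); apply: mF; exact: ltW.
    by rewrite -F10; apply: mF; exact: ltW.
  have [_ d0] := derive_near nb (is_derive_cst (0 : R) _ _).
  have [_ d1] := dF 2^-1; rewrite d0 in d1.
  have : 0 < f 2^-1; last by rewrite -d1 ltxx.
  have h2 : (0 : R) < 2^-1 by rewrite invr_gt0.
  have E : -1 * 2^-1 + 1 = 2^-1 :> R by field.
  by rewrite /f E /flat h2 hornerC mul1r mulr_gt0 ?expR_gt0.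
exists (fun x => F x * (F 1)^-1); split.
- move=> k; apply: smooth_mul; last exact: smooth_cst.
  by case: k => [|k]; [exact: derive_continuous dF|exists f].
- by move=> x /FA ->; rewrite mul0r.
- by move=> x x1; rewrite (constant_primitive dF fB x1) mulfV// gt_eqF.
- by move=> x y xy; rewrite ler_wpM2r ?invr_ge0 ?(ltW F1)//; exact: mF.
Qed.

(* The shifted differences of a smooth step form a partition of unity. *)
Lemma smooth_approx (h : R -> R) (B eps k : R) : 0 < k -> 0 <= B -> h 0 = 0 ->
  (forall s, s <= 0 -> h s = 0) -> (forall s, B <= s -> h s = 0) ->
  (forall s t, `|s - t| <= k^-1 -> `|h s - h t| <= eps) ->
  exists th : R -> R, [/\ forall j, smooth j th, forall s, `|th s - h s| <= eps,
    forall s, s <= 0 -> th s = 0 & forall s, B + k^-1 <= s -> th s = 0].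
Proof.
move=> k0 B0 h0 hA hB hm; have [sg [ssg sg0 sg1 sgm]] := smooth_step.
(* The grid points j/k with j < J cover [0, B] with a margin. *)
have [J hJ] : exists J : nat, B * k + 2 <= J%:R.
  by exists (Num.truncn (B * k + 2)).+1; exact: ltW (truncnS_gt _).
pose eta j s := sg (k * s + (1 - j%:R)) - sg (k * s + - j%:R).
have eta0 j s : 0 <= eta j s by rewrite subr_ge0; apply: sgm; rewrite lerD2l -[X in X <= _]add0r lerD2r.
have etaout j s : k^-1 < `|s - j%:R / k| -> eta j s = 0.
  move=> far; have {}far : 1 < `|k * s - j%:R|.
    have -> : k * s - j%:R = k * (s - j%:R / k) by field; rewrite gt_eqF.
    by rewrite normrM gtr0_norm// -ltr_pdivrMl// mulr1.
  rewrite /eta; have [h1|h1] := leP (k * s - j%:R) 0.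
    rewrite ler0_norm// in far; rewrite !sg0 ?subrr//; move: far h1; lra.
  by rewrite gtr0_norm// in far; rewrite !sg1 ?subrr//; move: far h1; lra.
have sumE s n : \sum_(j < n) eta j s = sg (k * s + 1) - sg (k * s + (1 - n%:R)).
  elim: n => [|n IH]; first by rewrite big_ord0 subr0 subrr.
  rewrite big_ord_recr/= IH /eta -natr1.
  have -> : 1 - (n%:R + 1) = - n%:R :> R by ring.
  ring.
(* For s <= 0 only j = 0 could contribute, and its coefficient is h 0 = 0. *)
have thz s j : s <= 0 -> h (j%:R / k) * eta j s = 0.
  move=> s0; have ks : k * s <= 0 by rewrite pmulr_rle0.
  case: j => [|j]; first by rewrite mul0r h0 mul0r.
  rewrite /eta !sg0 ?subrr ?mulr0//; have : (0 : R) <= j%:R by []; rewrite -natr1; move: (j%:R : R) => r r0; lra.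
exists (fun s => \sum_(j < J) h (j%:R / k) * eta j s); split.
- move=> i; apply: (@smooth_sum i J (fun j s => h (j%:R / k) * eta j s)) => j; apply: smooth_mul; first exact: smooth_cst.
  rewrite (_ : eta j = fun s => sg (k * s + (1 - j%:R)) + (fun=> -1) s * sg (k * s + - j%:R)).
    by apply: smooth_add; [exact: smooth_affine|apply: smooth_mul; [exact: smooth_cst|exact: smooth_affine]].
  by apply/funext => s; rewrite /eta mulN1r.
- move=> s; have e0 : 0 <= eps by have := hm 0 0; rewrite !subrr normr0 invr_ge0 (ltW k0); exact.
  have [s0|s0] := leP s 0.
    by rewrite big1 ?hA ?subrr ?normr0// => j _; exact: thz.
  have [sJ|sJ] := leP (k * s + (1 - J%:R)) 0; last first.
    have kB : B < s - k^-1.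
      have : k * B < k * (s - k^-1); last by rewrite ltr_pM2l.
      by rewrite mulrBr mulfV ?gt_eqF// [k * B]mulrC; move: hJ sJ; lra.
    have Bs : B <= s by apply: le_trans (ltW kB) _; rewrite gerBl invr_ge0 ltW.
    rewrite hB// subr0 big1 ?normr0// => j _.
    have [jB|jB] := leP B (j%:R / k); first by rewrite hB ?mul0r.
    rewrite etaout ?mulr0// gtr0_norm; first by move: kB jB; lra.
    by rewrite subr_gt0 (lt_le_trans jB).
  have S1 : \sum_(j < J) eta j s = 1.
    rewrite sumE (sg0 _ sJ) sg1 ?subr0// lerDr mulr_ge0// ltW//.
  have -> : h s = \sum_(j < J) h s * eta j s by rewrite -mulr_sumr S1 mulr1.
  rewrite -sumrB; apply: (le_trans (ler_norm_sum _ _ _)).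
  apply: (@le_trans _ _ (\sum_(j < J) eps * eta j s)); last by rewrite -mulr_sumr S1 mulr1.
  apply: ler_sum => j _; rewrite -mulrBl normrM [`|eta j s|]ger0_norm//.
  have [hj|hj] := leP `|s - j%:R / k| k^-1; last by rewrite etaout ?mulr0.
  by apply: ler_wpM2r => //; apply: hm; rewrite distrC.
- by move=> s s0; rewrite big1// => j _; exact: thz.
- move=> s sB; rewrite big1// => j _.
  have [jB|jB] := leP B (j%:R / k); first by rewrite hB ?mul0r.
  rewrite etaout ?mulr0// gtr0_norm; first by move: sB jB; lra.
  by rewrite subr_gt0 (lt_le_trans jB)// (le_trans _ sB)// lerDl invr_ge0 ltW.
Qed.

(** Heine-Cantor on an interval with a margin of 1 on both sides; with d < 1, two close points not
    covered by it lie in a region where h vanishes. *)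
Lemma uniform_modulus (h : R -> R) (A B : R) : continuous h -> (forall s, s <= A -> h s = 0) ->
  (forall s, B <= s -> h s = 0) ->
  forall eps, 0 < eps -> exists2 d, 0 < d & forall s t, `|s - t| <= d -> `|h s - h t| <= eps.
Proof.
move=> ch hA hB eps eps0.
have cK : compact `[A - 1, B + 1]%classic by exact: segment_compact.
pose P d x := forall s, `|s - x| <= d -> `|h s - h x| <= eps.
have loc x : `[A - 1, B + 1]%classic x -> \forall x' \near x & d \near (0 : R)^'+, P d x'.
  move=> _; have e2 : 0 < eps / 2 by rewrite divr_gt0.
  have /cvgrPdist_le/(_ _ e2)/nbhs_ballP[r /= r0 hr] := ch x.
  have r2 : 0 < r / 2 by rewrite divr_gt0.
  exists (ball x (r / 2), [set d | d < r / 2]) => /=.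
    by split; [exact: nbhsx_ballx|exact: nbhs_right_lt].
  move=> [x' d] /= [bx dr] s sx; rewrite /ball/= in bx.
  have b1 : `|h x - h x'| <= eps / 2 by apply: hr; rewrite /ball/=; move: bx r2; lra.
  have b2 : `|h x - h s| <= eps / 2.
    apply: hr; rewrite /ball/= (_ : x - s = (x - x') - (s - x')); last by ring.
    by apply: le_lt_trans (ler_normB _ _) _; move: bx sx dr; lra.
  have -> : h s - h x' = (h x - h x') - (h x - h s) by ring.
  by apply: (le_trans (ler_normB _ _)); move: b1 b2; lra.
have nd := (compact_near_coveringP _).1 cK R (at_right 0) P _ loc.
have Fr : Filter (0 : R)^'+ by exact _.
have ex : \forall d \near (0 : R)^'+, [/\ 0 < d, d < 1 & `[A - 1, B + 1]%classic `<=` P d].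
  have n0 : \forall d \near (0 : R)^'+, 0 < d by exact: nbhs_right_gt.
  have n1 : \forall d \near (0 : R)^'+, d < 1 by exact: nbhs_right_lt.
  by apply: filterS3 n0 n1 (nd Fr) => d.
have [d [d0 d1 Pd]] := filter_ex ex; exists d => // s t st.
have := le_lt_trans st d1; rewrite ltr_norml => /andP[u1 u2].
have [tA|tA] := ltP t (A - 1).
  by rewrite !hA ?subrr ?normr0 ?ltW//; move: tA u1 u2; lra.
have [tB|tB] := ltP (B + 1) t.
  by rewrite !hB ?subrr ?normr0 ?ltW//; move: tB u1 u2; lra.
by apply: Pd => //; rewrite /= in_itv/= tA tB.
Qed.

End Smooth1.

(** * Smooth functions of |x|^2 *)

Section SmoothRn.
Context {R : realType}.
Variable n : nat.
Local Notation e i := (delta_mx ord0 i : 'rV[R]_n).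
Implicit Types (f g : 'rV[R]_n -> R) (x : 'rV[R]_n).

Lemma Ck_continuous k f : Ck k f -> continuous f.
Proof. by case: k => [|k] []. Qed.

Lemma Ck_intro k f (df : 'I_n -> 'rV[R]_n -> R) : continuous f ->
  (forall i x, is_derive x (e i) f (df i x)) -> (forall i, Ck k (df i)) -> Ck k.+1 f.
Proof.
move=> cf dd ck; split=> // i; split; first by move=> x; case: (dd i x).
have -> : (fun x => 'D_(e i) f x) = df i by apply/funext => x; case: (dd i x).
exact: ck.
Qed.

Lemma CkS k f : Ck k.+1 f -> Ck k f.
Proof.
elim: k f => [f [cf _]|k IH f [cf df]]; first by split.
by split=> // i; have [di ci] := df i; split=> //; exact: IH.
Qed.

Lemma Ck_derive k f i x : Ck k.+1 f -> is_derive x (e i) f ('D_(e i) f x).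
Proof. by move=> [_ /(_ i)[d _]]; split. Qed.

Lemma line_derive_add f g i x a b : is_derive x (e i) f a -> is_derive x (e i) g b ->
  is_derive x (e i) (fun y => f y + g y) (a + b).
Proof.
move=> df dg; apply: line_derive.
have df' : is_derive (0 *: e i + x) (e i) f a by rewrite scale0r add0r.
have dg' : is_derive (0 *: e i + x) (e i) g b by rewrite scale0r add0r.
exact: derive_add (derive_line df') (derive_line dg').
Qed.

Lemma line_derive_mul f g i x a b : is_derive x (e i) f a -> is_derive x (e i) g b ->
  is_derive x (e i) (fun y => f y * g y) (f x * b + a * g x).
Proof.
move=> df dg; apply: line_derive.
have df' : is_derive (0 *: e i + x) (e i) f a by rewrite scale0r add0r.
have dg' : is_derive (0 *: e i + x) (e i) g b by rewrite scale0r add0r.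
by apply: derive_eq (derive_mul (derive_line df') (derive_line dg')) _; rewrite !scale0r !add0r.
Qed.

Lemma Ck_cst k (c : R) : Ck k (fun _ : 'rV[R]_n => c).
Proof.
elim: k c => [c|k IH c]; first by split=> //; exact: cst_continuous.
have dd i x : is_derive x (e i) (fun _ : 'rV[R]_n => c) 0 by apply: line_derive; exact: is_derive_cst.
by apply: (Ck_intro _ dd) => [|i]; [exact: cst_continuous|exact: IH].
Qed.

Lemma Ck_add k f g : Ck k f -> Ck k g -> Ck k (fun x => f x + g x).
Proof.
elim: k f g => [f g cf cg|k IH f g cf cg].
  split=> // x; have c1 := Ck_continuous cf (x := x); have c2 := Ck_continuous cg (x := x).
  exact: cvgD c1 c2.
apply: (Ck_intro (df := fun i x => 'D_(e i) f x + 'D_(e i) g x)).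
- move=> x; have c1 := Ck_continuous cf (x := x); have c2 := Ck_continuous cg (x := x).
  exact: cvgD c1 c2.
- by move=> i x; exact: line_derive_add (Ck_derive i x cf) (Ck_derive i x cg).
- by move=> i; apply: IH; [case: cf|case: cg] => _ /(_ i)[].
Qed.

Lemma Ck_mul k f g : Ck k f -> Ck k g -> Ck k (fun x => f x * g x).
Proof.
elim: k f g => [f g cf cg|k IH f g cf cg].
  split=> // x; exact: mul_continuous_at (Ck_continuous cf (x := x)) (Ck_continuous cg (x := x)).
apply: (Ck_intro (df := fun i x => f x * 'D_(e i) g x + 'D_(e i) f x * g x)).
- move=> x; exact: mul_continuous_at (Ck_continuous cf (x := x)) (Ck_continuous cg (x := x)).
- by move=> i x; exact: line_derive_mul (Ck_derive i x cf) (Ck_derive i x cg).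
- move=> i; have df : Ck k (fun x => 'D_(e i) f x) by case: cf => _ /(_ i)[].
  have dg : Ck k (fun x => 'D_(e i) g x) by case: cg => _ /(_ i)[].
  by apply: Ck_add; apply: IH => //; exact: CkS.
Qed.

Lemma coord_derive (i j : 'I_n) x : is_derive x (e i) (fun y => y ord0 j) (i == j)%:R.
Proof.
apply: line_derive; have -> : (fun h => (h *: e i + x) ord0 j) = fun h => x ord0 j + (i == j)%:R * h.
  by apply/funext => h; rewrite !mxE eqxx /= addrC mulrC eq_sym.
apply: derive_eq (derive_add (is_derive_cst _ _ _) (derive_scale _ (is_derive_id _ _))) _.
by rewrite add0r mulr1.
Qed.

Lemma Ck_coord k (j : 'I_n) : Ck k (fun x => x ord0 j).
Proof.
case: k => [|k]; first by split=> //; exact: coord_continuous.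
apply: (Ck_intro (df := fun i _ => (i == j)%:R)); first exact: coord_continuous.
  by move=> i x; exact: coord_derive.
by move=> i; exact: Ck_cst.
Qed.

Lemma dotp_continuous x : dotp y y @[y --> x] --> dotp x x.
Proof.
have := @sum_continuous R 'rV[R]_n 'I_n (index_enum 'I_n) (fun i y => y ord0 i * y ord0 i); apply => i y.
by apply: mul_continuous_at; exact: coord_continuous.
Qed.

Lemma square_derive (Th th : R -> R) i x : (forall s : R, is_derive s 1 Th (th s)) ->
  is_derive x (e i) (fun y => Th (dotp y y)) (th (dotp x x) * (2 * x ord0 i)).
Proof.
move=> dT; apply: line_derive.
have d := @is_derive1_comp R Th _ 0 _ _ (dT _) (dotp_line_derive x i).
by apply: derive_eq d _; rewrite scale0r add0r.
Qed.

Lemma Ck_square k (Th : R -> R) : smooth k Th -> Ck k (fun x => Th (dotp x x)).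
Proof.
have cc (f : R -> R) : continuous f -> continuous (fun x => f (dotp x x)).
  by move=> cf x; exact: (cvg_comp _ _ (@dotp_continuous x) (cf (dotp x x))).
elim: k Th => [Th cT|k IH Th [th dT sT]]; first by split=> //; exact: cc.
apply: (Ck_intro (df := fun i x => th (dotp x x) * (2 * x ord0 i))).
- by apply: cc; exact: derive_continuous dT.
- by move=> i x; exact: square_derive.
- move=> i; apply: Ck_mul; first exact: IH.
  by apply: Ck_mul; [exact: Ck_cst|exact: Ck_coord].
Qed.

Lemma cube_compact (L : R) : compact (@cube R n (- L) L) /\ closed (@cube R n (- L) L).
Proof.
have E : @cube R n (- L) L = [set x | forall i, `[- L, L]%classic (x ord0 i)].
  by apply/seteqP; split=> x cx i; have := cx i; rewrite /= in_itv.
split; first by rewrite E; exact: (rV_compact (fun _ : 'I_n => segment_compact (a := - L) (b := L))).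
have -> : @cube R n (- L) L = \bigcap_(i in [set: 'I_n]) ((fun x => x ord0 i) @^-1` `[- L, L]%classic).
  by rewrite E; apply/seteqP; split=> x cx i => [_|]; exact: cx.
apply: closed_bigI => i _; apply: closed_comp; last exact: itv_closed.
by move=> x _; exact: coord_continuous.
Qed.

(** Profiles in |x|^2 are smooth at the origin without any parity condition, because |x|^2 is a
    polynomial. *)
Lemma square_test (Th : R -> R) (B : R) : 0 <= B -> (forall k, smooth k Th) ->
  (forall s, B <= s -> Th s = 0) -> test_function (fun x => Th (dotp x x)).
Proof.
move=> B0 sT TB; split; first by move=> k; exact: Ck_square.
have [cc cl] := cube_compact (B + 1).
apply: (subclosed_compact _ cc); first exact: closed_closure.
rewrite closureE => x /(_ (@cube R n (- (B + 1)) (B + 1))); apply; split=> // y /= Ty i.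
rewrite -ler_norml; have lt : dotp y y < B by rewrite ltNge; apply/negP => /TB /eqP; apply/negP.
apply: (le_trans (coord_le_enorm y i)).
have B1 : 0 <= B + 1 by rewrite addr_ge0.
rewrite /Defs.enorm -[B + 1]ger0_norm// -sqrtr_sqr; apply: ler_wsqrtr; apply: (le_trans (ltW lt)).
by have := sqr_ge0 B; rewrite sqrrD expr1n; move: (B ^+ 2) B0 => b; rewrite mulr1 mulr2n; lra.
Qed.

Lemma square_grad (Th th : R -> R) x : (forall s : R, is_derive s 1 Th (th s)) ->
  grad (fun x => Th (dotp x x)) x = (2 * th (dotp x x)) *: x.
Proof.
move=> dT; apply/rowP => i; rewrite !mxE; have [_ ->] := square_derive i x dT; ring.
Qed.

End SmoothRn.

Lemma step_bounds {R : realType} (sg : R -> R) : (forall x, x <= 0 -> sg x = 0) ->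
  (forall x, 1 <= x -> sg x = 1) -> (forall x y, x <= y -> sg x <= sg y) -> forall x, 0 <= sg x <= 1.
Proof.
move=> sg0 sg1 sgm x; have [h|h] := leP x 0; first by rewrite sg0// lexx ler01.
have [h'|h'] := leP 1 x; first by rewrite sg1// lexx ler01.
have := sgm 0 x (ltW h); have := sgm x 1 (ltW h'); rewrite (sg0 0)// (sg1 1)// => -> ->; exact: erefl.
Qed.

(** * Approximation of radial profiles *)

Section RadialApproximation.
Context {R : realType}.
Variable N : nat.
Hypothesis N3 : (3 <= N)%N.
Local Notation nu := (@radial_measure R N).
Local Notation D := (@halfline R).
Local Notation rig := (rintegrable nu D).
Local Notation II g := (\int[nu]_(t in D) g t)%R.
Local Notation cb := (@ball_vol R N).
Let mD := @measurable_halfline R.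
Variables u v : R -> R.
Hypothesis du : forall t : R, 0 < t -> is_derive t 1 u (v t).
Hypothesis cv : forall t : R, 0 < t -> {for t, continuous v}.
Variables C U V : R.
Hypothesis C0 : 0 <= C.
Hypothesis U0 : 0 <= U.
Hypothesis V0 : 0 <= V.
Hypothesis vC : forall t, 0 < t -> `|v t| <= C * t.
Hypothesis uU : forall t, 0 < t -> `|u t| <= U.
Hypothesis vV : forall t, 0 < t -> `|v t| <= V.
Hypothesis iu : rig (fun t => u t ^+ 2).
Hypothesis iv : rig (fun t => v t ^+ 2).

Let cu (t : R) : 0 < t -> {for t, continuous u}.
Proof. by move=> t0; apply: differentiable_continuous; apply/derivable1_diffP; case: (du t0). Qed.

Lemma halfline_continuous_measurable (f : R -> R) : (forall t : R, 0 < t -> {for t, continuous f}) ->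
  measurable_fun D f.
Proof.
move=> cf; apply: open_continuous_measurable_fun; first exact: interval_open.
by move=> t; rewrite inE => /halflineE; exact: cf.
Qed.

Lemma cutoff : exists (chi chi' : R -> R) (M : R), [/\ 0 <= M,
  (forall t : R, is_derive t 1 chi (chi' t)) /\ continuous chi',
  forall t, 0 <= chi t <= 1, forall t, `|chi' t| <= M &
  (forall t, t < 1 -> chi t = 1 /\ chi' t = 0) /\ forall t, 2 < t -> chi t = 0 /\ chi' t = 0].
Proof.
have [sg [ssg sg0 sg1 sgm]] := smooth_step (R := R).
have s1 : smooth 1 (fun t => 1 + -1 * sg (1 * t + -1)).
  apply: smooth_add; first exact: smooth_cst.
  by apply: smooth_mul; [exact: smooth_cst|apply: smooth_affine].
case: s1 => chi' dchi cchi'.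
set chi := fun t => 1 + -1 * sg (1 * t + -1) in dchi.
have z1 (t : R) : t < 1 -> chi t = 1 by move=> t1; rewrite /chi sg0 ?mulr0 ?addr0//; move: t1; lra.
have z2 (t : R) : 2 < t -> chi t = 0 by move=> t1; rewrite /chi sg1 ?mulr1 ?subrr//; move: t1; lra.
have loc (A : set R) (k t : R) : open A -> A t -> (forall s, A s -> chi s = k) -> chi' t = 0.
  move=> oA At Ak; have nb : \forall s \near t, chi s = k.
    by have : nbhs t A by [exact: open_nbhs_nbhs]; apply: filterS.
  by have [_ <-] := derive_near nb (dchi t); exact: derive_cst.
have d1 (t : R) : t < 1 -> chi' t = 0 by move=> t1; exact: (loc [set s | s < 1] 1 t (@open_lt _ _) t1 z1).
have d2 (t : R) : 2 < t -> chi' t = 0 by move=> t1; exact: (loc [set s | 2 < s] 0 t (@open_gt _ _) t1 z2).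
have cpt : compact (chi' @` `[1, 2]).
  by apply: continuous_compact; [exact: continuous_subspaceT|exact: segment_compact].
have [M M0 hM] := bounded_real_set cpt.
exists chi, chi', M; split => //.
- move=> t; have /andP := step_bounds sg0 sg1 sgm (1 * t + -1).
  by rewrite /chi => -[]; move: (sg _) => y *; apply/andP; split; lra.
- move=> t; have [t1|t1] := ltP t 1; first by rewrite d1// normr0.
  have [t2|t2] := ltP 2 t; first by rewrite d2// normr0.
  by apply: hM; exists t => //=; rewrite in_itv/= t1.
- by split=> t h; [rewrite z1 ?d1|rewrite z2 ?d2].
Qed.

(** The derivative of Th(t^2) is 2 t th(t^2), so it is vn(sqrt s)/(2 sqrt s) that must be
    approximated by a smooth [th]; the error of the profile is then integrated inwards from n +
    1. *)
Lemma smooth_profile (n : R) (un vn : R -> R) : 1 <= n ->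
  (forall t : R, 0 < t -> is_derive t 1 un (vn t)) -> (forall t : R, 0 < t -> {for t, continuous vn}) ->
  (forall t, 0 < t -> t < 1 -> `|vn t| <= C * t) -> (forall t, n <= t -> un t = 0 /\ vn t = 0) ->
  forall eta, 0 < eta -> exists (Th th : R -> R) (B : R), [/\ 0 <= B,
    (forall k, smooth k Th) /\ (forall s : R, is_derive s 1 Th (th s)), forall s, B <= s -> Th s = 0,
    forall t, 0 < t -> `|vn t - 2 * t * th (t ^+ 2)| <= eta /\ `|un t - Th (t ^+ 2)| <= eta &
    forall t, n + 1 <= t -> vn t - 2 * t * th (t ^+ 2) = 0 /\ un t - Th (t ^+ 2) = 0].
Proof.
move=> n1 dn cn vnC out eta eta0.
have [sg [ssg sg0 sg1 sgm]] := smooth_step (R := R).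
have sg01 := step_bounds sg0 sg1 sgm.
(* Integration over a length of at most n + 1 must still leave an error below [eta]. *)
pose E := eta / (n + 2).
have n20 : 0 < n + 2 by move: n1; lra.
have E0 : 0 < E by rewrite divr_gt0.
(* On ]0, 2 de] the linear bound makes vn at most E/2, so it may be discarded there. *)
pose de := Num.min (1 / 4) (E / (4 * (C + 1))).
have C10 : 0 < C + 1 by move: C0; lra.
have de0 : 0 < de by rewrite lt_min !divr_gt0// mulr_gt0.
have de4 : de <= 1 / 4 by rewrite ge_min lexx.
have deC : C * (2 * de) <= E / 2.
  have : de <= E / (4 * (C + 1)) by rewrite ge_min lexx orbT.
  rewrite ler_pdivlMr ?mulr_gt0// => h.
  have : 0 <= de by exact: ltW.
  by move: h C0 => + + d; nra.
have dd0 : 0 < de ^+ 2 by rewrite exprn_gt0.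
(* The step vanishes for s <= de^2 and is 1 from 2 de^2 on; it removes the quotient's possible
   discontinuity at s = 0. *)
pose h s := sg (s / de ^+ 2 - 1) * (vn (Num.sqrt s) / (2 * Num.sqrt s)).
have hA s : s <= de ^+ 2 -> h s = 0.
  by move=> sd; rewrite /h sg0 ?mul0r// subr_le0 ler_pdivrMr// mul1r.
have n0 : 0 <= n by move: n1; lra.
have hB s : n ^+ 2 <= s -> h s = 0.
  move=> ns; have : n <= Num.sqrt s by rewrite -[n]ger0_norm// -sqrtr_sqr ler_wsqrtr.
  by move=> /out[_]; rewrite /h => ->; rewrite mul0r mulr0.
have ch : continuous h.
  move=> s; have [sd|sd] := ltP s (de ^+ 2).
    have nb : \forall x \near s, 0 = h x.
      have : nbhs s [set x : R | x < de ^+ 2] by apply: open_nbhs_nbhs; split => //; exact: open_lt.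
      by apply: filterS => x /= xd; rewrite hA ?ltW.
    have d := derive_near nb (is_derive_cst (0 : R) s 1).
    by apply: differentiable_continuous; apply/derivable1_diffP; case: d.
  have s0 : 0 < s by exact: lt_le_trans sd.
  have q0 : 0 < Num.sqrt s by rewrite sqrtr_gt0.
  have c1 : sg (x / de ^+ 2 - 1) @[x --> s] --> sg (s / de ^+ 2 - 1).
    have := smooth_continuous (smooth_affine (de ^- 2) (-1) (ssg 0%N)).
    move=> /(_ s); rewrite (_ : (fun t => sg (de ^- 2 * t + -1)) = (fun x => sg (x / de ^+ 2 - 1)))//.
    by apply/funext => x; rewrite mulrC.
  have cq : Num.sqrt x @[x --> s] --> Num.sqrt s := @sqrt_continuous R s.
  have c2 : vn (Num.sqrt x) @[x --> s] --> vn (Num.sqrt s) := cvg_comp _ _ cq (cn _ q0).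
  have c3 : (2 * Num.sqrt x)^-1 @[x --> s] --> (2 * Num.sqrt s)^-1.
    apply: cvgV; first by rewrite mulf_neq0// gt_eqF.
    by apply: cvgM => //; exact: cvg_cst.
  exact: cvgM c1 (cvgM c2 c3).
have h0 : h 0 = 0 by rewrite hA// ltW.
have hA0 s : s <= 0 -> h s = 0 by move=> s0; rewrite hA// (le_trans s0)// ltW.
(* Compensates for the factor 2t, with t < n + 1. *)
pose E' := E / (4 * (n + 2)).
have E'0 : 0 < E' by rewrite divr_gt0// mulr_gt0.
have [d d0 hd] := uniform_modulus ch hA0 hB E'0.
pose d' := Num.min d 1.
have d'0 : 0 < d' by rewrite lt_min d0 ltr01.
have k0 : 0 < d'^-1 by rewrite invr_gt0.
have hk s t : `|s - t| <= d'^-1^-1 -> `|h s - h t| <= E'.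
  by rewrite invrK => st; apply: hd; apply: (le_trans st); rewrite ge_min lexx.
have [th [sth thh tA tB]] := smooth_approx k0 (sqr_ge0 n) h0 hA0 hB hk.
rewrite invrK in tB.
have [F [dF _]] := primitive_compact (smooth_continuous (sth 0%N)) tA tB.
pose B := n ^+ 2 + d'.
have B0 : 0 <= B by rewrite addr_ge0 ?sqr_ge0// ltW.
(* The primitive is normalized to vanish for large s, as the profile does. *)
pose Th s := F s + - F B.
have dT (s : R) : is_derive s 1 Th (th s).
  by apply: derive_eq (derive_add (dF s) (is_derive_cst _ _ _)) _; rewrite addr0.
have TB s : B <= s -> Th s = 0.
  by move=> sB; rewrite /Th (constant_primitive dF tB sB) subrr.
have sqB t : n + 1 <= t -> B <= t ^+ 2.
  move=> nt; have d1 : d' <= 1 by rewrite ge_min lexx orbT.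
  have aux (x y z : R) : 0 <= y -> y + 1 <= z -> x <= 1 -> y ^+ 2 + x <= z ^+ 2 by move=> *; nra.
  exact: aux n0 nt d1.
have zout t : n + 1 <= t -> vn t - 2 * t * th (t ^+ 2) = 0 /\ un t - Th (t ^+ 2) = 0.
  move=> nt; have nt' : n <= t by apply: le_trans nt; rewrite lerDl.
  have [u1 v1] := out t nt'.
  by rewrite u1 v1 tB ?TB ?sqB// mulr0 !subr0.
have zE t : 0 < t -> `|vn t - 2 * t * th (t ^+ 2)| <= E.
  move=> t0; have [nt|tn] := leP (n + 1) t; first by rewrite (zout t nt).1 normr0 ltW.
  have E1 : vn t = vn t * (1 - sg (t ^+ 2 / de ^+ 2 - 1)) + 2 * t * h (t ^+ 2).
    by rewrite /h sqrtr_sqr gtr0_norm//; field; rewrite gt_eqF.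
  have -> : vn t - 2 * t * th (t ^+ 2) = vn t * (1 - sg (t ^+ 2 / de ^+ 2 - 1)) - 2 * t * (th (t ^+ 2) - h (t ^+ 2)).
    by rewrite {1}E1; ring.
  have -> : E = E / 2 + E / 2 by field.
  apply: (le_trans (ler_normB _ _)); apply: lerD.
    have [t2|t2] := leP 1 (t ^+ 2 / de ^+ 2 - 1).
      by rewrite sg1// subrr mulr0 normr0 divr_ge0// ltW.
    have tde : t <= 2 * de.
      have : t ^+ 2 < 2 * de ^+ 2 by move: t2; rewrite ltrBlDr ltr_pdivrMr// -[1 + 1]/(2 : R).
      by move: t0 de0; nra.
    have /andP[g0 g1] := sg01 (t ^+ 2 / de ^+ 2 - 1).
    rewrite normrM -[E / 2]mulr1; apply: ler_pM => //.
      apply: (le_trans (vnC t t0 _)); first by move: tde de4; lra.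
      by apply: le_trans deC; rewrite ler_wpM2l.
    by rewrite ger0_norm; move: g0 g1; lra.
  rewrite normrM [`|2 * t|]gtr0_norm ?mulr_gt0//.
  apply: (@le_trans _ _ (2 * t * E')); first by rewrite ler_wpM2l// mulr_ge0// ltW.
  rewrite /E' mulrA ler_pdivrMr ?mulr_gt0//.
  have aux (x y z : R) : 0 < x -> x < y + 1 -> 0 <= z -> 0 <= y -> 2 * x * z <= z / 2 * (4 * (y + 2)).
    by move=> *; nra.
  exact: aux t0 tn (ltW E0) n0.
have EN : E <= eta by rewrite ler_pdivrMr// ler_peMr ?(ltW eta0)//; move: n1; lra.
exists Th, th, B; split => //.
  by split => // k; apply: smooth_add; [case: k => [|k]; [exact: derive_continuous dF|exists th]|exact: smooth_cst].
move=> t t0; split; first exact: le_trans (zE t t0) EN.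
have [nt|tn] := leP (n + 1) t; first by rewrite (zout t nt).2 normr0 ltW.
pose g s := un s + -1 * Th (s * s).
have dg (s : R) : 0 < s -> is_derive s 1 g (vn s - 2 * s * th (s ^+ 2)).
  move=> s0; have di := @is_derive_id R R s 1.
  have dc := @is_derive1_comp R Th _ s _ _ (dT _) (derive_mul di di).
  by apply: derive_eq (derive_add (dn s s0) (derive_scale (-1) dc)) _; rewrite expr2; ring.
have gE s : g s = un s - Th (s ^+ 2) by rewrite /g expr2 mulN1r.
have [x /[!in_itv]/= /andP[tx xn] Ex] : exists2 x, x \in `]t, n + 1[ & g (n + 1) - g t = (vn x - 2 * x * th (x ^+ 2)) * (n + 1 - t).
  apply: MVT tn _ _ => [x /[!in_itv]/= /andP[tx _]|]; first by apply: dg; exact: lt_trans tx.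
  apply: derivable_within_continuous => x /[!in_itv]/= /andP[tx _].
  by case: (dg x (lt_le_trans t0 tx)).
rewrite -gE; move: Ex; rewrite {1}gE (zout (n + 1) (lexx _)).2 sub0r => /(congr1 Num.norm).
rewrite normrN normrM => ->.
apply: (@le_trans _ _ (E * (n + 2))); last by rewrite divfK// gt_eqF.
apply: ler_pM => //; first exact: zE (lt_trans t0 tx).
by rewrite ger0_norm; move: tn t0; lra.
Qed.

End RadialApproximation.

Section RadialDensity.
Context {R : realType}.
Variable N : nat.
Hypothesis N3 : (3 <= N)%N.
Let N0 : (0 < N)%N. Proof. exact: leq_trans N3. Qed.
Local Notation nu := (@radial_measure R N).
Local Notation D := (@halfline R).
Local Notation rig := (rintegrable nu D).
Local Notation II g := (\int[nu]_(t in D) g t)%R.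
Local Notation cb := (@ball_vol R N).
Let mD := @measurable_halfline R.

Lemma window_sqr (z : R -> R) (eta L : R) : 0 < L -> measurable_fun D z ->
  (forall t, 0 < t -> `|z t| <= eta) -> (forall t, L < t -> z t = 0) ->
  rig (fun t => z t ^+ 2) /\ II (fun t => z t ^+ 2) <= eta ^+ 2 * (cb * L ^+ N).
Proof.
move=> L0 mz zb z0; have [ic Ec] := rint_oc_cst N3 (eta ^+ 2) (lexx 0) (ltW L0).
have moc : measurable (`]0, L]%classic : set (measurableTypeR R)) by exact: measurable_itv.
have sub : `]0, L]%classic `<=` D by move=> t; rewrite /= in_itv/= => /andP[t0 _]; apply/halflineE.
pose g (t : R) : R := if t <= L then eta ^+ 2 else 0.
have ig : rig g.
  apply: (rint_extend moc sub).
    by move=> t /halflineE t0; rewrite /= in_itv/= t0 /g /=; case: ifP.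
  by apply: eq_rintegrable ic => // t; rewrite /= in_itv/= /g => /andP[_ ->].
have Eg : II g = eta ^+ 2 * (cb * L ^+ N).
  rewrite (rint_split L0 ig).
  have -> : \int[nu]_(t in `]L, +oo[) g t = 0.
    rewrite (@eq_rint _ _ _ nu _ _ (fun=> 0)); first by rewrite Rintegral_cst ?mul0r//; exact: measurable_itv.
    by move=> t; rewrite /= in_itv/= andbT /g => Lt; rewrite leNgt Lt.
  rewrite addr0 (@eq_rint _ _ _ nu _ _ (fun=> eta ^+ 2)); last first.
    by move=> t; rewrite /= in_itv/= /g => /andP[_ ->].
  by rewrite Ec expr0n gtn_eqF ?subr0// (leq_trans _ N3).
rewrite -Eg; apply: (rint_le0_dom mD) => //; first exact: measurable_funX.
move=> t /halflineE t0; have [Lt|Lt] := leP t L; last by rewrite z0// expr0n/= lexx /g /=; case: ifP => _; rewrite ?sqr_ge0.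
rewrite sqr_ge0 /g /= Lt.
by rewrite -real_normK ?num_real// lerXn2r ?nnegrE// (le_trans _ (zb t t0)).
Qed.

Variables u v : R -> R.
Hypothesis du : forall t : R, 0 < t -> is_derive t 1 u (v t).
Hypothesis cv : forall t : R, 0 < t -> {for t, continuous v}.
Variables C U V : R.
Hypothesis C0 : 0 <= C.
Hypothesis U0 : 0 <= U.
Hypothesis V0 : 0 <= V.
Hypothesis vC : forall t, 0 < t -> `|v t| <= C * t.
Hypothesis uU : forall t, 0 < t -> `|u t| <= U.
Hypothesis vV : forall t, 0 < t -> `|v t| <= V.
Hypothesis iu : rig (fun t => u t ^+ 2).
Hypothesis iv : rig (fun t => v t ^+ 2).

Let cu (t : R) : 0 < t -> {for t, continuous u}.
Proof. by move=> t0; apply: differentiable_continuous; apply/derivable1_diffP; case: (du t0). Qed.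

Lemma eventually_dct (f : nat -> R -> R) (g : R -> R) : (forall k, measurable_fun D (f k)) ->
  rig (fun t => g t ^+ 2) -> measurable_fun D g -> (forall k t, 0 < t -> `|f k t| <= `|g t|) ->
  (forall t, exists k0 : nat, forall k, (k0 <= k)%N -> f k t = 0) ->
  (forall k, rig (fun t => f k t ^+ 2)) /\ II (fun t => f k t ^+ 2) @[k --> \oo] --> (0 : R).
Proof.
move=> mf ig mg fg f0.
have le k t : D t -> `|f k t ^+ 2| <= g t ^+ 2.
  by move=> /halflineE t0; rewrite normrX -[g t ^+ 2]real_normK ?num_real// lerXn2r ?nnegrE// fg.
have m2 k : measurable_fun D (fun t => f k t ^+ 2) by exact: measurable_funX.
have ae : {ae nu, forall t, D t -> f k t ^+ 2 @[k --> \oo] --> (0 : R)}.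
  apply: aeW => t _; have [k0 hk] := f0 t.
  apply: cvg_near_cst; exists k0 => // k kk; by rewrite /= hk// expr0n.
have [_ c] := rint_dct mD m2 (measurable_cst (0 : R)) ig le ae.
split; first by move=> k; exact: (rintegrable_le mD (m2 k) ig (le k)).
by rewrite Rintegral_cst ?mul0r// in c.
Qed.

(** The sup bound [Bd] on the gradient error is fixed before eps; this uniformity lets smallness in
    L^2 imply smallness in L^q. *)
Lemma radial_density : exists2 Bd, 0 <= Bd & forall eps, 0 < eps -> exists (Th th : R -> R) (B : R),
  [/\ 0 <= B, (forall k, smooth k Th) /\ (forall s : R, is_derive s 1 Th (th s)), forall s, B <= s -> Th s = 0,
    forall t, 0 < t -> `|v t - 2 * t * th (t ^+ 2)| <= Bd &
    [/\ rig (fun t => (v t - 2 * t * th (t ^+ 2)) ^+ 2), II (fun t => (v t - 2 * t * th (t ^+ 2)) ^+ 2) <= eps,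
        rig (fun t => (u t - Th (t ^+ 2)) ^+ 2) & II (fun t => (u t - Th (t ^+ 2)) ^+ 2) <= eps]].
Proof.
have [chi [chi' [M [M0 [dchi cchi'] chi01 chiM [chi1 chi2]]]]] := cutoff (R := R).
exists (V + M * U + 1); first by rewrite !addr_ge0// mulr_ge0.
move=> eps eps0.
pose n (k : nat) : R := k.+1%:R.
have n0 k : 0 < n k by rewrite ltr0n.
have n1 k : 1 <= n k by rewrite ler1n.
(* Truncation at radius n; the extra term chi'(t/n) u/n of the derivative is supported beyond n and
   dominated by M |u|. *)
pose un k t := chi (t / n k) * u t.
pose vn k t := chi (t / n k) * v t + chi' (t / n k) / n k * u t.
have dchin k (t : R) : is_derive t 1 (fun t => chi (t / n k)) (chi' (t / n k) / n k).
  have d := derive_scale (n k)^-1 (is_derive_id t (1 : R)).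
  have := @is_derive1_comp R chi (fun t => (n k)^-1 * t) t _ _ (dchi _) d.
  rewrite mulr1 [(n k)^-1 * t]mulrC (_ : chi \o _ = fun t => chi (t / n k))//.
  by apply/funext => s /=; rewrite mulrC.
have dun k (t : R) : 0 < t -> is_derive t 1 (un k) (vn k t).
  by move=> t0; apply: derive_eq (derive_mul (dchin k t) (du t0)) _.
have cch k (t : R) : {for t, continuous (fun s : R => chi (s / n k))}.
  by apply: differentiable_continuous; apply/derivable1_diffP; case: (dchin k t).
have cch' k (t : R) : chi' (s / n k) @[s --> t] --> chi' (t / n k).
  have c1 : s / n k @[s --> t] --> t / n k by apply: cvgM; [exact: cvg_id|exact: cvg_cst].
  exact: (cvg_comp _ _ c1 (cchi' _)).
have cvn k (t : R) : 0 < t -> {for t, continuous (vn k)}.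
  move=> t0; have a1 : u s @[s --> t] --> u t := cu t0.
  have a2 : v s @[s --> t] --> v t := cv t0.
  have a3 : chi (s / n k) @[s --> t] --> chi (t / n k) := cch k t.
  apply: cvgD; first exact: cvgM a3 a2.
  apply: cvgM a1; apply: cvgM (cch' k t) _; exact: cvg_cst.
have cun k (t : R) : 0 < t -> {for t, continuous (un k)}.
  by move=> t0; apply: differentiable_continuous; apply/derivable1_diffP; case: (dun k t t0).
have mu_ := halfline_continuous_measurable cu.
have mv := halfline_continuous_measurable cv.
have mun k := halfline_continuous_measurable (@cun k).
have mvn k := halfline_continuous_measurable (@cvn k).
have small k t : t < n k -> chi (t / n k) = 1 /\ chi' (t / n k) = 0.
  by move=> tn; apply: chi1; rewrite ltr_pdivrMr// mul1r.
have big k t : 2 * n k < t -> chi (t / n k) = 0 /\ chi' (t / n k) = 0.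
  by move=> tn; apply: chi2; rewrite ltr_pdivlMr.
have ev t : exists k0 : nat, forall k, (k0 <= k)%N -> t < n k.
  exists (Num.truncn t) => k kk; apply: lt_le_trans (truncnS_gt t) _.
  by rewrite ler_nat ltnS.
have bdv k t : 0 < t -> `|v t - vn k t| <= `|v t| + M * `|u t|.
  move=> t0; have -> : v t - vn k t = (1 - chi (t / n k)) * v t - chi' (t / n k) / n k * u t by rewrite /vn; ring.
  have /andP[c0 c1] := chi01 (t / n k).
  apply: (le_trans (ler_normB _ _)); rewrite !normrM; apply: lerD.
    by rewrite ler_piMl// ger0_norm; move: c0 c1; lra.
  apply: ler_wpM2r => //; rewrite -[M]mulr1; apply: ler_pM => //.
  by rewrite normfV gtr0_norm// invf_le1.
have bdu k t : 0 < t -> `|u t - un k t| <= `|u t|.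
  move=> t0; have -> : u t - un k t = (1 - chi (t / n k)) * u t by rewrite /un; ring.
  by have /andP[c0 c1] := chi01 (t / n k); rewrite normrM ler_piMl// ger0_norm; move: c0 c1; lra.
have cS (t : R) : 0 < t -> {for t, continuous (fun s => `|v s| + M * `|u s|)}.
  move=> t0; have a1 : u s @[s --> t] --> u t := cu t0.
  have a2 : v s @[s --> t] --> v t := cv t0.
  by apply: cvgD; [exact: cvg_norm a2|apply: cvgM; [exact: cvg_cst|exact: cvg_norm a1]].
have mS := halfline_continuous_measurable cS.
have iS : rig (fun t => (`|v t| + M * `|u t|) ^+ 2).
  have mnv : measurable_fun D (fun t => `|v t|).
    by apply: halfline_continuous_measurable => t t0; have a2 : v s @[s --> t] --> v t := cv t0; exact: cvg_norm a2.
  have mnu : measurable_fun D (fun t => M * `|u t|).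
    apply: halfline_continuous_measurable => t t0; have a2 : u s @[s --> t] --> u t := cu t0.
    by apply: cvgM; [exact: cvg_cst|exact: cvg_norm a2].
  have i1 : rig (fun t => `|v t| ^+ 2).
    by apply: eq_rintegrable iv => // t _; rewrite real_normK// num_real.
  have i2 : rig (fun t => (M * `|u t|) ^+ 2).
    apply: eq_rintegrable (rintegrableZ mD (M ^+ 2) iu) => // t _.
    by rewrite exprMn real_normK// num_real.
  by have [] := rint_sqrD_le mD mnv mnu i1 i2.
have [iun aun] : (forall k, rig (fun t => (u t - un k t) ^+ 2)) /\ II (fun t => (u t - un k t) ^+ 2) @[k --> \oo] --> (0 : R).
  apply: (eventually_dct (g := u)) => //; first by move=> k; exact: measurable_funB.
  by move=> t; have [k0 hk] := ev t; exists k0 => k /hk /small[c1 _]; rewrite /un c1 mul1r subrr.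
have [ivn avn] : (forall k, rig (fun t => (v t - vn k t) ^+ 2)) /\ II (fun t => (v t - vn k t) ^+ 2) @[k --> \oo] --> (0 : R).
  apply: (eventually_dct (g := fun t => `|v t| + M * `|u t|)) => //.
  - by move=> k; exact: measurable_funB.
  - by move=> k t t0; rewrite [leRHS]ger0_norm ?bdv// addr_ge0// mulr_ge0.
  by move=> t; have [k0 hk] := ev t; exists k0 => k /hk /small[c1 c2]; rewrite /vn c1 c2 !mul0r mul1r addr0 subrr.
have e4 : 0 < eps / 4 by rewrite divr_gt0.
have [k [hu hv]] : exists k, II (fun t => (u t - un k t) ^+ 2) <= eps / 4 /\ II (fun t => (v t - vn k t) ^+ 2) <= eps / 4.
  have near0 (a : nat -> R) : a k @[k --> \oo] --> (0 : R) -> \forall k \near \oo, a k <= eps / 4.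
    move=> /cvgrPdist_le/(_ _ e4); apply: filterS => k; rewrite sub0r normrN; exact: le_trans (ler_norm _).
  have [k [h1 h2]] := filter_ex (filterI (near0 _ aun) (near0 _ avn)); by exists k.
pose T := 2 * n k + 1 + 1.
have T0 : 0 < T by rewrite /T; move: (n0 k); lra.
pose q := cb * T ^+ N.
have q0 : 0 < q by apply: mulr_gt0; [exact: ball_vol_gt0|exact: exprn_gt0].
(* A sup error [eta] on the ball of radius [T] costs at most eta^2 q <= eps/4 in L^2; eta <= 1 keeps
   [Bd] independent of eps. *)
pose eta := Num.min 1 (eps / 4 / q).
have eta0 : 0 < eta by rewrite lt_min ltr01 !divr_gt0.
have eta1 : eta <= 1 by rewrite ge_min lexx.
have etaq : eta ^+ 2 * q <= eps / 4.
  apply: (@le_trans _ _ (eta * q)).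
    by apply: ler_wpM2r; [exact: ltW|rewrite expr2 ler_piMl// ltW].
  by rewrite -ler_pdivlMr// ge_min lexx orbT.
have nn1 : 1 <= 2 * n k + 1 by move: (n1 k); lra.
have vC1 t : 0 < t -> t < 1 -> `|vn k t| <= C * t.
  move=> t0 t1; have [c1 c2] := small k t (lt_le_trans t1 (n1 k)).
  by rewrite /vn c1 c2 !mul0r mul1r addr0; exact: vC.
have out t : 2 * n k + 1 <= t -> un k t = 0 /\ vn k t = 0.
  move=> tT; have tT' : 2 * n k < t by move: tT; lra.
  by have [c1 c2] := big k t tT'; rewrite /un /vn c1 c2 !mul0r addr0.
have [Th [th [B [B0 [sT dT] TB zz zo]]]] := @smooth_profile R C C0 (2 * n k + 1) (un k) (vn k) nn1 (dun k) (@cvn k) vC1 out eta eta0.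
have cth : continuous th.
  have [th' dT' cT'] := sT 1%N; have -> : th = th'; last exact: cT'.
  by apply/funext => s; have [_ <-] := dT s; have [_ <-] := dT' s.
have cT := derive_continuous dT.
have mz1 : measurable_fun D (fun t => vn k t - 2 * t * th (t ^+ 2)).
  apply: halfline_continuous_measurable => t t0; have a1 : vn k s @[s --> t] --> vn k t := cvn k t t0.
  apply: cvgB a1 _; apply: cvgM; first by apply: cvgM; [exact: cvg_cst|exact: cvg_id].
  exact: (cvg_comp _ _ (@exprn_continuous R 2 t) (cth _)).
have mz2 : measurable_fun D (fun t => un k t - Th (t ^+ 2)).
  apply: halfline_continuous_measurable => t t0; have a1 : un k s @[s --> t] --> un k t := cun k t t0.
  by apply: cvgB a1 _; exact: (cvg_comp _ _ (@exprn_continuous R 2 t) (cT _)).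
have [w1 l1] := window_sqr T0 mz1 (fun t t0 => (zz t t0).1) (fun t tT => (zo t (ltW tT)).1).
have [w2 l2] := window_sqr T0 mz2 (fun t t0 => (zz t t0).2) (fun t tT => (zo t (ltW tT)).2).
have [x1 y1] := rint_sqrD_le mD (measurable_funB mv (mvn k)) mz1 (ivn k) w1.
have [x2 y2] := rint_sqrD_le mD (measurable_funB mu_ (mun k)) mz2 (iun k) w2.
have F1 t : (v t - vn k t + (vn k t - 2 * t * th (t ^+ 2))) ^+ 2 = (v t - 2 * t * th (t ^+ 2)) ^+ 2 by congr (_ ^+ 2); ring.
have F2 t : (u t - un k t + (un k t - Th (t ^+ 2))) ^+ 2 = (u t - Th (t ^+ 2)) ^+ 2 by congr (_ ^+ 2); ring.
have arith (a b c d : R) : a <= 2 * b + 2 * c -> b <= eps / 4 -> c <= d -> d <= eps / 4 -> a <= eps.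
  by move=> *; lra.
exists Th, th, B; split => //.
  move=> t t0; have -> : v t - 2 * t * th (t ^+ 2) = (v t - vn k t) + (vn k t - 2 * t * th (t ^+ 2)) by ring.
  apply: (le_trans (ler_normD _ _)); apply: lerD; last exact: le_trans (zz t t0).1 eta1.
  apply: (le_trans (bdv k t t0)); apply: lerD; first exact: vV.
  by apply: ler_wpM2l => //; exact: uU.
split.
- by apply: eq_rintegrable x1 => // t _; exact: F1.
- by rewrite -(eq_rint nu (fun t _ => F1 t)); exact: arith y1 hv l1 etaq.
- by apply: eq_rintegrable x2 => // t _; exact: F2.
- by rewrite -(eq_rint nu (fun t _ => F2 t)); exact: arith y2 hu l2 etaq.
Qed.

End RadialDensity.

(** * Conclusion *)

Section SolutionInX.
Context {R : realType}.
Variable N : nat.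
Hypothesis N3 : (3 <= N)%N.
Let N0 : (0 < N)%N. Proof. exact: leq_trans N3. Qed.
Variables p : R.
Hypothesis p2 : 2 < p.
Local Notation nu := (@radial_measure R N).
Local Notation D := (@halfline R).
Local Notation a := (@half_exp R N).
Hypothesis apN : a * p < N%:R.
Local Notation rig := (rintegrable nu D).
Local Notation II g := (\int[nu]_(t in D) g t)%R.
Local Notation K := (@K R N).
Local Notation L2 := (@L2 R N).
Local Notation nrm := (@nrm R N).
Local Notation Kc := (@Kcst R N N3).
Local Notation mu := (@lebesgue_rV R N).
Local Notation rigN := (rintegrable mu setT).
Local Notation enorm := (@Defs.enorm R N).
Let mD := @measurable_halfline R.

(** Interpolation: |y|^r <= k y^2. It is used with r = 2 and with r = q. *)
Lemma Lnorm_radial (f : 'rV[R]_N -> R) (y : R -> R) (r k eps e1 : R) : 2 <= r -> measurable_fun setT f ->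
  (forall x, x != 0 -> `|f x| = `|y (enorm x)|) -> measurable_fun D y ->
  0 <= k -> (forall t, 0 < t -> `|y t| `^ (r - 2) <= k) ->
  rig (fun t => y t ^+ 2) -> II (fun t => y t ^+ 2) <= eps -> 0 <= e1 -> k * eps <= e1 `^ r ->
  ('N[mu]_r%:E [EFin \o f] <= e1%:E)%E.
Proof.
move=> r2 mf fy my k0 yk iy ly e10 ke; have r0 : 0 < r by move: r2; lra.
have myr : measurable_fun D (fun t => `|y t| `^ r).
  apply: (measurableT_comp (measurable_powR r)); exact: measurableT_comp (@normr_measurable R setT) my.
have mfr : measurable_fun setT (fun x => `|f x| `^ r).
  apply: (measurableT_comp (measurable_powR r)); exact: measurableT_comp (@normr_measurable R setT) mf.
have le t : D t -> 0 <= `|y t| `^ r <= k * y t ^+ 2.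
  move=> /halflineE t0; rewrite powR_ge0 /=.
  have -> : `|y t| `^ r = `|y t| `^ (r - 2) * y t ^+ 2.
    have [->|y0] := eqVneq (y t) 0; first by rewrite normr0 expr0n mulr0 powR0// gt_eqF.
    rewrite -[y t ^+ 2]real_normK ?num_real// -powR_mulrn// -powRD ?subrK//.
    by rewrite normr_eq0 y0 implybT.
  by apply: ler_wpM2r; [exact: sqr_ge0|exact: yk].
have [iyr lyr] := rint_le0_dom mD myr (rintegrableZ mD k iy) le.
have [iF EF] := radial_integral N0 (F := fun x => `|f x| `^ r) (f := fun t => `|y t| `^ r) mfr
  (fun x x0 => congr1 (fun z => z `^ r) (fy x x0)) myr (fun t _ => powR_ge0 _ _) iyr.
apply: Lnorm_le => //; rewrite EF; apply: (le_trans lyr).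
by rewrite (RintegralZl _ mD iy); apply: le_trans ke; exact: ler_wpM2l.
Qed.

Variables (Phi beta : R -> R) (c th : R).
Hypothesis G : growth Phi beta c th.
Variable b : R -> R.
Hypothesis betaE : forall x, beta x = b (x ^+ 2) * x.
Hypothesis b_ge0 : forall s, 0 <= s -> 0 <= b s.
Hypothesis b_mono : forall s t, 0 <= s -> s <= t -> b s <= b t.
Variable m : R.
Local Notation adm := (@adm R N Phi m).
Variables (lam : R) (v : R -> R).
Hypothesis av : adm v.
Hypothesis sv : solves N p beta lam v.
Local Notation u := (K v).
Local Notation g := (src N p v lam).
Local Notation sol := (@sol R N v).
Local Notation sol_grad := (@sol_grad R N v).
Local Notation flux := (@flux R v).
Local Notation slope := (@slope R beta v).
Let lv : L2 v. Proof. by case: av. Qed.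
Let iu : rig (fun t => u t ^+ 2). Proof. by case: av. Qed.

Let cu (t : R) : 0 < t -> {for t, continuous u}.
Proof. by move=> t0; exact: (K_continuous N3 lv). Qed.

Let cv (t : R) : 0 < t -> {for t, continuous v}.
Proof. exact: (solution_continuous N3 p2 apN G av sv). Qed.

Lemma sol_measurable : measurable_fun setT sol.
Proof. exact: continuous_measurable_rV (sol_continuous N3 p2 apN G av sv). Qed.

Lemma sol_sqr : rigN (fun x => sol x ^+ 2) /\ \int[mu]_x sol x ^+ 2 = II (fun t => u t ^+ 2).
Proof.
apply: (radial_integral N0) => //.
- by apply: measurable_funX; exact: sol_measurable.
- by apply: measurable_funX; exact: halfline_continuous_measurable cu.
- by move=> t _; exact: sqr_ge0.
Qed.

Lemma sol_inX (q : R) : 2 <= q -> inX q sol sol_grad.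
Proof.
move=> q2; have msol := sol_measurable.
have msg := measurable_sol_grad av.
split => //; first exact: (sol_weak_gradient N3 p2 apN G av sv).
have du (t : R) : 0 < t -> is_derive t 1 u (v t) by move=> t0; apply: (K_derive N3 lv t0); exact: cv.
have [C C0 vC] := flux_le_linear N3 p2 apN G av sv.
have [V V0 vV] := flux_bounded N3 p2 apN G av sv.
have [U U0 uU] := solution_bounded N3 p2 apN G av sv.
have [Bd Bd0 dens] := radial_density N3 du cv C0 U0 V0 vC uU vV iu (proj2 lv).
pose k := (Bd + 1) `^ (q - 2).
have B1 : 0 < Bd + 1 by rewrite ltr_wpDl.
have k0 : 0 < k by rewrite powR_gt0.
have H (e : R) : 0 < e -> exists2 phi, test_function phi &
    (normX q (fun x => (sol x - phi x)%R) (fun x => (sol_grad x - grad phi x)%R) <= e%:E)%E.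
  move=> e0; pose e1 := e / 2; have e10 : 0 < e1 by rewrite divr_gt0.
  (* The two entries serve the L^2 norms and the L^q norm of the gradient error. *)
  pose eps := Num.min (e1 `^ 2) (e1 `^ q / k).
  have eps0 : 0 < eps by rewrite lt_min powR_gt0//= divr_gt0// powR_gt0.
  have [Th [th' [B [B0 [sT dT] TB zB [i1 l1 i2 l2]]]]] := dens eps eps0.
  pose phi (x : 'rV[R]_N) : R := Th (dotp x x).
  have tp : test_function phi := square_test N B0 sT TB.
  exists phi => //; have -> : e = 2 * e1 by rewrite /e1; field.
  have gE x : grad phi x = (2 * th' (dotp x x)) *: x := square_grad x dT.
  have md : measurable_fun setT (fun x => sol_grad x - grad phi x).
    apply: measurable_fun_rV => i.
    rewrite (_ : (fun x => _) = fun x => sol_grad x ord0 i - grad phi x ord0 i); last by apply/funext => x; rewrite !mxE.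
    apply: measurable_funB; first exact: measurableT_comp (measurable_coord i) msg.
    exact: measurableT_comp (measurable_coord i) (test_measurable_grad tp).
  have me : measurable_fun setT (enorm \o (fun x => sol_grad x - grad phi x)).
    exact: measurableT_comp (@measurable_enorm R N) md.
  have fE x : x != 0 -> `|(enorm \o (fun x => sol_grad x - grad phi x)) x| = `|v (enorm x) - 2 * enorm x * th' (enorm x ^+ 2)|.
    move=> x0; have t0 := enorm_gt0 x0; rewrite /= ger0_norm ?enorm_ge0// gE /sol_grad -scalerBl enorm_scale_le.
    rewrite /flux t0 -[X in _ * X]ger0_norm ?enorm_ge0// -normrM; congr Num.norm.
    by rewrite -sqr_enorm; field; rewrite gt_eqF.
  have cth : continuous th'.
    have [th1 dT' cT'] := sT 1%N; have -> : th' = th1; last exact: cT'.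
    by apply/funext => s; have [_ <-] := dT s; have [_ <-] := dT' s.
  have cT := derive_continuous dT.
  have my1 : measurable_fun D (fun t => v t - 2 * t * th' (t ^+ 2)).
    apply: halfline_continuous_measurable => t t0; have a1 : v s @[s --> t] --> v t := cv t0.
    apply: cvgB a1 _; apply: cvgM; first by apply: cvgM; [exact: cvg_cst|exact: cvg_id].
    exact: (cvg_comp _ _ (@exprn_continuous R 2 t) (cth _)).
  have my2 : measurable_fun D (fun t => u t - Th (t ^+ 2)).
    apply: halfline_continuous_measurable => t t0; have a1 : u s @[s --> t] --> u t := cu t0.
    by apply: cvgB a1 _; exact: (cvg_comp _ _ (@exprn_continuous R 2 t) (cT _)).
  have pw2 (x : R) : `|x| `^ (2 - 2) <= 1 by rewrite subrr powRr0.
  have ke2 : 1 * eps <= e1 `^ 2 by rewrite mul1r ge_min lexx.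
  apply: normX_le; first exact: ltW.
  - by apply: (Lnorm_radial (lexx 2) me fE my1 ler01 _ i1 l1 (ltW e10) ke2) => t _; exact: pw2.
  - apply: (Lnorm_radial (y := fun t => u t - Th (t ^+ 2)) (lexx 2) _ _ my2 ler01 _ i2 l2 (ltW e10) ke2).
    + by apply: measurable_funB => //; exact: continuous_measurable_rV (test_continuous tp).
    + by move=> x x0; rewrite /phi -sqr_enorm.
    + by move=> t _; exact: pw2.
  - apply: (Lnorm_radial q2 me fE my1 (ltW k0) _ i1 l1 (ltW e10)).
      move=> t t0; apply: ge0_ler_powR; rewrite ?nnegrE ?subr_ge0//; first exact: ltW.
      by apply: (le_trans (zB t t0)); rewrite lerDl.
    by rewrite mulrC -ler_pdivlMr// ge_min lexx orbT.
have /choice[phi hphi] : forall k : nat, exists phi, test_function phi /\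
    (normX q (fun x => (sol x - phi x)%R) (fun x => (sol_grad x - grad phi x)%R) <= (k.+1%:R^-1)%:E)%E.
  by move=> j; have [phi t1 t2] := H j.+1%:R^-1 ltac:(by rewrite invr_gt0); exists phi.
exists phi; split; first by move=> j; case: (hphi j).
apply: (@squeeze_cvge _ _ _ _ (fun=> 0%E) _ (fun k => (k.+1%:R^-1)%:E)).
- by apply: nearW => j; rewrite poweR_ge0 /=; case: (hphi j).
- exact: cvg_cst.
- by apply/fine_cvgP; split; [exact: nearW|exact: cvg_harmonic].
Qed.

Lemma dotpZl (k : R) (x y : 'rV[R]_N) : dotp (k *: x) y = k * dotp x y.
Proof. by rewrite /dotp mulr_sumr; apply: eq_bigr => i _; rewrite !mxE mulrA. Qed.

Lemma sol_weak_solution (q : R) : weak_solution q p b lam sol sol_grad.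
Proof.
(* W is b(|grad u|^2) grad u. It is square integrable since b is bounded on the range of |grad u|^2,
   which is what the extension from test functions to X requires. *)
move=> phi dphi hX; pose W (x : 'rV[R]_N) : 'rV[R]_N := slope (enorm x) *: x.
have WE x y : b (enorm (sol_grad x) ^+ 2) * dotp (sol_grad x) y = dotp (W x) y.
  rewrite /W /sol_grad !dotpZl; have [->|x0] := eqVneq x 0.
    by rewrite -(scale0r 0) dotpZl mul0r !mulr0.
  have t0 := enorm_gt0 x0; rewrite enorm_scale_le exprMn real_normK ?num_real// expr_div_n divfK ?expf_neq0 ?gt_eqF//.
  by rewrite /slope betaE; ring.
have [U U0 hU] := sol_bounded N3 p2 apN G av sv.
have [Cb Cb0 hCb] := beta_flux_le N3 p2 apN G betaE b_ge0 b_mono av sv.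
have mW : measurable_fun setT W.
  apply: measurable_fun_rV => i; under eq_fun do rewrite mxE.
  by apply: measurable_funM; [exact: (measurable_slope G av)|exact: measurable_coord].
have mg : measurable_fun setT (fun x => g (enorm x)).
  exact: continuous_measurable_rV (src_sol_continuous N3 p2 apN G av sv).
have meW : measurable_fun setT (fun x => enorm (W x)) by exact: measurableT_comp (@measurable_enorm R N) mW.
have iW : rigN (fun x => enorm (W x) ^+ 2).
  have mb : measurable_fun D (fun t => beta (v t)) by apply: (measurable_beta G); case: lv.
  have ib : rig (fun t => beta (v t) ^+ 2).
    apply: (rintegrable_le mD _ (rintegrableZ mD (Cb ^+ 2) (proj2 lv))); first exact: measurable_funX.
    move=> t /halflineE t0; have := hCb t; rewrite /flux t0 => h.
    rewrite normrX -(real_normK (num_real (v t))) -exprMn lerXn2r ?nnegrE// mulr_ge0//.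
  have WE2 x : x != 0 -> enorm (W x) ^+ 2 = beta (v (enorm x)) ^+ 2.
    move=> x0; have t0 := enorm_gt0 x0; rewrite /W enorm_scale_le exprMn real_normK ?num_real//.
    by rewrite /slope /flux t0 expr_div_n divfK// expf_neq0// gt_eqF.
  have [i1 _] := @radial_integral R N N0 (fun x => enorm (W x) ^+ 2) (fun t => beta (v t) ^+ 2)
    (measurable_funX 2 meW) WE2 (measurable_funX 2 mb) (fun t _ => sqr_ge0 _) ib.
  exact: i1.
have ig : rigN (fun x => g (enorm x) ^+ 2).
  pose A := U `^ (p - 2) + `|lam|.
  have A0 : 0 <= A by rewrite addr_ge0 ?powR_ge0.
  apply: (rintegrable_le measurableT (measurable_funX 2 mg) (rintegrableZ measurableT (A ^+ 2) (proj1 sol_sqr))).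
  move=> x _; rewrite normrX -(real_normK (num_real (sol x))) -exprMn lerXn2r ?nnegrE ?mulr_ge0//.
  rewrite /A mulrDl -(normrM lam); apply: (le_trans (ler_normB _ _)); apply: lerD => //.
  rewrite normrM ger0_norm ?powR_ge0//; apply: ler_wpM2r => //.
  have p20 : 0 <= p - 2 by have hp := p2; lra.
  by apply: (ge0_ler_powR p20); rewrite ?nnegrE//; exact: hU.
have tests psi : test_function psi -> [/\ rigN (fun x => dotp (W x) (grad psi x)), rigN (fun x => g (enorm x) * psi x) &
    \int[mu]_x dotp (W x) (grad psi x) = \int[mu]_x (g (enorm x) * psi x)].
  move=> tp; have [w1 w2 w3] := weak_equation_test N3 p2 apN G betaE b_ge0 b_mono av sv tp.
  have E x : slope (enorm x) * dotp x (grad psi x) = dotp (W x) (grad psi x) by rewrite dotpZl.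
  split => //; first by apply: eq_rintegrable w1 => // x _; exact: E.
  by rewrite -w3; apply: eq_rint => x _; rewrite E.
have [r1 r2 r3] := weak_extend mW mg iW ig tests hX.
split=> //; first by apply: eq_rintegrable r1 => // x _; rewrite WE.
by rewrite -[RHS]r3; apply: eq_rint => x _; rewrite WE.
Qed.

Lemma sol_radial : radial sol.
Proof. by move=> x y xy; rewrite /sol xy. Qed.

Lemma sol_vanishes : vanishes_at_infinity sol.
Proof.
move=> e e0; have a0 := half_exp_gt0 (R := R) N3.
(* The radial bound drops below e as soon as |x|^a exceeds X; the summand 1 keeps X positive when
   [nrm v] is 0. *)
pose X := Kc * nrm v / e + 1.
have Q0 : 0 <= Kc * nrm v by rewrite mulr_ge0 ?Kcst_ge0 ?nrm_ge0.
have X0 : 0 < X by rewrite ltr_wpDl// divr_ge0// ltW.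
exists (X `^ a^-1) => x hx; have t0 : 0 < enorm x by apply: le_lt_trans hx; exact: powR_ge0.
apply: (le_lt_trans (K_bound N3 lv t0)); rewrite mulrAC powRN ltr_pdivrMr ?powR_gt0//.
have ht : X < enorm x `^ a.
  have {1}-> : X = (X `^ a^-1) `^ a by rewrite -powRrM mulVf ?powRr1 ?gt_eqF// ltW.
  by apply: gt0_ltr_powR; rewrite ?nnegrE ?powR_ge0// ltW.
apply: (@lt_trans _ _ (e * X)); last by rewrite ltr_pM2l.
by rewrite /X mulrDr mulr1 mulrCA mulfV ?gt_eqF// mulr1 ltrDl.
Qed.

End SolutionInX.

(* If q < 2, the lower bound in (b1) makes b unbounded near 0. *)
Lemma exponent_ge2 {R : realType} (q c1 : R) (b : R -> R) : 0 < c1 ->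
  (forall s t, 0 <= s -> s <= t -> b s <= b t) ->
  (forall s : R, c1 * (s ^+ 2 + `|s| `^ q) <= b (s ^+ 2) * s ^+ 2) -> 2 <= q.
Proof.
move=> c10 bm h; rewrite leNgt; apply/negP => q2.
pose X := `|b 1| / c1 + 1.
have X1 : 1 <= X by rewrite lerDr divr_ge0// ltW.
have X0 : 0 < X by exact: lt_le_trans X1.
have d0 : 0 < 2 - q by rewrite subr_gt0.
pose s := X `^ (- (2 - q)^-1).
have s0 : 0 < s by rewrite powR_gt0.
have s1 : s <= 1.
  rewrite /s powRN invf_le1 ?powR_gt0// -[X in X <= _](powRr0 X).
  by rewrite ler_powR// invr_ge0 ltW.
have sq : s `^ q = X * s ^+ 2.
  have -> : s ^+ 2 = s `^ (2 - q) * s `^ q.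
    by rewrite -powRD ?subrK ?powR_mulrn ?(ltW s0)// gt_eqF ?implybT.
  rewrite mulrA /s -[X `^ _ `^ (2 - q)]powRrM mulNr mulVf ?gt_eqF// powR_inv1 ?(ltW X0)//.
  by rewrite mulfV ?mul1r// gt_eqF.
have := h s; rewrite gtr0_norm// sq => hs.
have bs : b (s ^+ 2) <= b 1 by apply: bm; [exact: sqr_ge0|rewrite expr_le1// ltW].
have : c1 * (1 + X) <= b 1.
  apply: le_trans bs; rewrite -(ler_pM2r (exprn_gt0 2 s0)); apply: le_trans hs.
  by rewrite -mulrA mulrDl mul1r.
rewrite /X !mulrDr mulrCA mulfV ?gt_eqF// !mulr1.
by have := ler_norm (b 1); lra.
Qed.

Lemma critical_exponent {R : realType} (n p : R) : 2 < n -> p < 2 * n / (n - 2) -> (n - 2) / 2 * p < n.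
Proof.
move=> n2; have n20 : 0 < n - 2 by rewrite subr_gt0.
by rewrite ltr_pdivlMr// => h; rewrite mulrAC ltr_pdivrMr// mulrC [n * 2]mulrC.
Qed.

Theorem theorem1p3 (R : realType) (N : nat) (rho p q : R) (b : R -> R)
  (hN : (3 <= N)%N) (hrho : 0 < rho)
  (b0 : (forall s, 0 <= s -> 0 < b s) /\ C1_on_nonneg b)
  (b1 : 1 < q /\
    exists c1 c2 : R, [/\ 0 < c1, 0 < c2 &
      forall s : R,
        c1 * (s ^+ 2 + `|s| `^ q) <= b (s ^+ 2) * s ^+ 2
          <= c2 * (s ^+ 2 + `|s| `^ q) /\
        c1 * (s ^+ 2 + `|s| `^ q) <= primitive b (s ^+ 2)
          <= c2 * (s ^+ 2 + `|s| `^ q)])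
  (b2 : forall s t, 0 <= s -> s <= t -> b s <= b t)
  (b3 : exists2 alpha : R, 2 * (N%:R + 2) / (N%:R * p) < alpha &
    forall s, 0 < s ->
      alpha * (b s * s) <= primitive b s /\
      primitive b s < 2 * (N%:R + p) / (N%:R * p) * (b s * s))
  (hp : (1 + 2 / N%:R) * Num.max 2 q < p < 2 * N%:R / (N%:R - 2))
  (hq : 2 * N%:R / (N%:R + 2) < q) :
  exists (lam : R) (u : 'rV[R]_N -> R) (du : 'rV[R]_N -> 'rV[R]_N),
    [/\ inX q u du,
        radial u,
        weak_solution q p b lam u du,
        vanishes_at_infinity u &
        (\int[lebesgue_rV N]_x ((u x) ^+ 2)%:E = (rho ^+ 2)%:E)%E].
Proof.
have [bpos bC1] := b0; have [_ [c1 [c2 [c10 _ hc]]]] := b1.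
have [alpha al hal] := b3; have /andP[hp1 hp2] := hp.
have n3 : (3 : R) <= N%:R by rewrite ler_nat.
have n0 : (0 : R) < N%:R by move: n3; lra.
have n2 : (2 : R) < N%:R by move: n3; lra.
have q2 : 2 <= q by apply: (exponent_ge2 c10 b2) => s; have [/andP[]] := hc s.
have p2 : 2 < p.
  apply: le_lt_trans hp1; apply: (@le_trans _ _ (Num.max 2 q)); first by rewrite le_max lexx.
  rewrite ler_peMl ?le_max ?ler0n// lerDl divr_ge0//; exact: ltW.
have p0 : 0 < p by move: p2; lra.
have apN : @half_exp R N * p < N%:R by exact: critical_exponent.
have np0 : 0 < N%:R * p by exact: mulr_gt0.
have al0 : 0 < alpha.
  by apply: le_lt_trans al; apply: divr_ge0; [rewrite mulr_ge0// addr_ge0// ltW|exact: ltW].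
have G := primitive_growth bpos bC1 b2 al0 (fun s s0 => (hal s s0).1).
(* After cancelling N this is (N+2)/alpha < N p/2, the lower bound on alpha. *)
have gam_chi : @chi R N (2 / alpha) < @gam R N p.
  rewrite /chi /gam; move: al; rewrite ltr_pdivrMr// => al.
  have h : (N%:R + 2) / alpha < N%:R * p / 2 by rewrite ltr_pdivrMr//; move: al; lra.
  have -> : (N%:R / 2 + 1) * (2 / alpha) = (N%:R + 2) / alpha by field; rewrite gt_eqF.
  by move: h; move: (_ / alpha) => z; lra.
(* The upper half of (b3) at s = x^2, multiplied by N/2. *)
have beta_upper (x : R) : x != 0 -> N%:R * Phi b x < (1 + N%:R / p) * (beta b x * x).
  move=> x0; have x20 : 0 < x ^+ 2 by rewrite exprn_even_gt0.
  have [_] := hal _ x20; rewrite /Phi /beta; have -> : b (x ^+ 2) * x * x = b (x ^+ 2) * x ^+ 2 by ring.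
  move: (primitive b _) (b _ * _) => P y h.
  have E : (1 + N%:R / p) * y = N%:R / 2 * (2 * (N%:R + p) / (N%:R * p) * y) by field; rewrite !gt_eqF.
  have -> : N%:R * (P / 2) = N%:R / 2 * P by ring.
  by rewrite E ltr_pM2l// divr_gt0.
have m0 : 0 < rho ^+ 2 by rewrite exprn_gt0.
have [lam [v [av PP0 sv mlam neh]]] := exists_radial_solution hN p2 apN G m0 gam_chi.
have ms := mass_full hN p2 apN G beta_upper av PP0 sv mlam neh.
have bnn s : 0 <= s -> 0 <= b s by move=> s0; exact: ltW (bpos s s0).
have [iS Es] := sol_sqr hN p2 apN G av sv.
exists lam, (@sol R N v), (@sol_grad R N v); split.
- exact: (sol_inX hN p2 apN G av sv q2).
- exact: sol_radial.
- exact: (sol_weak_solution hN p2 apN G (fun x => erefl) bnn b2 av sv).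
- exact: (sol_vanishes hN av).
- by rewrite (rint_lim measurableT iS) Es -ms.
Qed.
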